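(* Let $f$ satisfy $(\mathcal A)$, let $K>0$ be fixed and let $T>0$. Assume that $u^\varepsilon=\nabla\varphi^\varepsilon:[0,T]\times\mathbb R^d\to\mathbb R^d$ and $a^\varepsilon:[0,T]\times\mathbb R^d\to\mathbb C$ are smooth and such that $$M\equiv\|\nabla_xu^\varepsilon\|_{L^\infty([0,T]\times\mathbb R^d)}+\|\nabla_x(\nabla\cdot u^\varepsilon)\|_{L^\infty([0,T]\times\mathbb R^d)}+\big\||a^\varepsilon|^2\big\|_{L^\infty([0,T]\times\mathbb R^d)}<+\infty.$$ Let $w\in\mathcal C^1([0,T],H^2)$ be a solution of $$i\varepsilon\frac{\partial w}{\partial t}+\mathcal L^\varepsilon w=R_\varphi w+F^\varepsilon,\qquad x\in\mathbb R^d.$$ Then there exists $C_M$ depending only on $d$, $f$ and $M$ (and on the fixed constant $K$) such that, for every $\varepsilon\in(0,1]$, $w$ satisfies the energy estimate $$\begin{aligned}\frac{d}{dt}N^\varepsilon(w(t))\le\;& C_M\Big(1+\frac1\varepsilon\|R_a(t)\|_{L^\infty}+\frac1\varepsilon\|R_\varphi(t)\|_{W^{1,\infty}}+\frac1{\varepsilon^2}\|R_\varphi(t)\|_{L^\infty}\Big)N^\varepsilon(w(t))\\&+\|F^\varepsilon(t)\|_{L^2}^2-\int_{\mathbb R^d}\frac4\varepsilon f'(|a^\varepsilon|^2)(w,a^\varepsilon)(a^\varepsilon,iF^\varepsilon)+\int_{\mathbb R^d}(\varepsilon\Delta w,iF^\varepsilon).\end{aligned}$$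
   Context: Assumption $(\mathcal A)$: $f\in\mathcal C^\infty([0,+\infty))$ real-valued, $f(0)=0$, $f'>0$ on $(0,+\infty)$, and $f^{(n)}(0)\ne0$ for some $n\in\mathbb N^*$. $(\cdot,\cdot)$ is the real scalar product on $\mathbb C\simeq\mathbb R^2$, i.e. $(z,z')=\mathrm{Re}(z\overline{z'})$. The phase $\varphi^\varepsilon$ is smooth and real-valued, $u^\varepsilon=\nabla\varphi^\varepsilon$, and $$R_\varphi\equiv\partial_t\varphi^\varepsilon+\tfrac12|\nabla\varphi^\varepsilon|^2+f(|a^\varepsilon|^2),\qquad R_a\equiv\partial_ta^\varepsilon+\nabla\varphi^\varepsilon\cdot\nabla a^\varepsilon+\tfrac12a^\varepsilon\Delta\varphi^\varepsilon .$$ The linear operator $\mathcal L^\varepsilon$ is $$\mathcal L^\varepsilon w\equiv\frac{\varepsilon^2}{2}\Delta w+i\varepsilon\,u^\varepsilon\cdot\nabla w+\frac{i\varepsilon}{2}w\,\nabla\cdot u^\varepsilon-2f'(|a^\varepsilon|^2)(w,a^\varepsilon)a^\varepsilon .$$ $F^\varepsilon$ is a given complex-valued source term. The weighted energy is $$N^\varepsilon(w)\equiv\frac12\int_{\mathbb R^d}\Big(\varepsilon^2|\nabla w|^2+4f'(|a^\varepsilon|^2)(w,a^\varepsilon)^2+K\varepsilon^2|w|^2\Big)\,dx .$$ Norms $L^\infty,W^{1,\infty},L^2$ at time $t$ are in the $x$ variable.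
   Formalization: The estimate is stated at times t near which the norms of R_a in L^∞, R_φ in W^{1,∞} and F in L^2 are bounded, with F(t) measurable; finiteness at t alone is not enough, since bumps of a escaping to infinity can make N non-differentiable at t. *)

(* Defs.v *)
From HB Require Import structures.
From mathcomp Require Import all_boot all_order all_algebra.
From mathcomp Require Import all_classical all_reals all_analysis.
From mathcomp Require Import complex.

Set Implicit Arguments.
Unset Strict Implicit.
Unset Printing Implicit Defensive.
Import Order.TTheory GRing.Theory Num.Theory.
Import numFieldNormedType.Exports.

Local Open Scope classical_set_scope.
Local Open Scope complex_scope.
Local Open Scope ring_scope.

Definition rV_display : measure_display.
Proof. exact. Qed.

Section measurable_rV.
Variables (R : realType) (n : nat).

Let coord (i : 'I_n) (x : 'rV[R]_n) : measurableTypeR R := x ord0 i.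

Let rV_set0 : g_sigma_preimage coord set0.
Proof. exact: sigma_algebra0. Qed.

Let rV_setC A : g_sigma_preimage coord A -> g_sigma_preimage coord (~` A).
Proof. exact: sigma_algebraC. Qed.

Let rV_bigcup (F : _^nat) : (forall i, g_sigma_preimage coord (F i)) ->
  g_sigma_preimage coord (\bigcup_i (F i)).
Proof. exact: sigma_algebra_bigcup. Qed.

(* The sigma-algebra generated by the coordinates, i.e. the Borel one. *)
HB.instance Definition _ := @isMeasurable.Build rV_display
  'rV[R]_n (g_sigma_preimage coord) rV_set0 rV_setC rV_bigcup.

Lemma measurable_coord (i : 'I_n) :
  measurable_fun [set: 'rV[R]_n] (fun x : 'rV[R]_n => x ord0 i : measurableTypeR R).
Proof.
move=> _ Y mY; rewrite setTI; apply: sub_sigma_algebra => /=.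
rewrite -bigcup_seq/=; exists i => /=; first by rewrite mem_index_enum.
by exists Y => //; rewrite setTI.
Qed.

Lemma measurable_fun_rV d (T : measurableType d) (g : T -> 'rV[R]_n) :
  (forall i, measurable_fun [set: T] (fun t => g t ord0 i : measurableTypeR R)) ->
  measurable_fun [set: T] g.
Proof.
move=> mg _ Y mY; rewrite setTI.
move: Y mY; apply: smallest_sub.
  split => /=.
  - by rewrite preimage_set0.
  - by move=> A mA; rewrite setTD preimage_setC; exact: measurableC.
  - by move=> F mF; rewrite preimage_bigcup; exact: bigcup_measurable.
move=> A; rewrite -bigcup_seq/= => -[i _ [B mB]].
rewrite setTI => <-; rewrite /coord.
by have := mg i measurableT B mB; rewrite setTI.
Qed.

End measurable_rV.

Section lebesgue_step.
Variables (R : realType) (n : nat).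

Definition consrV (p : measurableTypeR R * 'rV[R]_n) : 'rV[R]_n.+1 :=
  row_mx (p.1%:M : 'M[R]_1) p.2.

Let unconsrV (x : 'rV[R]_n.+1) : measurableTypeR R * 'rV[R]_n :=
  (x ord0 ord0, \row_j x ord0 (lift ord0 j)).

Lemma consrV0 p : consrV p ord0 ord0 = p.1.
Proof.
rewrite /consrV (_ : ord0 = lshift n (ord0 : 'I_1)); last exact/val_inj.
by rewrite (@row_mxEl _ 1 1 n) mxE eqxx mulr1n.
Qed.

Lemma consrVS p j : consrV p ord0 (lift ord0 j) = p.2 ord0 j.
Proof.
rewrite /consrV (_ : lift ord0 j = rshift 1 j); last exact/val_inj.
by rewrite (@row_mxEr _ 1 1 n).
Qed.

Let consrVK : cancel consrV unconsrV.
Proof.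
move=> [x y]; rewrite /unconsrV consrV0; congr pair.
by apply/rowP => j; rewrite mxE consrVS.
Qed.

Lemma measurable_consrV : measurable_fun setT consrV.
Proof.
apply: measurable_fun_rV => i.
case: (unliftP ord0 i) => [j|] ->.
  under eq_fun do rewrite consrVS.
  exact: (measurableT_comp (measurable_coord j) measurable_snd).
under eq_fun do rewrite consrV0.
exact: measurable_fst.
Qed.

Let measurable_unconsrV : measurable_fun setT unconsrV.
Proof.
apply/measurable_fun_pair => /=; first exact: measurable_coord.
apply: measurable_fun_rV => j.
under eq_fun do rewrite mxE.
exact: measurable_coord.
Qed.

Variable mu : {sigma_finite_measure set 'rV[R]_n -> \bar R}.

Definition leb_step : set 'rV[R]_n.+1 -> \bar R :=
  pushforward (lebesgue_measure \x mu)%E consrV.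

Let leb_step0 : leb_step set0 = 0%E.
Proof. by rewrite /leb_step /pushforward preimage_set0 measure0. Qed.

Let leb_step_ge0 A : (0 <= leb_step A)%E.
Proof. exact: (@measure_ge0 _ _ _ (lebesgue_measure \x mu)%E). Qed.

Let mpre A : measurable A -> measurable (consrV @^-1` A).
Proof. by move=> mA; rewrite -[X in measurable X]setTI; exact: measurable_consrV. Qed.

Let leb_step_sigma_additive : semi_sigma_additive leb_step.
Proof.
move=> F mF tF mUF; rewrite /leb_step /pushforward preimage_bigcup.
apply: measure_semi_sigma_additive.
- by move=> k; exact: mpre.
- apply/trivIsetP => /= i j _ _ ij; rewrite -preimage_setI.
  by move/trivIsetP : tF => /(_ _ _ _ _ ij) ->//; rewrite preimage_set0.
- by rewrite -preimage_bigcup; exact: mpre.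
Qed.

HB.instance Definition _ := isMeasure.Build _ _ _ leb_step
  leb_step0 leb_step_ge0 leb_step_sigma_additive.

Let leb_step_sigma_finite : sigma_finite setT leb_step.
Proof.
have [F FT Ffin] : sigma_finite setT (lebesgue_measure \x mu)%E.
  have /sigma_finiteP[F [TF ndF Foo]] := sigma_finiteT (@lebesgue_measure R).
  have /sigma_finiteP[G [TG ndG Goo]] := sigma_finiteT mu.
  exists (fun k => F k `*` G k).
    rewrite -setXTT TF TG; apply/seteqP; split => -[x y] /=.
      move=> [[i _ Fix] [j _ Gjy]]; exists (maxn i j) => //; split.
        by move: x Fix; exact/subsetPset/ndF/leq_maxl.
      by move: y Gjy; exact/subsetPset/ndG/leq_maxr.
    by move=> [i _ [/= ? ?]]; split; exists i.
  move=> k; have [? ?] := Foo k; have [? ?] := Goo k.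
  split; first exact: measurableX.
  by rewrite product_measure1E// lte_mul_pinfty// ge0_fin_numE.
exists (fun k => unconsrV @^-1` F k).
  by rewrite -preimage_bigcup -FT preimage_setT.
move=> k; have [mFk Fkoo] := Ffin k; split.
  by rewrite -[X in measurable X]setTI; exact: measurable_unconsrV.
rewrite /leb_step /pushforward.
have -> : consrV @^-1` (unconsrV @^-1` F k) = F k.
  by apply/seteqP; split => p; rewrite /preimage/= consrVK.
exact: Fkoo.
Qed.

HB.instance Definition _ := Measure_isSigmaFinite.Build _ _ _ leb_step
  leb_step_sigma_finite.

End lebesgue_step.

(* Iterated product of the one-dimensional Lebesgue measure. *)
Fixpoint leb (R : realType) (n : nat) :
    {sigma_finite_measure set 'rV[R]_n -> \bar R} :=
  match n with
  | 0 => \d_ (0 : 'rV[R]_0)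
  | m.+1 => leb_step (leb R m)
  end.

Lemma leb_box (R : realType) (n : nat) (A : 'I_n -> set (measurableTypeR R)) :
  (forall i, measurable (A i)) ->
  (leb R n [set x | forall i, A i (x ord0 i)] =
   \prod_(i < n) lebesgue_measure (A i))%E.
Proof.
elim: n A => [|n IHn] A mA.
  rewrite big_ord0 /= diracE mem_set//=.
  by case.
rewrite big_ord_recl -IHn// /= /leb_step /pushforward.
pose B := [set y : 'rV[R]_n | forall i, A (lift ord0 i) (y ord0 i)].
have mB : measurable B.
  have -> : B = \bigcap_(i in [set: 'I_n])
      ((fun y : 'rV[R]_n => y ord0 i : measurableTypeR R) @^-1` A (lift ord0 i)).
    by apply/seteqP; split=> y /= h i; [move=> _; exact: h|exact: h].
  apply: fin_bigcap_measurable => // i _.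
  by rewrite -[X in measurable X]setTI; exact: measurable_coord.
have -> : consrV (n:=n) @^-1` [set x | forall i, A i (x ord0 i)] =
    A ord0 `*` B.
  apply/seteqP; split=> [p h|p [h0 h] i] /=.
    by split=> [|i] /=; [have := h ord0|have := h (lift ord0 i)];
      rewrite ?consrV0 ?consrVS.
  by case: (unliftP ord0 i) => [j|] ->; rewrite ?consrV0 ?consrVS//; exact: h.
by rewrite product_measure1E.
Qed.

Definition cdot (R : realType) (z z' : R[i]) : R := complex.Re (z * z'^*%C).

Definition csqr (R : realType) (z : R[i]) : R := cdot z z.

Definition componentwise (R : realType) (X : Type)
    (D : (X -> R) -> (X -> R)) (z : X -> R[i]) : X -> R[i] :=
  fun x => D (fun y => complex.Re (z y)) x +i* D (fun y => complex.Im (z y)) x.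

Definition both (R : realType) (X : Type) (P : (X -> R) -> Prop)
    (z : X -> R[i]) : Prop :=
  P (fun x => complex.Re (z x)) /\ P (fun x => complex.Im (z x)).

(* Relative to an interval [A], these are one-sided at its end points. *)

Section derivative_within.
Variables (R : realType) (A : set R) (g : R -> R) (t : R).

Let quotient (s : R) : R := (g s - g t) / (s - t).

Definition derivable_within : Prop := cvg (quotient s @[s --> within A t^']).

Definition derivative_within : R := lim (quotient s @[s --> within A t^']).

End derivative_within.

Section nonlinearity.
Variable R : realType.

Definition deriv0y (f : R -> R) : R -> R := derivative_within `[0, +oo[ f.

(* Smoothness on the closed half-line: derivatives at 0 are one-sided. *)
Definition assumptionA (f : R -> R) : Prop :=
  [/\ forall n rho, 0 <= rho -> derivable_within `[0, +oo[ (iter n deriv0y f) rho,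
      f 0 = 0,
      forall rho, 0 < rho -> 0 < deriv0y f rho &
      exists2 n, (0 < n)%N & iter n deriv0y f 0 != 0].

End nonlinearity.

Section space.
Variables (R : realType) (d : nat).
Local Notation X := 'rV[R]_d.
Local Notation dx := (leb R d).
Implicit Types (g h : X -> R) (z : X -> R[i]).

Definition partial (i : 'I_d) g : X -> R := 'D_(delta_mx ord0 i) g.

Definition laplacian g : X -> R := fun x => \sum_(i < d) partial i (partial i g) x.

Fixpoint Ck (k : nat) g : Prop :=
  continuous g /\
  match k with
  | 0 => True
  | k'.+1 => forall i, (forall x, derivable g x (delta_mx ord0 i)) /\
                       Ck k' (partial i g)
  end.

Definition test_function g : Prop :=
  (forall k, Ck k g) /\ exists2 K, compact K & forall x, ~ K x -> g x = 0.

Definition locally_L1 g : Prop :=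
  measurable_fun setT g /\
  forall K, compact K -> (\int[dx]_(x in K) `|(g x)%:E| < +oo)%E.

Definition is_weak_partial (i : 'I_d) g h : Prop :=
  [/\ locally_L1 g, locally_L1 h &
      forall phi, test_function phi ->
        \int[dx]_x (g x * partial i phi x) = - \int[dx]_x (h x * phi x)].

(* Some representative of the weak derivative (unique almost everywhere). *)
Definition weak_partial (i : 'I_d) g : X -> R :=
  xget (fun=> 0) [set h | is_weak_partial i g h].

Fixpoint sobolev (k : nat) g : Prop :=
  g \in Lfun dx 2%:E /\
  match k with
  | 0 => True
  | k'.+1 => forall i, (exists h, is_weak_partial i g h) /\
                       sobolev k' (weak_partial i g)
  end.

(* For k = 2 mixed second derivatives are counted twice. *)
Fixpoint sobolev_sqnorm (k : nat) g : \bar R :=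
  (\int[dx]_x ((g x) ^+ 2)%:E +
   match k with
   | 0 => 0
   | k'.+1 => \sum_(i < d) sobolev_sqnorm k' (weak_partial i g)
   end)%E.

Definition H2 z : Prop := both (sobolev 2) z.

Definition H2_sqnorm z : \bar R :=
  (sobolev_sqnorm 2 (fun x => complex.Re (z x)) +
   sobolev_sqnorm 2 (fun x => complex.Im (z x)))%E.

Definition wpartial (i : 'I_d) z : X -> R[i] := componentwise (weak_partial i) z.

Definition wlaplacian z : X -> R[i] :=
  fun x => \sum_(i < d) wpartial i (wpartial i z) x.

Definition wgrad_sqr z : X -> R := fun x => \sum_(i < d) csqr (wpartial i z x).

Definition Linfty g : \bar R := 'N[dx]_+oo[EFin \o g]%E.

Definition grad_norm g : X -> R :=
  fun x => Num.sqrt (\sum_(i < d) (partial i g x) ^+ 2).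

Definition W1infty g : \bar R := (Linfty g + Linfty (grad_norm g))%E.

Definition cabs (z : X -> R[i]) : X -> R := fun x => Num.sqrt (csqr (z x)).

Definition L2norm z : \bar R := 'N[dx]_2%:E[EFin \o cabs z]%E.

End space.

Section space_time.
Variables (R : realType) (d : nat) (T : R).
Local Notation X := 'rV[R]_d.
Local Notation dx := (leb R d).

(* Functions on [0,T] x R^d are total in time; values outside [0,T] are irrelevant. *)

Definition dt (g : R -> X -> R) : R -> X -> R :=
  fun t x => derivative_within `[0, T] (g^~ x) t.

Fixpoint Ck_slab (k : nat) (g : R -> X -> R) : Prop :=
  {within `[0, T] `*` [set: X], continuous (fun p : R * X => g p.1 p.2)} /\
  match k with
  | 0 => True
  | k'.+1 =>
      [/\ forall (t : R) x, t \in `[0, T] -> derivable_within `[0, T] (g^~ x) t,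
          Ck_slab k' (dt g) &
          forall i,
            (forall (t : R) x, t \in `[0, T] -> derivable (g t) x (delta_mx ord0 i)) /\
            Ck_slab k' (fun t => partial i (g t))]
  end.

Definition smooth_slab (g : R -> X -> R) : Prop := forall k, Ck_slab k g.

Definition csmooth_slab (a : R -> X -> R[i]) : Prop :=
  smooth_slab (fun t x => complex.Re (a t x)) /\
  smooth_slab (fun t x => complex.Im (a t x)).

Definition cdt (a : R -> X -> R[i]) : R -> X -> R[i] :=
  fun t x => dt (fun s y => complex.Re (a s y)) t x
          +i* dt (fun s y => complex.Im (a s y)) t x.

Definition slab_measure : {measure set (measurableTypeR R * X) -> \bar R} :=
  (mrestr (@lebesgue_measure R) (measurable_itv `[0%R, T]) \x dx)%E.

Definition Linfty_slab (g : R -> X -> R) : \bar R :=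
  'N[slab_measure]_+oo[EFin \o (fun p => g p.1 p.2)]%E.

(* [w'] is the derivative of [w] in C^1([0,T], H^2). *)
Definition C1_H2 (w w' : R -> X -> R[i]) : Prop :=
  [/\ forall t : R, t \in `[0, T] -> H2 (w t) /\ H2 (w' t),
      forall t : R, t \in `[0, T] ->
        H2_sqnorm (fun x => ((s - t)^-1)%:C * (w s x - w t x) - w' t x)
          @[s --> within `[0, T] t^'] --> (0 : \bar R)%E &
      forall t : R, t \in `[0, T] ->
        H2_sqnorm (fun x => w' s x - w' t x)
          @[s --> within `[0, T] (nbhs t)] --> (0 : \bar R)%E].

(* Being finite at one isolated time does not control the time derivative of an
   integral over R^d at that time; being bounded near it does. *)
Definition bounded_near_time (g : R -> \bar R) (t : R) : Prop :=
  exists B : R, \forall s \near within `[0, T] (nbhs t), (g s <= B%:E)%E.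

End space_time.

Section operators.
Variables (R : realType) (d : nat) (f : R -> R).
Local Notation X := 'rV[R]_d.
Local Notation dx := (leb R d).

Definition Rphi (T : R) (phi : R -> X -> R) (a : R -> X -> R[i])
    (t : R) (x : X) : R :=
  dt T phi t x + 2^-1 * (\sum_(i < d) (partial i (phi t) x) ^+ 2)
  + f (csqr (a t x)).

Definition Ra (T : R) (phi : R -> X -> R) (a : R -> X -> R[i])
    (t : R) (x : X) : R[i] :=
  cdt T a t x
  + \sum_(i < d) (partial i (phi t) x)%:C * componentwise (partial i) (a t) x
  + (2^-1)%:C * a t x * (laplacian (phi t) x)%:C.

(* The operator at a fixed time; here u = grad phi, hence div u = laplacian phi. *)
Definition Lop (eps : R) (phi : X -> R) (a w : X -> R[i]) (x : X) : R[i] :=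
  (eps ^+ 2 / 2)%:C * wlaplacian w x
  + 'i%C * eps%:C * (\sum_(i < d) (partial i phi x)%:C * wpartial i w x)
  + 'i%C * (eps / 2)%:C * w x * (laplacian phi x)%:C
  - (2 * deriv0y f (csqr (a x)) * cdot (w x) (a x))%:C * a x.

Definition energy (eps K : R) (a w : X -> R[i]) : R :=
  2^-1 * \int[dx]_x (eps ^+ 2 * wgrad_sqr w x
                     + 4 * deriv0y f (csqr (a x)) * (cdot (w x) (a x)) ^+ 2
                     + K * eps ^+ 2 * csqr (w x)).

(* Pointwise matrix and vector norms are Euclidean. *)
Definition flow_bound (T : R) (phi : R -> X -> R) (a : R -> X -> R[i]) : \bar R :=
  (Linfty_slab T (fun t x =>
     Num.sqrt (\sum_(i < d) \sum_(j < d) (partial j (partial i (phi t)) x) ^+ 2))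
   + Linfty_slab T (fun t => grad_norm (laplacian (phi t)))
   + Linfty_slab T (fun t x => csqr (a t x)))%E.

End operators.

(* Main.v *)
(* The quadratic term 4 f'(|a|^2)(w,a)^2 is differentiated along the flow: with D = d/dt + u . grad one
   has D a = R_a - (1/2) a div u, so that only R_a and div u remain, although the separate derivatives of
   a are not controlled.  Once the equation is substituted for D w, the terms f'(|a|^2)(w,a) times second
   derivatives of w cancel against those coming from the gradient term, and the terms div u |grad w|^2
   cancel by integration by parts.  The factor f''(|a|^2) is absorbed by rho |f''(rho)| <= C f'(rho) on
   [0, M], which holds because f' vanishes at most to finite order at 0; Young's inequality gives the rest.
   Since u is only of linear growth, the time derivative of the quadratic term is obtained with spatial
   cut-offs, the mean value theorem in time, and weak L2 convergence of u . grad w, whose L2 bound near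
   the given time comes from the equation. *)
Require Import Defs.
From HB Require Import structures.
From mathcomp Require Import all_boot all_order all_algebra.
From mathcomp Require Import all_classical all_reals all_analysis.
From mathcomp Require Import measurable_realfun ess_sup_inf complex.
From mathcomp Require Import ring lra.
Set Implicit Arguments.
Unset Strict Implicit.
Unset Printing Implicit Defensive.
Import Order.TTheory GRing.Theory Num.Theory.
Import numFieldNormedType.Exports.
Local Open Scope classical_set_scope.
Local Open Scope ring_scope.

(** * Square-integrable functions *)

(** The energy derivative is not estimated integral by integral. In the last step every integration
    by parts is recorded as a function of zero integral ([zero_mean]). A fixed combination of these
    is added to the integrand, and the estimate becomes an almost everywhere inequality between real
    numbers, into which the equation can be substituted. The main obstacle is that only the sum u .
    grad w is known to be in L2, not its summands. Identities involving u are therefore proved under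
    cut-offs whose gradient decays like 1/(1+|x|), which compensates the growth of u. The powers of
    eps come from what the energy controls, f'(w,a)^2 and eps^2 |w|^2: a product f' |(w,a)| |w|
    costs 1/eps, which is the price of R_a. The R_phi term carries a further 1/eps from the
    equation, and grad R_phi meets eps |w| |grad w|, which again costs 1/eps. The coefficient of
    |F|^2 stays equal to 1 because the constant K produced by Young's inequality is put on eps^2
    |w|^2. *)

Section L2theory.
Context d (T : measurableType d) (R : realType).
Variable mu : {measure set T -> \bar R}.
Implicit Types (g h b : T -> R).

Definition L1 g := mu.-integrable setT (EFin \o g).
Definition L2 g := measurable_fun setT g /\ L1 (fun x => g x ^+ 2).
(** The real-valued integral is 0 when the extended one is infinite, so this is the L2 norm only on
    [L2]; the norm inequalities below assume membership there. *)
Definition nrm g := Num.sqrt (\int[mu]_x (g x ^+ 2)).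

Lemma L1_meas g : L1 g -> measurable_fun setT g.
Proof. by move=> /measurable_int /measurable_EFinP. Qed.

Lemma L1_dom g h : measurable_fun setT g -> (forall x, `|g x| <= `|h x|) ->
  L1 h -> L1 g.
Proof.
move=> mg gh; apply: le_integrable => //; first exact/measurable_EFinP.
by move=> x _ /=; rewrite lee_fin.
Qed.

Lemma L1D g h : L1 g -> L1 h -> L1 (fun x => g x + h x).
Proof. by move=> ig ih; exact: (integrableD measurableT ig ih). Qed.

Lemma L1B g h : L1 g -> L1 h -> L1 (fun x => g x - h x).
Proof. by move=> ig ih; exact: (integrableB measurableT ig ih). Qed.

Lemma L1Z (k : R) g : L1 g -> L1 (fun x => k * g x).
Proof. by move=> ig; exact: (integrableZl measurableT k ig). Qed.

Lemma L1_0 : L1 (fun=> 0).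
Proof. exact: integrable0. Qed.

Lemma L1_sum (J : Type) (r : seq J) (P : pred J) (g : J -> T -> R) :
  (forall i, P i -> L1 (g i)) -> L1 (fun x => \sum_(i <- r | P i) g i x).
Proof.
move=> ig; elim: r => [|j r IH].
  by under eq_fun => x do rewrite big_nil; exact: L1_0.
under eq_fun => x do rewrite big_cons.
by case Pj: (P j) => //; apply: L1D => //; exact: ig.
Qed.

Lemma L1_bM B b g : measurable_fun setT b -> (forall x, `|b x| <= B) ->
  L1 g -> L1 (fun x => b x * g x).
Proof.
move=> mb bB ig; apply: (L1_dom _ _ (L1Z B ig)).
  by apply: measurable_funM => //; exact: L1_meas.
move=> x; rewrite !normrM ler_wpM2r//.
by rewrite (le_trans (bB x))// ler_norm.
Qed.

Lemma L1_norm g : L1 g -> L1 (fun x => `|g x|).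
Proof. exact: integrable_norm. Qed.

Lemma RintD g h : L1 g -> L1 h ->
  \int[mu]_x (g x + h x) = \int[mu]_x g x + \int[mu]_x h x.
Proof. exact: RintegralD. Qed.

Lemma RintB g h : L1 g -> L1 h ->
  \int[mu]_x (g x - h x) = \int[mu]_x g x - \int[mu]_x h x.
Proof. exact: RintegralB. Qed.

Lemma RintZ k g : L1 g -> \int[mu]_x (k * g x) = k * \int[mu]_x g x.
Proof. exact: RintegralZl. Qed.

Lemma Rint0 : \int[mu]_x (0 : R) = 0.
Proof. by rewrite Rintegral_cst// mul0r. Qed.

Lemma RintN g : L1 g -> \int[mu]_x (- g x) = - \int[mu]_x g x.
Proof.
move=> ig; rewrite -mulN1r -RintZ//.
by apply: eq_Rintegral => x _; rewrite mulN1r.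
Qed.

Lemma Rint_sum (J : Type) (r : seq J) (P : pred J) (g : J -> T -> R) :
  (forall i, P i -> L1 (g i)) ->
  \int[mu]_x (\sum_(i <- r | P i) g i x) = \sum_(i <- r | P i) \int[mu]_x g i x.
Proof.
move=> ig; elim: r => [|j r IH].
  by rewrite big_nil; under eq_Rintegral do rewrite big_nil; exact: Rint0.
rewrite big_cons; under eq_Rintegral do rewrite big_cons.
case: ifP => Pj //; rewrite RintD ?IH//; first exact: ig.
exact: L1_sum.
Qed.

Lemma L1_ae g h : measurable_fun setT h -> {ae mu, forall x, g x = h x} ->
  L1 g -> L1 h.
Proof.
move=> mh gh ig; apply/integrableP; split; first exact/measurable_EFinP.
have /integrableP[mg] := ig.
rewrite (_ : (\int[mu]_x `|(EFin \o g) x| = \int[mu]_x `|(EFin \o h) x|)%E) //.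
apply: ae_eq_integral => //.
- by apply: measurableT_comp => //; exact/measurable_EFinP.
- by apply: measurableT_comp => //; exact/measurable_EFinP.
by apply: filterS gh => x /= -> _.
Qed.

Lemma Rint_ae g h : measurable_fun setT g -> measurable_fun setT h ->
  {ae mu, forall x, g x = h x} -> \int[mu]_x g x = \int[mu]_x h x.
Proof.
move=> mg mh gh; congr fine; apply: ae_eq_integral => //.
- exact/measurable_EFinP.
- exact/measurable_EFinP.
by apply: filterS gh => x /= -> _.
Qed.

(** [le_Rintegral] compares functions everywhere, so [h] is first replaced by the maximum of [g] and
    [h], which equals [h] almost everywhere. *)
Lemma Rint_le_ae g h : L1 g -> L1 h -> {ae mu, forall x, g x <= h x} ->
  \int[mu]_x g x <= \int[mu]_x h x.
Proof.
move=> ig ih gh.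
have im : L1 (fun x => Num.max (g x) (h x)).
  have mm : measurable_fun setT (fun x => Num.max (g x) (h x)).
    by apply: measurable_maxr; apply: L1_meas.
  apply: (L1_dom mm _ (L1D (L1_norm ig) (L1_norm ih))) => x.
  rewrite [leRHS]ger0_norm ?addr_ge0//.
  by have [_|_] := leP (g x) (h x); rewrite ?lerDr ?lerDl.
rewrite (@Rint_ae h (fun x => Num.max (g x) (h x))); try exact: L1_meas.
  apply: le_Rintegral => // x _; first by rewrite le_max lexx.
by apply: filterS gh => x gx; rewrite max_r.
Qed.

Lemma L2_meas g : L2 g -> measurable_fun setT g. Proof. by case. Qed.

Lemma L2M g h : L2 g -> L2 h -> L1 (fun x => g x * h x).
Proof.
move=> [mg ig] [mh ih]; apply: (L1_dom _ _ (L1D ig ih)).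
  exact: measurable_funM.
move=> x; rewrite normrM [leRHS]ger0_norm ?addr_ge0 ?sqr_ge0//.
rewrite -(real_normK (num_real (g x))) -(real_normK (num_real (h x))).
have := sqr_ge0 (`|g x| - `|h x|); have := mulr_ge0 (normr_ge0 (g x)) (normr_ge0 (h x)).
by move: `|g x| `|h x| => u v; nra.
Qed.

Lemma L2D g h : L2 g -> L2 h -> L2 (fun x => g x + h x).
Proof.
move=> Lg Lh; have [mg ig] := Lg; have [mh ih] := Lh.
split; first exact: measurable_funD.
under eq_fun => x do rewrite sqrrD.
apply: L1D => //; apply: L1D => //.
under eq_fun => x do rewrite -mulr_natl.
exact/L1Z/L2M.
Qed.

Lemma L2Z k g : L2 g -> L2 (fun x => k * g x).
Proof.
move=> [mg ig]; split; first exact: measurable_funM.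
by under eq_fun => x do rewrite exprMn; exact: L1Z.
Qed.

Lemma L2N g : L2 g -> L2 (fun x => - g x).
Proof. by move=> Lg; under eq_fun => x do rewrite -mulN1r; exact: L2Z. Qed.

Lemma L2B g h : L2 g -> L2 h -> L2 (fun x => g x - h x).
Proof. by move=> Lg Lh; apply: L2D => //; exact: L2N. Qed.

Lemma L2_0 : L2 (fun=> 0).
Proof. by split => //; under eq_fun => x do rewrite expr0n/=; exact: L1_0. Qed.

Lemma L2_sum (J : Type) (r : seq J) (P : pred J) (g : J -> T -> R) :
  (forall i, P i -> L2 (g i)) -> L2 (fun x => \sum_(i <- r | P i) g i x).
Proof.
move=> ig; elim: r => [|j r IH].
  by under eq_fun => x do rewrite big_nil; exact: L2_0.
under eq_fun => x do rewrite big_cons.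
by case Pj: (P j) => //; apply: L2D => //; exact: ig.
Qed.

Lemma L2_dom g h : measurable_fun setT g -> (forall x, `|g x| <= `|h x|) ->
  L2 h -> L2 g.
Proof.
move=> mg gh [mh ih]; split => //; apply: L1_dom ih; first exact: measurable_funX.
move=> x; rewrite !normrX; exact: lerXn2r (gh x).
Qed.

Lemma L2_bM B b g : measurable_fun setT b -> (forall x, `|b x| <= B) ->
  L2 g -> L2 (fun x => b x * g x).
Proof.
move=> mb bB Lg; apply: (L2_dom _ _ (L2Z B Lg)).
  by apply: measurable_funM => //; case: Lg.
move=> x; rewrite !normrM ler_wpM2r//.
by rewrite (le_trans (bB x))// ler_norm.
Qed.

Lemma L1_bMM B b g h : measurable_fun setT b -> (forall x, `|b x| <= B) ->
  L2 g -> L2 h -> L1 (fun x => b x * g x * h x).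
Proof. by move=> mb bB Lg Lh; apply: L2M => //; exact: L2_bM bB Lg. Qed.

Lemma L2_ae g h : measurable_fun setT h -> {ae mu, forall x, g x = h x} ->
  L2 g -> L2 h.
Proof.
move=> mh gh [mg ig]; split => //; apply: L1_ae ig; first exact: measurable_funX.
by apply: filterS gh => x ->.
Qed.

Lemma nrm_ge0 g : 0 <= nrm g. Proof. exact: sqrtr_ge0. Qed.

Lemma Isqr_ge0 g : 0 <= \int[mu]_x (g x ^+ 2).
Proof. by apply: Rintegral_ge0 => x _; exact: sqr_ge0. Qed.

Lemma nrm_sqr g : nrm g ^+ 2 = \int[mu]_x (g x ^+ 2).
Proof. by rewrite sqr_sqrtr// Isqr_ge0. Qed.

Lemma nrm_ae g h : measurable_fun setT g -> measurable_fun setT h ->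
  {ae mu, forall x, g x = h x} -> nrm g = nrm h.
Proof.
move=> mg mh gh; congr Num.sqrt; apply: Rint_ae; try exact: measurable_funX.
by apply: filterS gh => x ->.
Qed.

Lemma eq_nrm g h : g =1 h -> nrm g = nrm h.
Proof. by move=> gh; congr Num.sqrt; apply: eq_Rintegral => x _; rewrite gh. Qed.

Lemma cauchy_schwarz g h : L2 g -> L2 h -> `|\int[mu]_x (g x * h x)| <= nrm g * nrm h.
Proof.
move=> Lg Lh; have igh := L2M Lg Lh.
set A := \int[mu]_x (g x ^+ 2); set B := \int[mu]_x (h x ^+ 2).
set C := \int[mu]_x (g x * h x).
(* The discriminant argument with two parameters, so that no division by [A] occurs: at [(C, - A)]
   the nonnegative form equals [A * (A * B - C ^+ 2)]. *)
have quad (s t : R) : 0 <= s ^+ 2 * A + 2 * s * t * C + t ^+ 2 * B.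
  have -> : s ^+ 2 * A + 2 * s * t * C + t ^+ 2 * B =
      \int[mu]_x ((s * g x + t * h x) ^+ 2).
    rewrite -(RintZ (s ^+ 2) Lg.2) -(RintZ (t ^+ 2) Lh.2) -(RintZ (2 * s * t) igh).
    rewrite -RintD; [|exact: L1Z Lg.2|exact: L1Z].
    rewrite -RintD; [|apply: L1D; [exact: L1Z Lg.2|exact: L1Z]|exact: L1Z Lh.2].
    by apply: eq_Rintegral => x _; ring.
  exact: Isqr_ge0.
have A0 : 0 <= A by exact: Isqr_ge0.
have B0 : 0 <= B by exact: Isqr_ge0.
have CAB : C ^+ 2 <= A * B.
  have [A_eq0|/eqP An0] := eqVneq A 0.
    have [->|C0] := eqVneq C 0; first by rewrite expr0n/= mulr_ge0.
    (* If [A] vanishes and [C] does not, this choice gives the form the value [- B - 2], which is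
       absurd. *)
    have := quad ((B + 1) / C) (-1); rewrite A_eq0.
    have -> : ((B + 1) / C) ^+ 2 * 0 + 2 * ((B + 1) / C) * -1 * C + (-1) ^+ 2 * B
        = - B - 2 by field.
    by move=> ?; exfalso; lra.
  have Ap : 0 < A by rewrite lt_neqAle A0 andbT eq_sym; exact/eqP.
  have := quad C (- A).
  have -> : C ^+ 2 * A + 2 * C * - A * C + (- A) ^+ 2 * B = A * (A * B - C ^+ 2) by ring.
  by rewrite pmulr_rge0// subr_ge0.
rewrite /nrm -/A -/B -sqrtrM// -sqrtr_sqr ler_wsqrtr//.
Qed.

Lemma nrmD g h : L2 g -> L2 h -> nrm (fun x => g x + h x) <= nrm g + nrm h.
Proof.
move=> Lg Lh; rewrite -(@ler_pXn2r _ 2)// ?nnegrE ?addr_ge0 ?nrm_ge0//.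
rewrite sqrrD !nrm_sqr.
have igh := L2M Lg Lh.
have -> : \int[mu]_x ((g x + h x) ^+ 2) =
   \int[mu]_x (g x ^+ 2) + 2 * \int[mu]_x (g x * h x) + \int[mu]_x (h x ^+ 2).
  rewrite -(RintZ _ igh) -RintD; [|exact: Lg.2|exact: L1Z].
  rewrite -RintD; [|apply: L1D; [exact: Lg.2|exact: L1Z]|exact: Lh.2].
  by apply: eq_Rintegral => x _; ring.
rewrite lerD2r lerD2l -[leRHS]mulr_natl ler_wpM2l//.
exact: le_trans (ler_norm _) (cauchy_schwarz Lg Lh).
Qed.

Lemma nrmZ k g : L2 g -> nrm (fun x => k * g x) = `|k| * nrm g.
Proof.
move=> Lg; rewrite /nrm; under eq_Rintegral do rewrite exprMn.
by rewrite (RintZ _ Lg.2) sqrtrM ?sqr_ge0// sqrtr_sqr.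
Qed.

Lemma nrmN g : nrm (fun x => - g x) = nrm g.
Proof. by congr Num.sqrt; apply: eq_Rintegral => x _; rewrite sqrrN. Qed.

Lemma nrmB g h : L2 g -> L2 h -> nrm (fun x => g x - h x) <= nrm g + nrm h.
Proof. by move=> Lg Lh; rewrite -(nrmN h); apply: nrmD => //; exact: L2N. Qed.

Lemma nrm_le g h : L2 g -> L2 h -> (forall x, `|g x| <= `|h x|) -> nrm g <= nrm h.
Proof.
move=> [_ Lg] [_ Lh] gh; apply: ler_wsqrtr; apply: Rint_le_ae => //; apply: aeW => x.
by rewrite -(real_normK (num_real (g x))) -(real_normK (num_real (h x))) lerXn2r.
Qed.

Lemma nrm_bM B b g : 0 <= B -> measurable_fun setT b -> (forall x, `|b x| <= B) ->
  L2 g -> nrm (fun x => b x * g x) <= B * nrm g.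
Proof.
move=> B0 mb bB Lg.
rewrite -[B in leRHS]ger0_norm// -nrmZ//; apply: nrm_le; first exact: L2_bM Lg.
  exact: L2Z.
by move=> x; rewrite !normrM ler_wpM2r// (ger0_norm B0).
Qed.

Lemma nrm0_ae g : L2 g -> nrm g = 0 -> {ae mu, forall x, g x = 0}.
Proof.
move=> [mg ig] /eqP; rewrite sqrtr_eq0 => I_le0.
have Ie : (\int[mu]_x `|(g x ^+ 2)%:E| = 0)%E.
  have : \int[mu]_x (g x ^+ 2) = 0 by apply/eqP; rewrite eq_le I_le0 Isqr_ge0.
  move=> /(f_equal (@EFin R)); rewrite /Rintegral fineK; last exact: integrable_fin_num.
  move=> Ie; rewrite -[RHS]Ie; apply: eq_integral => x _.
  by rewrite gee0_abs// lee_fin sqr_ge0.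
have mg2 : measurable_fun setT (EFin \o (fun x => g x ^+ 2)).
  by apply/measurable_EFinP; exact: measurable_funX.
have /= := ae_eq_integral_abs mu measurableT mg2.
case=> /(_ Ie) + _; apply: filterS => x /= /(_ I)[] /eqP.
by rewrite sqrf_eq0 => /eqP.
Qed.

Lemma Rint_dominated_cvg (gn : nat -> T -> R) g h : (forall n, measurable_fun setT (gn n)) ->
  (forall x, (fun n => gn n x) @ \oo --> g x) -> L1 h ->
  (forall n x, `|gn n x| <= h x) ->
  L1 g /\ (fun n => \int[mu]_x gn n x) @ \oo --> \int[mu]_x g x.
Proof.
move=> mgn gng ih gh.
have mg : measurable_fun setT g by apply: (measurable_fun_cvg mgn) => x _; exact: gng.
have [] := @dominated_convergence _ _ _ mu setT measurableT
  (fun n => EFin \o gn n) (EFin \o g) (EFin \o h).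
- by move=> n; exact/measurable_EFinP.
- exact/measurable_EFinP.
- by apply: aeW => x _ /=; apply/fine_cvgP; split; [exact: nearW | exact: gng].
- exact: ih.
- by apply: aeW => x n _ /=; rewrite lee_fin.
move=> ig _ cv; split => //.
by apply: fine_cvg; rewrite fineK//; exact: integrable_fin_num.
Qed.

End L2theory.

(** * Strong and weak convergence of sequences in L2 *)

Section strong_convergence.
Context d (T : measurableType d) (R : realType).
Variable mu : {measure set T -> \bar R}.
Implicit Types (g h b : T -> R) (gn hn bn : nat -> T -> R).
Local Notation L1 := (L1 mu).
Local Notation L2 := (L2 mu).
Local Notation nrm := (nrm mu).

Definition cvL2 gn g :=
  [/\ forall n, L2 (gn n), L2 g & (fun n => nrm (fun x => gn n x - g x)) @ \oo --> (0 : R)].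

(** The norm bound is kept in the definition because it allows a weakly convergent factor to be
    paired with a strongly convergent one ([wcvL2_I]). *)
Definition wcvL2 gn g :=
  [/\ forall n, L2 (gn n), L2 g, (exists B, forall n, nrm (gn n) <= B) &
   forall h, L2 h -> (fun n => \int[mu]_x (gn n x * h x)) @ \oo --> \int[mu]_x (g x * h x)].

Lemma squeeze0 (u v : nat -> R) : (forall n, `|u n| <= v n) -> v @ \oo --> (0 : R) ->
  u @ \oo --> (0 : R).
Proof.
move=> uv v0; apply/norm_cvg0P; apply: (squeeze_cvgr _ (@cvg_cst _ (0:R) _ _ _) v0).
by apply: nearW => n; rewrite normr_ge0 uv.
Qed.

Lemma cvg_bounded (u : nat -> R) (l : R) : u @ \oo --> l ->
  exists2 B, 0 <= B & forall n, `|u n| <= B.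
Proof.
move=> ul; have : bounded_fun u by apply: cvg_seq_bounded; apply/cvg_ex; exists l.
case=> M [_ /(_ (`|M| + 1))] /=; rewrite (le_lt_trans (ler_norm M)) ?ltrDl// => /(_ isT) H.
by exists (`|M| + 1) => [|n]; [rewrite addr_ge0 | exact: H].
Qed.

Lemma cvg_sub0 (u : nat -> R) (l : R) : (fun n => u n - l) @ \oo --> (0 : R) -> u @ \oo --> l.
Proof. by move=> H; apply/subr_cvg0. Qed.

Lemma cvg_subr0 (u : nat -> R) (l : R) : u @ \oo --> l -> (fun n => u n - l) @ \oo --> (0 : R).
Proof. by move=> H; apply/(subr_cvg0 u l). Qed.

Lemma cvg_eq (u v : nat -> R) (l m : R) : (forall n, u n = v n) -> l = m ->
  u @ \oo --> l -> v @ \oo --> m.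
Proof. by move=> uv <-; rewrite (_ : u = v)//; apply/funext. Qed.

Lemma scvgD (u v : nat -> R) (l m : R) : u @ \oo --> l -> v @ \oo --> m ->
  (fun n => u n + v n) @ \oo --> l + m.
Proof. exact: cvgD. Qed.

Lemma scvgB (u v : nat -> R) (l m : R) : u @ \oo --> l -> v @ \oo --> m ->
  (fun n => u n - v n) @ \oo --> l - m.
Proof. exact: cvgB. Qed.

Lemma scvgM (u v : nat -> R) (l m : R) : u @ \oo --> l -> v @ \oo --> m ->
  (fun n => u n * v n) @ \oo --> l * m.
Proof. exact: cvgM. Qed.

Lemma scvgZ (k : R) (u : nat -> R) (l : R) : u @ \oo --> l ->
  (fun n => k * u n) @ \oo --> k * l.
Proof. by move=> H; apply: scvgM H; exact: cvg_cst. Qed.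

Lemma scvg_unique (u : nat -> R) (l m : R) : u @ \oo --> l -> u @ \oo --> m -> l = m.
Proof. by move=> ul um; exact: (cvg_unique (@Rhausdorff R) ul um). Qed.

Lemma scvg_norm (u : nat -> R) (l : R) : u @ \oo --> l -> (fun n => `|u n|) @ \oo --> `|l|.
Proof. exact: cvg_norm. Qed.

Lemma le_lim_seq (u v : nat -> R) (l m : R) : u @ \oo --> l -> v @ \oo --> m ->
  (forall n, u n <= v n) -> l <= m.
Proof. by move=> ul vm uv; apply: (ler_cvg_to ul vm); apply: nearW => n; exact: uv. Qed.

Lemma scvg_sum (J : Type) (r : seq J) (P : pred J) (u : J -> nat -> R) (l : J -> R) :
  (forall i, P i -> u i @ \oo --> l i) ->
  (fun n => \sum_(i <- r | P i) u i n) @ \oo --> \sum_(i <- r | P i) l i.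
Proof.
move=> H; elim: r => [|j r IH].
  by apply: (cvg_eq _ _ (@cvg_cst _ (0 : R) _ _ _)) => [n|]; rewrite big_nil.
case Pj: (P j); last by apply: (cvg_eq _ _ IH) => [n|]; rewrite big_cons Pj.
by apply: (cvg_eq _ _ (scvgD (H _ Pj) IH)) => [n|]; rewrite big_cons Pj.
Qed.

Lemma cvL2_L2 gn g n : cvL2 gn g -> L2 (gn n). Proof. by case. Qed.
Lemma cvL2_squeeze gn g (v : nat -> R) : (forall n, L2 (gn n)) -> L2 g ->
  (forall n, nrm (fun x => gn n x - g x) <= v n) -> v @ \oo --> (0 : R) -> cvL2 gn g.
Proof.
move=> Lgn Lg gv v0; split => //; apply: squeeze0 v0 => n.
by rewrite ger0_norm ?nrm_ge0.
Qed.

Lemma cvL2_cst g : L2 g -> cvL2 (fun=> g) g.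
Proof.
move=> Lg; apply: (cvL2_squeeze _ Lg) (@cvg_cst _ (0 : R) _ _ _) => // n.
rewrite (@eq_nrm _ _ _ _ _ (fun x => 0 * 0)); last by move=> x; rewrite subrr mulr0.
by rewrite nrmZ ?normr0 ?mul0r//; exact: L2_0.
Qed.

Lemma cvL2_eq gn gn' g g' : (forall n, gn n =1 gn' n) -> g =1 g' -> cvL2 gn g -> cvL2 gn' g'.
Proof.
move=> e1 e2; have -> : g' = g by apply/funext => x; rewrite e2.
by have -> : gn' = gn by apply/funext => n; apply/funext => x; rewrite e1.
Qed.

Lemma cvL2D gn g hn h : cvL2 gn g -> cvL2 hn h ->
  cvL2 (fun n x => gn n x + hn n x) (fun x => g x + h x).
Proof.
move=> [Lgn Lg cg] [Lhn Lh ch].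
apply: (@cvL2_squeeze _ _ (fun n => nrm (fun x => gn n x - g x) + nrm (fun x => hn n x - h x))).
- by move=> n; exact: L2D.
- exact: L2D.
- move=> n; rewrite (@eq_nrm _ _ _ _ _ (fun x => (gn n x - g x) + (hn n x - h x))).
    by apply: nrmD; exact: L2B.
  by move=> x; ring.
by rewrite -[X in _ --> X](addr0 0); exact: cvgD.
Qed.

Lemma cvL2_nrm gn g : cvL2 gn g -> (fun n => nrm (gn n)) @ \oo --> nrm g.
Proof.
move=> [Lgn Lg cg]; apply: cvg_sub0; apply: squeeze0 cg => n.
have h1 : nrm (gn n) <= nrm (fun x => gn n x - g x) + nrm g.
  rewrite [X in X <= _](@eq_nrm _ _ _ _ _ (fun x => (gn n x - g x) + g x)); last by move=> x; ring.
  by apply: nrmD => //; exact: L2B.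
have h2 : nrm g <= nrm (fun x => gn n x - g x) + nrm (gn n).
  rewrite [X in X <= _](@eq_nrm _ _ _ _ _ (fun x => gn n x - (gn n x - g x))); last by move=> x; ring.
  by rewrite addrC; apply: nrmB => //; exact: L2B.
by rewrite ler_norml; apply/andP; split; lra.
Qed.

Lemma cvL2_bounded gn g : cvL2 gn g -> exists2 B, 0 <= B & forall n, nrm (gn n) <= B.
Proof.
move/cvL2_nrm/cvg_bounded => [B B0 H]; exists B => // n.
exact: le_trans (ler_norm _) (H n).
Qed.

Lemma cvL2_sum (J : Type) (r : seq J) (P : pred J) (gn : J -> nat -> T -> R) (g : J -> T -> R) :
  (forall i, P i -> cvL2 (gn i) (g i)) ->
  cvL2 (fun n x => \sum_(i <- r | P i) gn i n x) (fun x => \sum_(i <- r | P i) g i x).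
Proof.
move=> H; elim: r => [|j r IH].
  apply: (cvL2_eq _ _ (cvL2_cst (L2_0 mu))) => [n x|x]; by rewrite big_nil.
case Pj: (P j); last by apply: (cvL2_eq _ _ IH) => [n x|x]; rewrite big_cons Pj.
by apply: (cvL2_eq _ _ (cvL2D (H _ Pj) IH)) => [n x|x]; rewrite big_cons Pj.
Qed.

(** Dominated convergence for the squares of g_n - g, with majorant 4 h^2; the limit inherits the
    bound by [h]. *)
Lemma cvL2_dominated gn g h : (forall n, measurable_fun setT (gn n)) ->
  (forall x, (fun n => gn n x) @ \oo --> g x) -> L2 h ->
  (forall n x, `|gn n x| <= h x) -> cvL2 gn g.
Proof.
move=> mgn gng Lh gh.
have h0 n x : `|gn n x| <= `|h x| by rewrite (le_trans (gh n x))// ler_norm.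
have mg : measurable_fun setT g by apply: (measurable_fun_cvg mgn) => x _; exact: gng.
have gh' x : `|g x| <= h x.
  have /cvg_norm := gng x; move/cvgr_to_le; apply.
  by apply: nearW => n; exact: gh.
split; first by move=> n; exact: L2_dom Lh.
  by apply: (L2_dom mg _ Lh) => x; rewrite (le_trans (gh' x))// ler_norm.
rewrite -sqrtr0; apply: (@cvg_comp _ _ _ _ (@Num.sqrt R)).
  2: exact: sqrt_continuous.
have [] := @Rint_dominated_cvg _ _ _ mu (fun n x => (gn n x - g x) ^+ 2) (fun=> 0)
  (fun x => 2 ^+ 2 * h x ^+ 2).
- by move=> n; apply/measurable_funX/measurable_funB.
- move=> x; have c0 := cvg_subr0 (gng x).
  by apply: (cvg_eq _ _ (scvgM c0 c0)) => [n|]; rewrite ?mulr0// expr2.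
- by apply: L1Z; case: Lh.
- move=> n x; rewrite ger0_norm ?sqr_ge0// -exprMn.
  rewrite -[leLHS]real_normK ?num_real// lerXn2r ?nnegrE//.
    by rewrite mulr_ge0// (le_trans _ (gh n x)).
  by rewrite (le_trans (ler_normB _ _))// mulr_natl mulr2n lerD.
by move=> _; rewrite Rint0.
Qed.

Lemma cvL2_bounded_mul bn b g (B : R) : (forall n, measurable_fun setT (bn n)) ->
  (forall n x, `|bn n x| <= B) -> (forall x, (fun n => bn n x) @ \oo --> b x) -> L2 g ->
  cvL2 (fun n x => bn n x * g x) (fun x => b x * g x).
Proof.
move=> mbn bB bnb Lg.
have mb : measurable_fun setT b by apply: (measurable_fun_cvg mbn) => x _; exact: bnb.
apply: (@cvL2_dominated _ _ (fun x => B * `|g x|)).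
- by move=> n; apply: measurable_funM => //; exact: L2_meas Lg.
- by move=> x; apply: scvgM => //; exact: cvg_cst.
- apply: L2Z; apply: (L2_dom _ _ Lg) => [|x]; last by rewrite normr_id.
  by apply: measurableT_comp => //; exact: L2_meas Lg.
- by move=> n x; rewrite normrM ler_wpM2r.
Qed.

(** The multipliers converge only pointwise, though boundedly. Hence the splitting b_n (g_n - g) +
    (b_n - b) g: the bound [B] serves the first part, dominated convergence against the fixed [g]
    the second. *)
Lemma cvL2_bM bn b gn g (B : R) : (forall n, measurable_fun setT (bn n)) ->
  (forall n x, `|bn n x| <= B) -> (forall x, (fun n => bn n x) @ \oo --> b x) ->
  cvL2 gn g -> cvL2 (fun n x => bn n x * gn n x) (fun x => b x * g x).
Proof.
move=> mbn bB bnb [Lgn Lg cg].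
have bB' n x : `|bn n x| <= `|B| by rewrite (le_trans (bB n x))// ler_norm.
have [Lbn Lb cb] := cvL2_bounded_mul mbn bB bnb Lg.
apply: (@cvL2_squeeze _ _ (fun n => `|B| * nrm (fun x => gn n x - g x) +
   nrm (fun x => bn n x * g x - b x * g x))) => //.
- by move=> n; exact: L2_bM (bB' n) _.
- move=> n; rewrite (@eq_nrm _ _ _ _ _
    (fun x => bn n x * (gn n x - g x) + (bn n x * g x - b x * g x))); last by move=> x; ring.
  apply: (le_trans (nrmD _ _)); first by apply: (L2_bM _ (bB' n)) => //; exact: L2B.
    exact: L2B.
  by rewrite lerD2r; apply: nrm_bM => //; exact: L2B.
rewrite -[X in _ --> X](addr0 0); apply: cvgD => //.
by rewrite -[X in _ --> X](mulr0 `|B|); apply: cvgM => //; exact: cvg_cst.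
Qed.

Lemma cvL2_I gn g hn h : cvL2 gn g -> cvL2 hn h ->
  (fun n => \int[mu]_x (gn n x * hn n x)) @ \oo --> \int[mu]_x (g x * h x).
Proof.
move=> cg ch; have [Lgn Lg cg0] := cg; have [Lhn Lh ch0] := ch.
have [B B0 gB] := cvL2_bounded cg.
apply: cvg_sub0; apply: (@squeeze0 _
  (fun n => B * nrm (fun x => hn n x - h x) + nrm (fun x => gn n x - g x) * nrm h)).
  move=> n.
  have -> : \int[mu]_x (gn n x * hn n x) - \int[mu]_x (g x * h x) =
    \int[mu]_x (gn n x * (hn n x - h x)) + \int[mu]_x ((gn n x - g x) * h x).
    rewrite -RintB -?RintD; try (by apply: L2M => //; exact: L2B).
    by apply: eq_Rintegral => x _; ring.
  apply: (le_trans (ler_normD _ _)); apply: lerD.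
    apply: (le_trans (cauchy_schwarz _ _)) => //; first exact: L2B.
    by rewrite ler_wpM2r// nrm_ge0.
  by apply: cauchy_schwarz => //; exact: L2B.
rewrite -[X in _ --> X](addr0 0); apply: cvgD.
  by rewrite -[X in _ --> X](mulr0 B); apply: cvgM => //; exact: cvg_cst.
by rewrite -[X in _ --> X](mul0r (nrm h)); apply: cvgM => //; exact: cvg_cst.
Qed.

Lemma cvL2_I3 bn b gn g hn h (B : R) : (forall n, measurable_fun setT (bn n)) ->
  (forall n x, `|bn n x| <= B) -> (forall x, (fun n => bn n x) @ \oo --> b x) ->
  cvL2 gn g -> cvL2 hn h ->
  (fun n => \int[mu]_x (bn n x * gn n x * hn n x)) @ \oo --> \int[mu]_x (b x * g x * h x).
Proof. by move=> mb bB bnb cg ch; exact: cvL2_I (cvL2_bM mb bB bnb cg) ch. Qed.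

(** The second factor is frozen at its limit; the error is at most the uniform bound of the weak
    sequence times a norm tending to 0. *)
Lemma wcvL2_I gn g hn h : wcvL2 gn g -> cvL2 hn h ->
  (fun n => \int[mu]_x (gn n x * hn n x)) @ \oo --> \int[mu]_x (g x * h x).
Proof.
move=> [Lgn Lg [B gB] wg] [Lhn Lh ch].
have cgh := wg _ Lh.
have : (fun n => \int[mu]_x (gn n x * (hn n x - h x))) @ \oo --> (0 : R).
  apply: (@squeeze0 _ (fun n => B * nrm (fun x => hn n x - h x))).
    move=> n; apply: (le_trans (cauchy_schwarz _ _)) => //; first exact: L2B.
    by rewrite ler_wpM2r// nrm_ge0.
  by rewrite -[X in _ --> X](mulr0 B); apply: cvgM => //; exact: cvg_cst.
move=> /(cvgD cgh); apply: cvg_eq => [n|]; last by rewrite addr0.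
have -> : \int[mu]_x (gn n x * hn n x) =
  \int[mu]_x (gn n x * h x) + \int[mu]_x (gn n x * (hn n x - h x)); last by [].
rewrite -RintD; try (by apply: L2M => //; exact: L2B).
by apply: eq_Rintegral => x _; ring.
Qed.

End strong_convergence.
Arguments scvgZ [R] k [u l].

(** * Derivatives along sequences *)

Section sderiv.
Context (R : realType).
Implicit Types (A B : set R) (f g h : R -> R) (t l : R).

(* Sequences make products, compositions and dominated convergence uniform in [A]. *)
Definition sderiv A g t l := forall s : nat -> R, (forall n, A (s n)) ->
  (forall n, s n != t) -> s @ \oo --> t ->
  (fun n => (g (s n) - g t) / (s n - t)) @ \oo --> l.

Lemma cvg_dnbhs_within A t (s : nat -> R) : (forall n, A (s n)) ->
  (forall n, s n != t) -> s @ \oo --> t -> s @ \oo --> within A t^'.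
Proof.
move=> sA st cs P; rewrite /within/= => /cs.
by apply: (@filterS _ \oo _ (fun n => s n != t -> A (s n) -> P (s n))) => n; apply.
Qed.

Lemma sderiv_within A g t : derivable_within A g t ->
  sderiv A g t (derivative_within A g t).
Proof.
move=> dg s sA st cs.
exact: (@cvg_comp _ _ _ s _ _ _ _ (cvg_dnbhs_within sA st cs) dg).
Qed.

(** If the filter limit failed for some e, countable choice would give points of [A] other than [t],
    within 1/(n+1) of [t], on which [f] stays at distance at least e from [l]. *)
Lemma seq_cvg_within A t f l : (forall s : nat -> R, (forall n, A (s n)) ->
  (forall n, s n != t) -> s @ \oo --> t -> (fun n => f (s n)) @ \oo --> l) ->
  f @ within A t^' --> l.
Proof.
move=> H; apply/cvgrPdist_lt => e e0; apply: contrapT => nF.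
have /choice [s sP] : forall n : nat, exists s, [/\ A s, s != t, `|t - s| < n.+1%:R^-1 & e <= `|l - f s|].
  move=> n; apply: contrapT => nex; apply: nF.
  rewrite /within/=; exists n.+1%:R^-1 => /=; first by rewrite invr_gt0.
  move=> s /= ts st As; rewrite ltNge; apply/negP => le_e; apply: nex.
  by exists s; split.
have cs : s @ \oo --> t.
  apply: cvg_sub0; apply: (@squeeze0 _ _ (fun n => n.+1%:R^-1)); last exact: cvg_harmonic.
  by move=> n; rewrite distrC ltW//; have [] := sP n.
have /cvgrPdist_lt/(_ e e0)[N _ /(_ N (leqnn N))] :=
  H s (fun n => let: And4 a _ _ _ := sP n in a) (fun n => let: And4 _ a _ _ := sP n in a) cs.
by rewrite /= ltNge; have [_ _ _ ->] := sP N.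
Qed.

Lemma seq_cvg_within_nbhs A t f l : (forall s : nat -> R, (forall n, A (s n)) ->
  s @ \oo --> t -> (fun n => f (s n)) @ \oo --> l) -> f @ within A (nbhs t) --> l.
Proof.
move=> H; apply/cvgrPdist_lt => e e0; apply: contrapT => nF.
have /choice [s sP] : forall n : nat, exists s, [/\ A s, `|t - s| < n.+1%:R^-1 & e <= `|l - f s|].
  move=> n; apply: contrapT => nex; apply: nF.
  rewrite /within/=; exists n.+1%:R^-1 => /=; first by rewrite invr_gt0.
  move=> s /= ts As; rewrite ltNge; apply/negP => le_e; apply: nex.
  by exists s; split.
have cs : s @ \oo --> t.
  apply: cvg_sub0; apply: (@squeeze0 _ _ (fun n => n.+1%:R^-1)); last exact: cvg_harmonic.
  by move=> n; rewrite distrC ltW//; have [] := sP n.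
have /cvgrPdist_lt/(_ e e0)[N _ /(_ N (leqnn N))] :=
  H s (fun n => let: And3 a _ _ := sP n in a) cs.
by rewrite /= ltNge; have [_ _ ->] := sP N.
Qed.

(** The value of [derivative_within] rests on uniqueness of the limit, hence on [t] being an
    accumulation point of [A]; this is the properness of the filter. *)
Lemma within_sderiv A g t l : ProperFilter (within A t^') -> sderiv A g t l ->
  derivable_within A g t /\ derivative_within A g t = l.
Proof.
move=> PF dg; have cv := @seq_cvg_within A t (fun s => (g s - g t) / (s - t)) l dg.
by split; [apply/cvg_ex; exists l | exact/cvg_lim].
Qed.

Lemma within_itv_proper (a b t : R) : a < b -> a <= t <= b ->
  ProperFilter (within `[a, b]%classic t^').
Proof.
move=> ab /andP[at_ tb]; split; last exact: within_filter.
rewrite /within/= => -[e /= e0 He].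
have [tltb|btT] := ltP t b.
  (* A point of the interval different from [t] and closer than [e] is reached by moving right, or
     left when [t] is the right end point; the minimum keeps it inside. *)
  pose s := t + Num.min (e / 2) (b - t).
  have m0 : 0 < Num.min (e / 2) (b - t) by rewrite lt_min divr_gt0// subr_gt0.
  have m1 : Num.min (e / 2) (b - t) <= e / 2 by rewrite ge_min lexx.
  have m2 : Num.min (e / 2) (b - t) <= b - t by rewrite ge_min lexx orbT.
  apply: (He s).
  - rewrite /ball_/= /s opprD addNKr normrN ger0_norm ?ltW//.
    by apply: (le_lt_trans m1); rewrite ltr_pdivrMr// ltr_pMr// ltr1n.
  - by rewrite gt_eqF// ltrDl.
  - by rewrite /= in_itv/=; apply/andP; split; rewrite /s; lra.
pose s := t - Num.min (e / 2) (b - a).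
have tb' : t = b by apply/eqP; rewrite eq_le tb btT.
have m0 : 0 < Num.min (e / 2) (b - a) by rewrite lt_min divr_gt0// subr_gt0.
have m1 : Num.min (e / 2) (b - a) <= e / 2 by rewrite ge_min lexx.
have m2 : Num.min (e / 2) (b - a) <= b - a by rewrite ge_min lexx orbT.
apply: (He s).
- rewrite /ball_/= /s opprB addrC subrK ger0_norm ?ltW//.
  by apply: (le_lt_trans m1); rewrite ltr_pdivrMr// ltr_pMr// ltr1n.
- by rewrite lt_eqF// gtrBl.
- by rewrite /= in_itv/=; apply/andP; split; rewrite /s; lra.
Qed.

(** Convergence along sequences avoiding [t] is first turned into a filter limit, which then handles
    sequences that may take the value [t]. *)
Lemma sderiv_cont_gen A g t : (forall s : nat -> R, (forall n, A (s n)) ->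
    (forall n, s n != t) -> s @ \oo --> t -> (fun n => g (s n)) @ \oo --> g t) ->
  forall s : nat -> R, (forall n, A (s n)) -> s @ \oo --> t ->
  (fun n => g (s n)) @ \oo --> g t.
Proof.
move=> /seq_cvg_within H s sA cs; apply/cvgrPdist_lt => e e0.
have /cvgrPdist_lt/(_ e e0) := H; rewrite /within/= => /cs.
apply: (@filterS _ \oo _ (fun n => s n != t -> A (s n) -> `|g t - g (s n)| < e)) => n /= Hn.
have [->|sn] := eqVneq (s n) t; first by rewrite subrr normr0.
by apply: Hn => //; exact: sA.
Qed.

Lemma sderiv_cont A g t l (s : nat -> R) : sderiv A g t l ->
  (forall n, A (s n)) -> s @ \oo --> t -> (fun n => g (s n)) @ \oo --> g t.
Proof.
move=> dg; move: s; apply: sderiv_cont_gen => s sA st cs.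
have H := dg s sA st cs.
apply: cvg_sub0; apply: (cvg_eq _ _ (scvgM H (cvg_subr0 cs))); last by rewrite mulr0.
by move=> n /=; rewrite divfK// subr_eq0.
Qed.

Lemma sderivS A B g t l : A `<=` B -> sderiv B g t l -> sderiv A g t l.
Proof. by move=> AB dg s sA; apply: dg => n; exact/AB. Qed.

Lemma sderiv_cst A c t : sderiv A (fun=> c) t 0.
Proof.
move=> s sA st cs; apply: (cvg_eq _ _ (@cvg_cst _ (0 : R) _ _ _)) => // n.
by rewrite subrr mul0r.
Qed.

Lemma sderiv_id A t : sderiv A (fun x => x) t 1.
Proof.
move=> s sA st cs; apply: (cvg_eq _ _ (@cvg_cst _ (1 : R) _ _ _)) => // n.
by rewrite divff// subr_eq0 st.
Qed.

Lemma sderivD A f g t l m : sderiv A f t l -> sderiv A g t m ->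
  sderiv A (fun x => f x + g x) t (l + m).
Proof.
move=> df dg s sA st cs; apply: (cvg_eq _ _ (scvgD (df s sA st cs) (dg s sA st cs))) => // n /=.
by rewrite -mulrDl; congr (_ / _); ring.
Qed.

Lemma sderivM A f g t l m : sderiv A f t l -> sderiv A g t m ->
  sderiv A (fun x => f x * g x) t (l * g t + f t * m).
Proof.
move=> df dg s sA st cs; have cg := sderiv_cont dg sA cs.
have H := scvgD (scvgM (df s sA st cs) cg) (scvgZ (f t) (dg s sA st cs)).
refine (cvg_eq _ _ H) => // n /=.
rewrite mulrAC (mulrA (f t)) -mulrDl; congr (_ / _).
by ring.
Qed.

Lemma sderivZ A g t l k : sderiv A g t l -> sderiv A (fun x => k * g x) t (k * l).
Proof.
move=> dg s sA st cs.
apply: (cvg_eq _ _ (scvgZ k (dg s sA st cs))) => // n /=.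
by rewrite mulrA mulrBr.
Qed.

Arguments sderivZ [A g t l] k.

Lemma sderivB A f g t l m : sderiv A f t l -> sderiv A g t m ->
  sderiv A (fun x => f x - g x) t (l - m).
Proof.
move=> df dg; have := sderivD df (sderivZ (-1) dg).
rewrite mulN1r (_ : (fun x => _) = (fun x => f x - g x))//.
by apply/funext => x; rewrite mulN1r.
Qed.

Lemma sderiv_sum A (J : Type) (r : seq J) (P : pred J) (f : J -> R -> R) (l : J -> R) t :
  (forall i, P i -> sderiv A (f i) t (l i)) ->
  sderiv A (fun x => \sum_(i <- r | P i) f i x) t (\sum_(i <- r | P i) l i).
Proof.
move=> H; elim: r => [|j r IH].
  rewrite big_nil (_ : (fun x => _) = fun=> 0); last by apply/funext => x; rewrite big_nil.
  exact: sderiv_cst.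
rewrite big_cons; case Pj: (P j).
  rewrite (_ : (fun x => _) = fun x => f j x + \sum_(i <- r | P i) f i x).
    by apply: sderivD => //; exact: H.
  by apply/funext => x; rewrite big_cons Pj.
rewrite (_ : (fun x => _) = fun x => \sum_(i <- r | P i) f i x)//.
by apply/funext => x; rewrite big_cons Pj.
Qed.

Lemma sderiv_ext A f g t l : (forall x, A x -> f x = g x) -> f t = g t ->
  sderiv A f t l -> sderiv A g t l.
Proof.
move=> fg fgt df s sA st cs; apply: (cvg_eq _ _ (df s sA st cs)) => // n.
by rewrite fg// fgt.
Qed.

Lemma sderiv_comp A B f g t l m : (forall x, A x -> B (g x)) ->
  sderiv B f (g t) l -> sderiv A g t m -> sderiv A (fun x => f (g x)) t (l * m).
Proof.
move=> gAB df dg s sA st cs.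
(* Caratheodory's quotient: [g (s n)] may equal [g t], so the difference quotient of [f] is
   completed there by [l], which makes it continuous at [g t]. *)
pose Q r := if r == g t then l else (f r - f (g t)) / (r - g t).
have cg := sderiv_cont dg sA cs.
have cQ : (fun n => Q (g (s n))) @ \oo --> l.
  rewrite (_ : l = Q (g t)) in df *; last by rewrite /Q eqxx.
  apply: (@sderiv_cont_gen B Q (g t) _ (fun n => g (s n))) cg => [r rB rt cr|n].
    apply: (cvg_eq _ _ (df r rB rt cr)) => // n.
    by rewrite /Q; case: ifPn => // /eqP E; have := rt n; rewrite E eqxx.
  exact/gAB/sA.
apply: (cvg_eq _ _ (scvgM cQ (dg s sA st cs))) => // n /=.
rewrite /Q; case: ifPn => [/eqP ->|sn]; first by rewrite !subrr !mul0r mulr0.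
by rewrite mulrA divfK// subr_eq0.
Qed.

Lemma sderiv_is_derive A g t l : (\forall r \near t, A r) -> sderiv A g t l ->
  is_derive t 1 g l.
Proof.
move=> At dg.
suff H : (fun h : R => h^-1 *: ((g \o shift t) (h *: 1) - g t)) @ 0^' --> l.
  by apply: DeriveDef; [apply/cvg_ex; exists l | exact/cvg_lim].
suff H : (fun h : R => h^-1 *: ((g \o shift t) (h *: 1) - g t)) @ within setT 0^' --> l.
  by move=> P /H; rewrite /within/=; apply: (@filterS _ 0^') => x; apply.
apply: seq_cvg_within => s _ s0 cs.
have cst : (fun n => s n + t) @ \oo --> t.
  by apply: (cvg_eq _ _ (scvgD cs (@cvg_cst _ t _ \oo _))) => //; rewrite add0r.
(* Only a tail of the sequence is known to lie in [A], while [sderiv] asks for all terms; the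
   sequence is shifted by [N]. *)
have [N _ NA] : \forall n \near \oo, A (s n + t) by exact: (cst _ At).
rewrite -(cvg_shiftn N).
have H := dg (fun n => s (n + N)%N + t) _ _ _.
apply: (cvg_eq _ _ (H _ _ _)) => [n| | | |] //.
- have E : s (n + N)%N *: (1 : R) = s (n + N)%N by exact: mulr1.
  by rewrite /= /shift /= E addrK mulrC.
- by move=> n; apply: NA; rewrite /= leq_addl.
- by move=> n; rewrite -subr_eq0 addrK.
- by have := cst; rewrite -(cvg_shiftn N).
Qed.

Lemma sderiv_MVT g (g' : R -> R) (a b : R) : a < b ->
  (forall r, a <= r <= b -> sderiv `[a, b]%classic g r (g' r)) ->
  exists2 c, a <= c <= b & g b - g a = g' c * (b - a).
Proof.
move=> ab dg.
have [x||c cab ->] := @MVT R g g' a b ab; last first.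
- by exists c => //; move: cab; rewrite in_itv/= => /andP[/ltW -> /ltW ->].
- apply/subspace_continuousP => x /= xab.
  apply: seq_cvg_within_nbhs => s sA cs.
  have xab' : a <= x <= b by move: xab; rewrite in_itv.
  exact: sderiv_cont (dg x xab') sA cs.
rewrite in_itv/= => /andP[ax xb].
apply: (@sderiv_is_derive `[a, b]%classic); last by apply: dg; rewrite !ltW.
have /= := near_in_itvoo (_ : x \in `]a, b[); rewrite in_itv/= ax xb => /(_ isT).
apply: filterS => r /= /andP[/ltW ar /ltW rb].
by rewrite /= in_itv/= ar rb.
Qed.

(** The end points come in no fixed order because increments, in time as in space, may have either
    sign. *)
Lemma sderiv_MVT_unordered A g g' (a b : R) :
  (forall r, Num.min a b <= r <= Num.max a b -> A r) ->
  (forall r, Num.min a b <= r <= Num.max a b -> sderiv A g r (g' r)) ->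
  exists2 c, Num.min a b <= c <= Num.max a b & g b - g a = g' c * (b - a).
Proof.
wlog ab : a b / a <= b => [H AB dg|].
  case/orP: (le_total a b) => [/H|/H]; first exact.
  rewrite minC maxC => /(_ AB dg)[c cab E]; exists c => //.
  by rewrite -opprB E -mulrN opprB.
rewrite (min_idPl ab) (max_idPr ab).
move: ab; rewrite le_eqVlt => /predU1P[->|ab] AB dg.
  by exists b; rewrite ?lexx// !subrr mulr0.
apply: sderiv_MVT => // r rab; apply: (sderivS _ (dg _ rab)) => x /=.
by rewrite in_itv/=; exact: AB.
Qed.

Lemma sderiv_le A g g' (B : R) (a b : R) :
  (forall r, Num.min a b <= r <= Num.max a b -> A r) ->
  (forall r, Num.min a b <= r <= Num.max a b -> sderiv A g r (g' r)) ->
  (forall r, Num.min a b <= r <= Num.max a b -> `|g' r| <= B) ->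
  `|g b - g a| <= B * `|b - a|.
Proof.
move=> AB dg gB; have [c cab ->] := sderiv_MVT_unordered AB dg.
by rewrite normrM ler_wpM2r// gB.
Qed.

Lemma derivable_sderiv0 (V : normedModType R) (g : V -> R) (x v : V) :
  derivable g x v -> sderiv setT (fun r => g (x + r *: v)) 0 ('D_v g x).
Proof.
move=> dg s _ s0 cs.
have H : (fun n => (s n)^-1 *: ((g \o shift x) (s n *: v) - g x)) @ \oo --> 'D_v g x.
  apply: (@cvg_comp _ _ _ s (fun r => r^-1 *: ((g \o shift x) (r *: v) - g x)) _ 0^') dg.
  by move=> P P0; apply: (cvg_dnbhs_within (A := setT) (fun=> I) s0 cs); exact: cvg_within.
apply: cvg_eq H => // n; rewrite scale0r addr0 subr0 mulrC /shift/= [x + _]addrC.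
by [].
Qed.

Lemma derivable_sderiv (V : normedModType R) (g : V -> R) (x v : V) (r : R) :
  derivable g (x + r *: v) v ->
  sderiv setT (fun r => g (x + r *: v)) r ('D_v g (x + r *: v)).
Proof.
move=> /derivable_sderiv0 H s _ sr cs.
have := H (fun n => s n - r) (fun=> I) (fun n => _) (cvg_subr0 cs).
have E n : s n - r != 0 by rewrite subr_eq0.
move=> /(_ E); apply: cvg_eq => // n.
by rewrite scale0r addr0 subr0 -addrA -scalerDl [r + _]addrC subrK.
Qed.

Lemma is_derive_sderiv (g : R -> R) t l : is_derive t 1 g l -> sderiv setT g t l.
Proof.
case=> dg <-; have := @derivable_sderiv R g 0 1 t.
have E r : 0 + r *: 1 = r :> R by rewrite add0r; exact: mulr1.
by rewrite E => /(_ dg); apply: sderiv_ext => [r _|]; rewrite E.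
Qed.

End sderiv.
Arguments sderivZ [R A g t l] k.

(** * Lebesgue measure on row vectors *)

Section rV_measure.
Context (R : realType) (d : nat).
Local Notation X := 'rV[R]_d.
Local Notation dx := (leb R d).
Implicit Types (a b : 'I_d -> R) (g : X -> R).

Definition obox a b : set X := [set x | forall i, a i < x ord0 i < b i].
Definition cube (r : R) : set X := [set x | forall i, `|x ord0 i| <= r].

Let oboxE a b : obox a b = [set x | forall i, `]a i, b i[%classic (x ord0 i)].
Proof. by apply/seteqP; split => x /= + i => /(_ i); rewrite in_itv. Qed.

Lemma measurable_forall (A : 'I_d -> set R) : (forall i, measurable (A i)) ->
  measurable [set x : X | forall i, A i (x ord0 i)].
Proof.
move=> mA; have -> : [set x : X | forall i, A i (x ord0 i)] = \bigcap_(i in [set: 'I_d])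
    ((fun y : X => y ord0 i : measurableTypeR R) @^-1` A i).
  by apply/seteqP; split=> y /= h i; [move=> _; exact: h|exact: h].
apply: fin_bigcap_measurable => // i _.
by rewrite -[X in measurable X]setTI; exact: (measurable_coord i measurableT (mA i)).
Qed.

Lemma measurable_obox a b : measurable (obox a b).
Proof. by rewrite oboxE; apply: (measurable_forall (A := fun i => `]a i, b i[%classic)) => i; exact: measurable_itv. Qed.

Lemma measurable_cube r : measurable (cube r).
Proof.
have -> : cube r = [set x : X | forall i, `[- r, r]%classic (x ord0 i)].
  by apply/seteqP; split => x /= + i => /(_ i); rewrite in_itv/= ler_norml.
by apply: (measurable_forall (A := fun=> `[- r, r]%classic)) => i; exact: measurable_itv.
Qed.

Lemma leb_obox a b : (forall i, a i <= b i) -> dx (obox a b) = (\prod_(i < d) (b i - a i))%:E.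
Proof.
move=> ab; rewrite oboxE (leb_box (A := fun i => `]a i, b i[%classic)); last by move=> i; exact: measurable_itv.
rewrite (big_morph EFin (fun x y : R => EFinM x y) erefl); apply: eq_bigr => i _.
rewrite lebesgue_measure_itv/= lte_fin; case: ltP => //.
by move=> ba; rewrite (@le_anti _ _ (a i) (b i)) ?subrr// ab ba.
Qed.

Lemma obox_lty a b : (dx (obox a b) < +oo)%E.
Proof.
have [ab|/existsNP[i /negP]] := pselect (forall i, a i <= b i).
  by rewrite leb_obox// ltry.
rewrite -ltNge => ba; rewrite (_ : obox a b = set0) ?measure0//.
rewrite -subset0 => x /(_ i) /andP[h1 h2].
by have := lt_trans (lt_trans ba h1) h2; rewrite ltxx.
Qed.

Lemma cube_sub r : cube r `<=` obox (fun=> - (r + 1)) (fun=> r + 1).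
Proof.
move=> x xr i; have := xr i; rewrite ler_norml => /andP[h1 h2].
by apply/andP; split; lra.
Qed.

Lemma cube_lty r : (dx (cube r) < +oo)%E.
Proof.
apply: le_lt_trans (obox_lty (fun=> - (r + 1)) (fun=> r + 1)).
apply: le_measure; rewrite ?inE; [exact: measurable_cube|exact: measurable_obox|exact: cube_sub].
Qed.

Lemma leb_setT_gt0 : (0 < d)%N -> (0 < dx setT)%E.
Proof.
move=> _; apply: (@lt_le_trans _ _ (dx (obox (fun=> 0) (fun=> 1)))).
  rewrite leb_obox => [|i]; last exact: ler01.
  by rewrite lte_fin prodr_gt0// => i _; rewrite subr0.
by apply: le_measure; rewrite ?inE//; exact: measurable_obox.
Qed.

(** A pi-system generating the Borel sets; both translation invariance and the density of test
    functions are checked on it. *)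
Definition boxes : set (set X) := [set A | exists a b, A = obox a b].

Lemma boxes_setI : setI_closed boxes.
Proof.
move=> _ _ [a [b ->]] [a' [b' ->]].
exists (fun i => Num.max (a i) (a' i)), (fun i => Num.min (b i) (b' i)).
apply/seteqP; split => x /=.
  by move=> [h h'] i; have /andP[h1 h2] := h i; have /andP[h3 h4] := h' i; rewrite gt_max lt_min h1 h2 h3.
by move=> h; split=> i; have := h i; rewrite gt_max lt_min => /andP[/andP[h1 h2] /andP[h3 h4]]; apply/andP.
Qed.

Definition nbox (n : nat) : set X := obox (fun=> - n%:R) (fun=> n%:R).

Lemma nbox_cover : \bigcup_n nbox n = setT.
Proof.
apply/seteqP; split => // x _.
pose n := (\max_(i < d) Num.truncn `|x ord0 i|).+1.
exists n => // i; rewrite -ltr_norml.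
apply: lt_le_trans (truncnS_gt _) _.
by rewrite ler_nat /n ltnS; exact: (leq_bigmax_cond (P := xpredT) (F := fun i => Num.truncn `|x ord0 i|)).
Qed.

Lemma measurable_boxes : @measurable _ X = <<s boxes >>.
Proof.
apply/seteqP; split => A.
  apply: smallest_sub; first exact: smallest_sigma_algebra.
  rewrite -bigcup_seq => {}A [i _] [B mB <-]; rewrite setTI.
  move: B mB; change (@measurable _ (measurableTypeR R) `<=`
    [set B | <<s boxes >> ((fun x : X => x ord0 i) @^-1` B)]).
  rewrite [X in X `<=` _](RGenOInfty.measurableE R).
  apply: smallest_sub.
    split => /=.
    - by rewrite preimage_set0; exact: sigma_algebra0.
    - by move=> B sB; rewrite setTD preimage_setC; exact: sigma_algebraC.
    - by move=> F sF; rewrite preimage_bigcup; exact: sigma_algebra_bigcup.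
  move=> _ [c ->] /=.
  (* An open half-space is a countable union of bounded boxes: in direction [i] only the lower end
     is replaced by [c]. *)
  have -> : (fun x : X => x ord0 i) @^-1` `]c, +oo[%classic =
     \bigcup_n obox (fun j => if j == i then c else - n%:R) (fun=> n%:R).
    apply/seteqP; split => x /=.
      rewrite in_itv/= andbT => cx; have [n _ xn] : (\bigcup_n nbox n) x by rewrite nbox_cover.
      by exists n => // j; have /andP[h1 h2] := xn j; apply/andP; split => //; case: eqP => [->|].
    by move=> [n _ /(_ i)]; rewrite eqxx in_itv/= andbT => /andP[].
  apply: sigma_algebra_bigcup => n; apply: sub_sigma_algebra.
  by eexists; eexists.
apply: smallest_sub; first exact: sigma_algebra_measurable.
by move=> _ [a [b ->]]; exact: measurable_obox.
Qed.

Lemma rV_nbhsP (x : X) (U : set X) : nbhs x U <->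
  exists2 e : R, 0 < e & forall y : X, (forall i, `|x ord0 i - y ord0 i| < e) -> U y.
Proof.
split.
  move/nbhs_ballP => [e /= e0 eU]; exists e => // y xy; apply: eU.
  by split=> // i j; rewrite ord1; exact: xy.
move=> [e e0 eU]; apply/nbhs_ballP; exists e => // y [_ xy]; apply: eU => i.
exact: xy.
Qed.

(** Second countability made explicit: [U] is the union, over rational centres and radii 1/(k+1), of
    the boxes contained in [U], enumerated by [pickle]. *)
Lemma open_measurable_rV (U : set X) : open U -> measurable U.
Proof.
move=> oU.
pose B (q : 'rV[rat]_d) (k : nat) : set X :=
  obox (fun i => ratr (q ord0 i) - k.+1%:R^-1) (fun i => ratr (q ord0 i) + k.+1%:R^-1).
pose F (n : nat) : set X := if unpickle n is Some (q, k) then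
  (if `[< B q k `<=` U >] then B q k else set0) else set0.
have -> : U = \bigcup_n F n.
  apply/seteqP; split => x; last first.
    move=> [n _]; rewrite /F; case: unpickle => [[q k]|]//.
    by case: asboolP => // + h; apply.
  move=> Ux; have /rV_nbhsP[e e0 eU] : nbhs x U by exact: open_nbhs_nbhs.
  (* The radius 1/(k+1) is then at most e/2, so a box of this radius containing [x] stays within
     distance e of [x]. *)
  pose k := Num.truncn (2 / e).
  have ke : k.+1%:R^-1 + k.+1%:R^-1 <= e.
    have h : 2 / e < k.+1%:R by exact: truncnS_gt.
    have -> : k.+1%:R^-1 + k.+1%:R^-1 = 2 / k.+1%:R :> R by ring.
    by rewrite ler_pdivrMr// mulrC -ler_pdivrMr// ltW.
  have kp : 0 < k.+1%:R^-1 :> R by rewrite invr_gt0.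
  have /choice[q qP] : forall i : 'I_d, exists q : rat,
      x ord0 i - k.+1%:R^-1 < ratr q < x ord0 i + k.+1%:R^-1.
    move=> i; have [|q] := @rat_in_itvoo R (x ord0 i - k.+1%:R^-1) (x ord0 i + k.+1%:R^-1).
      by rewrite ltrD2l (lt_trans _ kp)// oppr_lt0.
    by rewrite in_itv/=; exists q.
  exists (pickle (\row_i q i : 'rV[rat]_d, k)) => //.
  rewrite /F pickleK asboolT.
    move=> i; rewrite mxE; have /andP[] := qP i.
    by move: (k.+1%:R^-1) => r h1 h2; apply/andP; split; lra.
  move=> y yB; apply: eU => i; have := yB i; rewrite mxE; have := qP i; move: ke.
  move: (k.+1%:R^-1) => r ke /andP[h1 h2] /andP[h3 h4].
  by rewrite ltr_norml; apply/andP; split; lra.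
apply: bigcup_measurable => n _; rewrite /F; case: unpickle => [[q k]|]//.
by case: asboolP => // _; exact: measurable_obox.
Qed.

Lemma continuous_measurable_rV g : continuous g -> measurable_fun setT g.
Proof.
move=> cg; apply: (measurability (RGenOInfty.G (R := R))); first exact: RGenOInfty.measurableE.
move=> _ [_ [c ->] <-]; rewrite setTI; apply: open_measurable_rV.
by apply: open_comp; [move=> x _; exact: cg | exact: interval_open].
Qed.

Lemma compact_measurable_rV (K : set X) : compact K -> measurable K.
Proof.
move=> /compact_closed cK; rewrite -(setCK K); apply: measurableC.
by apply: open_measurable_rV; apply: closed_openC; exact: cK.
Qed.

Lemma compact_cube (r : R) : compact (cube r).
Proof.
have -> : cube r = [set x : X | forall i, `[- r, r]%classic (x ord0 i)].
  by apply/seteqP; split => x /= + i => /(_ i); rewrite in_itv/= ler_norml.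
by apply: (@rV_compact _ _ (fun=> `[- r, r]%classic)) => i; exact: segment_compact.
Qed.

Lemma compact_sub_cube (K : set X) : compact K -> exists2 r, 0 < r & K `<=` cube r.
Proof.
move=> cK; have [M [_ /(_ (`|M| + 1))]] := compact_bounded cK.
rewrite (le_lt_trans (ler_norm M)) ?ltrDl// => /(_ isT) H.
exists (`|M| + 1) => [|x Kx i]; first by rewrite ltr_wpDl.
by apply: le_trans (H _ Kx); rewrite [leRHS]mx_normrE; exact: (le_bigmax _ _ (ord0, i)).
Qed.

Lemma compact_lty (K : set X) : compact K -> (dx K < +oo)%E.
Proof.
move=> cK; have [r _ Kr] := compact_sub_cube cK.
apply: le_lt_trans (cube_lty r); apply: le_measure; rewrite ?inE//.
- exact: compact_measurable_rV.
- exact: measurable_cube.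
Qed.

Definition transl (v x : X) : X := x + v.

Lemma measurable_transl v : measurable_fun setT (transl v).
Proof.
apply: measurable_fun_rV => i.
under eq_fun => x do rewrite mxE.
by apply: measurable_funD => //; exact: measurable_coord.
Qed.

(** Two measures that agree on a pi-system and are finite on a covering sequence of it coincide. On
    boxes translation only shifts the end points; boxes with reversed end points are empty. *)
Lemma leb_transl v A : measurable A -> dx (transl v @^-1` A) = dx A.
Proof.
move=> mA.
have := @measure_unique _ R _ boxes nbox measurable_boxes boxes_setI _ nbox_cover
  (measure_function_pushforward__canonical__measure_function_Measure (leb R d) (measurable_transl v)) (leb R d).
move=> /(_ _ _ _ A mA); apply.
- by move=> n; eexists; eexists.
- move=> _ [a [b ->]]; rewrite /= /pushforward.
  have -> : transl v @^-1` obox a b = obox (fun i => a i - v ord0 i) (fun i => b i - v ord0 i).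
    apply/seteqP; split => x /= h i; have := h i; rewrite /transl ?mxE => /andP[h1 h2];
      by apply/andP; split; lra.
  have [ab|/existsNP[i /negP]] := pselect (forall i, a i <= b i).
    rewrite !leb_obox// => [|i]; last by have := ab i; lra.
    by congr EFin; apply: eq_bigr => i _; ring.
  rewrite -ltNge => ba.
  have e0 (a' b' : 'I_d -> R) : b' i < a' i -> obox a' b' = set0.
    move=> ba'; rewrite -subset0 => x /(_ i) /andP[h1 h2].
    by have := lt_trans (lt_trans ba' h1) h2; rewrite ltxx.
  by rewrite !e0//; lra.
- move=> n; rewrite /= /pushforward.
  have -> : transl v @^-1` nbox n = obox (fun i => - n%:R - v ord0 i) (fun i => n%:R - v ord0 i).
    apply/seteqP; split => x /= h i; have := h i; rewrite /transl ?mxE => /andP[h1 h2];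
      by apply/andP; split; lra.
  exact: obox_lty.
Qed.

Lemma measurable_comp_transl (v : X) g : measurable_fun setT g ->
  measurable_fun setT (fun x : X => g (x + v)).
Proof. by move=> mg; exact: measurableT_comp mg (measurable_transl v). Qed.

Lemma ge0_integral_transl (v : X) (g : X -> \bar R) : measurable_fun setT g ->
  (forall x, (0 <= g x)%E) -> (\int[dx]_x g (x + v)%R = \int[dx]_x g x)%E.
Proof.
move=> mg g0.
have := ge0_integral_pushforward (measurable_transl v) dx measurableT mg (fun y _ => g0 y).
rewrite preimage_setT => <-; apply: eq_measure_integral => [|mT A mA _].
  exact: measurable_transl.
exact: leb_transl.
Qed.

Lemma L1_transl (v : X) g : L1 dx g -> L1 dx (fun x : X => g (x + v)).
Proof.
move=> ig; have mg := L1_meas ig; apply/integrableP; split.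
  by apply/measurable_EFinP; exact: measurable_comp_transl.
rewrite (@ge0_integral_transl v (fun x => `|(g x)%:E|%E)).
- by case/integrableP : ig.
- by apply: measurableT_comp => //; exact/measurable_EFinP.
- by move=> x; exact: abse_ge0.
Qed.

Lemma Rint_transl (v : X) g : measurable_fun setT g ->
  \int[dx]_x g (x + v) = \int[dx]_x g x.
Proof.
move=> mg; congr fine; have mEg : measurable_fun setT (fun x => (g x)%:E).
  exact/measurable_EFinP.
rewrite [RHS]integralE -(@ge0_integral_transl v _ (measurable_funepos mEg))//.
rewrite -(@ge0_integral_transl v _ (measurable_funeneg mEg))// [LHS]integralE.
by congr (_ - _)%E; apply: eq_integral => x _; rewrite ?funeposE ?funenegE.
Qed.

Lemma L2_transl (v : X) g : L2 dx g -> L2 dx (fun x : X => g (x + v)).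
Proof.
by move=> [mg ig]; split; [exact: measurable_comp_transl | exact: L1_transl ig].
Qed.

Lemma nrm_transl (v : X) g : measurable_fun setT g -> nrm dx (fun x : X => g (x + v)) = nrm dx g.
Proof.
move=> mg; rewrite /nrm (@Rint_transl v (fun x => g x ^+ 2))//.
exact: measurable_funX.
Qed.

(** A strict violation at one point persists by continuity on an open box, whose measure is
    positive. *)
Lemma ae_continuous_le g (B : R) : continuous g -> {ae dx, forall x, g x <= B} ->
  forall x, g x <= B.
Proof.
move=> cg [N [mN N0 BN]] x; rewrite leNgt; apply/negP => Bg.
have /rV_nbhsP[e e0 eU] : \forall y \near x, B < g y.
  by move: (cg x) => /(_ _ (lt_nbhsr Bg)) => H; exact: H.
pose a i := x ord0 i - e; pose b i := x ord0 i + e.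
have : (dx (obox a b) <= dx N)%E.
  apply: le_measure; rewrite ?inE//; first exact: measurable_obox.
  move=> y yx; apply: BN => /=; apply/negP; rewrite -ltNge; apply: eU => i.
  by have := yx i; rewrite /a /b => /andP[h1 h2]; rewrite ltr_norml; apply/andP; split; lra.
rewrite N0 leb_obox => [|i]; last by rewrite /a /b; lra.
by rewrite leNgt lte_fin prodr_gt0// => i _; rewrite /a /b; lra.
Qed.

End rV_measure.

(** * Test functions *)

Section flat_function.
Context (R : realType).
Implicit Types (x : R) (n : nat).

(** For n = 0 this is the classical smooth function vanishing on a half-line. The powers of 1/x make
    the family closed under differentiation up to linear combinations. *)
Definition flat n x : R := if 0 < x then x^-1 ^+ n * expR (- x^-1) else 0.

Lemma flat_ge0 n x : 0 <= flat n x.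
Proof.
by rewrite /flat; case: ltP => // x0; rewrite mulr_ge0 ?expR_ge0// exprn_ge0// invr_ge0 ltW.
Qed.

(** With y = 1/x this is y^(n+1) <= (n+1)! exp y. It settles differentiability at 0, because
    dividing [flat n] by x yields [flat n.+1]. *)
Lemma flat_le n x : `|flat n x| <= n.+1`!%:R * `|x|.
Proof.
rewrite ger0_norm ?flat_ge0// /flat; case: ltP => x0; last by rewrite mulr_ge0.
rewrite gtr0_norm//; set y := x^-1.
have y0 : 0 < y by rewrite invr_gt0.
have -> : x = y^-1 by rewrite invrK.
have := expR_ge1Dxn n (ltW y0); set e := expR y => He.
have e0 : 0 < e by exact: expR_gt0.
have f0 : 0 < n.+1`!%:R :> R by rewrite ltr0n fact_gt0.
rewrite expRN -/e ler_pdivrMr// mulrAC ler_pdivlMr// -exprSr.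
have : y ^+ n.+1 / n.+1`!%:R <= e by apply: le_trans He; rewrite lerDr.
by rewrite ler_pdivrMr// mulrC.
Qed.

Lemma flat_is_derive n x : is_derive x 1 (flat n) (flat n.+2 x - n%:R * flat n.+1 x).
Proof.
have [x0|x0|<-] := ltgtP 0 x.
- have Dinv : is_derive x 1 (fun y => y^-1) (- x^-1 ^+ 2).
    apply: is_derive_eq; first by apply: (@is_deriveV R id x 1 1); rewrite gt_eqF.
    by rewrite exprVn; apply: mulr1.
  have Dneg : is_derive x 1 (fun y => - y^-1) (x^-1 ^+ 2).
    by have := is_deriveN Dinv; rewrite opprK.
  have De : is_derive x 1 (fun y => expR (- y^-1)) (expR (- x^-1) * x^-1 ^+ 2).
    exact: (@is_derive1_comp R expR (fun y => - y^-1) x _ _ (is_derive_expR _) Dneg).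
  have Dn : is_derive x 1 (fun y => y^-1 ^+ n) (- n%:R * x^-1 ^+ n.+1).
    have := is_deriveX n Dinv; rewrite exprfctE /GRing.scale/=; case: (n) => [|m] H;
      apply: is_derive_eq H _; first by rewrite oppr0 !mul0r.
    by rewrite !exprS; ring.
  have D0 : is_derive x 1 (fun y => y^-1 ^+ n * expR (- y^-1))
      (flat n.+2 x - n%:R * flat n.+1 x).
    apply: is_derive_eq (is_deriveM Dn De) _.
    by rewrite /flat x0 /GRing.scale/= !exprS; ring.
  apply: near_eq_is_derive D0.
  near=> y; rewrite /flat ifT//; near: y; exact: lt_nbhsr.
- have D0 : is_derive x 1 (fun=> 0 : R) (flat n.+2 x - n%:R * flat n.+1 x).
    apply: is_derive_eq (is_derive_cst (0 : R) x 1) _.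
    by rewrite /flat !ifF ?(mulr0, subr0)//; apply/negbTE; rewrite -leNgt ltW.
  apply: near_eq_is_derive D0.
  near=> y; rewrite /flat ifF//; apply/negbTE; rewrite -leNgt ltW//; near: y; exact: lt_nbhsl.
apply: (@sderiv_is_derive _ setT); first exact: filterT.
have flat0 k : flat k 0 = 0 by rewrite /flat ltxx.
rewrite !flat0 mulr0 subr0 => s _ s0 cs.
apply: (@squeeze0 _ _ (fun k => n.+2`!%:R * `|s k|)).
  move=> k; rewrite flat0.
  suff -> : (flat n (s k) - 0) / (s k - 0) = flat n.+1 (s k) by exact: flat_le.
  by rewrite !subr0 /flat; case: ifP => _; rewrite ?mul0r// exprSr mulrAC.
rewrite -[X in _ --> X](mulr0 n.+2`!%:R); apply: scvgZ.
by apply: cvg_eq (cvg_norm cs) => //; rewrite normr0.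
Unshelve. all: by end_near.
Qed.

End flat_function.

Section Ck_algebra.
Context (R : realType) (d : nat).
Local Notation X := 'rV[R]_d.
Implicit Types (g h : X -> R) (i : 'I_d) (k : nat).
Local Notation e_ i := (delta_mx ord0 i : X).

Lemma Ck_cont k g : Ck k g -> continuous g. Proof. by case: k => [|k] []. Qed.

Lemma Ck_derivable k g i x : Ck k.+1 g -> derivable g x (e_ i).
Proof. by case=> _ /(_ i)[]. Qed.

Lemma Ck_partial k g i : Ck k.+1 g -> Ck k (partial i g).
Proof. by case=> _ /(_ i)[]. Qed.

Lemma CkW k g : Ck k.+1 g -> Ck k g.
Proof.
elim: k g => [|k IH] g [cg dg]; first by split.
by split => // i; split; [have [] := dg i | apply: IH; have [] := dg i].
Qed.

Lemma Ck_cst k (c : R) : Ck k (fun _ : X => c).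
Proof.
elim: k c => [|k IH] c; first by split => //; exact: cst_continuous.
split; first exact: cst_continuous.
move=> i; split; first by move=> x; exact: derivable_cst.
rewrite (_ : partial i _ = fun=> 0)//; apply/funext => x.
exact: (derive_cst (c : R)).
Qed.

Lemma CkD k g h : Ck k g -> Ck k h -> Ck k (fun x => g x + h x).
Proof.
elim: k g h => [|k IH] g h.
  by move=> [cg _] [ch _]; split => // x; apply: continuousD; [exact: cg|exact: ch].
move=> [cg dg] [ch dh]; split; first by move=> x; apply: continuousD; [exact: cg|exact: ch].
move=> i; have [dgi gi] := dg i; have [dhi hi] := dh i; split.
  by move=> x; exact: derivableD.
rewrite (_ : partial i _ = fun x => partial i g x + partial i h x); first exact: IH.
by apply/funext => x; exact: deriveD.
Qed.

Lemma CkM k g h : Ck k g -> Ck k h -> Ck k (fun x => g x * h x).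
Proof.
elim: k g h => [|k IH] g h.
  by move=> [cg _] [ch _]; split => // x; apply: continuousM; [exact: cg|exact: ch].
move=> Cg Ch; have [cg dg] := Cg; have [ch dh] := Ch.
split; first by move=> x; apply: continuousM; [exact: cg|exact: ch].
move=> i; have [dgi gi] := dg i; have [dhi hi] := dh i; split.
  by move=> x; exact: derivableM.
rewrite (_ : partial i _ = fun x => g x * partial i h x + h x * partial i g x).
  by apply: CkD; apply: IH => //; exact: CkW.
by apply/funext => x; exact: deriveM.
Qed.

Lemma Ck_prod k (J : Type) (r : seq J) (P : pred J) (g : J -> X -> R) :
  (forall j, Ck k (g j)) -> Ck k (fun x => \prod_(j <- r | P j) g j x).
Proof.
move=> Cg; elim: r => [|j r IH].
  rewrite (_ : (fun x => _) = fun=> 1); first exact: Ck_cst.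
  by apply/funext => x; rewrite big_nil.
case Pj: (P j).
  rewrite (_ : (fun x => _) = fun x => g j x * \prod_(j <- r | P j) g j x); first exact: CkM.
  by apply/funext => x; rewrite big_cons Pj.
rewrite (_ : (fun x => _) = fun x => \prod_(j <- r | P j) g j x)//.
by apply/funext => x; rewrite big_cons Pj.
Qed.

Lemma growth_transl g x (v w : X) :
  (fun r : R => r^-1 *: (((fun y : X => g (y + w)) \o shift x) (r *: v) - (fun y : X => g (y + w)) x)) =
  (fun r : R => r^-1 *: ((g \o shift (x + w)) (r *: v) - g (x + w))).
Proof. by apply/funext => r /=; rewrite /shift addrA. Qed.

Lemma derivable_transl g x (v w : X) : derivable g (x + w) v ->
  derivable (fun y : X => g (y + w)) x v.
Proof. by rewrite /derivable growth_transl. Qed.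

Lemma partial_transl i g (w : X) : partial i (fun y : X => g (y + w)) = fun x => partial i g (x + w).
Proof. by apply/funext => x; rewrite /partial /derive growth_transl. Qed.

Lemma Ck_transl k g (w : X) : Ck k g -> Ck k (fun x : X => g (x + w)).
Proof.
have ct g' : continuous g' -> continuous (fun x : X => g' (x + w)).
  move=> cg x; apply: (@continuous_comp _ _ _ (fun y : X => y + w) g'); last exact: cg.
  by apply: continuousD; [exact: cvg_id | exact: cst_continuous].
elim: k g => [|k IH] g [cg dg]; first by split => //; exact: ct.
split; first exact: ct.
move=> i; have [dgi gi] := dg i; split; first by move=> x; exact: derivable_transl.
by rewrite partial_transl; exact: IH.
Qed.

Lemma growth_coord (th : R -> R) i j (x : X) (c b : R) :
  (fun r : R => r^-1 *: (((fun y : X => th (c * y ord0 i + b)) \o shift x) (r *: e_ j)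
     - (fun y : X => th (c * y ord0 i + b)) x)) =
  (fun r : R => r^-1 *: (((fun s => th (c * ((i == j)%:R * s + x ord0 i) + b)) \o shift 0) (r *: 1)
     - (fun s => th (c * ((i == j)%:R * s + x ord0 i) + b)) 0)).
Proof.
apply/funext => r /=; congr (_ *: (th (c * _ + _) - th _)).
  rewrite /shift !mxE eqxx/= addr0; congr (_ + _).
  by rewrite mulrC; congr (_ * _); rewrite -[LHS]mulr1.
by rewrite mulr0 add0r.
Qed.

Lemma coord_is_derive (th th' : R -> R) i (j : 'I_d) (x : X) (c b : R) :
  (forall y : R, is_derive y 1 th (th' y)) ->
  is_derive x (e_ j) (fun y : X => th (c * y ord0 i + b))
    ((i == j)%:R * c * th' (c * x ord0 i + b)).
Proof.
move=> dth.
have : is_derive (0 : R) (1 : R) (fun s : R => th (c * ((i == j)%:R * s + x ord0 i) + b))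
    ((i == j)%:R * c * th' (c * x ord0 i + b)).
  apply: (@sderiv_is_derive _ setT); first exact: filterT.
  have -> : (i == j)%:R * c * th' (c * x ord0 i + b) = th' (c * x ord0 i + b) * (c * (i == j)%:R).
    by ring.
  have := @sderiv_comp R setT setT th (fun s => c * ((i == j)%:R * s + x ord0 i) + b) 0
    (th' (c * x ord0 i + b)) (c * (i == j)%:R).
  apply => //.
    by rewrite mulr0 add0r; exact/is_derive_sderiv.
  have := sderivD (sderivZ c (sderivD (sderivZ (i == j)%:R (@sderiv_id R setT 0))
    (@sderiv_cst R setT (x ord0 i) 0))) (@sderiv_cst R setT b 0).
  by rewrite !addr0 mulr1.
case=> dd <-; apply: DeriveDef; first by rewrite /derivable growth_coord.
by rewrite /derive growth_coord.
Qed.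

(** Induction on [k] for all [n] at once, since differentiation raises [n]. The affine argument
    covers both one-sided factors of [bump]. *)
Lemma Ck_flat k n i (c b : R) : Ck k (fun x : X => flat n (c * x ord0 i + b)).
Proof.
have cont n' : continuous (fun x : X => flat n' (c * x ord0 i + b)).
  move=> x; apply: (@continuous_comp _ _ _ (fun y : X => c * y ord0 i + b) (flat n')).
    apply: continuousD; last exact: cst_continuous.
    by apply: continuousM; [exact: cst_continuous | exact: coord_continuous].
  apply: differentiable_continuous; apply/derivable1_diffP.
  by have [] := flat_is_derive n' (c * x ord0 i + b).
elim: k n => [|k IH] n; first by split.
split => // j.
have D x := @coord_is_derive (flat n) _ i j x c b (flat_is_derive n).
split; first by move=> x; have [] := D x.
rewrite (_ : partial j _ = fun x : X => (i == j)%:R * c *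
  (flat n.+2 (c * x ord0 i + b) + - n%:R * flat n.+1 (c * x ord0 i + b))).
  by apply: CkM; [exact: Ck_cst|apply: CkD => //; apply: CkM => //; exact: Ck_cst].
by apply/funext => x; have [_ E] := D x; rewrite /partial E mulNr.
Qed.

Lemma test_functionD g h : test_function g -> test_function h ->
  test_function (fun x => g x + h x).
Proof.
move=> [Cg [K cK Kg]] [Ch [L cL Lh]]; split; first by move=> k; exact: CkD.
exists (K `|` L); first exact: compactU.
by move=> x /not_orP[nK nL]; rewrite Kg// Lh// addr0.
Qed.

Lemma test_functionZ (c : R) g : test_function g -> test_function (fun x => c * g x).
Proof.
move=> [Cg [K cK Kg]]; split; first by move=> k; apply: CkM => //; exact: Ck_cst.
by exists K => // x nK; rewrite Kg// mulr0.
Qed.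

Lemma test_function_partial i g : test_function g -> test_function (partial i g).
Proof.
move=> [Cg [K cK Kg]]; split; first by move=> k; exact: Ck_partial (Cg k.+1).
exists K => // x nK.
have oK : open (~` K) by apply: closed_openC; exact: compact_closed.
rewrite /partial (near_eq_derive (g := cst (0 : R))) ?derive_cst//.
have : nbhs x (~` K) by exact: open_nbhs_nbhs.
by apply: filterS => y; exact: Kg.
Qed.

Lemma test_function_transl g (w : X) : test_function g -> test_function (fun x => g (x + w)).
Proof.
move=> [Cg [K cK Kg]]; split; first by move=> k; exact: Ck_transl.
have [r r0 Kr] := compact_sub_cube cK.
exists (cube (r + `|w|)); first exact: compact_cube.
move=> x nx; apply: Kg => /Kr Kx; apply: nx => i.
have := Kx i; rewrite mxE.
have : `|w ord0 i| <= `|w| by rewrite [leRHS]mx_normrE; exact: (le_bigmax _ _ (ord0, i)).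
move=> h1 h2; rewrite -[x ord0 i](addrK (w ord0 i)).
by apply: (le_trans (ler_normB _ _)); exact: lerD.
Qed.

Lemma test_function_cont g : test_function g -> continuous g.
Proof. by move=> [/(_ 0%N)[]]. Qed.

Lemma test_function_bounded g : test_function g -> exists2 B, 0 <= B & forall x, `|g x| <= B.
Proof.
move=> tg; have cg := test_function_cont tg; have [_ [K cK Kg]] := tg.
have cn : {within K, continuous (fun x => `|g x|)}.
  by apply: continuous_subspaceT => x; exact: cvg_norm (cg x).
have [M [_ /(_ (`|M| + 1))]] := compact_bounded (continuous_compact cn cK).
rewrite (le_lt_trans (ler_norm M)) ?ltrDl// => /(_ isT) H.
exists (`|M| + 1); first by rewrite addr_ge0.
move=> x; have [Kx|nKx] := pselect (K x); last by rewrite Kg// normr0 addr_ge0.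
have /= := H (`|g x|) (ex_intro2 _ _ x Kx erefl).
by rewrite normr_id.
Qed.

(** On the open box each factor is exp(-1/(lam y)) with y > 0, which tends to 1 as [lam] grows; the
    family thus approximates the indicator of the box from below. *)
Definition bump (lam : R) (a b : 'I_d -> R) : X -> R :=
  fun x => \prod_(i < d) (flat 0 (lam * x ord0 i + - (lam * a i)) * flat 0 (- lam * x ord0 i + lam * b i)).

Lemma Ck_bump k lam a b : Ck k (bump lam a b).
Proof. by apply: Ck_prod => i; apply: CkM; exact: Ck_flat. Qed.

Lemma flat0_01 (y : R) : 0 <= flat 0 y <= 1.
Proof.
rewrite flat_ge0/= /flat; case: ifP => // y0; rewrite expr0 mul1r.
by rewrite -expR0 ler_expR oppr_le0 invr_ge0 ltW.
Qed.

Lemma bump_01 lam a b x : 0 <= bump lam a b x <= 1.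
Proof.
apply/andP; split; first by apply: prodr_ge0 => i _; rewrite mulr_ge0 ?flat_ge0.
apply: prodr_ile1 => i _; rewrite mulr_ge0 ?flat_ge0//=.
have /andP[h1 h2] := flat0_01 (lam * x ord0 i + - (lam * a i)).
have /andP[h3 h4] := flat0_01 (- lam * x ord0 i + lam * b i).
exact: mulr_ile1.
Qed.

Lemma bump_out lam a b x : 0 < lam -> ~ obox a b x -> bump lam a b x = 0.
Proof.
move=> lam0 /existsNP[i ni]; rewrite /bump (bigD1 i)//=.
suff -> : flat 0 (lam * x ord0 i + - (lam * a i)) * flat 0 (- lam * x ord0 i + lam * b i) = 0 :> R.
  by rewrite mul0r.
have -> : lam * x ord0 i + - (lam * a i) = lam * (x ord0 i - a i) by ring.
have -> : - lam * x ord0 i + lam * b i = lam * (b i - x ord0 i) by ring.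
rewrite /flat !pmulr_rgt0// !subr_gt0.
by case: ifP => [ax|]; case: ifP => [xb|]; rewrite ?(mul0r, mulr0)//; case: ni; rewrite ax xb.
Qed.

Lemma bump_test lam a b : 0 < lam -> test_function (bump lam a b).
Proof.
move=> lam0; split; first by move=> k; exact: Ck_bump.
pose r := \sum_(i < d) (`|a i| + `|b i|).
exists (cube r); first exact: compact_cube.
move=> x nx; apply: bump_out => // xab; apply: nx => i.
have /andP[h1 h2] := xab i.
have : `|a i| + `|b i| <= r.
  by rewrite /r (bigD1 i)//= lerDl sumr_ge0// => j _; rewrite addr_ge0.
apply: le_trans; rewrite ler_norml.
have := ler_norm (b i); have := ler_norm (- a i); rewrite normrN.
by have := normr_ge0 (a i); have := normr_ge0 (b i) => *; apply/andP; split; lra.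
Qed.

Lemma flat0_cvg (y : R) : (fun n => flat 0 (n.+1%:R * y)) @ \oo --> ((0 < y)%R%:R : R).
Proof.
have [y0|y0] := ltP 0 y; last first.
  apply: cvg_eq (@cvg_cst _ (0 : R) _ _ _) => // n.
  by rewrite /flat pmulr_rgt0// ltNge y0.
have c : (fun n => - (n.+1%:R * y)^-1) @ \oo --> (0 : R).
  have := scvgZ (- y^-1) (@cvg_harmonic R); apply: cvg_eq => [n|]; last by rewrite mulr0.
  by rewrite invfM mulNr mulrC.
have := @cvg_comp _ _ _ _ (@expR R) _ _ _ c (@continuous_expR R 0).
apply: cvg_eq => [n|]; last by rewrite expR0.
by rewrite /flat pmulr_rgt0// y0 expr0 mul1r.
Qed.

Lemma cvg_prod (J : Type) (r : seq J) (P : pred J) (u : J -> nat -> R) (l : J -> R) :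
  (forall j, P j -> u j @ \oo --> l j) ->
  (fun n => \prod_(j <- r | P j) u j n) @ \oo --> \prod_(j <- r | P j) l j.
Proof.
move=> H; elim: r => [|j r IH].
  by apply: (cvg_eq _ _ (@cvg_cst _ (1 : R) _ _ _)) => [n|]; rewrite big_nil.
case Pj: (P j); last by apply: (cvg_eq _ _ IH) => [n|]; rewrite big_cons Pj.
by apply: (cvg_eq _ _ (scvgM (H _ Pj) IH)) => [n|]; rewrite big_cons Pj.
Qed.

Lemma bump_cvg a b x : (fun n => bump n.+1%:R a b x) @ \oo --> (\1_(obox a b) x : R).
Proof.
apply: cvg_eq (@cvg_prod _ (index_enum 'I_d) xpredT
  (fun i n => flat 0 (n.+1%:R * x ord0 i + - (n.+1%:R * a i)) *
              flat 0 (- n.+1%:R * x ord0 i + n.+1%:R * b i))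
  (fun i => (0 < x ord0 i - a i)%R%:R * (0 < b i - x ord0 i)%R%:R) _) => // [|i _].
  rewrite indicE; case: asboolP (asboolP (obox a b x)) => [xab|nxab].
    rewrite mem_set// big1// => i _; have /andP[h1 h2] := xab i.
    by rewrite !subr_gt0 h1 h2 mulr1.
  rewrite memNset//; have /existsNP[i ni] := nxab.
  rewrite (bigD1 i)//= !subr_gt0.
  have -> : (a i < x ord0 i)%R%:R * (x ord0 i < b i)%R%:R = 0 :> R.
    by case: ltP => ax; case: ltP => xb; rewrite ?(mul0r, mulr0)//; case: ni; rewrite ax xb.
  by rewrite mul0r.
apply: scvgM.
  by apply: cvg_eq (@flat0_cvg (x ord0 i - a i)) => // n; congr flat; ring.
by apply: cvg_eq (@flat0_cvg (b i - x ord0 i)) => // n; congr flat; ring.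
Qed.

End Ck_algebra.

(** * Density of test functions in L2 *)

Section density.
Context (R : realType) (d : nat).
Local Notation X := 'rV[R]_d.
Local Notation dx := (leb R d).
Implicit Types (g h : X -> R) (A : set X).

Lemma L1_indic A : measurable A -> (dx A < +oo)%E -> L1 dx (\1_A : X -> R).
Proof.
move=> mA Aoo; apply/integrableP; split; first exact/measurable_EFinP/measurable_indic.
rewrite (eq_integral (fun x => (\1_A x)%:E)).
  by rewrite integral_indic// setIT.
by move=> t _; rewrite gee0_abs// lee_fin.
Qed.

Lemma L2_indic A : measurable A -> (dx A < +oo)%E -> L2 dx (\1_A : X -> R).
Proof.
move=> mA Aoo; split; first exact: measurable_indic.
rewrite (_ : (fun x => _) = \1_A); first exact: L1_indic.
by apply/funext => x; rewrite indicE; case: (x \in A); rewrite ?expr1n ?expr0n.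
Qed.

Lemma L2_bounded_support g (B : R) (K : set X) : measurable_fun setT g ->
  (forall x, `|g x| <= B) -> measurable K -> (dx K < +oo)%E -> (forall x, ~ K x -> g x = 0) -> L2 dx g.
Proof.
move=> mg gB mK Koo g0.
have -> : g = fun x => g x * \1_K x.
  apply/funext => x; rewrite indicE; have [Kx|nK] := pselect (K x).
    by rewrite mem_set// mulr1.
  by rewrite g0// mul0r.
exact: L2_bM gB (L2_indic mK Koo).
Qed.

Lemma test_L2 g : test_function g -> L2 dx g.
Proof.
move=> tg; have [B _ gB] := test_function_bounded tg; have [_ [K cK Kg]] := tg.
apply: (@L2_bounded_support g B K) => //.
- exact: continuous_measurable_rV (test_function_cont tg).
- exact: compact_measurable_rV.
- exact: compact_lty.
Qed.

(** The L2 closure of the test functions. Being closed under sums, multiples and L2 limits, it can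
    be enlarged from boxes to all of L2. *)
Definition test_approx g := L2 dx g /\
  forall e : R, 0 < e -> exists2 phi, test_function phi & nrm dx (fun x => phi x - g x) < e.

Lemma test_function0 : test_function (fun _ : X => 0 : R).
Proof. by split; [move=> k; exact: Ck_cst | exists set0; [exact: compact0|]]. Qed.

Lemma test_approx0 : test_approx (fun=> 0).
Proof.
split; first exact: L2_0.
move=> e e0; exists (fun=> 0); first exact: test_function0.
rewrite (@eq_nrm _ _ _ _ _ (fun x => 0 * 0)); last by move=> x; rewrite subrr mulr0.
by rewrite nrmZ ?normr0 ?mul0r//; exact: L2_0.
Qed.

Lemma test_approxD g h : test_approx g -> test_approx h -> test_approx (fun x => g x + h x).
Proof.
move=> [Lg ag] [Lh ah]; split; first exact: L2D.
move=> e e0; have [phi tphi pg] := ag (e / 2) (divr_gt0 e0 (ltr0Sn _ 1)).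
have [psi tpsi ph] := ah (e / 2) (divr_gt0 e0 (ltr0Sn _ 1)).
exists (fun x => phi x + psi x); first exact: test_functionD.
rewrite (@eq_nrm _ _ _ _ _ (fun x => (phi x - g x) + (psi x - h x))); last by move=> x; ring.
apply: le_lt_trans (nrmD _ _) _; try (by apply: L2B => //; exact: test_L2).
by rewrite (splitr e) ltrD.
Qed.

Lemma test_approxZ (c : R) g : test_approx g -> test_approx (fun x => c * g x).
Proof.
move=> [Lg ag]; split; first exact: L2Z.
move=> e e0; have c0 : 0 < `|c| + 1 by rewrite ltr_wpDl.
have [phi tphi pg] := ag (e / (`|c| + 1)) (divr_gt0 e0 c0).
exists (fun x => c * phi x); first exact: test_functionZ.
rewrite (@eq_nrm _ _ _ _ _ (fun x => c * (phi x - g x))); last by move=> x; ring.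
rewrite nrmZ; last by apply: L2B => //; exact: test_L2.
apply: (@le_lt_trans _ _ ((`|c| + 1) * nrm dx (fun x => phi x - g x))).
  by rewrite ler_wpM2r ?nrm_ge0// lerDl.
by rewrite mulrC -ltr_pdivlMr.
Qed.

Lemma test_approx_cvL2 (gn : nat -> X -> R) g : (forall n, test_approx (gn n)) ->
  cvL2 dx gn g -> test_approx g.
Proof.
move=> ag cg; have [Lgn Lg /cvgrPdist_lt c0] := cg; split => // e e0.
have [N _ /(_ N (leqnn N))] := c0 (e / 2) (divr_gt0 e0 (ltr0Sn _ 1)).
rewrite /= sub0r normrN ger0_norm ?nrm_ge0// => H.
have [_ /(_ (e / 2) (divr_gt0 e0 (ltr0Sn _ 1)))[phi tphi pg]] := ag N.
exists phi => //.
rewrite (@eq_nrm _ _ _ _ _ (fun x => (phi x - gn N x) + (gn N x - g x))); last by move=> x; ring.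
apply: le_lt_trans (nrmD _ _) _.
- by apply: L2B => //; exact: test_L2.
- exact: L2B.
by rewrite (splitr e) ltrD.
Qed.

Lemma test_approx_ext g h : g =1 h -> test_approx g -> test_approx h.
Proof. by move=> /funext ->. Qed.

Lemma test_approx_sum (J : Type) (r : seq J) (g : J -> X -> R) :
  (forall i, test_approx (g i)) -> test_approx (fun x => \sum_(i <- r) g i x).
Proof.
move=> H; elim: r => [|j r IH].
  by apply: test_approx_ext test_approx0 => x; rewrite big_nil.
by apply: test_approx_ext (test_approxD (H j) IH) => x; rewrite big_cons.
Qed.

Lemma test_approx_test g : test_function g -> test_approx g.
Proof.
move=> tg; split; first exact: test_L2.
move=> e e0; exists g => //.
rewrite (@eq_nrm _ _ _ _ _ (fun x => 0 * 0)); last by move=> x; rewrite subrr mulr0.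
by rewrite nrmZ ?normr0 ?mul0r//; exact: L2_0.
Qed.

Lemma test_approx_box a b : test_approx (\1_(obox a b) : X -> R).
Proof.
have n0 (n : nat) : 0 < n.+1%:R :> R by [].
apply: (@test_approx_cvL2 (fun n => bump n.+1%:R a b)).
  by move=> n; apply: test_approx_test; exact: bump_test.
apply: (@cvL2_dominated _ _ _ _ _ _ (\1_(obox a b))).
- by move=> n; apply: continuous_measurable_rV; exact: Ck_cont (Ck_bump 0 _ _ _).
- by move=> x; exact: bump_cvg.
- by apply: L2_indic; [exact: measurable_obox | exact: obox_lty].
- move=> n x; have /andP[h1 h2] := bump_01 n.+1%:R a b x.
  rewrite ger0_norm// indicE; have [xab|nab] := pselect (obox a b x).
    by rewrite mem_set.
  by rewrite bump_out.
Qed.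

(** Dynkin's pi-lambda argument, with every set intersected with a fixed box so that all indicators
    are in L2; disjoint countable unions pass through dominated convergence. *)
Lemma test_approx_indic A N : measurable A -> test_approx (\1_(A `&` nbox N) : X -> R).
Proof.
have LI B : measurable B -> L2 dx (\1_(B `&` nbox N) : X -> R).
  move=> mB; have mBN : measurable (B `&` nbox N) by apply: measurableI => //; exact: measurable_obox.
  apply: L2_indic => //; apply: le_lt_trans (obox_lty (fun=> - N%:R) (fun=> N%:R)).
  by apply: le_measure; rewrite ?inE//; exact: measurable_obox.
rewrite [X in X A](measurable_boxes R d).
move: A; apply: (dynkin_induction (measurable_boxes R d) (@boxes_setI R d)).
- by rewrite setTI; exact: test_approx_box.
- move=> B [a [b ->]]; have [a' [b' ->]] := @boxes_setI R d (obox a b) (nbox N)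
    (ex_intro _ a (ex_intro _ b erefl)) (ex_intro _ _ (ex_intro _ _ erefl)).
  exact: test_approx_box.
- move=> S mS aS.
  have := test_approxD (test_approx_box (fun=> - N%:R) (fun=> N%:R)) (test_approxZ (-1) aS).
  apply: test_approx_ext => x; rewrite !indicE !in_setI in_setC -/(nbox N).
  by case: (x \in S); case: (x \in nbox N); rewrite /= ?mulr0 ?mulr1 ?addr0 ?subrr.
- move=> F mF tF aF.
  apply: (@test_approx_cvL2 (fun n x => \sum_(i < n) \1_(F i `&` nbox N) x)).
    by move=> n; apply: test_approx_sum => i; exact: aF.
  apply: (@cvL2_dominated _ _ _ _ _ _ (\1_(nbox N))).
  + move=> n; apply: measurable_sum => i; exact: L2_meas (LI _ (mF i)).
  + move=> x; rewrite indicE; have [[Fx Nx]|nF] := pselect (((\bigcup_k F k) `&` nbox N) x).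
      rewrite mem_set//; case: Fx => k _ Fkx.
      apply/cvgrPdist_lt => e e0; exists k.+1 => // n /= kn.
      rewrite (bigD1 (Ordinal kn))//= big1 ?addr0.
        by rewrite indicE mem_set// subrr normr0.
      move=> i ik; rewrite indicE memNset// => -[Fix _].
      have /trivIsetP/(_ i k I I) := tF; rewrite -val_eqE/= in ik => /(_ ik) E.
      have : (F i `&` F k) x by split.
      by rewrite E.
    rewrite memNset//; apply: cvg_eq (@cvg_cst _ (0 : R) _ _ _) => // n.
    rewrite big1// => i _; rewrite indicE memNset// => -[Fx Nx]; apply: nF; split => //.
    by exists i.
  + by apply: L2_indic; [exact: measurable_obox | exact: obox_lty].
  + move=> n x; rewrite ger0_norm ?sumr_ge0//.
    have [[k kn Fkx]|nF] := pselect (exists2 k, (k < n)%N & (F k `&` nbox N) x).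
      rewrite (bigD1 (Ordinal kn))//= big1 ?addr0.
        by rewrite !indicE !mem_set//; case: Fkx.
      move=> i ik; rewrite indicE memNset// => -[Fix _].
      have /trivIsetP/(_ i k I I) := tF; rewrite -val_eqE/= in ik => /(_ ik) E.
      have : (F i `&` F k) x by split; [|case: Fkx].
      by rewrite E.
    rewrite big1// => i _; rewrite indicE memNset// => Fx; apply: nF; exists i => //.
Qed.

Import HBNNSimple.

Lemma test_approx_ge0 g : L2 dx g -> (forall x, 0 <= g x) -> test_approx g.
Proof.
move=> Lg g0; have mg := L2_meas Lg.
have mEg : measurable_fun setT (EFin \o g) by exact/measurable_EFinP.
pose f := nnsfun_approx measurableT mEg.
have fc x : (fun n => f n x) @ \oo --> g x.
  have := @cvg_nnsfun_approx _ _ _ _ measurableT _ mEg (fun x _ => g0 x) x I.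
  by move/fine_cvg.
have fg n x : f n x <= g x.
  move/cvgr_to_ge : (fc x); apply; exists n => // m /= nm.
  by have /lefP := nd_nnsfun_approx measurableT mEg nm; apply.
(* The approximating simple functions are cut by growing boxes, because their level sets may have
   infinite measure. *)
apply: (@test_approx_cvL2 (fun n x => \1_(nbox n) x * f n x)).
  move=> n.
  have E x : f n x = \sum_(y <- finmap.enum_fset (fset_set (range (f n)))) (y * \1_(f n @^-1` [set y]) x).
    by rewrite fimfunE fsbig_finite.
  have H y : test_approx (fun x => y * \1_((f n @^-1` [set y]) `&` nbox n) x).
    apply: test_approxZ; apply: test_approx_indic.
    by rewrite -[X in measurable X]setTI; exact: measurable_funP.
  have := @test_approx_sum _ (finmap.enum_fset (fset_set (range (f n)))) _ H; apply: test_approx_ext => x.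
  rewrite E mulr_sumr; apply: eq_bigr => i _.
  by rewrite indicI /=; ring.
apply: (cvL2_dominated _ _ Lg).
- move=> n; apply: measurable_funM => //; apply: measurable_indic; exact: measurable_obox.
- move=> x; have [k _ kx] : (\bigcup_n nbox n) x by rewrite nbox_cover.
  rewrite -[g x]mul1r; apply: scvgM => //.
  apply/cvgrPdist_lt => e e0; exists k => // n /= kn.
  rewrite indicE mem_set ?subrr ?normr0// => i; have /andP[h1 h2] := kx i.
  have : k%:R <= n%:R :> R by rewrite ler_nat.
  by move=> ?; apply/andP; split; lra.
- move=> n x; rewrite ger0_norm ?mulr_ge0// indicE.
  case: (x \in _); rewrite /= ?mul1r ?mul0r//; exact: fg.
Qed.

Theorem test_function_dense g : L2 dx g ->
  exists2 phi : nat -> X -> R, (forall n, test_function (phi n)) & cvL2 dx phi g.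
Proof.
move=> Lg; have mg := L2_meas Lg.
have [_ H] : test_approx g.
  have Lp : L2 dx (fun x => Num.max (g x) 0).
    apply: (L2_dom _ _ Lg) => [|x]; first exact: measurable_maxr.
    by rewrite ger0_norm ?le_max ?lexx ?orbT// ge_max ler_norm normr_ge0.
  have Ln : L2 dx (fun x => Num.max (- g x) 0).
    apply: (L2_dom _ _ Lg) => [|x]; first by apply: measurable_maxr => //; exact: measurable_funN.
    by rewrite ger0_norm ?le_max ?lexx ?orbT// ge_max normr_ge0 -normrN ler_norm.
  have := test_approxD (test_approx_ge0 Lp _) (test_approxZ (-1) (test_approx_ge0 Ln _)).
  have p0 (u : R) : 0 <= Num.max u 0 by rewrite le_max lexx orbT.
  move=> /(_ (fun=> p0 _) (fun=> p0 _)); apply: test_approx_ext => x.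
  by rewrite mulN1r; case: (leP (g x) 0); case: (leP (- g x) 0) => *; lra.
have n0 (n : nat) : 0 < n.+1%:R^-1 :> R by rewrite invr_gt0.
have /choice[phi phiP] : forall n, exists phi, test_function phi /\ nrm dx (fun x => phi x - g x) < n.+1%:R^-1.
  by move=> n; have [phi ? ?] := H _ (n0 n); exists phi.
exists phi; first by move=> n; have [] := phiP n.
apply: (cvL2_squeeze _ _ _ (@cvg_harmonic R)) => // n.
- by apply: test_L2; have [] := phiP n.
- by apply: ltW; have [] := phiP n.
Qed.

End density.

(** * Weak derivatives *)

Section weak_partials.
Context (R : realType) (d : nat).
Local Notation X := 'rV[R]_d.
Local Notation dx := (leb R d).
Local Notation e_ i := (delta_mx ord0 i : X).
Implicit Types (g h b : X -> R) (i j : 'I_d).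

Lemma locally_L1P g : locally_L1 g <->
  measurable_fun setT g /\ forall K, compact K -> L1 dx (fun x => \1_K x * g x).
Proof.
have E K : (\int[dx]_(x in K) `|(g x)%:E| = \int[dx]_x `|(\1_K x * g x)%:E|)%E.
  rewrite integral_mkcond; apply: eq_integral => x _; rewrite patchE indicE.
  by case: ifP => _ /=; rewrite ?mul1r ?mul0r ?normr0.
split=> -[mg H]; split => // K cK.
  apply/integrableP; split; last by rewrite -E; exact: H.
  apply/measurable_EFinP; apply: measurable_funM => //.
  by apply: measurable_indic; exact: compact_measurable_rV.
by rewrite E; have /integrableP[] := H K cK.
Qed.

Lemma locally_L1D g h : locally_L1 g -> locally_L1 h -> locally_L1 (fun x => g x + h x).
Proof.
move=> /locally_L1P[mg ig] /locally_L1P[mh ih]; apply/locally_L1P.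
split=> [|K cK]; first exact: measurable_funD.
under eq_fun => x do rewrite mulrDr.
by apply: L1D; [exact: ig | exact: ih].
Qed.

Lemma locally_L1Z (c : R) g : locally_L1 g -> locally_L1 (fun x => c * g x).
Proof.
move=> /locally_L1P[mg ig]; apply/locally_L1P.
split=> [|K cK]; first exact: measurable_funM.
under eq_fun => x do rewrite mulrCA.
by apply: L1Z; exact: ig.
Qed.

Lemma locally_L1_test g phi : locally_L1 g -> test_function phi -> L1 dx (fun x => g x * phi x).
Proof.
move=> /locally_L1P[mg ig] tphi; have [B _ pB] := test_function_bounded tphi.
have [_ [K cK K0]] := tphi.
have := L1_bM (continuous_measurable_rV (test_function_cont tphi)) pB (ig K cK).
rewrite (_ : (fun x => _) = (fun x => g x * phi x))//; apply/funext => x; rewrite indicE.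
have [Kx|nK] := pselect (K x); first by rewrite mem_set// mul1r mulrC.
by rewrite K0// mul0r mulr0.
Qed.

Lemma is_weak_partialD i g h dg dh : is_weak_partial i g dg -> is_weak_partial i h dh ->
  is_weak_partial i (fun x => g x + h x) (fun x => dg x + dh x).
Proof.
move=> [lg ldg gP] [lh ldh hP]; split; try exact: locally_L1D.
move=> phi tphi; have tp := test_function_partial i tphi.
under eq_Rintegral do rewrite mulrDl.
rewrite RintD ?gP ?hP//; try exact: locally_L1_test.
under [in RHS]eq_Rintegral do rewrite mulrDl.
by rewrite RintD ?opprD//; exact: locally_L1_test.
Qed.

Lemma is_weak_partialZ i (c : R) g dg : is_weak_partial i g dg ->
  is_weak_partial i (fun x => c * g x) (fun x => c * dg x).
Proof.
move=> [lg ldg gP]; split; try exact: locally_L1Z.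
move=> phi tphi; have tp := test_function_partial i tphi.
under eq_Rintegral do rewrite -mulrA.
rewrite RintZ ?gP//; try exact: locally_L1_test.
under [in RHS]eq_Rintegral do rewrite -mulrA.
by rewrite RintZ ?mulrN//; exact: locally_L1_test.
Qed.

Lemma is_weak_partial_ae i g g' h : measurable_fun setT g' -> {ae dx, forall x, g x = g' x} ->
  is_weak_partial i g h -> is_weak_partial i g' h.
Proof.
move=> mg' gg' [lg lh gP].
have mg : measurable_fun setT g by case: lg.
split => //.
  apply/locally_L1P; split => // K cK; have /locally_L1P[_ /(_ K cK)] := lg.
  apply: L1_ae.
    by apply: measurable_funM => //; apply: measurable_indic; exact: compact_measurable_rV.
  by apply: filterS gg' => x ->.
move=> phi tphi; rewrite -gP//.
have mp : measurable_fun setT (partial i phi).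
  by apply: continuous_measurable_rV; exact: test_function_cont (test_function_partial i tphi).
apply: Rint_ae; try exact: measurable_funM.
by apply: filterS gg' => x ->.
Qed.

(** Approximating [g] itself by test functions turns orthogonality into [nrm dx g = 0]. *)
Lemma test_orth_ae0 g : L2 dx g -> (forall phi, test_function phi -> \int[dx]_x (g x * phi x) = 0) ->
  {ae dx, forall x, g x = 0}.
Proof.
move=> Lg H; apply: (nrm0_ae Lg).
have [phi tphi cphi] := test_function_dense Lg.
have := cvL2_I (cvL2_cst Lg) cphi.
have -> : (fun n => \int[dx]_x (g x * phi n x)) = fun=> 0 by apply/funext => n; exact: H.
move=> /(cvg_unique (@Rhausdorff R) (@cvg_cst _ (0 : R) _ \oo _)) E.
by rewrite /nrm; under eq_Rintegral do rewrite expr2; rewrite -E sqrtr0.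
Qed.

Lemma weak_partial_unique i g h h' : is_weak_partial i g h -> is_weak_partial i g h' ->
  L2 dx h -> L2 dx h' -> {ae dx, forall x, h x = h' x}.
Proof.
move=> [lg lh hP] [_ lh' hP'] Lh Lh'.
have := test_orth_ae0 (L2B Lh Lh') _.
have H phi : test_function phi -> \int[dx]_x ((h x - h' x) * phi x) = 0.
  move=> tphi; under eq_Rintegral do rewrite mulrBl.
  rewrite RintB; try exact: locally_L1_test.
  by apply/eqP; rewrite subr_eq0 -eqr_opp -hP// hP'.
move=> /(_ H); apply: filterS => x /eqP; rewrite subr_eq0 => /eqP //.
Qed.

Lemma weak_partialP i g : (exists h, is_weak_partial i g h) ->
  is_weak_partial i g (weak_partial i g).
Proof. by move=> [h gh]; rewrite /weak_partial; case: xgetP => // H; case: (H h). Qed.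

(** The norm bound reduces weak convergence to a dense set of multipliers: replacing [psi] by
    [phi N] costs at most [nrm dx v + B] times their distance, uniformly in n. *)
Lemma wcvL2_test (vn : nat -> X -> R) (v : X -> R) (B : R) :
  (forall n, L2 dx (vn n)) -> L2 dx v -> (forall n, nrm dx (vn n) <= B) ->
  (forall phi, test_function phi ->
    (fun n => \int[dx]_x (vn n x * phi x)) @ \oo --> \int[dx]_x (v x * phi x)) ->
  wcvL2 dx vn v.
Proof.
move=> Lvn Lv vB test; split => //; first by exists B.
move=> psi Lpsi; apply/cvgrPdist_le => e e0.
have B0 : 0 <= B by apply: le_trans (vB 0%N); exact: nrm_ge0.
have [phi tphi cphi] := test_function_dense Lpsi.
have [Lphi _ /cvgrPdist_lt c0] := cphi.
have D0 : 0 < nrm dx v + B + 1 by rewrite ltr_wpDl// addr_ge0// nrm_ge0.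
have [N _ /(_ N (leqnn N))] := c0 _ (divr_gt0 (divr_gt0 e0 (ltr0Sn _ 1)) D0).
rewrite /= sub0r normrN ger0_norm ?nrm_ge0// => Ne.
have /cvgrPdist_le/(_ _ (divr_gt0 e0 (ltr0Sn _ 1))) := test _ (tphi N).
apply: filterS => n He.
have -> : \int[dx]_x (v x * psi x) - \int[dx]_x (vn n x * psi x) =
  (\int[dx]_x (v x * phi N x) - \int[dx]_x (vn n x * phi N x))
  - (\int[dx]_x (v x * (phi N x - psi x)) - \int[dx]_x (vn n x * (phi N x - psi x))).
  have E k : L2 dx k -> \int[dx]_x (k x * (phi N x - psi x)) =
      \int[dx]_x (k x * phi N x) - \int[dx]_x (k x * psi x).
    move=> Lk; rewrite -RintB; try exact: L2M.
    by apply: eq_Rintegral => x _; ring.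
  by rewrite !E//; ring.
have Lpp := L2B (Lphi N) Lpsi.
rewrite (splitr e); apply: (le_trans (ler_normB _ _)); apply: lerD => //.
apply: (le_trans (ler_normB _ _)).
apply: (@le_trans _ _ ((nrm dx v + B) * nrm dx (fun x => phi N x - psi x))).
  rewrite mulrDl; apply: lerD; first exact: cauchy_schwarz.
  by apply: (le_trans (cauchy_schwarz _ _)) => //; rewrite ler_wpM2r ?nrm_ge0.
move: Ne; rewrite ltr_pdivlMr// => /ltW; apply: le_trans.
by rewrite mulrC ler_wpM2l ?nrm_ge0// lerDl.
Qed.

Definition dquot i (s : R) g : X -> R := fun x => (g (x + s *: e_ i) - g x) / s.

Lemma L2_dquot i s g : L2 dx g -> L2 dx (dquot i s g).
Proof.
move=> Lg; rewrite /dquot; under eq_fun => x do rewrite mulrC.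
by apply/L2Z/L2B => //; exact: L2_transl.
Qed.

Lemma dquot_adjoint i s g h : L2 dx g -> L2 dx h ->
  \int[dx]_x (dquot i s g x * h x) = - \int[dx]_x (g x * dquot i (- s) h x).
Proof.
move=> Lg Lh.
have Lgt := L2_transl (s *: e_ i) Lg; have Lht := L2_transl (- s *: e_ i) Lh.
have -> : \int[dx]_x (dquot i s g x * h x) =
    s^-1 * (\int[dx]_x (g (x + s *: e_ i) * h x) - \int[dx]_x (g x * h x)).
  rewrite -RintB; try exact: L2M.
  rewrite -RintZ; last by apply: L1B; exact: L2M.
  by apply: eq_Rintegral => x _; rewrite /dquot; ring.
have -> : \int[dx]_x (g x * dquot i (- s) h x) =
    - s^-1 * (\int[dx]_x (g x * h (x + - s *: e_ i)) - \int[dx]_x (g x * h x)).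
  rewrite -RintB; try exact: L2M.
  rewrite -RintZ; last by apply: L1B; exact: L2M.
  by apply: eq_Rintegral => x _; rewrite /dquot invrN; ring.
rewrite mulNr opprK; congr (_ * (_ - _)).
have := Rint_transl (s *: e_ i) (g := fun x => g x * h (x + - s *: e_ i)) _.
rewrite -[X in _ -> _ = X]/(\int[dx]_x (g x * h (x + - s *: e_ i))) => <-.
  by apply: eq_Rintegral => x _; rewrite scaleNr addrK.
by apply: measurable_funM; [exact: L2_meas Lg | exact: L2_meas Lht].
Qed.

Lemma sderiv_line k g i (x : X) (r : R) : Ck k.+1 g ->
  sderiv setT (fun r => g (x + r *: e_ i)) r (partial i g (x + r *: e_ i)).
Proof. by move=> Cg; apply: derivable_sderiv; exact: Ck_derivable Cg. Qed.

Lemma test_dquot_cv i phi (s : nat -> R) (r : R) : test_function phi -> (forall n, s n != r) ->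
  s @ \oo --> r ->
  cvL2 dx (fun n x => (phi (x + s n *: e_ i) - phi (x + r *: e_ i)) / (s n - r))
    (fun x => partial i phi (x + r *: e_ i)).
Proof.
move=> tphi sr cs; have [Cphi [K cK K0]] := tphi.
have [B B0 dB] := test_function_bounded (test_function_partial i tphi).
have [r0 r00 Kr] := compact_sub_cube cK.
have [S S0 sS] := cvg_bounded cs.
(* The shifts are bounded by [S] and [|r|], so all the quotients vanish outside this common cube,
   and the constant [B] on it is a square-integrable majorant. *)
pose rr := r0 + S + `|r|.
have out (t : R) x : `|t| <= S + `|r| -> ~ cube rr x -> phi (x + t *: e_ i) = 0.
  move=> tS nx; apply: K0 => /Kr Kx; apply: nx => k; have := Kx k.
  rewrite !mxE eqxx/= => h1; rewrite -[x ord0 k](addrK (t * (k == i)%:R)).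
  apply: (le_trans (ler_normB _ _)); rewrite /rr -addrA lerD//.
  by apply: le_trans tS; rewrite normrM; case: (k == i); rewrite ?normr1 ?mulr1// normr0 mulr0.
have ms (t : R) : measurable_fun setT (fun x : X => phi (x + t *: e_ i)).
  by apply: measurable_comp_transl; exact: continuous_measurable_rV (test_function_cont tphi).
apply: (@cvL2_dominated _ _ _ _ _ _ (fun x => B * \1_(cube rr) x)).
- by move=> n; apply: measurable_funM => //; apply: measurable_funB.
- by move=> x; apply: (@sderiv_line 0 phi i x r (Cphi _)).
- by apply: L2Z; apply: L2_indic; [exact: measurable_cube | exact: cube_lty].
- move=> n x; have snr : 0 < `|s n - r| by rewrite normr_gt0 subr_eq0.
  have [xin|nx] := pselect (cube rr x).
    rewrite indicE mem_set// mulr1 normrM normfV ler_pdivrMr//.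
    apply: (@sderiv_le _ setT (fun t => phi (x + t *: e_ i)) (fun t => partial i phi (x + t *: e_ i))) => //.
    by move=> t _; exact: (@sderiv_line 0 phi i x t (Cphi 1%N)).
  rewrite !out// ?subrr ?mul0r ?normr0 ?mulr_ge0//.
    by rewrite lerDr.
  by rewrite (le_trans (sS n))// lerDl.
Qed.

Section dquot_limits.
Variables (i : 'I_d) (g dg : X -> R).
Hypotheses (Lg : L2 dx g) (Ldg : L2 dx dg) (gP : is_weak_partial i g dg).

(** With the translation carried by the test function, this is differentiable in [r], and the weak
    derivative of [g] is all that its derivative involves. *)
Let m phi (r : R) := \int[dx]_x (g x * phi (x + r *: e_ i)).

Let m_deriv phi r : test_function phi ->
  sderiv setT (m phi) r (- \int[dx]_x (dg x * phi (x + r *: e_ i))).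
Proof.
move=> tphi s _ sr cs; have tr := test_function_transl (r *: e_ i) tphi.
have [_ _ /(_ _ tr) <-] := gP.
rewrite partial_transl.
apply: cvg_eq (cvL2_I (cvL2_cst Lg) (test_dquot_cv i tphi sr cs)) => // n.
have Ls t := test_L2 (test_function_transl (t *: e_ i) tphi).
rewrite /m -RintB; try exact: L2M.
rewrite mulrC -RintZ; last by apply: L1B; exact: L2M.
by apply: eq_Rintegral => x _; ring.
Qed.

Let dquot_m phi s : s != 0 -> test_function phi ->
  \int[dx]_x (dquot i s g x * phi x) = (m phi (- s) - m phi 0) / s.
Proof.
move=> s0 tphi; rewrite dquot_adjoint//; last exact: test_L2.
have Ls t := test_L2 (test_function_transl (t *: e_ i) tphi).
rewrite /m -RintB; try exact: L2M.
rewrite mulrC -RintZ; last by apply: L1B; exact: L2M.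
rewrite -RintN; last by apply: L2M => //; apply: L2_dquot; exact: test_L2.
by apply: eq_Rintegral => x _; rewrite /dquot invrN scale0r addr0; ring.
Qed.

Let dquot_test_le phi s : s != 0 -> test_function phi ->
  `|\int[dx]_x (dquot i s g x * phi x)| <= nrm dx dg * nrm dx phi.
Proof.
move=> s0 tphi; rewrite dquot_m//.
have [|c _ E] := @sderiv_MVT_unordered R setT (m phi)
  (fun r => - \int[dx]_x (dg x * phi (x + r *: e_ i))) 0 (- s) (fun _ _ => I).
  by move=> r _; exact: m_deriv.
rewrite E subr0 mulrNN mulfK//.
apply: (le_trans (cauchy_schwarz _ _)) => //; first exact: test_L2 (test_function_transl _ tphi).
by rewrite nrm_transl//; exact: L2_meas (test_L2 tphi).
Qed.

(** By the mean value theorem for [m], the pairing of the quotient with a test function is at most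
    the product of the norms of [dg] and of that function. Letting test functions tend to the
    quotient itself turns the pairing into its squared norm. *)
Lemma nrm_dquot_le s : s != 0 -> nrm dx (dquot i s g) <= nrm dx dg.
Proof.
move=> s0; have Ld := L2_dquot i s Lg.
have [phi tphi cphi] := test_function_dense Ld.
have := scvg_norm (cvL2_I (cvL2_cst Ld) cphi).
have := scvgZ (nrm dx dg) (cvL2_nrm cphi).
move=> c1 c2.
have : `|\int[dx]_x (dquot i s g x * dquot i s g x)| <= nrm dx dg * nrm dx (dquot i s g).
  by apply: (le_lim_seq c2 c1) => n; exact: dquot_test_le.
have -> : \int[dx]_x (dquot i s g x * dquot i s g x) = nrm dx (dquot i s g) ^+ 2.
  by rewrite nrm_sqr; apply: eq_Rintegral => x _; rewrite expr2.
rewrite ger0_norm ?sqr_ge0// expr2.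
have [->|n0] := eqVneq (nrm dx (dquot i s g)) 0; first by rewrite nrm_ge0.
by rewrite ler_pM2r// lt_neqAle eq_sym n0 nrm_ge0.
Qed.

Lemma dquot_wcv (s : nat -> R) : (forall n, s n != 0) -> s @ \oo --> (0 : R) ->
  wcvL2 dx (fun n => dquot i (s n) g) dg.
Proof.
move=> s0 cs; apply: (@wcvL2_test _ _ (nrm dx dg)) => //.
- by move=> n; exact: L2_dquot.
- by move=> n; exact: nrm_dquot_le.
move=> phi tphi; have cNs : (fun n => - s n) @ \oo --> (0 : R) by rewrite -oppr0; exact: cvgN.
have Ns0 n : - s n != 0 by rewrite oppr_eq0.
have := scvgZ (-1) (@m_deriv phi 0 tphi (fun n => - s n) (fun=> I) Ns0 cNs); apply: cvg_eq => [n|].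
  by rewrite dquot_m// subr0 invrN; ring.
by rewrite mulN1r opprK; apply: eq_Rintegral => x _; rewrite scale0r addr0.
Qed.

End dquot_limits.
End weak_partials.

(** * Integration by parts for weak derivatives, and mixed derivatives *)

Section integration_by_parts.
Context (R : realType) (d : nat).
Local Notation X := 'rV[R]_d.
Local Notation dx := (leb R d).
Local Notation e_ i := (delta_mx ord0 i : X).
Implicit Types (g h b : X -> R) (i j : 'I_d).

(** Differentiability along axis lines is what products of the velocity, the cut-offs and functions
    of [a] inherit factor by factor; measurability of [db] follows from difference quotients. *)
Definition diff_along i b (db : X -> R) := forall (x : X) (r : R),
  sderiv setT (fun r => b (x + r *: e_ i)) r (db (x + r *: e_ i)).

Lemma diff_along_cvg i b db x (s : nat -> R) : diff_along i b db -> (forall n, s n != 0) ->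
  s @ \oo --> (0 : R) -> (fun n => dquot i (s n) b x) @ \oo --> db x.
Proof.
move=> bdb s0 cs; have := @bdb x 0 s (fun=> I) s0 cs; rewrite scale0r addr0.
by apply: cvg_eq => // n; rewrite subr0.
Qed.

Lemma diff_along_lip i b db (B : R) x (s : R) : diff_along i b db -> (forall x, `|db x| <= B) ->
  `|b (x + s *: e_ i) - b x| <= B * `|s|.
Proof.
move=> bdb dB; have := @sderiv_le _ setT (fun s => b (x + s *: e_ i))
  (fun s => db (x + s *: e_ i)) B 0 s (fun _ _ => I) (fun r _ => bdb x r) (fun r _ => dB _).
by rewrite scale0r addr0 subr0.
Qed.

Lemma diff_along_meas i b db : measurable_fun setT b -> diff_along i b db ->
  measurable_fun setT db.
Proof.
move=> mb bdb; apply: (@measurable_fun_cvg _ _ _ setT (fun n => dquot i n.+1%:R^-1 b)).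
  move=> n; apply: measurable_funM => //; apply: measurable_funB => //.
  exact: measurable_comp_transl.
by move=> x _; apply: diff_along_cvg => //; exact: cvg_harmonic.
Qed.

(** The difference quotient of b g h has zero integral by translation invariance, and the discrete
    product rule splits it into three terms. Two pair a weakly convergent quotient with a strongly
    convergent factor; in the third the quotient of [b] converges pointwise and boundedly. *)
Theorem integration_by_parts i g h dg dh b db (B B' : R) :
  L2 dx g -> L2 dx h -> L2 dx dg -> L2 dx dh ->
  is_weak_partial i g dg -> is_weak_partial i h dh ->
  measurable_fun setT b -> (forall x, `|b x| <= B) ->
  diff_along i b db -> (forall x, `|db x| <= B') ->
  \int[dx]_x (b x * g x * dh x) + \int[dx]_x (b x * dg x * h x)
    + \int[dx]_x (db x * g x * h x) = 0.
Proof.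
move=> Lg Lh Ldg Ldh gP hP mb bB bdb dbB.
pose s n : R := n.+1%:R^-1.
have s0 n : s n != 0 by rewrite invr_neq0.
have Ns0 n : - s n != 0 by rewrite oppr_eq0.
have cs : s @ \oo --> (0 : R) by exact: cvg_harmonic.
have cNs : (fun n => - s n) @ \oo --> (0 : R) by rewrite -oppr0; exact: cvgN.
have bT x : (fun n => b (x + s n *: e_ i)) @ \oo --> b x.
  have := @sderiv_cont _ setT _ 0 _ s (bdb x 0) (fun=> I) cs.
  by rewrite scale0r addr0.
have mbT n : measurable_fun setT (fun x : X => b (x + s n *: e_ i)) by exact: measurable_comp_transl.
have Lbg := L2_bM mb bB Lg; have Lbh := L2_bM mb bB Lh.
have c1 : (fun n => \int[dx]_x (dquot i (- s n) g x * (b x * h x))) @ \oo -->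
    \int[dx]_x (dg x * (b x * h x)).
  by apply: wcvL2_I (cvL2_cst Lbh); exact: dquot_wcv.
have c2 : (fun n => \int[dx]_x (dquot i (s n) h x * (b (x + s n *: e_ i) * g x))) @ \oo -->
    \int[dx]_x (dh x * (b x * g x)).
  apply: wcvL2_I; first exact: dquot_wcv.
  exact: (cvL2_bounded_mul mbT (fun n x => bB _) bT Lg).
have mdq n : measurable_fun setT (dquot i (s n) b).
  by apply: measurable_funM => //; exact: measurable_funB.
have dqB n x : `|dquot i (s n) b x| <= B'.
  rewrite normrM normfV ler_pdivrMr ?normr_gt0//.
  exact: diff_along_lip.
have c3 : (fun n => \int[dx]_x (dquot i (s n) b x * g x * h x)) @ \oo -->
    \int[dx]_x (db x * g x * h x).
  apply: cvL2_I3 (cvL2_cst Lg) (cvL2_cst Lh) => // x.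
  exact: diff_along_cvg.
(* Once translated by [s n], the backward quotient of [g] becomes the forward one, and the three
   terms telescope to the quotient of b g h. *)
have key n : \int[dx]_x (dquot i (- s n) g x * (b x * h x)) +
    \int[dx]_x (dquot i (s n) h x * (b (x + s n *: e_ i) * g x)) +
    \int[dx]_x (dquot i (s n) b x * g x * h x) = 0.
  have L1a : L1 dx (fun x => b x * g x * h x) by exact: L2M.
  have L1b := L1_transl (s n *: e_ i) L1a.
  have Ldq := L2_dquot i (- s n) Lg.
  have LA : L1 dx (fun x => dquot i (- s n) g x * (b x * h x)) by exact: L2M.
  have LAt := L1_transl (s n *: e_ i) LA.
  have LB : L1 dx (fun x => dquot i (s n) h x * (b (x + s n *: e_ i) * g x)).
    apply: L2M; first exact: L2_dquot.
    exact: (L2_bM (mbT n) (fun x => bB _) Lg).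
  have LC : L1 dx (fun x => dquot i (s n) b x * g x * h x).
    by apply: L2M => //; exact: L2_bM (dqB n) Lg.
  have E0 : (\int[dx]_x (b (x + s n *: e_ i) * g (x + s n *: e_ i) * h (x + s n *: e_ i)) -
      \int[dx]_x (b x * g x * h x)) / s n = 0.
    by rewrite (@Rint_transl _ _ (s n *: e_ i) (fun x => b x * g x * h x)) ?subrr ?mul0r//; exact: L1_meas L1a.
  rewrite -E0 -[X in X + _ + _](@Rint_transl _ _ (s n *: e_ i)); last exact: L1_meas LA.
  rewrite -RintD// -RintD//; last exact: L1D.
  rewrite -RintB// [RHS]mulrC -RintZ; last exact: L1B.
  apply: eq_Rintegral => x _.
  rewrite /dquot scaleNr addrK invrN; field.
  exact: s0.
have c0 := scvgD (scvgD c1 c2) c3.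
have -> : \int[dx]_x (b x * g x * dh x) = \int[dx]_x (dh x * (b x * g x)).
  by apply: eq_Rintegral => x _; ring.
have -> : \int[dx]_x (b x * dg x * h x) = \int[dx]_x (dg x * (b x * h x)).
  by apply: eq_Rintegral => x _; ring.
rewrite [X in X + _ = _]addrC; apply: (scvg_unique c0).
by apply: cvg_eq (@cvg_cst _ (0 : R) _ _ _) => // n; rewrite key.
Qed.

(* Taking difference quotients in one direction avoids symmetry of classical second derivatives. *)
Lemma weak_partial_comm i j g gi gj gij gji : L2 dx g -> L2 dx gi -> L2 dx gj ->
  L2 dx gij -> L2 dx gji ->
  is_weak_partial i g gi -> is_weak_partial j g gj ->
  is_weak_partial i gj gij -> is_weak_partial j gi gji ->
  {ae dx, forall x, gij x = gji x}.
Proof.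
move=> Lg Lgi Lgj Lgij Lgji giP gjP gijP gjiP.
suff H phi : test_function phi -> \int[dx]_x ((gij x - gji x) * phi x) = 0.
  have := test_orth_ae0 (L2B Lgij Lgji) H.
  by apply: filterS => x /eqP; rewrite subr_eq0 => /eqP.
move=> tphi; have Lphi := test_L2 tphi.
have tpj := test_function_partial j tphi; have Lpj := test_L2 tpj.
under eq_Rintegral do rewrite mulrBl.
rewrite RintB; try exact: L2M.
pose s n : R := n.+1%:R^-1.
have s0 n : s n != 0 by rewrite invr_neq0.
have cs : s @ \oo --> (0 : R) by exact: cvg_harmonic.
have [_ _ _ c1] := dquot_wcv Lgj Lgij gijP s0 cs.
have [_ _ _ c2] := dquot_wcv Lg Lgi giP s0 cs.
(* The quotient is a combination of translates, so it commutes with [partial j]; the weak derivative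
   of [g] is tested against [dquot i (- s n) phi]. *)
have key n : \int[dx]_x (dquot i (s n) gj x * phi x) = - \int[dx]_x (dquot i (s n) g x * partial j phi x).
  rewrite !dquot_adjoint//; congr (- _).
  have tdq : test_function (dquot i (- s n) phi).
    have -> : dquot i (- s n) phi = fun x => (- s n)^-1 * (phi (x + - s n *: e_ i) + -1 * phi x).
      by apply/funext => x; rewrite /dquot; ring.
    apply: test_functionZ; apply: test_functionD; first exact: test_function_transl.
    exact: test_functionZ.
  have [_ _ /(_ _ tdq) E] := gjP.
  rewrite -[LHS]opprK -E; congr (- _); apply: eq_Rintegral => x _; congr (_ * _).
  have D0 y : derivable phi y (e_ j) by case: tphi => /(_ 1%N) C _; exact: Ck_derivable C.
  have D1 y : derivable (fun y : X => phi (y + - s n *: e_ i)) y (e_ j) by exact: derivable_transl.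
  have -> : dquot i (- s n) phi = (- s n)^-1 \*: ((fun y : X => phi (y + - s n *: e_ i)) - phi).
    by apply/funext => y; rewrite /dquot mulrC.
  rewrite /partial deriveZ ?deriveB//; last exact: derivableB.
  rewrite /dquot mulrC; congr (_ * (_ - _)).
  by rewrite -[LHS]/(partial j _ x) partial_transl.
have {}c1 := c1 _ Lphi; have {}c2 := c2 _ Lpj.
have [_ _ /(_ _ tphi) E2] := gjiP.
apply/eqP; rewrite subr_eq0; apply/eqP.
apply: (scvg_unique c1).
have := scvgZ (-1) c2; apply: cvg_eq => [n|]; first by rewrite key mulN1r.
by rewrite mulN1r E2 opprK.
Qed.

End integration_by_parts.

(** * From paths with values in H2 to paths of derivatives with values in L2 *)

Section sobolev_paths.
Context (R : realType) (d : nat).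
Local Notation X := 'rV[R]_d.
Local Notation dx := (leb R d).
Local Notation wp := (@weak_partial R d).
Implicit Types (g h : X -> R) (i j : 'I_d).

Lemma Lfun2_L2 g : g \in Lfun dx 2%:E -> L2 dx g.
Proof.
move=> Lg; split; last exact: Lfun2_integrable_sqr.
by move: Lg => /sub_Lfun_mfun; rewrite inE.
Qed.

Lemma sobolev2P g : sobolev 2 g -> L2 dx g /\
  forall i, [/\ is_weak_partial i g (wp i g), L2 dx (wp i g) &
    forall j, is_weak_partial j (wp i g) (wp j (wp i g)) /\ L2 dx (wp j (wp i g))].
Proof.
move=> /= [Lg H]; split; first exact: Lfun2_L2.
move=> i; have [ei [Li Hi]] := H i; split.
- exact: weak_partialP.
- exact: Lfun2_L2.
- by move=> j; have [ej [Lj _]] := Hi j; split; [exact: weak_partialP | exact: Lfun2_L2].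
Qed.

(** [weak_partial] selects some weak derivative, not known in advance to be square-integrable.
    Finiteness of its square integral restores this, and then uniqueness in L2 applies. *)
Lemma weak_partial_ae_eq i g v : is_weak_partial i g v -> L2 dx v ->
  (\int[dx]_x ((wp i g x) ^+ 2)%:E < +oo)%E ->
  L2 dx (wp i g) /\ {ae dx, forall x, wp i g x = v x}.
Proof.
move=> gv Lv foo; have gw := weak_partialP (ex_intro _ v gv).
have Lw : L2 dx (wp i g).
  have mw : measurable_fun setT (wp i g) by case: gw => _ [].
  split => //; apply/integrableP; split; first exact/measurable_EFinP/measurable_funX.
  apply: le_lt_trans foo; apply: ge0_le_integral => //.
  - by apply: measurableT_comp => //; exact/measurable_EFinP/measurable_funX.
  - by apply/measurable_EFinP; exact: measurable_funX.
  - by move=> x _ /=; rewrite ger0_norm// sqr_ge0.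
by split => //; exact: weak_partial_unique gw gv Lw Lv.
Qed.

(** Transfers smallness from the selected derivative of [z n] to the explicit one [v n]. The
    identification is made for large [n], once the square integral has become finite. *)
Lemma cvg_weak_partial i (z v : nat -> X -> R) :
  (\forall n \near \oo, is_weak_partial i (z n) (v n)) -> (forall n, L2 dx (v n)) ->
  (fun n => \int[dx]_x ((wp i (z n) x) ^+ 2)%:E)%E @ \oo --> (0 : \bar R)%E ->
  (\forall n \near \oo, {ae dx, forall x, wp i (z n) x = v n x}) /\
  (fun n => nrm dx (v n)) @ \oo --> (0 : R).
Proof.
move=> zv Lv cz; have /fine_cvgP[fz cz'] := cz.
have H : \forall n \near \oo, L2 dx (wp i (z n)) /\ {ae dx, forall x, wp i (z n) x = v n x}.
  apply: filterS2 zv fz => n zvn fn; apply: weak_partial_ae_eq => //.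
  by rewrite -ge0_fin_numE//; apply: integral_ge0 => x _; rewrite lee_fin sqr_ge0.
split; first by apply: filterS H => n [].
have c1 : (fun n => Num.sqrt (fine (\int[dx]_x ((wp i (z n) x) ^+ 2)%:E)%E)) @ \oo --> (0 : R).
  rewrite -[X in _ --> X](@sqrtr0 R); apply: (@cvg_comp _ _ _ _ (@Num.sqrt R)) cz' _.
  exact: sqrt_continuous.
apply: cvg_trans c1; apply: near_eq_cvg; apply: filterS H => n [Lw vw].
by rewrite -(nrm_ae (L2_meas Lw) (L2_meas (Lv n)) vw).
Qed.

Variables (T : R) (g g' : R -> X -> R).
Hypotheses
  (Hg : forall t : R, t \in `[0, T] -> sobolev 2 (g t) /\ sobolev 2 (g' t))
  (Hq : forall t : R, t \in `[0, T] ->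
     sobolev_sqnorm 2 (fun x => (s - t)^-1 * (g s x - g t x) - g' t x)
          @[s --> within `[0, T] t^'] --> (0 : \bar R)%E)
  (Hc : forall t : R, t \in `[0, T] ->
      sobolev_sqnorm 2 (fun x => g' s x - g' t x)
          @[s --> within `[0, T] (nbhs t)] --> (0 : \bar R)%E).

Let Lg t : t \in `[0, T] -> L2 dx (g t).
Proof. by move=> /Hg[/sobolev2P[]]. Qed.
Let Lg' t : t \in `[0, T] -> L2 dx (g' t).
Proof. by move=> /Hg[_ /sobolev2P[]]. Qed.

Let z (s : nat -> R) t n : X -> R := fun x => (s n - t)^-1 * (g (s n) x - g t x) - g' t x.
Let dz i (s : nat -> R) t n : X -> R :=
  fun x => (s n - t)^-1 * (wp i (g (s n)) x - wp i (g t) x) - wp i (g' t) x.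
Let ddz i j (s : nat -> R) t n : X -> R :=
  fun x => (s n - t)^-1 * (wp j (wp i (g (s n))) x - wp j (wp i (g t)) x) - wp j (wp i (g' t)) x.

Lemma is_weak_partial_quot i (a b c da db dc : X -> R) (k : R) :
  is_weak_partial i a da -> is_weak_partial i b db -> is_weak_partial i c dc ->
  is_weak_partial i (fun x => k * (a x - b x) - c x) (fun x => k * (da x - db x) - dc x).
Proof.
move=> aP bP cP.
have := is_weak_partialD (is_weak_partialZ k (is_weak_partialD aP (is_weak_partialZ (-1) bP)))
  (is_weak_partialZ (-1) cP).
by congr is_weak_partial; apply/funext => x; ring.
Qed.

Let L2_quot (a b c : X -> R) (k : R) : L2 dx a -> L2 dx b -> L2 dx c ->
  L2 dx (fun x => k * (a x - b x) - c x).
Proof. by move=> La Lb Lc; apply: L2B => //; apply: L2Z; exact: L2B. Qed.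

Let ecvg0_le (u v : nat -> \bar R) : (forall n, (0 <= u n <= v n)%E) ->
  v @ \oo --> (0 : \bar R)%E -> u @ \oo --> (0 : \bar R)%E.
Proof.
move=> uv; apply: (squeeze_cvge (f := fun=> 0%E)); last exact: cvg_cst.
by apply: nearW => n; exact: uv.
Qed.

Let sum_term_le (F : 'I_d -> \bar R) i : (forall j, (0 <= F j)%E) ->
  (F i <= \sum_(j < d) F j)%E.
Proof. by move=> F0; rewrite (bigD1 i)//= leeDl// sume_ge0. Qed.

Lemma path_quot_lim t (s : nat -> R) : t \in `[0, T] -> (forall n, s n \in `[0, T]) ->
  (forall n, s n != t) -> s @ \oo --> t ->
  [/\ (fun n => nrm dx (z s t n)) @ \oo --> (0 : R),
      forall i, (fun n => nrm dx (dz i s t n)) @ \oo --> (0 : R) &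
      forall i j, (fun n => nrm dx (ddz i j s t n)) @ \oo --> (0 : R)].
Proof.
move=> tT sT st cs.
have c : (fun n => sobolev_sqnorm 2 (z s t n)) @ \oo --> (0 : \bar R)%E.
  exact: (@cvg_comp _ _ _ s (fun r => sobolev_sqnorm 2 (fun x => (r - t)^-1 * (g r x - g t x) - g' t x))
    _ _ _ (cvg_dnbhs_within (A := `[0, T]%classic) sT st cs) (Hq tT)).
have [/sobolev2P[Lt Pt] /sobolev2P[Lt' Pt']] := Hg tT.
have Hs n := sobolev2P (Hg (sT n)).1.
have ge0 (v : X -> R) : (0 <= \int[dx]_x ((v x) ^+ 2)%:E)%E.
  by apply: integral_ge0 => x _; rewrite lee_fin sqr_ge0.
have S1_ge0 (v : X -> R) : (0 <= \int[dx]_x ((v x) ^+ 2)%:E +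
    \sum_(j < d) (\int[dx]_x ((wp j v x) ^+ 2)%:E + 0))%E.
  by rewrite adde_ge0// sume_ge0// => j _; rewrite adde0.
have c0 : (fun n => \int[dx]_x ((z s t n x) ^+ 2)%:E)%E @ \oo --> (0 : \bar R)%E.
  apply: (ecvg0_le _ c) => n; rewrite ge0/= leeDl// sume_ge0// => i _; exact: S1_ge0.
have c1 i : (fun n => \int[dx]_x ((wp i (z s t n) x) ^+ 2)%:E)%E @ \oo --> (0 : \bar R)%E.
  apply: (ecvg0_le _ c) => n; rewrite ge0/=.
  apply: le_trans (leeDr _ (ge0 _)).
  apply: le_trans (sum_term_le (F := fun i => _ + \sum_(j < d) _)%E i (fun=> S1_ge0 _)).
  by rewrite leeDl// sume_ge0// => j _; rewrite adde0.
have c2 i j : (fun n => \int[dx]_x ((wp j (wp i (z s t n)) x) ^+ 2)%:E)%E @ \oo --> (0 : \bar R)%E.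
  apply: (ecvg0_le _ c) => n; rewrite ge0/=.
  apply: le_trans (leeDr _ (ge0 _)).
  apply: le_trans (sum_term_le (F := fun i => _ + \sum_(j < d) _)%E i (fun=> S1_ge0 _)).
  apply: le_trans (leeDr _ (ge0 _)).
  have F0 k : (0 <= \int[dx]_x ((wp k (wp i (z s t n)) x) ^+ 2)%:E + 0)%E by rewrite adde0.
  apply: le_trans (sum_term_le j F0).
  by rewrite adde0.
have Pz i n : is_weak_partial i (z s t n) (dz i s t n).
  have [_ /(_ i)[p1 _ _]] := Hs n; have [p2 _ _] := Pt i; have [p3 _ _] := Pt' i.
  exact: is_weak_partial_quot.
have Ldz i n : L2 dx (dz i s t n).
  have [_ /(_ i)[_ p1 _]] := Hs n; have [_ p2 _] := Pt i; have [_ p3 _] := Pt' i.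
  exact: L2_quot.
split.
- have /fine_cvgP[_ cz'] := c0.
  rewrite -[X in _ --> X](@sqrtr0 R); apply: (@cvg_comp _ _ _ _ (@Num.sqrt R)) cz' _.
  exact: sqrt_continuous.
- by move=> i; have [|_ //] := @cvg_weak_partial i _ (dz i s t) _ (Ldz i) (c1 i); apply: nearW.
(* The Sobolev norm contains the derivative of the selected first derivative. The latter must be
   identified almost everywhere with the quotient [dz] before the argument can be repeated. *)
move=> i j; have [|ae1 _] := @cvg_weak_partial i _ (dz i s t) _ (Ldz i) (c1 i).
  exact: nearW.
have [||_ //] := @cvg_weak_partial j _ (ddz i j s t) _ _ (c2 i j).
  apply: filterS ae1 => n ae1.
  apply: (@is_weak_partial_ae _ _ _ (dz i s t n)).
  - by have [_ []] := weak_partialP (ex_intro _ _ (Pz i n)).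
  - by apply: filterS ae1 => x ->.
  have [_ /(_ i)[_ _ /(_ j)[p1 _]]] := Hs n; have [_ _ /(_ j)[p2 _]] := Pt i.
  have [_ _ /(_ j)[p3 _]] := Pt' i.
  exact: is_weak_partial_quot.
move=> n; have [_ /(_ i)[_ _ /(_ j)[_ p1]]] := Hs n; have [_ _ /(_ j)[_ p2]] := Pt i.
have [_ _ /(_ j)[_ p3]] := Pt' i.
exact: L2_quot.
Qed.

Lemma path_cont' t (s : nat -> R) : t \in `[0, T] -> (forall n, s n \in `[0, T]) ->
  s @ \oo --> t -> cvL2 dx (fun n => g' (s n)) (g' t).
Proof.
move=> tT sT cs.
have cw : s @ \oo --> within `[0, T]%classic (nbhs t).
  move=> P; rewrite /within/= => /cs.
  by apply: (@filterS _ \oo _ (fun n => `[0, T]%classic (s n) -> P (s n))) => n; apply; exact: sT.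
have c : (fun n => sobolev_sqnorm 2 (fun x => g' (s n) x - g' t x)) @ \oo --> (0 : \bar R)%E.
  exact: (@cvg_comp _ _ _ s (fun r => sobolev_sqnorm 2 (fun x => g' r x - g' t x)) _ _ _ cw (Hc tT)).
split; [by move=> n; exact: Lg' | exact: Lg' |].
have c0 : (fun n => \int[dx]_x ((g' (s n) x - g' t x) ^+ 2)%:E)%E @ \oo --> (0 : \bar R)%E.
  have ge0 (v : X -> R) : (0 <= \int[dx]_x ((v x) ^+ 2)%:E)%E.
    by apply: integral_ge0 => x _; rewrite lee_fin sqr_ge0.
  apply: (ecvg0_le _ c) => n; rewrite (ge0 (fun x => g' (s n) x - g' t x))/= leeDl// sume_ge0// => i _.
  by rewrite adde_ge0// sume_ge0// => j _; rewrite adde0.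
have /fine_cvgP[_ cz'] := c0.
rewrite -[X in _ --> X](@sqrtr0 R); apply: (@cvg_comp _ _ _ _ (@Num.sqrt R)) cz' _.
exact: sqrt_continuous.
Qed.

End sobolev_paths.

Section path_diff.
Context (R : realType) (d : nat) (T : R).
Local Notation X := 'rV[R]_d.
Local Notation dx := (leb R d).
Implicit Types (v : R -> X -> R).

Definition path_diff v (v' : R -> X -> R) := forall t : R, t \in `[0, T] ->
  [/\ L2 dx (v t), L2 dx (v' t) & forall s : nat -> R,
    (forall n, s n \in `[0, T]) -> (forall n, s n != t) -> s @ \oo --> t ->
    cvL2 dx (fun n x => (v (s n) x - v t x) / (s n - t)) (v' t)].

Lemma path_diff_cont v (v' : R -> X -> R) t (s : nat -> R) : path_diff v v' -> t \in `[0, T] ->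
  (forall n, s n \in `[0, T]) -> s @ \oo --> t -> cvL2 dx (fun n => v (s n)) (v t).
Proof.
move=> vv' tT sT cs; have [Lt Lt' H] := vv' t tT.
have Lr r : r \in `[0, T] -> L2 dx (v r) by move=> /vv'[].
split => //; first by move=> n; exact: Lr.
have u0 : nrm dx (fun x => v t x - v t x) = 0.
  rewrite (@eq_nrm _ _ _ _ _ (fun x => 0 * 0)); last by move=> x; rewrite subrr mulr0.
  by rewrite nrmZ ?normr0 ?mul0r//; exact: L2_0.
rewrite -u0; apply: (@sderiv_cont_gen R `[0, T]%classic (fun r => nrm dx (fun x => v r x - v t x)) t) => //.
move=> {sT cs} {}s sT st cs; rewrite u0.
have Hn := cvL2_nrm (H s sT st cs).
apply: cvg_eq (scvgM (scvg_norm (cvg_subr0 cs)) Hn) => [n|]; last by rewrite normr0 mul0r.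
rewrite -nrmZ; last by have := cvL2_L2 n (H s sT st cs).
by apply: eq_nrm => x; rewrite mulrC divfK// subr_eq0.
Qed.

Lemma C1_H2_path_diff (g g' : R -> X -> R) :
  (forall t : R, t \in `[0, T] -> sobolev 2 (g t) /\ sobolev 2 (g' t)) ->
  (forall t : R, t \in `[0, T] ->
     sobolev_sqnorm 2 (fun x => (s - t)^-1 * (g s x - g t x) - g' t x)
          @[s --> within `[0, T] t^'] --> (0 : \bar R)%E) ->
  [/\ path_diff g g',
     forall i, path_diff (fun t => weak_partial i (g t)) (fun t => weak_partial i (g' t)) &
     forall i j, path_diff (fun t => weak_partial j (weak_partial i (g t)))
        (fun t => weak_partial j (weak_partial i (g' t)))].
Proof.
move=> Hg Hq.
have aux v (v' : R -> X -> R) : (forall t, t \in `[0, T] -> L2 dx (v t)) -> (forall t, t \in `[0, T] -> L2 dx (v' t)) ->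
  (forall t s, t \in `[0, T] -> (forall n, s n \in `[0, T]) ->
  (forall n, s n != t) -> s @ \oo --> t ->
  (fun n => nrm dx (fun x => (s n - t)^-1 * (v (s n) x - v t x) - v' t x)) @ \oo --> (0 : R)) ->
  path_diff v v'.
  move=> Lv Lv' H t tT; split; [exact: Lv|exact: Lv'|move=> s sT st cs; split].
  - by move=> n; under eq_fun => x do rewrite mulrC; apply: L2Z; apply: L2B; exact: Lv.
  - exact: Lv'.
  apply: cvg_eq (H t s tT sT st cs) => // n.
  by apply: eq_nrm => x; rewrite mulrC.
split=> [|i|i j]; apply: aux.
- by move=> t /Hg[/sobolev2P[]].
- by move=> t /Hg[_ /sobolev2P[]].
- by move=> t s tT sT st cs; have [] := path_quot_lim Hg Hq tT sT st cs.
- by move=> t /Hg[/sobolev2P[_ /(_ i)[]]].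
- by move=> t /Hg[_ /sobolev2P[_ /(_ i)[]]].
- by move=> t s tT sT st cs; have [] := path_quot_lim Hg Hq tT sT st cs.
- by move=> t /Hg[/sobolev2P[_ /(_ i)[_ _ /(_ j)[]]]].
- by move=> t /Hg[_ /sobolev2P[_ /(_ i)[_ _ /(_ j)[]]]].
- by move=> t s tT sT st cs; have [] := path_quot_lim Hg Hq tT sT st cs.
Qed.

Lemma path_bounded_near v t : t \in `[0, T] ->
  (forall s : nat -> R, (forall n, s n \in `[0, T]) -> s @ \oo --> t -> cvL2 dx (fun n => v (s n)) (v t)) ->
  exists2 e : R, 0 < e & forall s, s \in `[0, T] -> `|s - t| < e -> nrm dx (v s) <= nrm dx (v t) + 1.
Proof.
move=> tT H; apply: contrapT => nex.
have /choice[s sP] : forall n : nat, exists s, [/\ s \in `[0, T], `|s - t| < n.+1%:R^-1 &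
    nrm dx (v t) + 1 < nrm dx (v s)].
  move=> n; apply: contrapT => nn; apply: nex; exists n.+1%:R^-1; first by rewrite invr_gt0.
  move=> s sT st; rewrite leNgt; apply/negP => h; apply: nn.
  by exists s; split.
have sT n : s n \in `[0, T] by have [] := sP n.
have cs : s @ \oo --> t.
  apply: cvg_sub0; apply: (@squeeze0 _ _ (fun n => n.+1%:R^-1)); last exact: cvg_harmonic.
  by move=> n; rewrite ltW//; have [] := sP n.
have c := cvL2_nrm (H s sT cs).
have : nrm dx (v t) + 1 <= nrm dx (v t).
  apply: (le_lim_seq (@cvg_cst _ (nrm dx (v t) + 1) _ \oo _) c) => n.
  by rewrite ltW//; have [] := sP n.
by rewrite gerDl ler10.
Qed.

End path_diff.

(** * Cut-offs compensating linear growth *)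

Section cutoffs.
Context (R : realType) (d : nat).
Local Notation X := 'rV[R]_d.
Local Notation dx := (leb R d).
Local Notation e_ i := (delta_mx ord0 i : X).
Implicit Types (g h b : X -> R) (i j : 'I_d).

(** The l1 norm suits bounds on each partial derivative: linear growth follows by changing one
    coordinate at a time. *)
Definition n1 (x : X) : R := \sum_(j < d) `|x ord0 j|.

Lemma n1_ge0 x : 0 <= n1 x. Proof. exact: sumr_ge0. Qed.

Lemma n1_cube r x : cube r x -> n1 x <= d%:R * r.
Proof.
move=> xr; rewrite /n1 -[d in d%:R]card_ord mulr_natl -sumr_const.
by apply: ler_sum => i _; exact: xr.
Qed.

(* [chi k] is a test function dilated by [k + 1]. *)
Definition cutoff_spec (chi : nat -> X -> R) (dchi : nat -> 'I_d -> X -> R) := exists B : R,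
  [/\ 0 <= B, forall k, test_function (chi k), forall k x, `|chi k x| <= B,
   forall x, (fun k => chi k x) @ \oo --> (1 : R) &
   [/\ forall k i, diff_along i (chi k) (dchi k i),
   forall k i, continuous (dchi k i),
   forall k, exists r, forall x, ~ cube r x -> chi k x = 0 /\ forall i, dchi k i x = 0,
   forall k i x, `|dchi k i x| * (1 + n1 x) <= B &
   forall i x, (fun k => dchi k i x) @ \oo --> (0 : R)]].

Lemma Ck_scale k g (c : R) : Ck k g -> Ck k (fun x : X => g (c *: x)) /\
  (k != 0%N -> forall i x, derivable (fun y : X => g (c *: y)) x (e_ i) /\
    partial i (fun y : X => g (c *: y)) x = c * partial i g (c *: x)).
Proof.
have ct g' : continuous g' -> continuous (fun x : X => g' (c *: x)).
  move=> cg x; apply: (@continuous_comp _ _ _ (fun y : X => c *: y) g'); last exact: cg.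
  exact: scaler_continuous.
have D k' g' i x : Ck k'.+1 g' -> is_derive x (e_ i) (fun y : X => g' (c *: y)) (c * partial i g' (c *: x)).
  move=> Cg.
  have : sderiv setT (fun r => g' (c *: x + r *: e_ i)) 0 (partial i g' (c *: x)).
    by have := derivable_sderiv0 (@Ck_derivable _ _ k' g' i (c *: x) Cg).
  move=> H.
  have H2 : sderiv setT (fun r => g' (c *: x + (c * r) *: e_ i)) 0 (partial i g' (c *: x) * c).
    apply: (@sderiv_comp _ setT setT (fun r => g' (c *: x + r *: e_ i)) (fun r => c * r)) => //.
      by rewrite mulr0.
    by rewrite -[X in sderiv _ _ _ X]mulr1; apply: sderivZ; exact: sderiv_id.
  have := sderiv_is_derive (@filterT _ _ _) H2; rewrite mulrC.
  have E : (fun r : R => r^-1 *: (((fun y : X => g' (c *: y)) \o shift x) (r *: e_ i) - g' (c *: x))) =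
    (fun r : R => r^-1 *: (((fun s => g' (c *: x + (c * s) *: e_ i)) \o shift 0) (r *: 1)
     - (fun s => g' (c *: x + (c * s) *: e_ i)) 0)).
    apply/funext => r /=; rewrite /shift addr0 mulr0 scale0r addr0; congr (_ *: (g' _ - _)).
    have -> : r *: (1 : R) = r by exact: mulr1.
    by rewrite scalerDr scalerA addrC.
  case=> dd <-; apply: DeriveDef; first by rewrite /derivable E.
  by rewrite /derive E.
move=> Cg; split; last first.
  case: k Cg => // k Cg _ i x; have [d1 d2] := D k g i x Cg; split => //.
elim: k g Cg => [|k IH] g Cg; first by have [cg _] := Cg; split => //; exact: ct.
have [cg dg] := Cg; split; first exact: ct.
move=> i; split; first by move=> x; have [] := D k g i x Cg.
rewrite (_ : partial i _ = fun x => c * partial i g (c *: x)).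
  by apply: CkM; [exact: Ck_cst | apply: IH; have [] := dg i].
by apply/funext => x; have [_ <-] := D k g i x Cg.
Qed.

(** Dilation divides the gradient by k + 1, while the support lies in a cube of size proportional to
    k + 1; their product stays bounded. The bump is normalised at the origin, and the pointwise
    limit 1 comes from its continuity there. *)
Lemma cutoffs_exist : exists chi dchi, cutoff_spec chi dchi.
Proof.
pose a := fun _ : 'I_d => (-1 : R); pose b := fun _ : 'I_d => (1 : R).
have t0 : test_function (bump 1 a b) by apply: bump_test.
have b0 : bump 1 a b 0 != 0.
  apply/prodf_neq0 => i _; rewrite /= !mxE /a /b /flat.
  by rewrite !mulr0 !add0r mulrN1 opprK mulr1 ltr01 expr0 mul1r mulf_neq0// gt_eqF// expR_gt0.
pose psi x := (bump 1 a b 0)^-1 * bump 1 a b x.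
have tpsi : test_function psi by exact: test_functionZ.
have psi0 : psi 0 = 1 by rewrite /psi mulVf.
have [Cpsi [K cK K0]] := tpsi.
have [r r0 Kr] := compact_sub_cube cK.
have [B B0 pB] := test_function_bounded tpsi.
have /choice[Bi BiP] : forall i, exists Bi, 0 <= Bi /\ forall x, `|partial i psi x| <= Bi.
  by move=> i; have [Bi] := test_function_bounded (test_function_partial i tpsi); exists Bi.
pose c k : R := k.+1%:R^-1.
have c0 k : 0 < c k by rewrite invr_gt0.
have c1 k : c k <= 1 by rewrite invf_le1// ler1n.
pose chi k x := psi (c k *: x); pose dchi k i x := c k * partial i psi (c k *: x).
have out (x : X) : ~ cube r x -> psi x = 0 by move=> nx; apply: K0 => /Kr.
have dout i (x : X) : ~ cube r x -> partial i psi x = 0.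
  move=> nx; rewrite /partial (near_eq_derive (g := cst (0 : R))) ?derive_cst//.
  have oK : open (~` (cube r : set X)) by apply: closed_openC; exact: compact_closed (@compact_cube R d r).
  have : nbhs x (~` cube r) by exact: open_nbhs_nbhs.
  by apply: filterS => y; exact: out.
have in_cube k (x : X) : cube r (c k *: x) -> cube (r * k.+1%:R) x.
  move=> h i; have := h i; rewrite mxE normrM gtr0_norm//.
  by rewrite mulrC ler_pdivrMr.
have cx (x : X) : (fun k => c k *: x) @ \oo --> (0 : X).
  rewrite -(scale0r x); apply: cvgZr_tmp; exact: cvg_harmonic.
pose S := \sum_i Bi i.
have S0 : 0 <= S by apply: sumr_ge0 => i _; have [] := BiP i.
have BS i : Bi i <= S by rewrite /S (bigD1 i)//= lerDl sumr_ge0// => j _; have [] := BiP j.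
have X0 : 0 <= S * (1 + d%:R * r) by rewrite mulr_ge0 ?addr_ge0// mulr_ge0// ltW.
exists chi, dchi, (B + S * (1 + d%:R * r)); split.
- by rewrite addr_ge0.
- move=> k; split; first by move=> k'; have [] := Ck_scale (c k) (Cpsi k').
  exists (cube (r * k.+1%:R)); first exact: compact_cube.
  by move=> x nx; apply: out => /in_cube.
- by move=> k x; apply: (le_trans (pB _)); rewrite lerDl.
- move=> x; rewrite -psi0; apply: (@cvg_comp _ _ _ (fun k => c k *: x) psi _ _ _ (cx x)).
  exact: (test_function_cont tpsi).
split.
- move=> k i x s; have [_ /(_ isT i) H] := Ck_scale (c k) (Cpsi 1%N).
  have [D1 D2] := H (x + s *: e_ i).
  by have := derivable_sderiv D1; rewrite -/(partial i _ _) D2.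
- move=> k i; have [Cs _] := Ck_scale (c k) ((test_function_partial i tpsi).1 0%N).
  exact: Ck_cont (CkM (Ck_cst _ 0 (c k)) Cs).
- move=> k; exists (r * k.+1%:R) => x nx; split; first by apply: out => /in_cube.
  by move=> i; rewrite /dchi dout ?mulr0// => /in_cube.
- move=> k i x; have [/in_cube xin|nx] := pselect (cube r (c k *: x)); last first.
    by rewrite /dchi dout// mulr0 normr0 mul0r addr_ge0.
  apply: (@le_trans _ _ (S * (1 + d%:R * r))); last by rewrite lerDr.
  rewrite /dchi normrM gtr0_norm// mulrAC mulrC; apply: ler_pM => //.
  - by rewrite mulr_ge0 ?addr_ge0 ?n1_ge0// ltW.
  - by apply: le_trans (BS i); have [_ ->] := BiP i.
  rewrite mulrDr mulr1 lerD//.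
  rewrite mulrC ler_pdivrMr// -mulrA; exact: n1_cube.
- move=> i x; apply: (@squeeze0 _ _ (fun k => S * c k)).
    move=> k; rewrite /dchi normrM gtr0_norm// mulrC; apply: ler_wpM2r; first exact: ltW.
    by apply: le_trans (BS i); have [_ ->] := BiP i.
  by rewrite -[X in _ --> X](mulr0 S); apply: scvgZ; exact: cvg_harmonic.
Qed.

End cutoffs.

(** * The nonlinearity near 0 *)

Section sderiv_eps.
Context (R : realType).
Implicit Types (A : set R) (g : R -> R).

Lemma sderiv_cont_eps A g t l (e : R) : A t -> sderiv A g t l -> 0 < e ->
  exists2 dl, 0 < dl & forall r, A r -> `|r - t| < dl -> `|g r - g t| < e.
Proof.
move=> At dg e0.
have /cvgrPdist_lt/(_ e e0) := @seq_cvg_within_nbhs R A t g (g t) (fun s sA cs => sderiv_cont dg sA cs).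
rewrite /within/= => -[dl /= dl0 H]; exists dl => // r Ar rt.
by rewrite distrC; apply: H => //=; rewrite /ball_/= distrC.
Qed.

Lemma sderiv_continuous_itv (a b : R) g (g' : R -> R) :
  (forall r, a <= r <= b -> sderiv `[a, b]%classic g r (g' r)) ->
  {within `[a, b], continuous g}.
Proof.
move=> dg; apply/subspace_continuousP => x /= xab.
apply: seq_cvg_within_nbhs => s sA cs.
have xab' : a <= x <= b by move: xab; rewrite in_itv.
exact: sderiv_cont (dg x xab') sA cs.
Qed.

End sderiv_eps.

Section nonlinearity_bounds.
Context (R : realType).
Local Notation halfline := (`[(0:R), +oo[%classic).
Implicit Types (G : nat -> R -> R).

Definition jet G := forall k rho, 0 <= rho -> sderiv halfline (G k) rho (G k.+1 rho).

Let half_itv (a b : R) : 0 <= a -> `[a, b]%classic `<=` halfline.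
Proof. by move=> a0 x; rewrite /= !in_itv/= => /andP[ax _]; rewrite andbT (le_trans a0). Qed.

Let in_half (rho : R) : 0 <= rho -> halfline rho.
Proof. by move=> r0; rewrite /= in_itv/= r0. Qed.

(* Induction on the order of vanishing: if [|rho G''| <= C G'], then [rho G' - (C + 1) G] is nonincreasing. *)
Lemma jet_finite_order G m : jet G -> (forall j, (j < m)%N -> G j 0 = 0) -> 0 < G m 0 ->
  exists dl C : R, [/\ 0 < dl, 0 <= C &
    forall rho, 0 <= rho <= dl -> 0 <= G 0%N rho /\ `|rho * G 1%N rho| <= C * G 0%N rho].
Proof.
elim: m G => [|m IH] G jG G0 Gm.
  have G2 : 0 < G 0%N 0 / 2 by rewrite divr_gt0.
  have [d0 d00 H0] := sderiv_cont_eps (in_half (lexx 0)) (jG 0%N 0 (lexx 0)) G2.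
  have [d1 d10 H1] := sderiv_cont_eps (in_half (lexx 0)) (jG 1%N 0 (lexx 0)) (@ltr01 R).
  pose dl := Num.min (d0 / 2) (d1 / 2).
  have dl0 : 0 < dl by rewrite lt_min !divr_gt0.
  have dl0' : dl <= d0 / 2 by rewrite ge_min lexx.
  have dl1' : dl <= d1 / 2 by rewrite ge_min lexx orbT.
  (* Order 0: by continuity [G 0] stays above half its value at 0 and [G 1] stays below its initial
     size plus 1, whence this ratio. *)
  pose C := dl * (`|G 1%N 0| + 1) / (G 0%N 0 / 2).
  exists dl, C; split => //; first by rewrite divr_ge0 ?mulr_ge0 ?addr_ge0// ltW.
  move=> rho /andP[r0 rd].
  have := H0 rho (in_half r0); rewrite subr0 ger0_norm// => /(_ _).
  have -> : rho < d0 by lra.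
  move=> /(_ isT); rewrite ltr_norml => /andP[h1 _].
  have := H1 rho (in_half r0); rewrite subr0 ger0_norm// => /(_ _).
  have -> : rho < d1 by lra.
  move=> /(_ isT) h2.
  have Gr : G 0%N 0 / 2 <= G 0%N rho by lra.
  split; first by apply: le_trans Gr; exact: ltW.
  rewrite normrM ger0_norm//.
  have h3 : `|G 1%N rho| <= `|G 1%N 0| + 1.
    rewrite -[G 1%N rho](subrK (G 1%N 0)).
    by rewrite (le_trans (ler_normD _ _))// addrC lerD// ltW.
  apply: (@le_trans _ _ (C * (G 0%N 0 / 2))).
    by rewrite /C divfK ?gt_eqF//; apply: ler_pM.
  by rewrite ler_wpM2l// divr_ge0 ?mulr_ge0 ?addr_ge0// ltW.
have [dl [C [dl0 C0 H]]] : exists dl C : R, [/\ 0 < dl, 0 <= C &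
    forall rho, 0 <= rho <= dl -> 0 <= G 1%N rho /\ `|rho * G 2%N rho| <= C * G 1%N rho].
  apply: (IH (fun k => G k.+1)) => // [k rho r0|j jm]; first exact: jG.
  exact: G0.
exists dl, (C + 1); split => // [|rho /andP[r0 rd]]; first by rewrite addr_ge0.
have g00 : G 0%N 0 = 0 by exact: G0.
have [<-|rp] := eqVneq 0 rho; first by rewrite mul0r normr0 g00 mulr0.
have r0' : 0 < rho by rewrite lt_neqAle rp.
have [k0 _] := H rho (introT andP (conj r0 rd)).
have jr k r : 0 <= r <= rho -> sderiv `[0, rho]%classic (G k) r (G k.+1 r).
  by move=> /andP[h _]; apply: sderivS (jG k r h); exact: half_itv.
split.
  have [c /andP[c0 cr]] := sderiv_MVT r0' (jr 0%N).
  rewrite g00 !subr0 => ->; apply: mulr_ge0 => //.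
  by have [] := H c; rewrite // c0 (le_trans cr).
rewrite ger0_norm ?mulr_ge0//.
pose h r := r * G 1%N r - (C + 1) * G 0%N r.
have dh r : 0 <= r <= rho -> sderiv `[0, rho]%classic h r
    (1 * G 1%N r + r * G 2%N r - (C + 1) * G 1%N r).
  move=> hr; apply: sderivB; last exact: sderivZ (jr 0%N r hr).
  by apply: sderivM; [exact: sderiv_id | exact: jr].
have [c /andP[c0 cr]] := sderiv_MVT r0' dh.
rewrite /h g00 mul0r mulr0 !subr0 => E.
have [k0c kc] := H c (introT andP (conj c0 (le_trans cr rd))).
have := ler_norm (c * G 2%N c) => h2.
have : (1 * G 1%N c + c * G 2%N c - (C + 1) * G 1%N c) * rho <= 0.
  rewrite pmulr_lle0//; have := le_trans h2 kc; lra.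
rewrite -E subr_le0; exact.
Qed.

Variable f : R -> R.
Hypothesis Af : assumptionA f.
Let F k := iter k (@deriv0y R) f.

Let jF : jet F.
Proof. by move=> k rho r0; have [H _ _ _] := Af; exact: sderiv_within (H k rho r0). Qed.

Lemma deriv0y_sderiv rho : 0 <= rho -> sderiv halfline f rho (deriv0y f rho).
Proof. by move=> r0; exact: (@jF 0%N rho r0). Qed.

Lemma deriv0y2_sderiv rho : 0 <= rho ->
  sderiv halfline (deriv0y f) rho (deriv0y (deriv0y f) rho).
Proof. by move=> r0; exact: (@jF 1%N rho r0). Qed.

Let jet_bounded k (M : R) : exists2 B, 0 <= B & forall rho, 0 <= rho <= M -> `|F k rho| <= B.
Proof.
have [M0|M0] := leP 0 M; last first.
  by exists 0 => // rho /andP[h1 h2]; have := le_lt_trans (le_trans h1 h2) M0; rewrite ltxx.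
have cF : {within `[0, M], continuous F k}.
  apply: (@sderiv_continuous_itv _ 0 M (F k) (F k.+1)) => r /andP[r0 _].
  by apply: (sderivS _ (@jF k r r0)); exact: half_itv.
have [c1 _ H1] := EVT_max M0 cF; have [c2 _ H2] := EVT_min M0 cF.
exists (`|F k c1| + `|F k c2|); first by rewrite addr_ge0.
move=> rho rM; have rM' : rho \in `[0, M] by rewrite in_itv.
have := H1 _ rM'; have := H2 _ rM'.
have := ler_norm (F k c1); have := ler_norm (- F k c2); rewrite normrN.
have := normr_ge0 (F k c1); have := normr_ge0 (F k c2).
by rewrite ler_norml => *; apply/andP; split; lra.
Qed.

(** Near 0 the weighted bound is the finite-order lemma applied to f'; on the rest of [0, M],
    compactness bounds f' from below and f'' from above. *)
Lemma nonlinearity_bounds (M : R) : exists B C : R, [/\ 0 <= B, 0 <= C &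
  forall rho, 0 <= rho <= M -> [/\ 0 <= deriv0y f rho <= B,
    `|deriv0y (deriv0y f) rho| <= C & rho * `|deriv0y (deriv0y f) rho| <= C * deriv0y f rho]].
Proof.
have [B B0 HB] := jet_bounded 1 M.
have [B2 B20 HB2] := jet_bounded 2 M.
have [_ _ fpos [n n0 Fn]] := Af.
(* The jet starts at f', so orders are shifted by one with respect to [f]; the least one is taken
   below. *)
have ex : exists m, (fun m => F m.+1 0 != 0) m by exists n.-1; rewrite prednK.
have jF1 : jet (fun k => F k.+1) by move=> k rho; exact: jF.
have Fm0 j : (j < ex_minn ex)%N -> F j.+1 0 = 0.
  case: ex_minnP => m _ mmin jm; apply/eqP; apply: contraTT jm => Fj.
  by rewrite -leqNgt; exact: mmin.
(* The leading coefficient is positive: otherwise the finite-order lemma for - f' would make f'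
   nonpositive at the positive point [dl]. *)
have Fm : 0 < F (ex_minn ex).+1 0.
  have : F (ex_minn ex).+1 0 != 0 by case: ex_minnP.
  rewrite neq_lt => /orP[Fneg|//]; exfalso.
  have jN : jet (fun k r => - F k.+1 r).
    move=> k rho r0; have := sderivZ (-1) (@jF1 k rho r0); rewrite mulN1r.
    by apply: sderiv_ext => [x _|]; rewrite mulN1r.
  have [|| dl [C [dl0 _ H]]] := @jet_finite_order _ (ex_minn ex) jN.
  - by move=> j jm; rewrite Fm0// oppr0.
  - by rewrite oppr_gt0.
  have [] := H dl; first by rewrite lexx ltW.
  by rewrite oppr_ge0 leNgt fpos.
have [dl [C [dl0 C0 H]]] := jet_finite_order jF1 Fm0 Fm.
have [c c0 Hc] : exists2 c, 0 < c & forall rho, dl <= rho <= M -> c <= F 1%N rho.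
  have [Md|Md] := ltP M dl.
    by exists 1 => // rho /andP[h1 h2]; have := le_lt_trans (le_trans h1 h2) Md; rewrite ltxx.
  have cF : {within `[dl, M], continuous F 1%N}.
    apply: (@sderiv_continuous_itv _ dl M (F 1%N) (F 2%N)) => r /andP[r0 _].
    by apply: (sderivS _ (@jF 1%N r (le_trans (ltW dl0) r0))); apply: half_itv; exact: ltW.
  have [c cin Hc] := EVT_min Md cF.
  exists (F 1%N c); last by move=> rho rM; apply: Hc; rewrite in_itv.
  by apply: fpos; move: cin; rewrite in_itv/= => /andP[+ _]; exact: lt_le_trans.
(* [C] serves near 0, [B2] bounds f'' itself, and the last term serves away from 0, where f' is at
   least [c]. *)
exists B, (C + B2 + `|M| * B2 / c); split => //.
  by rewrite !addr_ge0// divr_ge0 ?mulr_ge0// ltW.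
move=> rho /andP[r0 rM].
have h1 := HB rho (introT andP (conj r0 rM)); have h2 := HB2 rho (introT andP (conj r0 rM)).
have X0 : 0 <= `|M| * B2 / c by rewrite divr_ge0 ?mulr_ge0// ltW.
have f0 : 0 <= F 1%N rho.
  by have [rd|/ltW rd] := leP rho dl; [have [] := H rho; rewrite ?r0 | apply: ltW; apply: fpos; exact: lt_le_trans rd].
split.
- by apply/andP; split => //; exact: le_trans (ler_norm _) h1.
- by apply: (le_trans h2); rewrite -addrA addrCA lerDl addr_ge0.
have [rd|/ltW rd] := leP rho dl.
  have [_] := H rho (introT andP (conj r0 rd)); rewrite normrM ger0_norm// => h3.
  by apply: (le_trans h3); rewrite ler_wpM2r// -addrA lerDl addr_ge0.
have cF := Hc rho (introT andP (conj rd rM)).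
apply: (@le_trans _ _ (`|M| * B2)).
  by apply: ler_pM => //; apply: (le_trans rM); exact: ler_norm.
apply: (@le_trans _ _ ((`|M| * B2 / c) * F 1%N rho)).
  by rewrite -mulrA ler_peMr ?mulr_ge0// mulrC ler_pdivlMr// mul1r.
by rewrite ler_wpM2r// lerDr addr_ge0.
Qed.

End nonlinearity_bounds.

(** * Quadratic forms transported by a flow *)

Section transported_form.
Context (R : realType) (d : nat).
Local Notation X := 'rV[R]_d.
Local Notation dx := (leb R d).
Local Notation e_ i := (delta_mx ord0 i : X).
Implicit Types (chi : X -> R) (i j : 'I_d) (s : R).

Variables (T t0 dl : R).
(** A relative neighbourhood of [t0] in the time interval; its convexity is what the mean value
    theorem in time uses. *)
Definition near_time : set R := [set s | s \in `[0, T] /\ `|s - t0| < dl].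
Local Notation N := near_time.
Hypotheses (t0T : t0 \in `[0, T]) (dl0 : 0 < dl).

Variables (m mt : R -> X -> R) (mi : 'I_d -> R -> X -> R) (Bm : R).
Hypotheses (m_meas : forall s, N s -> measurable_fun setT (m s))
  (m_bd : forall s x, N s -> `|m s x| <= Bm)
  (mt_meas : forall s, N s -> measurable_fun setT (mt s))
  (m_t : forall s x, N s -> sderiv N (m^~ x) s (mt s x))
  (mt_loc : forall r, exists B, forall s x, N s -> cube r x -> `|mt s x| <= B)
  (m_i : forall i s, N s -> diff_along i (m s) (mi i s))
  (mi_loc : forall i s r, N s -> exists B, forall x, cube r x -> `|mi i s x| <= B).

Variables (u du : 'I_d -> R -> X -> R) (Cu Bd : R).
Hypotheses (u_meas : forall i s, N s -> measurable_fun setT (u i s))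
  (u_bd : forall i s x, N s -> `|u i s x| <= Cu * (1 + n1 x))
  (u_i : forall i s, N s -> diff_along i (u i s) (du i s))
  (du_bd : forall i s x, N s -> `|du i s x| <= Bd)
  (u_cv : forall i (s : nat -> R) x, (forall n, N (s n)) -> s @ \oo --> t0 ->
     (fun n => u i (s n) x) @ \oo --> u i t0 x)
  (du_cv : forall i (s : nat -> R) x, (forall n, N (s n)) -> s @ \oo --> t0 ->
     (fun n => du i (s n) x) @ \oo --> du i t0 x).

Definition mat_deriv s x := mt s x + \sum_i u i s x * mi i s x.
Definition divu s x := \sum_i du i s x.

Variable BD : R.
Hypotheses (D_bd : forall s x, N s -> `|mat_deriv s x| <= BD)
  (D_cv : forall (s : nat -> R) x, (forall n, N (s n)) -> s @ \oo --> t0 ->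
     (fun n => mat_deriv (s n) x) @ \oo --> mat_deriv t0 x).

(* The separate time and space derivatives of [m] may be unbounded: only [mat_deriv] is bounded,
   and products with the unbounded [u i] are controlled through [\sum_i u i s * gi i s]. *)
Record transported (g g' : R -> X -> R) (gi : 'I_d -> R -> X -> R) (Bv : R) : Prop := {
  tr_path : path_diff T g g';
  tr_cont' : forall s : nat -> R, (forall n, N (s n)) -> s @ \oo --> t0 ->
     cvL2 dx (fun n => g' (s n)) (g' t0);
  tr_partial : forall i s, N s -> is_weak_partial i (g s) (gi i s);
  tr_partial_cont : forall i (s : nat -> R), (forall n, N (s n)) -> s @ \oo --> t0 ->
     cvL2 dx (fun n => gi i (s n)) (gi i t0);
  tr_partial_L2 : forall i s, N s -> L2 dx (gi i s);
  tr_adv_L2 : forall s, N s -> L2 dx (fun x => \sum_i u i s x * gi i s x);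
  tr_adv_bd : forall s, N s -> nrm dx (fun x => \sum_i u i s x * gi i s x) <= Bv }.

Variables (g g' h h' : R -> X -> R) (gi hi : 'I_d -> R -> X -> R) (Bg Bh : R).
Hypotheses (gP : transported g g' gi Bg) (hP : transported h h' hi Bh).

Let adv (gi : 'I_d -> R -> X -> R) s x := \sum_i u i s x * gi i s x.

Let NT s : N s -> s \in `[0, T]. Proof. by case. Qed.
Let Nt0 : N t0. Proof. by split => //; rewrite subrr normr0. Qed.

Let N_convex a b c : N a -> N b -> Num.min a b <= c <= Num.max a b -> N c.
Proof.
rewrite /near_time/= !in_itv/= !ltr_norml => -[/andP[a1 a2] /andP[a3 a4]] [/andP[b1 b2] /andP[b3 b4]].
rewrite ge_min le_max => /andP[/orP[c1|c1] /orP[c2|c2]];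
  by split; apply/andP; split; lra.
Qed.

Let Lg s : N s -> L2 dx (g s). Proof. by move=> /NT sT; have [] := tr_path gP sT. Qed.
Let Lh s : N s -> L2 dx (h s). Proof. by move=> /NT sT; have [] := tr_path hP sT. Qed.
Let Lg' s : N s -> L2 dx (g' s). Proof. by move=> /NT sT; have [] := tr_path gP sT. Qed.
Let Lh' s : N s -> L2 dx (h' s). Proof. by move=> /NT sT; have [] := tr_path hP sT. Qed.
Let Bm0 : 0 <= Bm. Proof. exact: le_trans (m_bd 0 Nt0). Qed.

Definition cut_form chi s := \int[dx]_x (chi x * m s x * g s x * h s x).

Section cut_derivative.
Variables (chi : X -> R) (B r : R).
Hypotheses (mchi : measurable_fun setT chi) (chiB : forall x, `|chi x| <= B)
  (chi0 : forall x, ~ cube r x -> chi x = 0).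

Let B0 : 0 <= B. Proof. exact: le_trans (chiB 0). Qed.

Let chim_bd s x : N s -> `|chi x * m s x| <= B * Bm.
Proof. by move=> Ns; rewrite normrM ler_pM// m_bd. Qed.

Let chim_meas s : N s -> measurable_fun setT (fun x => chi x * m s x).
Proof. by move=> Ns; apply: measurable_funM => //; exact: m_meas. Qed.

(** The time derivative of [m] is bounded on cubes only, so dominating its difference quotients
    relies on the support of [chi]. *)
Lemma cut_form_deriv s : N s -> sderiv N (cut_form chi) s
  (\int[dx]_x (chi x * mt s x * g s x * h s x) +
   \int[dx]_x (chi x * m s x * g' s x * h s x) +
   \int[dx]_x (chi x * m s x * g s x * h' s x)).
Proof.
move=> Ns sg Nsg sgs csg.
have sgT n := NT (Nsg n).
have cg := path_diff_cont (tr_path gP) (NT Ns) sgT csg.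
have ch := path_diff_cont (tr_path hP) (NT Ns) sgT csg.
have [_ _ /(_ sg sgT sgs csg) qg] := tr_path gP (NT Ns).
have [_ _ /(_ sg sgT sgs csg) qh] := tr_path hP (NT Ns).
have [Bt mtB] := mt_loc r.
have c_m x : (fun n => chi x * m (sg n) x) @ \oo --> chi x * m s x.
  by apply: scvgZ; apply: (@sderiv_cont R N (m^~ x) s (mt s x) sg) => //; exact: m_t.
have q_bd n x : `|chi x * ((m (sg n) x - m s x) / (sg n - s))| <= B * `|Bt|.
  have [xr|nx] := pselect (cube r x); last by rewrite chi0// mul0r normr0 mulr_ge0.
  rewrite normrM ler_pM// normrM normfV ler_pdivrMr; last by rewrite normr_gt0 subr_eq0.
  apply: (@sderiv_le _ N (m^~ x) (mt^~ x)) => c cc.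
  - exact: N_convex cc.
  - by apply: m_t; exact: N_convex cc.
  - by apply: le_trans (ler_norm _); apply: mtB => //; exact: N_convex cc.
have c1 := cvL2_I3 (fun n => chim_meas (Nsg n)) (fun n x => chim_bd x (Nsg n)) c_m qg ch.
have c2 := cvL2_I3 (fun n => chim_meas (Nsg n)) (fun n x => chim_bd x (Nsg n)) c_m (cvL2_cst (Lg Ns)) qh.
have mq n : measurable_fun setT (fun x => chi x * ((m (sg n) x - m s x) / (sg n - s))).
  by apply: measurable_funM => //; apply: measurable_funM => //; apply: measurable_funB; exact: m_meas.
have c3 := cvL2_I3 mq q_bd (fun x => scvgZ (chi x) (@m_t s x Ns sg Nsg sgs csg))
  (cvL2_cst (Lg Ns)) (cvL2_cst (Lh Ns)).
have := scvgD (scvgD c3 c1) c2; apply: cvg_eq => // n.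
have Nn := Nsg n.
have Lqg := cvL2_L2 n qg; have Lqh := cvL2_L2 n qh.
have A1 := L1_bMM (mq n) (q_bd n) (Lg Ns) (Lh Ns).
have A2 := L1_bMM (chim_meas Nn) (fun x => chim_bd x Nn) Lqg (Lh Nn).
have A3 := L1_bMM (chim_meas Nn) (fun x => chim_bd x Nn) (Lg Ns) Lqh.
rewrite -RintD// -RintD//; last exact: L1D.
have A4 := L1_bMM (chim_meas Nn) (fun x => chim_bd x Nn) (Lg Nn) (Lh Nn).
have A5 := L1_bMM (chim_meas Ns) (fun x => chim_bd x Ns) (Lg Ns) (Lh Ns).
rewrite /cut_form -RintB// [RHS]mulrC -RintZ; last exact: L1B.
apply: eq_Rintegral => x _; field.
by rewrite subr_eq0.
Qed.

Variables (dchi : 'I_d -> X -> R) (Bc : R).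
Hypotheses (chi_i : forall i, diff_along i chi (dchi i))
  (dchi0 : forall i x, ~ cube r x -> dchi i x = 0)
  (dchiB : forall i x, `|dchi i x| * (1 + n1 x) <= Bc).

Let n1p (x : X) : 0 < 1 + n1 x. Proof. by rewrite ltr_wpDr// n1_ge0. Qed.

Let chiu_bd i s x : N s -> `|chi x * u i s x| <= B * (`|Cu| * (1 + d%:R * `|r|)).
Proof.
move=> Ns; have [xr|nx] := pselect (cube r x); last first.
  by rewrite chi0// mul0r normr0 !mulr_ge0// addr_ge0// mulr_ge0.
rewrite normrM ler_pM//; apply: (le_trans (u_bd i x Ns)).
apply: (@le_trans _ _ (`|Cu| * (1 + n1 x))).
  by rewrite ler_wpM2r ?ler_norm// ltW.
rewrite ler_wpM2l// lerD2l; apply: (le_trans (n1_cube xr)).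
by rewrite ler_wpM2l// ler_norm.
Qed.

Let dchiu_bd i s x : N s -> `|dchi i x * u i s x| <= `|Cu| * Bc.
Proof.
move=> Ns; rewrite normrM; apply: (@le_trans _ _ (`|dchi i x| * (`|Cu| * (1 + n1 x)))).
  rewrite ler_wpM2l//; apply: (le_trans (u_bd i x Ns)).
  by rewrite ler_wpM2r ?ler_norm// ltW.
by rewrite mulrCA ler_wpM2l.
Qed.

Let dchi_meas i : measurable_fun setT (dchi i).
Proof. exact: (@diff_along_meas _ _ i chi _ mchi (@chi_i i)). Qed.

Let mi_meas i s : N s -> measurable_fun setT (mi i s).
Proof. by move=> Ns; exact: (@diff_along_meas _ _ i _ _ (m_meas Ns) (@m_i i s Ns)). Qed.

Let du_meas i s : N s -> measurable_fun setT (du i s).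
Proof. by move=> Ns; exact: (@diff_along_meas _ _ i _ _ (u_meas i Ns) (@u_i i s Ns)). Qed.

(** The time derivative of [m] is [mat_deriv] minus u . grad m, and integrating the latter by parts
    removes the uncontrolled derivatives of [m]. The price is u . grad on [g] and on [h], a
    divergence term, and a term with the gradient of [chi]. *)
Lemma cut_form_advect s : N s ->
  \int[dx]_x (chi x * mt s x * g s x * h s x) =
  \int[dx]_x (chi x * mat_deriv s x * g s x * h s x) +
  \int[dx]_x (chi x * m s x * adv gi s x * h s x) +
  \int[dx]_x (chi x * m s x * g s x * adv hi s x) +
  \int[dx]_x (chi x * divu s x * m s x * g s x * h s x) +
  \int[dx]_x ((\sum_i dchi i x * u i s x) * m s x * g s x * h s x).
Proof.
move=> Ns.
pose b i x := chi x * u i s x * m s x.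
pose db i x := dchi i x * u i s x * m s x + chi x * du i s x * m s x + chi x * u i s x * mi i s x.
have mb i : measurable_fun setT (b i).
  by apply: measurable_funM; [apply: measurable_funM => //; exact: u_meas|exact: m_meas].
have b_bd i x : `|b i x| <= B * (`|Cu| * (1 + d%:R * `|r|)) * Bm.
  by rewrite normrM; apply: ler_pM => //; [exact: chiu_bd | exact: m_bd].
have b_i i : diff_along i (b i) (db i).
  move=> x rr; have := sderivM (sderivM (@chi_i i x rr) (@u_i i s Ns x rr)) (@m_i i s Ns x rr).
  by congr sderiv; rewrite /db; ring.
have mi_bd i : exists C, forall x, `|chi x * u i s x * mi i s x| <= C.
  have [C miC] := mi_loc i r Ns.
  exists (B * (`|Cu| * (1 + d%:R * `|r|)) * `|C|) => x.
  have X0 : 0 <= B * (`|Cu| * (1 + d%:R * `|r|)) by rewrite !mulr_ge0// addr_ge0// mulr_ge0.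
  have [xr|nx] := pselect (cube r x); last first.
    by rewrite chi0// !mul0r normr0 mulr_ge0.
  rewrite normrM; apply: ler_pM => //; first exact: chiu_bd.
  by apply: (le_trans (miC x xr)); exact: ler_norm.
have mui i : measurable_fun setT (fun x => chi x * u i s x * mi i s x).
  by apply: measurable_funM; [apply: measurable_funM => //; exact: u_meas|exact: mi_meas].
have mdu i : measurable_fun setT (fun x => chi x * du i s x * m s x).
  by apply: measurable_funM; [apply: measurable_funM => //; exact: du_meas|exact: m_meas].
have du_bd' i x : `|chi x * du i s x * m s x| <= B * Bd * Bm.
  rewrite normrM; apply: ler_pM => //; last exact: m_bd.
  by rewrite normrM; apply: ler_pM => //; exact: du_bd.
have mdc i : measurable_fun setT (fun x => dchi i x * u i s x * m s x).
  by apply: measurable_funM; [apply: measurable_funM => //; exact: u_meas|exact: m_meas].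
have dc_bd i x : `|dchi i x * u i s x * m s x| <= `|Cu| * Bc * Bm.
  by rewrite normrM; apply: ler_pM => //; [exact: dchiu_bd | exact: m_bd].
have Lgi i : L2 dx (gi i s) by exact: tr_partial_L2 gP i s Ns.
have Lhi i : L2 dx (hi i s) by exact: tr_partial_L2 hP i s Ns.
(* Integration by parts with coefficient chi u_i m, solved for the term in which the derivative
   falls on [m]. *)
have ibp i : \int[dx]_x (chi x * u i s x * mi i s x * g s x * h s x) =
   - (\int[dx]_x (b i x * g s x * hi i s x) + \int[dx]_x (b i x * gi i s x * h s x) +
      \int[dx]_x (dchi i x * u i s x * m s x * g s x * h s x) +
      \int[dx]_x (chi x * du i s x * m s x * g s x * h s x)).
  have [C miC] := mi_bd i.
  have dbC x : `|db i x| <= `|Cu| * Bc * Bm + B * Bd * Bm + C.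
    by rewrite (le_trans (ler_normD _ _))// lerD// (le_trans (ler_normD _ _))// lerD.
  have := integration_by_parts (Lg Ns) (Lh Ns) (Lgi i) (Lhi i) (tr_partial gP i Ns) (tr_partial hP i Ns)
    (mb i) (b_bd i) (b_i i) dbC.
  have -> : \int[dx]_x (db i x * g s x * h s x) =
      \int[dx]_x (dchi i x * u i s x * m s x * g s x * h s x) +
      \int[dx]_x (chi x * du i s x * m s x * g s x * h s x) +
      \int[dx]_x (chi x * u i s x * mi i s x * g s x * h s x).
    have A1 := L1_bMM (mdc i) (dc_bd i) (Lg Ns) (Lh Ns).
    have A2 := L1_bMM (mdu i) (du_bd' i) (Lg Ns) (Lh Ns).
    have A3 := L1_bMM (mui i) miC (Lg Ns) (Lh Ns).
    rewrite -RintD// -RintD//; last exact: L1D.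
    by apply: eq_Rintegral => x _; rewrite /db; ring.
  by move=> E; apply/eqP; rewrite -addr_eq0; apply/eqP; rewrite -[RHS]E; ring.
have mD : measurable_fun setT (mat_deriv s).
  apply: measurable_funD; first exact: mt_meas.
  by apply: measurable_sum => i; apply: measurable_funM; [exact: u_meas|exact: mi_meas].
have LD : L1 dx (fun x => chi x * mat_deriv s x * g s x * h s x).
  apply: (@L1_bMM _ _ _ dx (B * BD) (fun x => chi x * mat_deriv s x)) => //; [|move=> x|exact: Lg|exact: Lh].
    exact: measurable_funM.
  by rewrite normrM; apply: ler_pM => //; exact: D_bd.
have Li i : L1 dx (fun x => chi x * u i s x * mi i s x * g s x * h s x).
  by have [C miC] := mi_bd i; exact: L1_bMM (mui i) miC (Lg Ns) (Lh Ns).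
have -> : \int[dx]_x (chi x * mt s x * g s x * h s x) =
    \int[dx]_x (chi x * mat_deriv s x * g s x * h s x) -
    \sum_i \int[dx]_x (chi x * u i s x * mi i s x * g s x * h s x).
  rewrite -Rint_sum// -RintB//; last exact: L1_sum.
  apply: eq_Rintegral => x _; rewrite /mat_deriv mulrDr !mulrDl mulr_sumr !mulr_suml.
  rewrite -addrA [X in _ + X](_ : _ = 0) ?addr0//.
  by rewrite -sumrB big1// => i _; ring.
have E1 : \int[dx]_x (chi x * m s x * adv gi s x * h s x) = \sum_i \int[dx]_x (b i x * gi i s x * h s x).
  rewrite -Rint_sum; last by move=> i _; exact: L1_bMM (mb i) (b_bd i) (Lgi i) (Lh Ns).
  apply: eq_Rintegral => x _; rewrite mulr_sumr mulr_suml.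
  by apply: eq_bigr => i _; rewrite /b; ring.
have E2 : \int[dx]_x (chi x * m s x * g s x * adv hi s x) = \sum_i \int[dx]_x (b i x * g s x * hi i s x).
  rewrite -Rint_sum; last by move=> i _; exact: L1_bMM (mb i) (b_bd i) (Lg Ns) (Lhi i).
  apply: eq_Rintegral => x _; rewrite mulr_sumr.
  by apply: eq_bigr => i _; rewrite /b; ring.
have E3 : \int[dx]_x (chi x * divu s x * m s x * g s x * h s x) =
    \sum_i \int[dx]_x (chi x * du i s x * m s x * g s x * h s x).
  rewrite -Rint_sum; last by move=> i _; exact: L1_bMM (mdu i) (du_bd' i) (Lg Ns) (Lh Ns).
  by apply: eq_Rintegral => x _; rewrite /divu mulr_sumr !mulr_suml.
have E4 : \int[dx]_x ((\sum_i dchi i x * u i s x) * m s x * g s x * h s x) =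
    \sum_i \int[dx]_x (dchi i x * u i s x * m s x * g s x * h s x).
  rewrite -Rint_sum; last by move=> i _; exact: L1_bMM (mdc i) (dc_bd i) (Lg Ns) (Lh Ns).
  by apply: eq_Rintegral => x _; rewrite !mulr_suml.
under eq_bigr do rewrite ibp.
by rewrite sumrN opprK !big_split/= E1 E2 E3 E4; ring.
Qed.

End cut_derivative.

(** Only the norm of the whole sum is bounded, so the convergence obtained is weak. Against a test
    function the velocity is cut to a cube, where it is bounded, and the strong convergence of each
    [ki] gives the limit. *)
Lemma adv_wcv k (k' : R -> X -> R) ki Bk (tau : nat -> R) : transported k k' ki Bk ->
  (forall n, N (tau n)) -> tau @ \oo --> t0 ->
  wcvL2 dx (fun n => adv ki (tau n)) (adv ki t0).
Proof.
move=> kP Nt ct; apply: (@wcvL2_test _ _ _ _ Bk).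
- by move=> n; exact: tr_adv_L2 kP _ (Nt n).
- exact: tr_adv_L2 kP _ Nt0.
- by move=> n; exact: tr_adv_bd kP _ (Nt n).
move=> phi tphi; have [_ [K cK K0]] := tphi; have [r r0 Kr] := compact_sub_cube cK.
have Lphi := test_L2 tphi.
pose b i s (x : X) := \1_(cube r) x * u i s x.
have mb i s : N s -> measurable_fun setT (b i s).
  move=> Ns; apply: measurable_funM; last exact: u_meas.
  by apply: measurable_indic; exact: measurable_cube.
have b_bd i s x : N s -> `|b i s x| <= `|Cu| * (1 + d%:R * r).
  move=> Ns; rewrite /b indicE; have [xr|nx] := pselect (cube r x); last first.
    by rewrite memNset// mul0r normr0 mulr_ge0// addr_ge0// mulr_ge0// ltW.
  rewrite mem_set// mul1r; apply: (le_trans (u_bd i x Ns)).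
  apply: (@le_trans _ _ (`|Cu| * (1 + n1 x))).
    by rewrite ler_wpM2r ?ler_norm// addr_ge0// n1_ge0.
  by rewrite ler_wpM2l// lerD2l; exact: n1_cube.
have E s : N s -> \int[dx]_x (adv ki s x * phi x) = \sum_i \int[dx]_x (b i s x * phi x * ki i s x).
  move=> Ns; rewrite -Rint_sum.
    apply: eq_Rintegral => x _; rewrite mulr_suml; apply: eq_bigr => i _.
    rewrite /b indicE; have [xr|nx] := pselect (cube r x).
      by rewrite mem_set// mul1r; ring.
    by rewrite (K0 x) ?mulr0 ?mul0r// => /Kr.
  move=> i _; apply: L1_bMM (mb i s Ns) (fun x => b_bd i s x Ns) Lphi _.
  exact: tr_partial_L2 kP i s Ns.
rewrite E//; apply: (cvg_eq (u := fun n => \sum_i \int[dx]_x (b i (tau n) x * phi x * ki i (tau n) x))) => //.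
  by move=> n; rewrite E.
apply: scvg_sum => i _.
apply: (cvL2_I3 (fun n => mb i _ (Nt n)) (fun n x => b_bd i _ x (Nt n)) _ (cvL2_cst Lphi)).
  by move=> x; apply: scvgZ; exact: u_cv.
exact: tr_partial_cont kP i tau Nt ct.
Qed.

Definition full_form s := \int[dx]_x (m s x * g s x * h s x).

(** Reynolds' transport formula: the material derivatives of the three factors plus the divergence
    term. *)
Definition full_form_deriv :=
  \int[dx]_x (mat_deriv t0 x * g t0 x * h t0 x) +
  \int[dx]_x (m t0 x * adv gi t0 x * h t0 x) +
  \int[dx]_x (m t0 x * g t0 x * adv hi t0 x) +
  \int[dx]_x (divu t0 x * m t0 x * g t0 x * h t0 x) +
  \int[dx]_x (m t0 x * g' t0 x * h t0 x) +
  \int[dx]_x (m t0 x * g t0 x * h' t0 x).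

Let m_cv (tau : nat -> R) x : (forall n, N (tau n)) -> tau @ \oo --> t0 ->
  (fun n => m (tau n) x) @ \oo --> m t0 x.
Proof. by move=> Nt ct; apply: (@sderiv_cont R N (m^~ x) t0 (mt t0 x) tau) => //; exact: m_t. Qed.

Let mat_deriv_meas s : N s -> measurable_fun setT (mat_deriv s).
Proof.
move=> Ns; apply: measurable_funD; first exact: mt_meas.
apply: measurable_sum => i; apply: measurable_funM; first exact: u_meas.
exact: (@diff_along_meas _ _ i _ _ (m_meas Ns) (@m_i i s Ns)).
Qed.

Let divu_meas s : N s -> measurable_fun setT (divu s).
Proof.
move=> Ns; apply: measurable_sum => i.
exact: (@diff_along_meas _ _ i _ _ (u_meas i Ns) (@u_i i s Ns)).
Qed.

Let divu_bd s x : N s -> `|divu s x| <= d%:R * Bd.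
Proof.
move=> Ns; apply: (le_trans (ler_norm_sum _ _ _)).
rewrite -[d in d%:R]card_ord mulr_natl -sumr_const.
by apply: ler_sum => i _; exact: du_bd.
Qed.

(* The mean value theorem in time applies to a cut-off form, whose cut-off index is tied to the
   time step; the weakly convergent terms [adv] are paired with strongly convergent factors. *)
Lemma full_form_sderiv : sderiv `[0, T]%classic full_form t0 full_form_deriv.
Proof.
have [chi [dchi [B [B0 tchi chiB chi1 [chi_i cdchi out dB dchi_cv]]]]] := @cutoffs_exist R d.
have mchi k : measurable_fun setT (chi k).
  by apply: continuous_measurable_rV; exact: test_function_cont.
have cut_cv s : N s -> (fun k => cut_form (chi k) s) @ \oo --> full_form s.
  move=> Ns; apply: (@cvL2_I3 _ _ _ dx (fun k x => chi k x * m s x) (m s) _ _ _ _ (B * Bm)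
     _ _ _ (cvL2_cst (Lg Ns)) (cvL2_cst (Lh Ns))).
  - by move=> k; apply: measurable_funM => //; exact: m_meas.
  - by move=> k x; rewrite normrM ler_pM// m_bd.
  - move=> x; apply: cvg_eq (scvgM (chi1 x) (@cvg_cst _ (m s x) _ \oo _)) => //.
    by rewrite mul1r.
have core (s : nat -> R) : (forall n, N (s n)) -> (forall n, s n != t0) -> s @ \oo --> t0 ->
    (fun n => (full_form (s n) - full_form t0) / (s n - t0)) @ \oo --> full_form_deriv.
  move=> Ns st cs.
  (* The cut-off index grows with [n] and is so large that the cut-off error remains negligible
     after division by s n - t0. *)
  have /choice[k kP] : forall n, exists k, (n <= k)%N /\
      `|cut_form (chi k) (s n) - full_form (s n)| + `|cut_form (chi k) t0 - full_form t0|
       <= `|s n - t0| * n.+1%:R^-1.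
    move=> n.
    have e0 : 0 < `|s n - t0| * n.+1%:R^-1 / 2.
      by rewrite divr_gt0// mulr_gt0 ?invr_gt0// normr_gt0 subr_eq0.
    have /cvgrPdist_le/(_ _ e0)[K1 _ H1] := cut_cv _ (Ns n).
    have /cvgrPdist_le/(_ _ e0)[K2 _ H2] := cut_cv _ Nt0.
    exists (maxn n (maxn K1 K2)); split; first exact: leq_maxl.
    rewrite (splitr (_ * _)); apply: lerD; rewrite distrC.
      by apply: H1; rewrite /= (leq_trans _ (leq_maxr _ _))// leq_maxl.
    by apply: H2; rewrite /= (leq_trans _ (leq_maxr _ _))// leq_maxr.
  have ck : k @ \oo --> \oo.
    move=> P [K _ KP]; exists K => // n /= Kn; apply: KP => /=.
    by have [nk _] := kP n; exact: leq_trans nk.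
  pose Dc n tau := \int[dx]_x (chi (k n) x * mt tau x * g tau x * h tau x) +
    \int[dx]_x (chi (k n) x * m tau x * g' tau x * h tau x) +
    \int[dx]_x (chi (k n) x * m tau x * g tau x * h' tau x).
  have out1 n : exists r, forall x, ~ cube r x -> chi (k n) x = 0.
    by have [r H] := out (k n); exists r => x /H[].
  (* The intermediate time depends on both the time step and the cut-off, but it is squeezed to [t0]
     with [s n]. *)
  have /choice[tau tauP] : forall n, exists tau, Num.min t0 (s n) <= tau <= Num.max t0 (s n) /\
      cut_form (chi (k n)) (s n) - cut_form (chi (k n)) t0 = Dc n tau * (s n - t0).
    move=> n; have [r chi0] := out1 n.
    have [|c cc E] := @sderiv_MVT_unordered R N (cut_form (chi (k n))) (Dc n) t0 (s n)
      (fun c cc => N_convex Nt0 (Ns n) cc).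
      move=> c cc; apply: (cut_form_deriv (mchi (k n)) (chiB (k n)) chi0).
      exact: N_convex cc.
    by exists c.
  have Nt n : N (tau n) by have [cc _] := tauP n; exact: N_convex cc.
  have ct : tau @ \oo --> t0.
    apply: cvg_sub0; apply: (@squeeze0 _ _ (fun n => `|s n - t0|)); last first.
      by apply: cvg_eq (scvg_norm (cvg_subr0 cs)) => //; rewrite normr0.
    move=> n; have [/andP[+ +] _] := tauP n; rewrite ge_min le_max.
    have := ler_norm (s n - t0); have := ler_norm (- (s n - t0)); rewrite normrN.
    have := normr_ge0 (s n - t0).
    move=> h1 h2 h3 /orP[c1|c1] /orP[c2|c2]; rewrite ler_norml; apply/andP; split; lra.
  have tauT n := NT (Nt n).
  have cg := path_diff_cont (tr_path gP) t0T tauT ct.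
  have ch := path_diff_cont (tr_path hP) t0T tauT ct.
  have cg' := tr_cont' gP Nt ct; have ch' := tr_cont' hP Nt ct.
  have wg := adv_wcv gP Nt ct; have wh := adv_wcv hP Nt ct.
  have chk x : (fun n => chi (k n) x) @ \oo --> (1 : R).
    have := @cvg_comp _ _ _ k (fun q : nat => chi q x) _ _ _ ck (chi1 x).
    by apply: cvg_eq.
  have mcm n : measurable_fun setT (fun x => chi (k n) x * m (tau n) x).
    by apply: measurable_funM => //; exact: m_meas.
  have bcm n x : `|chi (k n) x * m (tau n) x| <= B * Bm by rewrite normrM ler_pM// m_bd.
  have ccm x : (fun n => chi (k n) x * m (tau n) x) @ \oo --> m t0 x.
    by have := scvgM (chk x) (@m_cv tau x Nt ct); apply: cvg_eq => //; rewrite mul1r.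
  have t1 : (fun n => \int[dx]_x (chi (k n) x * mat_deriv (tau n) x * g (tau n) x * h (tau n) x))
      @ \oo --> \int[dx]_x (mat_deriv t0 x * g t0 x * h t0 x).
    apply: (@cvL2_I3 _ _ _ dx (fun n x => chi (k n) x * mat_deriv (tau n) x) (mat_deriv t0)
      _ _ _ _ (B * BD) _ _ _ cg ch).
    - by move=> n; apply: measurable_funM => //; exact: mat_deriv_meas.
    - by move=> n x; rewrite normrM ler_pM// D_bd.
    - by move=> x; have := scvgM (chk x) (@D_cv tau x Nt ct); apply: cvg_eq => //; rewrite mul1r.
  have t2 := cvL2_I3 mcm bcm ccm cg' ch.
  have t3 := cvL2_I3 mcm bcm ccm cg ch'.
  have t4 : (fun n => \int[dx]_x (chi (k n) x * m (tau n) x * adv gi (tau n) x * h (tau n) x))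
      @ \oo --> \int[dx]_x (m t0 x * adv gi t0 x * h t0 x).
    apply: cvg_eq (wcvL2_I wg (cvL2_bM mcm bcm ccm ch)) => [n|];
      by apply: eq_Rintegral => x _; ring.
  have t5 : (fun n => \int[dx]_x (chi (k n) x * m (tau n) x * g (tau n) x * adv hi (tau n) x))
      @ \oo --> \int[dx]_x (m t0 x * g t0 x * adv hi t0 x).
    apply: cvg_eq (wcvL2_I wh (cvL2_bM mcm bcm ccm cg)) => [n|];
      by apply: eq_Rintegral => x _; ring.
  have t6 : (fun n => \int[dx]_x (chi (k n) x * divu (tau n) x * m (tau n) x * g (tau n) x * h (tau n) x))
      @ \oo --> \int[dx]_x (divu t0 x * m t0 x * g t0 x * h t0 x).
    apply: (@cvL2_I3 _ _ _ dx (fun n x => chi (k n) x * divu (tau n) x * m (tau n) x)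
      (fun x => divu t0 x * m t0 x) _ _ _ _ (B * (d%:R * Bd) * Bm) _ _ _ cg ch).
    - by move=> n; apply: measurable_funM; [apply: measurable_funM => //; exact: divu_meas|exact: m_meas].
    - move=> n x; rewrite normrM; apply: ler_pM => //; last exact: m_bd.
      by rewrite normrM; apply: ler_pM => //; exact: divu_bd.
    - move=> x; apply: scvgM; last exact: m_cv.
      have cd : (fun n => divu (tau n) x) @ \oo --> divu t0 x.
        by apply: scvg_sum => i _; exact: du_cv.
      by have := scvgM (chk x) cd; apply: cvg_eq => //; rewrite mul1r.
  (* The term from the cut-off gradient: dchi times u is bounded uniformly by the decay of dchi, and
     tends to 0 pointwise. *)
  have t7 : (fun n => \int[dx]_x ((\sum_i dchi (k n) i x * u i (tau n) x) * m (tau n) x * g (tau n) x * h (tau n) x))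
      @ \oo --> (0 : R).
    have E0 : \int[dx]_x ((0 : R) * g t0 x * h t0 x) = 0.
      by rewrite -[RHS](Rint0 dx); apply: eq_Rintegral => x _; rewrite !mul0r.
    have ub i n x : `|dchi (k n) i x * u i (tau n) x| <= `|Cu| * B.
      rewrite normrM; apply: (@le_trans _ _ (`|dchi (k n) i x| * (`|Cu| * (1 + n1 x)))).
        rewrite ler_wpM2l//; apply: (le_trans (u_bd i x (Nt n))).
        by rewrite ler_wpM2r ?ler_norm// addr_ge0// n1_ge0.
      by rewrite mulrCA ler_wpM2l.
    refine (cvg_eq (fun _ => erefl) E0 _).
    apply: (@cvL2_I3 _ _ _ dx (fun n x => (\sum_i dchi (k n) i x * u i (tau n) x) * m (tau n) x)
      (fun=> 0) _ _ _ _ (d%:R * (`|Cu| * B) * Bm) _ _ _ cg ch).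
    - move=> n; apply: measurable_funM; last exact: m_meas.
      apply: measurable_sum => i; apply: measurable_funM; last exact: u_meas.
      exact: (continuous_measurable_rV (@cdchi (k n) i)).
    - move=> n x; rewrite normrM; apply: ler_pM => //; last exact: m_bd.
      apply: (le_trans (ler_norm_sum _ _ _)).
      rewrite -[d in d%:R]card_ord mulr_natl -sumr_const.
      by apply: ler_sum => i _; exact: ub.
    - move=> x.
      have dc i : (fun n => dchi (k n) i x * u i (tau n) x) @ \oo --> 0 * u i t0 x.
        apply: scvgM; last exact: u_cv.
        have := @cvg_comp _ _ _ k (fun q : nat => dchi q i x) _ _ _ ck (dchi_cv i x).
        by apply: cvg_eq.
      have ds := @scvg_sum _ _ (index_enum _) xpredT _ _ (fun i _ => dc i).
      have := scvgM ds (@m_cv tau x Nt ct).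
      by apply: cvg_eq => //; rewrite big1 ?mul0r// => i _; rewrite mul0r.
  have Dc_cv : (fun n => Dc n (tau n)) @ \oo --> full_form_deriv.
    have := scvgD (scvgD (scvgD (scvgD (scvgD (scvgD t1 t4) t5) t6) t7) t2) t3.
    apply: cvg_eq => [n|]; last by rewrite /full_form_deriv addr0.
    rewrite /Dc; congr (_ + _ + _); apply/esym.
    have [r chi0] := out (k n).
    apply: (cut_form_advect (mchi (k n)) (chiB (k n)) (fun x nx => (chi0 x nx).1) (chi_i (k n))
      (dB (k n)) (Nt n)).
  pose err n := ((full_form (s n) - cut_form (chi (k n)) (s n)) -
    (full_form t0 - cut_form (chi (k n)) t0)) / (s n - t0).
  have err0 : err @ \oo --> (0 : R).
    apply: (@squeeze0 _ _ (fun n => n.+1%:R^-1)); last exact: cvg_harmonic.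
    move=> n; rewrite /err normrM normfV ler_pdivrMr ?normr_gt0 ?subr_eq0//.
    have [_ H] := kP n; rewrite mulrC; apply: le_trans H.
    apply: (le_trans (ler_normB _ _)).
    by rewrite distrC lerD2l distrC.
  have := scvgD Dc_cv err0; apply: cvg_eq => [n|]; last by rewrite addr0.
  have [_ E] := tauP n; have sn : s n - t0 != 0 by rewrite subr_eq0.
  have -> : Dc n (tau n) = (cut_form (chi (k n)) (s n) - cut_form (chi (k n)) t0) / (s n - t0).
    by rewrite E mulfK.
  by rewrite /err -mulrDl; congr (_ / _); ring.
move=> s sT st cs.
(* Only finitely many terms lie outside the neighbourhood; they are dropped by a shift. *)
have [K _ KP] : \forall n \near \oo, N (s n).
  move/cvgrPdist_lt : (cs) => /(_ dl dl0); apply: filterS => n h1.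
  by split; [exact: sT | rewrite distrC].
rewrite -(cvg_shiftn K).
apply: (core (fun n => s (n + K)%N)) => //.
- by move=> n; apply: KP; rewrite /= leq_addl.
- by have := cs; rewrite -(cvg_shiftn K).
Qed.

End transported_form.

(** * Integral identities for advection by a field of linear growth *)

Section advection.
Context (R : realType) (d : nat).
Local Notation X := 'rV[R]_d.
Local Notation dx := (leb R d).
Implicit Types (g h b : X -> R) (i j k : 'I_d).

Variables (u : 'I_d -> X -> R) (du : 'I_d -> 'I_d -> X -> R) (Cu Bd : R).
Hypotheses (u_meas : forall k, measurable_fun setT (u k))
  (u_bd : forall k x, `|u k x| <= Cu * (1 + n1 x))
  (u_i : forall i k, diff_along i (u k) (du i k))
  (du_bd : forall i k x, `|du i k x| <= Bd).

Let n1p (x : X) : 0 < 1 + n1 x. Proof. by rewrite ltr_wpDr// n1_ge0. Qed.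

Let u_bd' k x : `|u k x| <= `|Cu| * (1 + n1 x).
Proof. by apply: (le_trans (u_bd k x)); rewrite ler_wpM2r ?ler_norm// ltW. Qed.

Let du_meas i k : measurable_fun setT (du i k).
Proof. exact: (@diff_along_meas _ _ i _ _ (u_meas k) (@u_i i k)). Qed.

Let Bd0 i k : 0 <= Bd. Proof. exact: le_trans (du_bd i k 0). Qed.

Section products.
Variables (i k : 'I_d) (g h dg dh : X -> R).
Hypotheses (Lg : L2 dx g) (Lh : L2 dx h) (Ldg : L2 dx dg) (Ldh : L2 dx dh)
  (gP : is_weak_partial i g dg) (hP : is_weak_partial i h dh).

Lemma cut_parts (chi : X -> R) (dchi : 'I_d -> X -> R) (B r : R) :
  measurable_fun setT chi -> (forall x, `|chi x| <= B) ->
  diff_along i chi (dchi i) -> (forall x, ~ cube r x -> chi x = 0) ->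
  (forall x, `|dchi i x| * (1 + n1 x) <= B) ->
  \int[dx]_x (chi x * u k x * g x * dh x) + \int[dx]_x (chi x * u k x * dg x * h x)
  + \int[dx]_x (chi x * du i k x * g x * h x) + \int[dx]_x (dchi i x * u k x * g x * h x) = 0.
Proof.
move=> mchi chiB chi_i chi0 dB.
have B0 : 0 <= B := le_trans (normr_ge0 _) (chiB 0).
have md : measurable_fun setT (dchi i) := @diff_along_meas _ _ i chi _ mchi chi_i.
have b1 x : `|chi x * u k x| <= B * (`|Cu| * (1 + d%:R * `|r|)).
  have [xr|nx] := pselect (cube r x); last first.
    by rewrite chi0// mul0r normr0 !mulr_ge0// addr_ge0// mulr_ge0.
  rewrite normrM ler_pM//; apply: (le_trans (u_bd' k x)).
  rewrite ler_wpM2l// lerD2l; apply: (le_trans (n1_cube xr)).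
  by rewrite ler_wpM2l// ler_norm.
have b2 x : `|dchi i x * u k x| <= `|Cu| * B.
  rewrite normrM; apply: (@le_trans _ _ (`|dchi i x| * (`|Cu| * (1 + n1 x)))).
    by rewrite ler_wpM2l.
  by rewrite mulrCA ler_wpM2l.
have b3 x : `|chi x * du i k x| <= B * Bd by rewrite normrM ler_pM.
have m1 : measurable_fun setT (fun x => chi x * u k x) by exact: measurable_funM.
have m2 : measurable_fun setT (fun x => dchi i x * u k x) by exact: measurable_funM.
have m3 : measurable_fun setT (fun x => chi x * du i k x) by exact: measurable_funM.
have b_i : diff_along i (fun x => chi x * u k x) (fun x => chi x * du i k x + dchi i x * u k x).
  by move=> x s; rewrite addrC; exact: sderivM (chi_i x s) (@u_i i k x s).
have b4 x : `|chi x * du i k x + dchi i x * u k x| <= B * Bd + `|Cu| * B.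
  by apply: (le_trans (ler_normD _ _)); exact: lerD.
have L3 := L1_bMM m3 b3 Lg Lh; have L2 := L1_bMM m2 b2 Lg Lh.
rewrite -addrA -[X in _ + X]RintD//.
rewrite -[RHS](integration_by_parts Lg Lh Ldg Ldh gP hP m1 b1 b_i b4); congr (_ + _).
by apply: eq_Rintegral => x _; rewrite !mulrDl.
Qed.

End products.

Definition adv (gi : 'I_d -> X -> R) (x : X) : R := \sum_k u k x * gi k x.
Definition udiv (x : X) : R := \sum_k du k k x.

Lemma udiv_bd x : `|udiv x| <= d%:R * Bd.
Proof.
apply: (le_trans (ler_norm_sum _ _ _)).
rewrite -[d in d%:R]card_ord mulr_natl -sumr_const.
by apply: ler_sum => i _; exact: du_bd.
Qed.

Lemma udiv_meas : measurable_fun setT udiv.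
Proof. by apply: measurable_sum => i; exact: du_meas. Qed.

Section cutoff_limits.
Variables (chi : nat -> X -> R) (dchi : nat -> 'I_d -> X -> R) (B : R).
Hypotheses (mchi : forall q, measurable_fun setT (chi q)) (chiB : forall q x, `|chi q x| <= B)
  (chi1 : forall x, (fun q => chi q x) @ \oo --> (1 : R))
  (mdchi : forall q i, measurable_fun setT (dchi q i))
  (dB : forall q i x, `|dchi q i x| * (1 + n1 x) <= B)
  (dchi0 : forall i x, (fun q => dchi q i x) @ \oo --> (0 : R)).

Lemma cut_cvg g h : L2 dx g -> L2 dx h ->
  (fun q => \int[dx]_x (chi q x * g x * h x)) @ \oo --> \int[dx]_x (g x * h x).
Proof.
move=> Lg Lh.
have H := @cvL2_I3 _ _ _ dx chi (fun=> 1) _ _ _ _ B mchi chiB chi1 (cvL2_cst Lg) (cvL2_cst Lh).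
by apply: cvg_eq H => //; apply: eq_Rintegral => x _; rewrite mul1r.
Qed.

Lemma cut_cvg_b b (C : R) g h : measurable_fun setT b -> (forall x, `|b x| <= C) ->
  L2 dx g -> L2 dx h ->
  (fun q => \int[dx]_x (chi q x * b x * g x * h x)) @ \oo --> \int[dx]_x (b x * g x * h x).
Proof.
move=> mb bC Lg Lh; have H := cut_cvg (L2_bM mb bC Lg) Lh.
by apply: cvg_eq H => [q|//]; apply: eq_Rintegral => x _; rewrite mulrA.
Qed.

Lemma dcut_cvg i k g h : L2 dx g -> L2 dx h ->
  (fun q => \int[dx]_x (dchi q i x * u k x * g x * h x)) @ \oo --> (0 : R).
Proof.
move=> Lg Lh.
have mb q : measurable_fun setT (fun x => dchi q i x * u k x) by exact: measurable_funM.
have bB q x : `|dchi q i x * u k x| <= `|Cu| * B.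
  rewrite normrM; apply: (@le_trans _ _ (`|dchi q i x| * (`|Cu| * (1 + n1 x)))).
    by rewrite ler_wpM2l.
  by rewrite mulrCA ler_wpM2l.
have b0 x : (fun q => dchi q i x * u k x) @ \oo --> (0 : R).
  have := scvgZ (u k x) (@dchi0 i x).
  by apply: cvg_eq => [q|]; rewrite ?mulr0// mulrC.
have H := @cvL2_I3 _ _ _ dx _ (fun=> 0) _ _ _ _ _ mb bB b0 (cvL2_cst Lg) (cvL2_cst Lh).
apply: cvg_eq H => //; rewrite -[RHS](Rint0 dx).
by apply: eq_Rintegral => x _; rewrite !mul0r.
Qed.

End cutoff_limits.

(** Under a cut-off each product g u_k d_k g is integrable and equals half a divergence up to
    controlled terms. The cut-off is removed only after summing over k, because it is the sum
    [adv gi] that is assumed to be in L2. *)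
Lemma advection_self g gi : L2 dx g -> (forall k, L2 dx (gi k)) ->
  (forall k, is_weak_partial k g (gi k)) -> L2 dx (adv gi) ->
  L1 dx (fun x => g x * adv gi x + 2^-1 * udiv x * g x * g x) /\
  \int[dx]_x (g x * adv gi x + 2^-1 * udiv x * g x * g x) = 0.
Proof.
move=> Lg Lgi gP La.
have mb : measurable_fun setT (fun x => 2^-1 * udiv x).
  by apply: measurable_funM => //; exact: udiv_meas.
have bb x : `|2^-1 * udiv x| <= 2^-1 * (d%:R * Bd).
  by rewrite normrM ger0_norm// ler_wpM2l// udiv_bd.
have A1 := L2M Lg La; have A2 := L1_bMM mb bb Lg Lg.
split; first exact: L1D.
rewrite RintD//.
have [chi [dchi [B [B0 tchi chiB chi1 [chi_i cdchi out dB dchi_cv]]]]] := @cutoffs_exist R d.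
have mchi q : measurable_fun setT (chi q).
  by apply: continuous_measurable_rV; exact: test_function_cont.
have md q i : measurable_fun setT (dchi q i) := continuous_measurable_rV (@cdchi q i).
have C1 := cut_cvg mchi chiB chi1 Lg La.
have C2 := cut_cvg_b mchi chiB chi1 mb bb Lg Lg.
have C3 := @scvg_sum _ _ (index_enum _) xpredT _ _ (fun i _ => dcut_cvg md dB dchi_cv i i Lg Lg).
have := scvgD (scvgD C1 C2) (scvgZ 2^-1 C3).
rewrite big1_eq mulr0 addr0 => /scvg_unique; apply.
apply: cvg_eq (@cvg_cst _ (0 : R) _ \oo _) => // q.
have [r chi0] := out q.
have Lu k : L1 dx (fun x => chi q x * u k x * g x * gi k x).
  apply: (@L1_bMM _ _ _ dx (B * (`|Cu| * (1 + d%:R * `|r|)))) => //.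
    exact: measurable_funM.
  move=> x; have [xr|nx] := pselect (cube r x); last first.
    by rewrite (chi0 x nx).1 mul0r normr0 !mulr_ge0// addr_ge0// mulr_ge0.
  rewrite normrM ler_pM//; apply: (le_trans (u_bd' k x)).
  rewrite ler_wpM2l// lerD2l; apply: (le_trans (n1_cube xr)).
  by rewrite ler_wpM2l// ler_norm.
have Ld k : L1 dx (fun x => chi q x * du k k x * g x * g x).
  apply: (@L1_bMM _ _ _ dx (B * Bd)) => //; first exact: measurable_funM.
  by move=> x; rewrite normrM ler_pM.
have -> : \int[dx]_x (chi q x * g x * adv gi x) = \sum_k \int[dx]_x (chi q x * u k x * g x * gi k x).
  rewrite -Rint_sum//; apply: eq_Rintegral => x _; rewrite mulr_sumr.
  by apply: eq_bigr => k _; ring.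
have -> : \int[dx]_x (chi q x * (2^-1 * udiv x) * g x * g x) =
    2^-1 * \sum_k \int[dx]_x (chi q x * du k k x * g x * g x).
  rewrite -Rint_sum// -RintZ; last exact: L1_sum.
  apply: eq_Rintegral => x _; rewrite mulrCA -!mulrA; congr (_ * _).
  by rewrite /udiv mulr_suml mulr_sumr; apply: eq_bigr => k _; ring.
rewrite !mulr_sumr -!big_split/=; apply/esym/big1 => k _.
have := @cut_parts k k g g (gi k) (gi k) Lg Lg (Lgi k) (Lgi k) (gP k) (gP k) (chi q) (dchi q) B r
  (mchi q) (chiB q) (chi_i q k) (fun x nx => (chi0 x nx).1) (dB q k).
have -> : \int[dx]_x (chi q x * u k x * gi k x * g x) = \int[dx]_x (chi q x * u k x * g x * gi k x).
  by apply: eq_Rintegral => x _; ring.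
lra.
Qed.

(** A Rellich-type identity: the integral of (Laplacian g)(u . grad g) involves first derivatives of
    [g] only. One derivative of the Laplacian is moved onto u . grad g, and the resulting u . grad
    |grad g|^2 / 2 is integrated by parts once more. *)
Lemma advection_laplacian g gi gij : L2 dx g -> (forall k, L2 dx (gi k)) ->
  (forall i j, L2 dx (gij i j)) ->
  (forall k, is_weak_partial k g (gi k)) -> (forall i j, is_weak_partial j (gi i) (gij i j)) ->
  L2 dx (adv gi) ->
  let Z x := (\sum_i gij i i x) * adv gi x - 2^-1 * udiv x * (\sum_i gi i x ^+ 2)
     + \sum_i \sum_k du i k x * gi i x * gi k x in
  L1 dx Z /\ \int[dx]_x Z x = 0.
Proof.
move=> Lg Lgi Lgij gP giP La Z.
have mb : measurable_fun setT (fun x => 2^-1 * udiv x).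
  by apply: measurable_funM => //; exact: udiv_meas.
have bb x : `|2^-1 * udiv x| <= 2^-1 * (d%:R * Bd).
  by rewrite normrM ger0_norm// ler_wpM2l// udiv_bd.
have LL : L2 dx (fun x => \sum_i gij i i x) by exact: L2_sum.
have A1 := L2M LL La; have A2 i := L1_bMM mb bb (Lgi i) (Lgi i).
have A3 i k := L1_bMM (du_meas i k) (du_bd i k) (Lgi i) (Lgi k).
have A2' : L1 dx (fun x => \sum_i 2^-1 * udiv x * gi i x * gi i x) by exact: L1_sum.
have A3' : L1 dx (fun x => \sum_i \sum_k du i k x * gi i x * gi k x).
  by apply: L1_sum => i _; exact: L1_sum.
have ZE : Z = fun x => (\sum_i gij i i x) * adv gi x - (\sum_i 2^-1 * udiv x * gi i x * gi i x)
   + \sum_i \sum_k du i k x * gi i x * gi k x.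
  apply/funext => x; congr (_ - _ + _); rewrite mulr_sumr.
  by apply: eq_bigr => i _; ring.
have Lab := L1B A1 A2'.
rewrite ZE; split; first exact: L1D.
rewrite RintD// RintB// Rint_sum// Rint_sum; last by move=> i _; exact: L1_sum.
under [X in _ + X]eq_bigr do rewrite Rint_sum//.
have [chi [dchi [B [B0 tchi chiB chi1 [chi_i cdchi out dB dchi_cv]]]]] := @cutoffs_exist R d.
have mchi q : measurable_fun setT (chi q).
  by apply: continuous_measurable_rV; exact: test_function_cont.
have md q i : measurable_fun setT (dchi q i) := continuous_measurable_rV (@cdchi q i).
have C1 := cut_cvg mchi chiB chi1 LL La.
have C2 := @scvg_sum _ _ (index_enum _) xpredT _ _
  (fun i _ => cut_cvg_b mchi chiB chi1 mb bb (Lgi i) (Lgi i)).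
have C3 := @scvg_sum _ _ (index_enum _) xpredT _ _ (fun i _ => @scvg_sum _ _ (index_enum _) xpredT _ _
  (fun k _ => cut_cvg_b mchi chiB chi1 (du_meas i k) (du_bd i k) (Lgi i) (Lgi k))).
have C4 := @scvg_sum _ _ (index_enum _) xpredT _ _ (fun i _ => @scvg_sum _ _ (index_enum _) xpredT _ _
  (fun k _ => dcut_cvg md dB dchi_cv k k (Lgi i) (Lgi i))).
have C5 := @scvg_sum _ _ (index_enum _) xpredT _ _ (fun i _ => @scvg_sum _ _ (index_enum _) xpredT _ _
  (fun k _ => dcut_cvg md dB dchi_cv i k (Lgi i) (Lgi k))).
have := scvgD (scvgD (scvgB C1 C2) C3) (scvgB C5 (scvgZ 2^-1 C4)).
have Z0 : \sum_(i < d) \sum_(k < d) (0 : R) = 0 by rewrite big1// => i _; rewrite big1.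
rewrite !Z0 mulr0 subrr addr0 => /scvg_unique; apply.
apply: cvg_eq (@cvg_cst _ (0 : R) _ \oo _) => // q.
have [r chi0] := out q.
have mcu k : measurable_fun setT (fun x => chi q x * u k x) by exact: measurable_funM.
have bcu k x : `|chi q x * u k x| <= B * (`|Cu| * (1 + d%:R * `|r|)).
  have [xr|nx] := pselect (cube r x); last first.
    by rewrite (chi0 x nx).1 mul0r normr0 !mulr_ge0// addr_ge0// mulr_ge0.
  rewrite normrM ler_pM//; apply: (le_trans (u_bd' k x)).
  rewrite ler_wpM2l// lerD2l; apply: (le_trans (n1_cube xr)).
  by rewrite ler_wpM2l// ler_norm.
have Ld i k : L1 dx (fun x => chi q x * du k k x * gi i x * gi i x).
  apply: (@L1_bMM _ _ _ dx (B * Bd)) => //; first exact: measurable_funM.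
  by move=> x; rewrite normrM ler_pM.
have Lu i k := L1_bMM (mcu k) (bcu k) (Lgij i i) (Lgi k).
have -> : \int[dx]_x (chi q x * (\sum_i gij i i x) * adv gi x) =
    \sum_i \sum_k \int[dx]_x (chi q x * u k x * gij i i x * gi k x).
  under [RHS]eq_bigr do rewrite -Rint_sum//.
  rewrite -Rint_sum; last by move=> i _; exact: L1_sum.
  apply: eq_Rintegral => x _; rewrite -mulrA mulr_suml mulr_sumr; apply: eq_bigr => i _.
  by rewrite /adv !mulr_sumr; apply: eq_bigr => k _; ring.
have -> : \sum_i \int[dx]_x (chi q x * (2^-1 * udiv x) * gi i x * gi i x) =
    \sum_i \sum_k 2^-1 * \int[dx]_x (chi q x * du k k x * gi i x * gi i x).
  apply: eq_bigr => i _; rewrite -mulr_sumr -Rint_sum// -RintZ; last exact: L1_sum.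
  apply: eq_Rintegral => x _; rewrite mulrCA -!mulrA; congr (_ * _).
  by rewrite /udiv mulr_suml mulr_sumr; apply: eq_bigr => k _; ring.
rewrite mulr_sumr -!sumrB -!big_split/=; apply/esym/big1 => i _.
rewrite mulr_sumr -!sumrB -!big_split/=; apply: big1 => k _.
(* [E1] moves d_i away from the second derivative d_i d_i g, [E2] integrates u_k d_k of the square
   of d_i g, and [E3] exchanges the mixed derivatives almost everywhere so that the second-order
   terms cancel. *)
have E1 := @cut_parts i k _ _ _ _ (Lgi i) (Lgi k) (Lgij i i) (Lgij k i) (giP i i) (giP k i) (chi q) (dchi q) B r
  (mchi q) (chiB q) (chi_i q i) (fun x nx => (chi0 x nx).1) (dB q i).
have E2 := @cut_parts k k _ _ _ _ (Lgi i) (Lgi i) (Lgij i k) (Lgij i k) (giP i k) (giP i k) (chi q) (dchi q) B r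
  (mchi q) (chiB q) (chi_i q k) (fun x nx => (chi0 x nx).1) (dB q k).
have E3 : \int[dx]_x (chi q x * u k x * gi i x * gij k i x) = \int[dx]_x (chi q x * u k x * gi i x * gij i k x).
  apply: Rint_ae.
  - by apply: measurable_funM; [apply: measurable_funM => //; exact: L2_meas|exact: L2_meas].
  - by apply: measurable_funM; [apply: measurable_funM => //; exact: L2_meas|exact: L2_meas].
  - have := weak_partial_comm Lg (Lgi i) (Lgi k) (Lgij k i) (Lgij i k) (gP i) (gP k) (giP k i) (giP i k).
    by apply: filterS => x ->.
have E4 : \int[dx]_x (chi q x * u k x * gij i k x * gi i x) = \int[dx]_x (chi q x * u k x * gi i x * gij i k x).
  by apply: eq_Rintegral => x _; ring.
move: E1 E2; rewrite E3 E4; lra.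
Qed.

End advection.

(** * Smooth fields on the slab *)

Section sup_norm.
Context d (Y : measurableType d) (R : realType) (mu : {measure set Y -> \bar R}).

(** The norm of infinite exponent is an essential supremum only on a space of positive mass, hence
    the first hypothesis. *)
Lemma Linf_ae (g : Y -> R) (B : R) : (0 < mu setT)%E -> ('N[mu]_+oo[EFin \o g] <= B%:E)%E ->
  {ae mu, forall x, `|g x| <= B}.
Proof.
move=> mu0; rewrite unlock mu0 => /ess_supP.
by apply: filterS => x /=; rewrite lee_fin.
Qed.

Lemma ae_imp (P Q : Y -> Prop) : (forall x, P x -> Q x) -> {ae mu, forall x, P x} ->
  {ae mu, forall x, Q x}.
Proof. by move=> PQ; apply: filterS. Qed.

End sup_norm.

Section slab.
Context (R : realType) (d : nat).
Local Notation X := 'rV[R]_d.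
Local Notation dx := (leb R d).
Local Notation e_ i := (delta_mx ord0 i : X).
Implicit Types (i j k : 'I_d).

Lemma diff_along_partial i (g dg : X -> R) : diff_along i g dg -> partial i g = dg.
Proof.
move=> H; apply/funext => x.
have /(@sderiv_is_derive _ setT) D := H x 0.
have [_] := D (filterE _ (fun=> I)); rewrite scale0r addr0 => <-.
rewrite /partial /derive; have -> // : (fun r : R => r^-1 *: ((g \o shift x) (r *: e_ i) - g x)) =
  (fun r : R => r^-1 *: (((fun s => g (x + s *: e_ i)) \o shift 0) (r *: 1) - g (x + 0 *: e_ i))).
apply/funext => r /=; rewrite !addr0 scale0r addr0 /shift/= [_ + x]addrC.
by rewrite -[r *: 1]/(r * 1) mulr1.
Qed.

Lemma Linfty_ae (g : X -> R) (B : R) : (0 < d)%N -> (Linfty g <= B%:E)%E ->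
  {ae dx, forall x, `|g x| <= B}.
Proof. by move=> d0; apply: Linf_ae; exact: leb_setT_gt0. Qed.

Lemma Linfty_le (g : X -> R) (B : R) : (0 < d)%N -> continuous g -> (Linfty g <= B%:E)%E ->
  forall x, `|g x| <= B.
Proof.
move=> d0 cg /(Linfty_ae d0) H x.
apply: (@ae_continuous_le _ _ (fun x => `|g x|)) H x => y.
by apply: continuous_comp; [exact: cg | exact: norm_continuous].
Qed.

(** Induction on the list of coordinates: each step moves along one axis, where [diff_along_lip]
    applies. *)
Lemma linear_growth (g : X -> R) (dg : 'I_d -> X -> R) (B : R) x :
  (forall i, diff_along i g (dg i)) -> (forall i x, `|dg i x| <= B) ->
  `|g x - g 0| <= B * n1 x.
Proof.
move=> gi dB.
suff H (r : seq 'I_d) : `|g (\sum_(i <- r) x ord0 i *: e_ i) - g 0| <= B * \sum_(i <- r) `|x ord0 i|.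
  by have := H (index_enum _); rewrite -row_sum_delta.
elim: r => [|i r IH]; first by rewrite !big_nil subrr normr0 mulr0.
rewrite !big_cons [X in g X]addrC mulrDr.
apply: le_trans (ler_distD (g (\sum_(i <- r) x ord0 i *: e_ i)) _ _) _; apply: lerD => //.
exact: diff_along_lip (gi i) (dB i).
Qed.

Section fixed_horizon.
Variable T : R.
Local Notation A := (`[0, T]%classic `*` [set: X]).
Implicit Types (g : R -> X -> R) (s t : R).

Lemma slab_nbhs g t (x : X) (P : set R) : {within A, continuous (fun p : R * X => g p.1 p.2)} ->
  t \in `[0, T] -> nbhs (g t x) P -> exists2 e : R, 0 < e &
  forall s (y : X), s \in `[0, T] -> `|t - s| < e -> (forall i, `|x ord0 i - y ord0 i| < e) -> P (g s y).
Proof.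
move=> /subspace_continuousP cg tT Pg.
have [[U V] /= [Ut Vx] UV] := cg (t, x) (conj tT I) P Pg.
have [e1 e10 H1] := (nbhs_ballP _ _).1 Ut.
have [e2 e20 H2] := (rV_nbhsP x V).1 Vx.
exists (Num.min e1 e2); first by rewrite lt_min e10.
move=> s y sT st xy; apply: (UV (s, y)) => //; split => /=.
  by apply: H1; rewrite /ball/=; move: st; rewrite lt_min => /andP[].
by apply: H2 => i; have := xy i; rewrite lt_min => /andP[].
Qed.

Lemma slab_space_cont g s : Ck_slab T 0 g -> s \in `[0, T] -> continuous (g s).
Proof.
move=> [cg _] sT x P Pg; have [e e0 H] := slab_nbhs cg sT Pg.
apply/(rV_nbhsP x); exists e => // y xy; apply: H => //.
by rewrite subrr normr0.
Qed.

Lemma slab_time_cvg g t x (s : nat -> R) : Ck_slab T 0 g -> t \in `[0, T] ->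
  (forall n, s n \in `[0, T]) -> s @ \oo --> t -> (fun n => g (s n) x) @ \oo --> g t x.
Proof.
move=> [cg _] tT sT cs P Pg; have [e e0 H] := slab_nbhs cg tT Pg.
move/cvgrPdist_lt : cs => /(_ e e0); apply: filterS => n h.
by apply: H => // i; rewrite subrr normr0.
Qed.

Lemma slab_loc_bd g (r : R) : Ck_slab T 0 g ->
  exists B, forall s x, s \in `[0, T] -> cube r x -> `|g s x| <= B.
Proof.
move=> [cg _].
have cK : compact (`[0, T]%classic `*` @cube R d r).
  by apply: compact_setX; [exact: segment_compact | exact: compact_cube].
have sub : `[0, T]%classic `*` @cube R d r `<=` A by move=> p [].
have /compact_bounded/pinfty_ex_gt0[B B0 H] := continuous_compact (continuous_subspaceW sub cg) cK.
by exists B => s x sT xr; apply: H; exists (s, x).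
Qed.

Lemma slab_measureX (J : set R) (O : set X) : measurable J -> measurable O ->
  slab_measure d T (J `*` O) = (lebesgue_measure (J `&` `[0%R, T]%classic) * dx O)%E.
Proof. by move=> mJ mO; exact: (@product_measure1E _ _ _ _ R). Qed.

(** Continuity on the closed slab carries a violation at any time, end points included, to an open
    box of interior times and positions, which has positive measure. *)
Lemma slab_ae_le g (B : R) : 0 < T -> Ck_slab T 0 g ->
  {ae slab_measure d T, forall p, p.1 \in `[0, T] -> g p.1 p.2 <= B} ->
  forall s x, s \in `[0, T] -> g s x <= B.
Proof.
move=> T0 [cg _] [Z [mZ Z0 ZP]] s x sT; rewrite leNgt; apply/negP => gB.
have [e e0 H] := @slab_nbhs g s x (fun y => B < y) cg sT (lt_nbhsr gB).
(* Positivity of [T] keeps this time interval nonempty even when [s] is an end point. *)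
pose l := Num.max 0 (s - e); pose h := Num.min T (s + e).
have := sT; rewrite in_itv/= => /andP[s0 s1].
have lh : l < h.
  by rewrite /l /h lt_min !gt_max; apply/andP; split; apply/andP; split; lra.
pose O := obox (fun i => x ord0 i - e) (fun i => x ord0 i + e).
have JO : `]l, h[%classic `*` O `<=` Z.
  move=> [r y] /= [rJ yO]; apply: ZP => /= K.
  have [r1 r2 r3 r4] : [/\ 0 < r, s - e < r, r < T & r < s + e].
    by move: rJ; rewrite in_itv/= gt_max lt_min => /andP[/andP[-> ->] /andP[-> ->]].
  have rT : r \in `[0, T] by rewrite in_itv/= !ltW.
  have := K rT; rewrite leNgt => /negP; apply; apply: H => //.
    by rewrite ltr_distlC; apply/andP; split; lra.
  by move=> i; have /andP[y1 y2] := yO i; rewrite ltr_distlC; apply/andP; split; lra.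
have : (slab_measure d T (`]l, h[%classic `*` O) <= 0)%E.
  rewrite -Z0; apply: le_measure => //; rewrite inE//.
  by apply: measurableX => //; exact: measurable_obox.
apply/negP; rewrite -ltNge slab_measureX//; last exact: measurable_obox.
rewrite leb_obox; last by move=> i; lra.
rewrite setIidl; last first.
  move=> r /=; rewrite !in_itv/= gt_max lt_min => /andP[/andP[r1 _] /andP[r2 _]].
  by rewrite !ltW.
rewrite lebesgue_measure_itv/= lte_fin lh -EFinD mule_gt0// lte_fin ?subr_gt0//.
by rewrite prodr_gt0// => i _; lra.
Qed.

Lemma slab_measure_gt0 : (0 < d)%N -> 0 < T -> (0 < slab_measure d T setT)%E.
Proof.
move=> d0 T0; rewrite -setXTT slab_measureX//.
rewrite setTI lebesgue_measure_itv/= lte_fin T0 sube0.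
by rewrite mule_gt0//; exact: leb_setT_gt0.
Qed.

Lemma Linfty_slab_ae g (B : R) : (0 < d)%N -> 0 < T -> (Linfty_slab T g <= B%:E)%E ->
  {ae slab_measure d T, forall p, `|g p.1 p.2| <= B}.
Proof. by move=> d0 T0; apply: Linf_ae; exact: slab_measure_gt0. Qed.

Lemma slab_norm_le g (B : R) : 0 < T -> Ck_slab T 0 g ->
  {ae slab_measure d T, forall p, p.1 \in `[0, T] -> `|g p.1 p.2| <= B} ->
  forall s x, s \in `[0, T] -> `|g s x| <= B.
Proof.
move=> T0 [cg ?] H; apply: (@slab_ae_le (fun s x => `|g s x|)) => //; split => //.
move=> p; apply: (@continuous_comp (subspace A) R R) => //; first exact: cg.
exact: norm_continuous.
Qed.

Lemma slab_time_sderiv g t x : Ck_slab T 1 g -> t \in `[0, T] ->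
  sderiv `[0, T]%classic (g^~ x) t (dt T g t x).
Proof. by move=> [_ [H _ _]] tT; apply: sderiv_within; exact: H. Qed.

Lemma slab_diff_along g i t : Ck_slab T 1 g -> t \in `[0, T] -> diff_along i (g t) (partial i (g t)).
Proof.
move=> [_ [_ _ H]] tT x r; apply: derivable_sderiv.
by have [H1 _] := H i; exact: H1.
Qed.

Lemma smooth_slab_dt g : smooth_slab T g -> smooth_slab T (dt T g).
Proof. by move=> H k; have [_ []] := H k.+1. Qed.

Lemma smooth_slab_partial g i : smooth_slab T g -> smooth_slab T (fun t => partial i (g t)).
Proof. by move=> H k; have [_ [_ _ /(_ i)[]]] := H k.+1. Qed.

Lemma partial_laplacian g i t : smooth_slab T g -> t \in `[0, T] ->
  diff_along i (laplacian (g t)) (fun x => \sum_k partial i (partial k (partial k (g t))) x).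
Proof.
move=> sg tT x r; apply: sderiv_sum => k _.
exact: (@slab_diff_along _ i t (smooth_slab_partial k (smooth_slab_partial k sg) 1) tT x r).
Qed.

Lemma bounded_near_timeP (G : R -> \bar R) t : bounded_near_time T G t ->
  exists dl B : R, 0 < dl /\ forall s, near_time T t dl s -> (G s <= B%:E)%E.
Proof.
move=> [B /nbhs_ballP[e /= e0 H]]; exists e, B; split => // s [sT st].
by apply: H => //; rewrite /ball/= distrC.
Qed.

End fixed_horizon.
End slab.

Section slab_fields.
Context (R : realType) (d : nat) (T : R).
Local Notation X := 'rV[R]_d.
Local Notation dx := (leb R d).
Local Notation halfline := (`[(0:R), +oo[%classic).
Implicit Types (i k : 'I_d) (g h : R -> X -> R).

(* Separate continuity and local bounds, stable under composition with functions smooth on a half-line. *)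
Definition slab_field g := forall t, t \in `[0, T] -> [/\ continuous (g t),
  forall x (s : nat -> R), (forall n, s n \in `[0, T]) -> s @ \oo --> t ->
    (fun n => g (s n) x) @ \oo --> g t x &
  forall r, exists B, forall s x, s \in `[0, T] -> cube r x -> `|g s x| <= B].

Lemma slab_field0 g : Ck_slab T 0 g -> slab_field g.
Proof.
move=> g0 t tT; split.
- exact: slab_space_cont g0 tT.
- by move=> x s sT cs; exact: (@slab_time_cvg _ _ _ g t x s g0 tT sT cs).
- by move=> r; exact: slab_loc_bd g0.
Qed.

Lemma slab_fieldD g h : slab_field g -> slab_field h -> slab_field (fun s x => g s x + h s x).
Proof.
move=> gF hF t tT; have [g1 g2 g3] := gF t tT; have [h1 h2 h3] := hF t tT; split.
- by move=> x; apply: continuousD; [exact: g1|exact: h1].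
- by move=> x s sT cs; apply: scvgD; [exact: g2|exact: h2].
- move=> r; have [B gB] := g3 r; have [C hC] := h3 r; exists (B + C) => s x sT xr.
  by apply: (le_trans (ler_normD _ _)); apply: lerD; [exact: gB|exact: hC].
Qed.

Lemma slab_fieldM g h : slab_field g -> slab_field h -> slab_field (fun s x => g s x * h s x).
Proof.
move=> gF hF t tT; have [g1 g2 g3] := gF t tT; have [h1 h2 h3] := hF t tT; split.
- by move=> x; apply: continuousM; [exact: g1|exact: h1].
- by move=> x s sT cs; apply: scvgM; [exact: g2|exact: h2].
- move=> r; have [B gB] := g3 r; have [C hC] := h3 r; exists (B * C) => s x sT xr.
  by rewrite normrM; apply: ler_pM => //; [exact: gB|exact: hC].
Qed.

Lemma slab_field_cst (c : R) : slab_field (fun _ _ => c).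
Proof.
move=> t tT; split=> [x|x s _ _|r]; [exact: cst_continuous|exact: cvg_cst|].
by exists `|c|.
Qed.

Lemma slab_field_sum (J : Type) (r : seq J) (g : J -> R -> X -> R) :
  (forall j, slab_field (g j)) -> slab_field (fun s x => \sum_(j <- r) g j s x).
Proof.
move=> gF; elim: r => [|j r IH].
  by under eq_fun do under eq_fun do rewrite big_nil; exact: slab_field_cst.
by under eq_fun do under eq_fun do rewrite big_cons; exact: slab_fieldD.
Qed.

(** [G] is differentiable on the closed half-line only, one-sidedly at 0; the composite is
    continuous because [g] takes its values there. *)
Lemma slab_field_comp (G G' : R -> R) g (M C : R) :
  (forall r, 0 <= r -> sderiv halfline G r (G' r)) -> slab_field g ->
  (forall s x, s \in `[0, T] -> 0 <= g s x <= M) -> (forall r, 0 <= r <= M -> `|G r| <= C) ->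
  slab_field (fun s x => G (g s x)).
Proof.
move=> GG' gF gM GC t tT; have [g1 g2 g3] := gF t tT.
have g0 s x : s \in `[0, T] -> halfline (g s x).
  by move=> sT; have /andP[h _] := gM s x sT; rewrite /= in_itv/= h.
split.
- move=> x P /nbhs_ballP[e /= e0 HP].
  have := g0 t x tT; rewrite /= in_itv/= andbT => gt0.
  have [dl dl0 H] := sderiv_cont_eps (g0 t x tT) (GG' _ gt0) e0.
  suff HS : g t @^-1` ball (g t x) dl `<=` (fun y => G (g t y)) @^-1` P.
    exact: (filterS HS (g1 x _ (nbhsx_ballx (g t x) dl dl0))).
  move=> y yx.
  by apply: HP; rewrite /ball/= distrC; apply: (H (g t y) (g0 t y tT)); rewrite distrC.
- move=> x s sT cs; have := g0 t x tT; rewrite /= in_itv/= andbT => gt0.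
  apply: (sderiv_cont (GG' _ gt0)) => [n|]; first exact: g0.
  exact: g2.
- by move=> r; exists C => s x sT _; apply: GC; exact: gM.
Qed.

Lemma slab_field_meas g t : slab_field g -> t \in `[0, T] -> measurable_fun setT (g t).
Proof. by move=> gF tT; apply: continuous_measurable_rV; have [] := gF t tT. Qed.

Lemma slab_field_smooth g : smooth_slab T g -> slab_field g.
Proof. by move=> sg; exact: slab_field0 (sg 0%N). Qed.

End slab_fields.

Section complex_components.
Context (R : realType).
Implicit Types z : R[i].

Lemma cdotE z z' : cdot z z' = complex.Re z * complex.Re z' + complex.Im z * complex.Im z'.
Proof. by case: z => a b; case: z' => a' b'; rewrite /cdot /=; ring. Qed.

Lemma csqrE z : csqr z = complex.Re z ^+ 2 + complex.Im z ^+ 2.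
Proof. by rewrite /csqr cdotE !expr2. Qed.

Lemma csqr_ge0 z : 0 <= csqr z.
Proof. by rewrite csqrE addr_ge0// sqr_ge0. Qed.

Lemma sqrt_ge_term (J : finType) (v : J -> R) j : `|v j| <= Num.sqrt (\sum_i v i ^+ 2).
Proof.
rewrite -sqrtr_sqr ler_wsqrtr// (bigD1 j)//= lerDl.
by apply: sumr_ge0 => i _; exact: sqr_ge0.
Qed.

Lemma Re_le_cabs z : `|complex.Re z| <= Num.sqrt (csqr z).
Proof. by rewrite -sqrtr_sqr ler_wsqrtr// csqrE lerDl sqr_ge0. Qed.

Lemma Im_le_cabs z : `|complex.Im z| <= Num.sqrt (csqr z).
Proof. by rewrite -sqrtr_sqr ler_wsqrtr// csqrE lerDr sqr_ge0. Qed.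

Lemma Re_sum (J : Type) (r : seq J) (v : J -> R[i]) :
  complex.Re (\sum_(j <- r) v j) = \sum_(j <- r) complex.Re (v j).
Proof. exact: (big_morph _ (fun x y : R[i] => raddfD (@complex.Re R) x y) (raddf0 _)). Qed.

Lemma Im_sum (J : Type) (r : seq J) (v : J -> R[i]) :
  complex.Im (\sum_(j <- r) v j) = \sum_(j <- r) complex.Im (v j).
Proof. exact: (big_morph _ (fun x y : R[i] => raddfD (@complex.Im R) x y) (raddf0 _)). Qed.

End complex_components.

(** * Fields of the flow and their bounds in terms of [M] *)

Section fluid.
Context (R : realType) (d : nat) (f : R -> R) (T M : R).
Local Notation X := 'rV[R]_d.
Local Notation dx := (leb R d).
Local Notation e_ i := (delta_mx ord0 i : X).
Local Notation halfline := (`[(0:R), +oo[%classic).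
Implicit Types (i k : 'I_d).
Variables (phi : R -> X -> R) (a : R -> X -> R[i]).
Hypotheses (d0 : (0 < d)%N) (T0 : 0 < T) (Af : assumptionA f)
  (sphi : smooth_slab T phi) (sa : csmooth_slab T a) (flowM : flow_bound T phi a = M%:E).

Definition vel k s x := partial k (phi s) x.
Definition dvel i k s x := partial i (partial k (phi s)) x.
Definition divv s x := \sum_k dvel k k s x.
(** The gradient of the divergence, in the form in which [partial_laplacian] produces it. *)
Definition ddivv i s x := \sum_k partial i (partial k (partial k (phi s))) x.
Definition re_part s x := complex.Re (a s x).
Definition im_part s x := complex.Im (a s x).
Definition rho s x := csqr (a s x).
Definition f_prime s x := deriv0y f (rho s x).
Definition f_second s x := deriv0y (deriv0y f) (rho s x).
Local Notation a1 := re_part.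
Local Notation a2 := im_part.
Local Notation f1 := f_prime.
Local Notation f2 := f_second.
(** The material derivative D; on the two parts of [a] it equals R_a minus half of a div u
    ([mder_Re], [mder_Im]). *)
Definition mder (b : R -> X -> R) s x := dt T b s x + \sum_k vel k s x * partial k (b s) x.

Lemma slab_field_vel k : slab_field T (vel k).
Proof. exact: slab_field_smooth (smooth_slab_partial k sphi). Qed.

Lemma slab_field_dvel i k : slab_field T (dvel i k).
Proof. exact: slab_field_smooth (smooth_slab_partial i (smooth_slab_partial k sphi)). Qed.

Lemma slab_field_divv : slab_field T divv.
Proof. by apply: slab_field_sum => k; exact: slab_field_dvel. Qed.

Lemma slab_field_mder b : smooth_slab T b -> slab_field T (mder b).
Proof.
move=> sb; apply: slab_fieldD; first exact: slab_field_smooth (smooth_slab_dt sb).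
apply: slab_field_sum => k; apply: slab_fieldM; first exact: slab_field_vel.
exact: slab_field_smooth (smooth_slab_partial k sb).
Qed.

Lemma Ck_slab0_sum (J : Type) (r : seq J) (g : J -> R -> X -> R) :
  (forall j, Ck_slab T 0 (g j)) -> Ck_slab T 0 (fun s x => \sum_(j <- r) g j s x).
Proof.
move=> gC; split => //; elim: r => [|j r IH].
  rewrite (_ : (fun p => _) = fun=> 0); first exact: cst_continuous.
  by apply/funext => p; rewrite big_nil.
rewrite (_ : (fun p => _) = fun p => g j p.1 p.2 + \sum_(l <- r) g l p.1 p.2).
  by have [cg _] := gC j; move=> p; apply: continuousD; [exact: cg|exact: IH].
by apply/funext => p; rewrite big_cons.
Qed.

Lemma Ck_slab_rho : Ck_slab T 0 rho.
Proof.
have [[c1 _] [c2 _]] := (sa.1 0%N, sa.2 0%N); split => //.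
rewrite (_ : (fun p => _) = fun p => a1 p.1 p.2 * a1 p.1 p.2 + a2 p.1 p.2 * a2 p.1 p.2).
  move=> p; have h1 := c1 p; have h2 := c2 p.
  by apply: (cvgD (cvgM h1 h1) (cvgM h2 h2)).
by apply/funext => p; rewrite /rho csqrE !expr2.
Qed.

(** [flow_bound] is a sum of nonnegative terms, so each is at most [M]. Entries are dominated by
    Euclidean norms, and almost everywhere bounds of continuous fields hold everywhere. *)
Lemma flow_bounds : [/\ 0 <= M,
  forall i k s x, s \in `[0, T] -> `|dvel i k s x| <= M,
  forall i s x, s \in `[0, T] -> `|ddivv i s x| <= M &
  forall s x, s \in `[0, T] -> 0 <= rho s x <= M].
Proof.
have [E1 E2 E3] : [/\ (0 <= Linfty_slab T (fun t x =>
     Num.sqrt (\sum_(i < d) \sum_(j < d) (partial j (partial i (phi t)) x) ^+ 2)) <= M%:E)%E,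
   (Linfty_slab T (fun t => grad_norm (laplacian (phi t))) <= M%:E)%E &
   (Linfty_slab T (fun t x => csqr (a t x)) <= M%:E)%E].
  have N0 (g : R -> X -> R) : (0 <= Linfty_slab T g)%E by exact: Lnorm_ge0.
  rewrite -flowM /flow_bound N0; split.
  - by rewrite -addeA leeDl// adde_ge0.
  - by rewrite addeAC leeDr// adde_ge0.
  - by rewrite leeDr// adde_ge0.
have M0 : 0 <= M by have /andP[h1 h2] := E1; rewrite -lee_fin; exact: le_trans h2.
have {E1}/andP[_ E1] := E1.
split => //.
- move=> i k; apply: slab_norm_le => //.
    exact: (smooth_slab_partial i (smooth_slab_partial k sphi) 0%N).
  have := Linfty_slab_ae d0 T0 E1; apply: ae_imp => p /= H _; apply: le_trans H.
  rewrite [leRHS]ger0_norm ?sqrtr_ge0//.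
  apply: (le_trans (@sqrt_ge_term R _ (fun j => partial j (partial k (phi p.1)) p.2) i)).
  rewrite ler_wsqrtr// [leRHS](bigD1 k)//= lerDl.
  by apply: sumr_ge0 => j _; apply: sumr_ge0 => l _; exact: sqr_ge0.
- move=> i; apply: slab_norm_le => //.
    apply: Ck_slab0_sum => k.
    exact: (smooth_slab_partial i (smooth_slab_partial k (smooth_slab_partial k sphi)) 0%N).
  have := Linfty_slab_ae d0 T0 E2; apply: ae_imp => p /= H pT; apply: le_trans H.
  rewrite [leRHS]ger0_norm ?sqrtr_ge0//.
  have /(congr1 (@^~ p.2)) := diff_along_partial (@partial_laplacian _ _ _ _ i _ sphi pT).
  rewrite -/(ddivv i p.1 p.2) => <-.
  exact: (@sqrt_ge_term R _ (fun i => partial i (laplacian (phi p.1)) p.2)).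
- move=> s x sT; rewrite csqr_ge0/= (le_trans (ler_norm _))//.
  apply: (slab_norm_le T0 Ck_slab_rho) sT => //.
  by have := Linfty_slab_ae d0 T0 E3; apply: ae_imp => p /= H _.
Qed.

Let M0 : 0 <= M. Proof. by have [] := flow_bounds. Qed.

Lemma rho_half s x : halfline (rho s x).
Proof. by rewrite /= in_itv/= csqr_ge0. Qed.

(** The square is at most [M], and [M + 1] dominates the square root of [M], which keeps radicals
    out of the constants. *)
Lemma a1_bd s x : s \in `[0, T] -> `|a1 s x| <= M + 1.
Proof.
move=> sT; have [_ _ _ /(_ s x sT)/andP[_ H]] := flow_bounds.
move: H; rewrite /rho csqrE -/(a1 s x) -/(a2 s x) => H.
have h1 := sqr_ge0 (a2 s x); have h2 : `|a1 s x| ^+ 2 <= M by rewrite real_normK ?num_real//; lra.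
have h3 := normr_ge0 (a1 s x); nra.
Qed.

Lemma a2_bd s x : s \in `[0, T] -> `|a2 s x| <= M + 1.
Proof.
move=> sT; have [_ _ _ /(_ s x sT)/andP[_ H]] := flow_bounds.
move: H; rewrite /rho csqrE -/(a1 s x) -/(a2 s x) => H.
have h1 := sqr_ge0 (a1 s x); have h2 : `|a2 s x| ^+ 2 <= M by rewrite real_normK ?num_real//; lra.
have h3 := normr_ge0 (a2 s x); nra.
Qed.

Lemma divv_bd s x : s \in `[0, T] -> `|divv s x| <= d%:R * M.
Proof.
move=> sT; apply: (le_trans (ler_norm_sum _ _ _)).
rewrite -[d in d%:R]card_ord mulr_natl -sumr_const.
by apply: ler_sum => i _; have [_ H _ _] := flow_bounds; exact: H.
Qed.

(** The gradient is bounded, and the velocity at the origin, which is all of [cube 0], is bounded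
    over the compact time interval. [Cu] may depend on the solution: it serves limits and
    integrability and does not enter the final constant. *)
Lemma vel_growth : exists Cu, forall k s x, s \in `[0, T] -> `|vel k s x| <= Cu * (1 + n1 x).
Proof.
have [_ dM _ _] := flow_bounds.
have /choice[B HB] k : exists B, forall s x, s \in `[0, T] -> cube 0 x -> `|vel k s x| <= B.
  by apply: slab_loc_bd; exact: (smooth_slab_partial k sphi 0%N).
exists (M + \sum_k `|B k|) => k s x sT.
have h0 : `|vel k s 0| <= \sum_k `|B k|.
  apply: (@le_trans _ _ `|B k|).
    apply: (le_trans (HB k s 0 sT _)); last exact: ler_norm.
    by move=> i; rewrite mxE normr0.
  by rewrite (bigD1 k)//= lerDl sumr_ge0.
have h1 : `|vel k s x - vel k s 0| <= M * n1 x.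
  apply: (@linear_growth _ _ _ (fun i => dvel i k s)) => [i|i y]; last exact: dM.
  exact: (@slab_diff_along _ _ T (fun t => partial k (phi t)) i s (smooth_slab_partial k sphi 1%N) sT).
have := ler_normD (vel k s x - vel k s 0) (vel k s 0); rewrite subrK.
have S0 := le_trans (normr_ge0 _) h0; have SN := mulr_ge0 S0 (n1_ge0 x).
set S := \sum_k _ in h0 S0 SN *; move: M0 => M0' h; lra.
Qed.

Lemma slab_field_rho : slab_field T rho.
Proof. exact: slab_field0 Ck_slab_rho. Qed.

Lemma slab_field_f1 : slab_field T f1.
Proof.
have [_ _ _ rM] := flow_bounds; have [B [C [_ _ H]]] := nonlinearity_bounds Af M.
apply: (@slab_field_comp _ _ _ _ _ _ M B (deriv0y2_sderiv Af)) => //.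
  exact: slab_field_rho.
by move=> r /H[/andP[h1 h2] _ _]; rewrite ger0_norm.
Qed.

Lemma slab_field_f2 : slab_field T f2.
Proof.
have [_ _ _ rM] := flow_bounds; have [B [C [_ _ H]]] := nonlinearity_bounds Af M.
have [D _ _ _] := Af.
apply: (@slab_field_comp _ _ _ _ _ _ M C (fun r r0 => sderiv_within (D 2%N r r0))) => //.
  exact: slab_field_rho.
by move=> r /H[].
Qed.

Lemma rho_time s x : s \in `[0, T] -> sderiv `[0, T]%classic (rho^~ x) s
  (2 * (a1 s x * dt T a1 s x + a2 s x * dt T a2 s x)).
Proof.
move=> sT; have H1 := @slab_time_sderiv _ _ T a1 s x (sa.1 1%N) sT.
have H2 := @slab_time_sderiv _ _ T a2 s x (sa.2 1%N) sT.
have := sderivD (sderivM H1 H1) (sderivM H2 H2).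
have -> : 2 * (a1 s x * dt T a1 s x + a2 s x * dt T a2 s x) =
  dt T a1 s x * a1 s x + a1 s x * dt T a1 s x + (dt T a2 s x * a2 s x + a2 s x * dt T a2 s x) by ring.
by apply: sderiv_ext => [r _|]; rewrite /rho csqrE !expr2.
Qed.

Lemma rho_space i s : s \in `[0, T] -> diff_along i (rho s)
  (fun x => 2 * (a1 s x * partial i (a1 s) x + a2 s x * partial i (a2 s) x)).
Proof.
move=> sT x r; have H1 := @slab_diff_along _ _ T a1 i s (sa.1 1%N) sT x r.
have H2 := @slab_diff_along _ _ T a2 i s (sa.2 1%N) sT x r.
have := sderivD (sderivM H1 H1) (sderivM H2 H2).
set y := x + r *: e_ i.
have -> : 2 * (a1 s y * partial i (a1 s) y + a2 s y * partial i (a2 s) y) =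
  partial i (a1 s) y * a1 s y + a1 s y * partial i (a1 s) y +
  (partial i (a2 s) y * a2 s y + a2 s y * partial i (a2 s) y) by ring.
by apply: sderiv_ext => [q _|]; rewrite /rho csqrE !expr2.
Qed.

Lemma f1_time s x : s \in `[0, T] -> sderiv `[0, T]%classic (f1^~ x) s
  (f2 s x * (2 * (a1 s x * dt T a1 s x + a2 s x * dt T a2 s x))).
Proof.
move=> sT; refine (@sderiv_comp R _ halfline (deriv0y f) (rho^~ x) s _ _
  (fun r _ => rho_half r x) (deriv0y2_sderiv Af (csqr_ge0 _)) (@rho_time s x sT)).
Qed.

Lemma f1_space i s : s \in `[0, T] -> diff_along i (f1 s)
  (fun x => f2 s x * (2 * (a1 s x * partial i (a1 s) x + a2 s x * partial i (a2 s) x))).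
Proof.
move=> sT x r; refine (@sderiv_comp R _ halfline (deriv0y f) (fun q => rho s (x + q *: e_ i)) r _ _
  (fun q _ => rho_half s (x + q *: e_ i)) (deriv0y2_sderiv Af (csqr_ge0 _)) (@rho_space i s sT x r)).
Qed.

End fluid.

(** * Time derivative of the quadratic term of the energy *)

Section fluid_form.
Context (R : realType) (d : nat) (f : R -> R) (T M : R).
Local Notation X := 'rV[R]_d.
Local Notation dx := (leb R d).
Implicit Types (i k : 'I_d).
Variables (phi : R -> X -> R) (a : R -> X -> R[i]).
Hypotheses (d0 : (0 < d)%N) (T0 : 0 < T) (Af : assumptionA f)
  (sphi : smooth_slab T phi) (sa : csmooth_slab T a) (flowM : flow_bound T phi a = M%:E).
Local Notation vel := (vel phi).
Local Notation divv := (divv phi).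
Local Notation a1 := (re_part a).
Local Notation a2 := (im_part a).
Local Notation f1 := (f_prime f a).
Local Notation f2 := (f_second f a).
Local Notation mder := (mder T phi).

Lemma mder_Re s x : complex.Re (Ra T phi a s x) = mder a1 s x + 2^-1 * a1 s x * divv s x.
Proof.
rewrite /Ra /cdt /mder -/a1 -/a2; have -> : laplacian (phi s) x = divv s x by [].
rewrite !raddfD /= Re_sum; congr (_ + _ + _).
  by apply: eq_bigr => k _; rewrite /= mul0r subr0.
by rewrite /a1; case: (a s x) => p q /=; ring.
Qed.

Lemma mder_Im s x : complex.Im (Ra T phi a s x) = mder a2 s x + 2^-1 * a2 s x * divv s x.
Proof.
rewrite /Ra /cdt /mder -/a1 -/a2; have -> : laplacian (phi s) x = divv s x by [].
rewrite !raddfD /= Im_sum; congr (_ + _ + _).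
  by apply: eq_bigr => k _; rewrite /= mul0r addr0.
by rewrite /a2; case: (a s x) => p q /=; ring.
Qed.

Variables (t0 dl D : R).
Local Notation N := (near_time T t0 dl).
Hypotheses (t0T : t0 \in `[0, T]) (dl0 : 0 < dl)
  (a1D : forall s x, N s -> `|mder a1 s x| <= D) (a2D : forall s x, N s -> `|mder a2 s x| <= D).

(** The material derivative of f'(|a|^2) b c by the chain rule, that of |a|^2 being twice a1 D a1 +
    a2 D a2. *)
Definition form_rate (b c : R -> X -> R) s x :=
  f2 s x * (2 * (a1 s x * mder a1 s x + a2 s x * mder a2 s x)) * b s x * c s x
  + f1 s x * mder b s x * c s x + f1 s x * b s x * mder c s x.

Variables (g g' h h' : R -> X -> R) (gi hi : 'I_d -> R -> X -> R) (Bg Bh : R).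
Hypotheses (gP : transported T t0 dl vel g g' gi Bg) (hP : transported T t0 dl vel h h' hi Bh).

Let aadv (gi : 'I_d -> R -> X -> R) x := \sum_i vel i t0 x * gi i t0 x.

(** With [b] and [c] among the two parts of [a], this differentiates each product in the expansion
    of f'(|a|^2)(w,a)^2. In [Z] the transport terms are regrouped so that [g] and [h] occur with
    their full material derivative, which the equation determines. *)
Lemma form_sderiv (b c : R -> X -> R) : smooth_slab T b -> smooth_slab T c ->
  (forall s x, s \in `[0, T] -> `|b s x| <= M + 1) -> (forall s x, s \in `[0, T] -> `|c s x| <= M + 1) ->
  (forall s x, N s -> `|mder b s x| <= D) -> (forall s x, N s -> `|mder c s x| <= D) ->
  let Z x := form_rate b c t0 x * g t0 x * h t0 x
    + f1 t0 x * b t0 x * c t0 x * (g' t0 x + aadv gi x) * h t0 x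
    + f1 t0 x * b t0 x * c t0 x * g t0 x * (h' t0 x + aadv hi x)
    + divv t0 x * (f1 t0 x * b t0 x * c t0 x) * g t0 x * h t0 x in
  L1 dx Z /\ sderiv `[0, T]%classic (fun s => \int[dx]_x (f1 s x * b s x * c s x * g s x * h s x)) t0
    (\int[dx]_x Z x).
Proof.
move=> sb sc bA cA bD cD Z.
pose m s x := f1 s x * b s x * c s x.
pose mt s x := f2 s x * (2 * (a1 s x * dt T a1 s x + a2 s x * dt T a2 s x)) * b s x * c s x
  + f1 s x * dt T b s x * c s x + f1 s x * b s x * dt T c s x.
pose mi i s x := f2 s x * (2 * (a1 s x * partial i (a1 s) x + a2 s x * partial i (a2 s) x)) * b s x * c s x
  + f1 s x * partial i (b s) x * c s x + f1 s x * b s x * partial i (c s) x.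
have [M0 dM _ rM] := flow_bounds d0 T0 sphi sa flowM.
have [B [C [B0 C0 BC]]] := nonlinearity_bounds Af M.
have f1B s x : s \in `[0, T] -> `|f1 s x| <= B.
  by move=> sT; have [/andP[h0 h1] _ _] := BC _ (rM s x sT); rewrite ger0_norm.
have f2C s x : s \in `[0, T] -> `|f2 s x| <= C by move=> sT; have [] := BC _ (rM s x sT).
have A0 : 0 <= M + 1 by rewrite addr_ge0.
have Nt0 : N t0 by split => //; rewrite subrr normr0.
have D0 : 0 <= D := le_trans (normr_ge0 _) (a1D 0 Nt0).
have F1 : slab_field T f1 := slab_field_f1 d0 T0 Af sphi sa flowM.
have F2 : slab_field T f2 := slab_field_f2 d0 T0 Af sphi sa flowM.
have Fb := slab_field_smooth sb; have Fc := slab_field_smooth sc.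
have Fa1 := slab_field_smooth sa.1; have Fa2 := slab_field_smooth sa.2.
have Fm : slab_field T m by apply: slab_fieldM => //; exact: slab_fieldM.
have Fgen (p q r v : R -> X -> R) : slab_field T p -> slab_field T q -> slab_field T r ->
  slab_field T v -> slab_field T (fun s x =>
    f2 s x * (2 * (a1 s x * p s x + a2 s x * q s x)) * b s x * c s x
    + f1 s x * r s x * c s x + f1 s x * b s x * v s x).
  move=> Fp Fq Fr Fv.
  apply: slab_fieldD; [apply: slab_fieldD|]; do ?[apply: slab_fieldM => //].
    exact: slab_field_cst.
  by apply: slab_fieldD; apply: slab_fieldM.
have Fmt : slab_field T mt.
  by apply: Fgen; apply: slab_field_smooth; apply: smooth_slab_dt => //; [exact: sa.1|exact: sa.2].
have Fmi i : slab_field T (mi i).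
  by apply: Fgen; apply: slab_field_smooth; apply: (smooth_slab_partial i) => //; [exact: sa.1|exact: sa.2].
have FD : slab_field T (form_rate b c).
  by apply: Fgen; apply: slab_field_mder => //; [exact: sa.1|exact: sa.2].
have m_bd s x : N s -> `|m s x| <= B * (M + 1) * (M + 1).
  move=> [sT _]; rewrite /m normrM; apply: ler_pM => //; last exact: cA.
  by rewrite normrM; apply: ler_pM => //; [exact: f1B|exact: bA].
(* The separate derivatives of [a], [b] and [c] recombine into [mder], which [D] bounds near
   [t0]. *)
have DE s x : mat_deriv mt mi vel s x = form_rate b c s x.
  rewrite /mat_deriv /form_rate /mder.
  have -> : \sum_i vel i s x * mi i s x =
    f2 s x * (2 * (a1 s x * (\sum_i vel i s x * partial i (a1 s) x)
      + a2 s x * (\sum_i vel i s x * partial i (a2 s) x))) * b s x * c s x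
    + f1 s x * (\sum_i vel i s x * partial i (b s) x) * c s x
    + f1 s x * b s x * (\sum_i vel i s x * partial i (c s) x).
    rewrite !mulr_sumr -big_split/= !mulr_sumr !mulr_suml -!big_split/=.
    by apply: eq_bigr => i _; rewrite /mi; ring.
  by rewrite /mt; ring.
have D_bd s x : N s -> `|mat_deriv mt mi vel s x| <=
   C * (2 * ((M + 1) * D + (M + 1) * D)) * (M + 1) * (M + 1) + B * D * (M + 1) + B * (M + 1) * D.
  move=> Ns; have [sT _] := Ns; rewrite DE /form_rate.
  apply: (le_trans (ler_normD _ _)); apply: lerD.
    apply: (le_trans (ler_normD _ _)); apply: lerD.
      rewrite normrM; apply: ler_pM => //; last exact: cA.
      rewrite normrM; apply: ler_pM => //; last exact: bA.
      rewrite normrM; apply: ler_pM => //; first exact: f2C.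
      rewrite normrM [`|2|]ger0_norm// ler_wpM2l//.
      apply: (le_trans (ler_normD _ _)); apply: lerD.
        by rewrite normrM; apply: ler_pM => //; [exact: (a1_bd d0 T0 sphi sa flowM)|exact: a1D].
      by rewrite normrM; apply: ler_pM => //; [exact: (a2_bd d0 T0 sphi sa flowM)|exact: a2D].
    rewrite normrM; apply: ler_pM => //; last exact: cA.
    by rewrite normrM; apply: ler_pM => //; [exact: f1B|exact: bD].
  rewrite normrM; apply: ler_pM => //; last exact: cD.
  by rewrite normrM; apply: ler_pM => //; [exact: f1B|exact: bA].
have [Cu uC] := vel_growth d0 T0 sphi sa flowM.
have NT s : N s -> s \in `[0, T] by case.
have m_t s x : N s -> sderiv N (m^~ x) s (mt s x).
  move=> /NT sT.
  have E : mt s x = (f2 s x * (2 * (a1 s x * dt T a1 s x + a2 s x * dt T a2 s x)) * b s x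
    + f1 s x * dt T b s x) * c s x + f1 s x * b s x * dt T c s x by rewrite /mt; ring.
  rewrite E; apply: (@sderivS _ _ `[0, T]%classic) => [r /NT//|].
  apply: sderivM; last exact: (@slab_time_sderiv _ _ T c s x (sc 1%N) sT).
  apply: sderivM; last exact: (@slab_time_sderiv _ _ T b s x (sb 1%N) sT).
  exact: (@f1_time _ _ _ _ _ Af sa s x sT).
have m_i i s : N s -> diff_along i (m s) (mi i s).
  move=> /NT sT x r; set y := x + _.
  have E : mi i s y = (f2 s y * (2 * (a1 s y * partial i (a1 s) y + a2 s y * partial i (a2 s) y)) * b s y
    + f1 s y * partial i (b s) y) * c s y + f1 s y * b s y * partial i (c s) y by rewrite /mi; ring.
  rewrite E; apply: sderivM; last exact: (@slab_diff_along _ _ T c i s (sc 1%N) sT x r).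
  apply: sderivM; last exact: (@slab_diff_along _ _ T b i s (sb 1%N) sT x r).
  exact: (@f1_space _ _ _ _ _ Af sa i s sT x r).
have mt_loc r : exists B', forall s x, N s -> cube r x -> `|mt s x| <= B'.
  have [_ _ /(_ r)[B' H]] := Fmt t0 t0T.
  by exists B' => s x /NT; exact: H.
have mi_loc i s r : N s -> exists B', forall x, cube r x -> `|mi i s x| <= B'.
  move=> /NT sT; have [_ _ /(_ r)[B' H]] := Fmi i t0 t0T.
  by exists B' => x; exact: H.
have u_i i s : N s -> diff_along i (vel i s) (dvel phi i i s).
  by move=> /NT sT; exact: (@slab_diff_along _ _ T (vel i) i s (smooth_slab_partial i sphi 1%N) sT).
have cv (p : R -> X -> R) : slab_field T p -> forall (s : nat -> R) x, (forall n, N (s n)) ->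
    s @ \oo --> t0 -> (fun n => p (s n) x) @ \oo --> p t0 x.
  by move=> /(_ _ t0T)[_ H _] s x Ns; apply: H => n; exact: NT.
have D_cv (s : nat -> R) x : (forall n, N (s n)) -> s @ \oo --> t0 ->
    (fun n => mat_deriv mt mi vel (s n) x) @ \oo --> mat_deriv mt mi vel t0 x.
  move=> Ns cs; have := cv _ FD s x Ns cs.
  by apply: cvg_eq => [n|]; rewrite DE.
have u_m i s (Ns : N s) := slab_field_meas (@slab_field_vel _ _ _ _ sphi i) (NT s Ns).
have := @full_form_sderiv R d T t0 dl t0T dl0 m mt mi (B * (M + 1) * (M + 1))
   (fun s Ns => slab_field_meas Fm (NT s Ns)) m_bd (fun s Ns => slab_field_meas Fmt (NT s Ns))
   m_t mt_loc m_i mi_loc vel (fun i s x => dvel phi i i s x) Cu M u_m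
   (fun i s x Ns => uC i s x (NT s Ns)) u_i (fun i s x Ns => dM i i s x (NT s Ns))
   (fun i => cv _ (slab_field_vel sphi i)) (fun i => cv _ (slab_field_dvel sphi i i)) _ D_bd D_cv
   g g' h h' gi hi Bg Bh gP hP.
have [Lg Lg' _] := tr_path gP t0T; have [Lh Lh' _] := tr_path hP t0T.
have Lag := tr_adv_L2 gP Nt0; have Lah := tr_adv_L2 hP Nt0.
have mD := slab_field_meas FD t0T; have mm := slab_field_meas Fm t0T.
have D_bd0 x : `|form_rate b c t0 x| <= C * (2 * ((M + 1) * D + (M + 1) * D)) * (M + 1) * (M + 1)
   + B * D * (M + 1) + B * (M + 1) * D by rewrite -DE; exact: D_bd.
have m_bd0 x := m_bd t0 x Nt0.
have mdm : measurable_fun setT (fun x => divv t0 x * m t0 x).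
  by apply: measurable_funM => //; exact: (slab_field_meas (slab_field_divv sphi) t0T).
have dm_bd x : `|divv t0 x * m t0 x| <= d%:R * M * (B * (M + 1) * (M + 1)).
  by rewrite normrM; apply: ler_pM => //; exact: (divv_bd d0 T0 sphi sa flowM).
have I1 := L1_bMM mD D_bd0 Lg Lh.
have I2 := L1_bMM mm m_bd0 Lag Lh; have I3 := L1_bMM mm m_bd0 Lg Lah.
have I4 := L1_bMM mdm dm_bd Lg Lh.
have I5 := L1_bMM mm m_bd0 Lg' Lh; have I6 := L1_bMM mm m_bd0 Lg Lh'.
have ZE : Z = fun x => form_rate b c t0 x * g t0 x * h t0 x + m t0 x * aadv gi x * h t0 x
  + m t0 x * g t0 x * aadv hi x + divv t0 x * m t0 x * g t0 x * h t0 x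
  + m t0 x * g' t0 x * h t0 x + m t0 x * g t0 x * h' t0 x.
  by apply/funext => x; rewrite /Z -/(m t0 x); ring.
have J2 := L1D I1 I2; have J3 := L1D J2 I3; have J4 := L1D J3 I4; have J5 := L1D J4 I5.
move=> H; split; first by rewrite ZE; exact: L1D.
rewrite ZE !RintD//.
rewrite /full_form_deriv in H.
have <- : \int[dx]_x (mat_deriv mt mi vel t0 x * g t0 x * h t0 x) =
  \int[dx]_x (form_rate b c t0 x * g t0 x * h t0 x).
  by apply: eq_Rintegral => x _; rewrite DE.
exact: H.
Qed.

End fluid_form.

(** * Pointwise energy balance *)

Section pointwise_identity.
Context (R : realType).

(** The scalars are the values at one point: [p1], [p2] for a, [A1], [A2] for R_a, [q1], [q2] for f'
    and f'' at |a|^2, [D1], [D2] for the Laplacians of the parts of w, [V1], [V2] for their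
    transport, [S] for grad w . grad w', [G] for |grad w|^2, and [E], [H], [J] for the terms pairing
    grad w with grad u, grad div u and grad R_phi. The terms following the forms have zero integral
    as fields; on the right, second derivatives of w survive only against the source. *)
Lemma energy_density_identity (eps K w1 w2 w1' w2' D1 D2 V1 V2 dv rp F1 F2 p1 p2 A1 A2 q1 q2 S G E H J : R) :
  eps != 0 ->
  let q := w1 * p1 + w2 * p2 in
  let m1 := A1 - 2^-1 * p1 * dv in let m2 := A2 - 2^-1 * p2 * dv in
  let rate b c mb mc := q2 * (2 * (p1 * m1 + p2 * m2)) * b * c + q1 * mb * c + q1 * b * mc in
  let form b c mb mc g h yg yh := rate b c mb mc * g * h + q1 * b * c * yg * h + q1 * b * c * g * yh
    + dv * (q1 * b * c) * g * h in
  let y1 := w1' + V1 in let y2 := w2' + V2 in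
  - (eps * y2) + eps ^+ 2 / 2 * D1 - eps / 2 * w2 * dv - 2 * q1 * q * p1 = rp * w1 + F1 ->
  eps * y1 + eps ^+ 2 / 2 * D2 + eps / 2 * w1 * dv - 2 * q1 * q * p2 = rp * w2 + F2 ->
  eps ^+ 2 * S + K * eps ^+ 2 * (w1 * w1' + w2 * w2')
   + 2 * (form p1 p1 m1 m1 w1 w1 y1 y1 + 2 * form p1 p2 m1 m2 w1 w2 y1 y2 + form p2 p2 m2 m2 w2 w2 y2 y2)
   - eps ^+ 2 * (S + (D1 * w1' + D2 * w2'))
   - eps ^+ 2 * (D1 * V1 + D2 * V2 - 2^-1 * dv * G + E)
   - eps ^+ 2 / 2 * (dv * G + dv * (D1 * w1 + D2 * w2) + H)
   + eps * (rp * (D1 * w2 - D2 * w1) + J)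
   + K * eps ^+ 2 * (w1 * V1 + w2 * V2 + 2^-1 * dv * (w1 ^+ 2 + w2 ^+ 2))
   + K * eps ^+ 3 / 2 * (w1 * D2 - w2 * D1)
  = - eps ^+ 2 * E - eps ^+ 2 / 2 * H + eps * J
   + 2 * K * eps * q1 * q * (w1 * p2 - w2 * p1) + K * eps * (w1 * F2 - w2 * F1)
   + 4 * q2 * (p1 * A1 + p2 * A2) * q ^+ 2 - 2 * q2 * (p1 ^+ 2 + p2 ^+ 2) * dv * q ^+ 2
   + 4 * q1 * q * (w1 * A1 + w2 * A2) - 2 * q1 * q ^+ 2 * dv
   + 4 / eps * q1 * q * rp * (p1 * w2 - p2 * w1)
   - 4 / eps * q1 * q * (p2 * F1 - p1 * F2) + eps * (D2 * F1 - D1 * F2).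
Proof.
move=> e0 q m1 m2 rate form y1 y2 e1 e2.
(* The imaginary part of the equation determines [w1'] and the real part determines [w2']; the
   division by [eps] happens here. *)
have E1 : w1' = (rp * w2 + F2 - eps ^+ 2 / 2 * D2 - eps / 2 * w1 * dv + 2 * q1 * q * p2) / eps - V1.
  apply/eqP; rewrite eq_sym subr_eq eq_sym -/y1; apply/eqP.
  by apply: (mulfI e0); rewrite mulrCA mulfV// mulr1 -e2; ring.
have E2 : w2' = - (rp * w1 + F1 - eps ^+ 2 / 2 * D1 + eps / 2 * w2 * dv + 2 * q1 * q * p1) / eps - V2.
  apply/eqP; rewrite eq_sym subr_eq eq_sym -/y2; apply/eqP.
  by apply: (mulfI e0); rewrite mulrCA mulfV// mulr1 -e1; ring.
rewrite /form /rate /m1 /m2 /y1 /y2 E1 E2 /q; field.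
exact: e0.
Qed.

End pointwise_identity.

Section pointwise_bound.
Context (R : realType).

(** Expand q1 (q - eps s)^2 and q1 (q + eps s)^2. The weight is kept on q^2, because the energy
    controls only q1 q^2 and q1 may vanish; on the other square it is replaced by its bound [B]. *)
Lemma young_weighted (q1 B q s eps S : R) : 0 <= q1 <= B -> s ^+ 2 <= S ->
  `|q1 * q * s * eps| <= 2^-1 * (q1 * q ^+ 2 + B * eps ^+ 2 * S).
Proof.
move=> /andP[h0 h1] hs.
have a1 := mulr_ge0 h0 (sqr_ge0 (q - eps * s)); have a2 := mulr_ge0 h0 (sqr_ge0 (q + eps * s)).
have B0 := le_trans h0 h1.
have a3 : 0 <= (B - q1) * (eps ^+ 2 * s ^+ 2) by rewrite mulr_ge0 ?subr_ge0// mulr_ge0// sqr_ge0.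
have a4 : 0 <= B * eps ^+ 2 * (S - s ^+ 2) by rewrite mulr_ge0 ?subr_ge0// mulr_ge0// sqr_ge0.
by rewrite ler_norml; apply/andP; split; lra.
Qed.

Lemma norm_prod_le (x y : R) : `|x * y| <= 2^-1 * (x ^+ 2 + y ^+ 2).
Proof.
have := sqr_ge0 (x - y); have := sqr_ge0 (x + y).
by rewrite ler_norml => h1 h2; apply/andP; split; lra.
Qed.

Lemma sum_linear_bound d (M w : R) (c g : 'I_d -> R) : 0 <= M -> (forall i, `|c i| <= M) ->
  `|\sum_i c i * g i * w| <= M / 2 * (\sum_i g i ^+ 2 + d%:R * w ^+ 2).
Proof.
move=> M0 cM; apply: (le_trans (ler_norm_sum _ _ _)).
have -> : d%:R * w ^+ 2 = \sum_(i < d) w ^+ 2 by rewrite sumr_const card_ord mulr_natl.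
rewrite -big_split/= mulr_sumr.
apply: ler_sum => i _; rewrite -!mulrA normrM; apply: ler_pM => //.
exact: norm_prod_le.
Qed.

Lemma sum_bilinear_bound d (M : R) (c : 'I_d -> 'I_d -> R) (g : 'I_d -> R) : 0 <= M ->
  (forall i k, `|c i k| <= M) ->
  `|\sum_i \sum_k c i k * g i * g k| <= d%:R * M * \sum_i g i ^+ 2.
Proof.
move=> M0 cM; apply: (le_trans (ler_norm_sum _ _ _)).
apply: (@le_trans _ _ (\sum_(i < d) M / 2 * (\sum_k g k ^+ 2 + d%:R * g i ^+ 2))).
  apply: ler_sum => i _; have := @sum_linear_bound d M (g i) (c i) g M0 (cM i).
  by under eq_bigr do rewrite -mulrA [g _ * g i]mulrC mulrA.
rewrite -mulr_sumr big_split/= -mulr_sumr sumr_const card_ord -mulr_natl.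
by rewrite le_eqVlt; apply/orP; left; apply/eqP; field.
Qed.

Lemma assemble_bound (c1 ca cr1 cr0 xa x1 x0 P e k : R) : 0 <= c1 -> 0 <= ca -> 0 <= cr1 -> 0 <= cr0 ->
  0 <= xa -> 0 <= x1 -> 0 <= x0 -> 0 <= P -> P <= k * e ->
  c1 * P + (xa * (ca * P) + (x1 * (cr1 * P) + x0 * (cr0 * P)))
  <= (c1 + ca + cr1 + cr0) * k * (1 + xa + x1 + x0) * e.
Proof.
move=> h1 ha hr1 hr0 ya y1 y0 P0 Pe.
set c := c1 + ca + cr1 + cr0.
have c0 : 0 <= c by rewrite !addr_ge0.
have -> : c * k * (1 + xa + x1 + x0) * e = c * (1 + xa + x1 + x0) * (k * e) by ring.
apply: (@le_trans _ _ (c * (1 + xa + x1 + x0) * P)); last first.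
  by apply: ler_wpM2l => //; rewrite mulr_ge0// !addr_ge0.
have cP (b : R) : b <= c -> b * P <= c * P by exact: ler_wpM2r.
have -> : c * (1 + xa + x1 + x0) * P = c * P + (xa * (c * P) + (x1 * (c * P) + x0 * (c * P))) by ring.
apply: lerD; last apply: lerD; last apply: lerD; last first.
- by apply: ler_wpM2l => //; apply: cP; rewrite /c lerDr !addr_ge0.
- by apply: ler_wpM2l => //; apply: cP; rewrite /c -addrA addrCA lerDl !addr_ge0.
- by apply: ler_wpM2l => //; apply: cP; rewrite /c -!addrA addrCA lerDl !addr_ge0.
- by apply: cP; rewrite /c -!addrA lerDl !addr_ge0.
Qed.

(** The energy density consists of eps^2 |grad w|^2, f'(w,a)^2 and eps^2 |w|^2 with positive
    weights. Each term on the left is bounded by these three quantities, except for the source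
    terms, which are carried over unchanged or completed to |F|^2. *)
Lemma energy_density_bound d (K M B C : R) : 0 < K -> 0 <= M -> 0 <= B -> 0 <= C ->
  exists Cst : R, forall (eps ra r0 r1 w1 w2 D1 D2 dv rp F1 F2 p1 p2 A1 A2 q1 q2 : R)
   (g1 g2 ddv dr : 'I_d -> R) (du : 'I_d -> 'I_d -> R), 0 < eps <= 1 ->
  let q := w1 * p1 + w2 * p2 in
  let G := \sum_i g1 i ^+ 2 + \sum_i g2 i ^+ 2 in
  let E := \sum_i \sum_k du i k * g1 i * g1 k + \sum_i \sum_k du i k * g2 i * g2 k in
  let H := \sum_i ddv i * g1 i * w1 + \sum_i ddv i * g2 i * w2 in
  let J := \sum_i dr i * g1 i * w2 - \sum_i dr i * g2 i * w1 in
  (forall i k, `|du i k| <= M) -> (forall i, `|ddv i| <= M) -> `|dv| <= d%:R * M ->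
  p1 ^+ 2 + p2 ^+ 2 <= M -> 0 <= q1 <= B -> `|q2| <= C -> (p1 ^+ 2 + p2 ^+ 2) * `|q2| <= C * q1 ->
  `|A1| <= ra -> `|A2| <= ra -> `|rp| <= r0 -> 0 <= r1 -> (forall i, `|dr i| <= r1) ->
  - eps ^+ 2 * E - eps ^+ 2 / 2 * H + eps * J
   + 2 * K * eps * q1 * q * (w1 * p2 - w2 * p1) + K * eps * (w1 * F2 - w2 * F1)
   + 4 * q2 * (p1 * A1 + p2 * A2) * q ^+ 2 - 2 * q2 * (p1 ^+ 2 + p2 ^+ 2) * dv * q ^+ 2
   + 4 * q1 * q * (w1 * A1 + w2 * A2) - 2 * q1 * q ^+ 2 * dv
   + 4 / eps * q1 * q * rp * (p1 * w2 - p2 * w1)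
   - 4 / eps * q1 * q * (p2 * F1 - p1 * F2) + eps * (D2 * F1 - D1 * F2)
  <= Cst * (1 + ra / eps + r1 / eps + r0 / eps ^+ 2)
       * (2^-1 * (eps ^+ 2 * G + 4 * q1 * q ^+ 2 + K * eps ^+ 2 * (w1 ^+ 2 + w2 ^+ 2)))
     + (F1 ^+ 2 + F2 ^+ 2)
     - 4 / eps * q1 * q * (p2 * F1 - p1 * F2) + eps * (D2 * F1 - D1 * F2).
Proof.
move=> K0 M0 B0 C0.
(* [c1] collects the terms free of residuals, [ca] those with R_a, [cr1] those with the gradient of
   R_phi and [cr0] those with R_phi itself. *)
pose c1 := d%:R * M + M * (1 + d%:R) + K * (1 + B * M) + K ^+ 2 + 2 * d%:R * M * (C + 1).
pose ca := (4 * C + 2) * (1 + 2 * B).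
pose cr1 := (1 + d%:R) : R.
pose cr0 := 2 * (1 + B * M).
exists ((c1 + ca + cr1 + cr0) * (3 + 2 / K)).
move=> eps ra r0 r1 w1 w2 D1 D2 dv rp F1 F2 p1 p2 A1 A2 q1 q2 g1 g2 ddv dr du /andP[e0 e1].
move=> q G E H J duM ddvM dvM rM q1B q2C rC A1a A2a rpr r10 drr.
have /andP[q10 q1B'] := q1B.
have ra0 := le_trans (normr_ge0 _) A1a; have r00 := le_trans (normr_ge0 _) rpr.
have d0 : 0 <= d%:R :> R by [].
have dM0 : 0 <= d%:R * M by rewrite mulr_ge0.
pose W := w1 ^+ 2 + w2 ^+ 2; have W0 : 0 <= W by rewrite addr_ge0 ?sqr_ge0.
have G0 : 0 <= G by rewrite addr_ge0// sumr_ge0// => i _; exact: sqr_ge0.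
pose u := eps ^+ 2 * G; pose v := q1 * q ^+ 2; pose z := eps ^+ 2 * W.
have u0 : 0 <= u by rewrite mulr_ge0// sqr_ge0.
have v0 : 0 <= v by rewrite mulr_ge0// sqr_ge0.
have z0 : 0 <= z by rewrite mulr_ge0// sqr_ge0.
have en0 : eps != 0 by rewrite gt_eqF.
have t1 : - eps ^+ 2 * E <= d%:R * M * u.
  have h1 := @sum_bilinear_bound d M du g1 M0 duM; have h2 := @sum_bilinear_bound d M du g2 M0 duM.
  have hE : - E <= d%:R * M * G.
    rewrite /E /G mulrDr; move: h1 h2; rewrite !ler_norml => /andP[h1 _] /andP[h2 _].
    clear -h1 h2; lra.
  have hE' : 0 <= d%:R * M * G + E by clear -hE; lra.
  by have := mulr_ge0 (sqr_ge0 eps) hE'; rewrite /u; clear; lra.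
have t2 : - (eps ^+ 2 / 2 * H) <= M * (1 + d%:R) * (u + z).
  have h1 := @sum_linear_bound d M w1 ddv g1 M0 ddvM; have h2 := @sum_linear_bound d M w2 ddv g2 M0 ddvM.
  have hH : - H <= M / 2 * (G + d%:R * W).
    rewrite /H /G /W; move: h1 h2; rewrite !ler_norml => /andP[h1 _] /andP[h2 _].
    clear -h1 h2; lra.
  have hH' : 0 <= M / 2 * (G + d%:R * W) + H by clear -hH; lra.
  have := mulr_ge0 (sqr_ge0 eps) hH'.
  have := mulr_ge0 M0 u0; have := mulr_ge0 dM0 u0; have := mulr_ge0 M0 z0; have := mulr_ge0 dM0 z0.
  rewrite /u /z; clear; lra.
have t3 : eps * J <= r1 / eps * (cr1 * (u + z)).
  have h1 := @sum_linear_bound d r1 w2 dr g1 r10 drr; have h2 := @sum_linear_bound d r1 w1 dr g2 r10 drr.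
  have hJ : J <= r1 / 2 * (G + d%:R * W).
    rewrite /J /G /W; move: h1 h2; rewrite !ler_norml => /andP[_ h1] /andP[h2 _].
    clear -h1 h2; lra.
  apply: (@le_trans _ _ (r1 / eps * (2^-1 * (u + d%:R * z)))).
    rewrite (_ : r1 / eps * _ = eps * (r1 / 2 * (G + d%:R * W))); last by rewrite /u /z; field.
    by rewrite ler_wpM2l// ltW.
  apply: ler_wpM2l; first by rewrite divr_ge0// ltW.
  rewrite /cr1; have := mulr_ge0 d0 u0; have := mulr_ge0 d0 z0; have := u0; have := z0.
  generalize u, z; clear; move=> u z; lra.
(* Lagrange's identity in the plane together with |a|^2 <= M. *)
have cross (s t : R) : (s * p1 + t * p2) ^+ 2 <= M * (s ^+ 2 + t ^+ 2).
  have h1 := sqr_ge0 (s * p2 - t * p1).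
  have h2 : 0 <= (M - (p1 ^+ 2 + p2 ^+ 2)) * (s ^+ 2 + t ^+ 2).
    by rewrite mulr_ge0 ?subr_ge0// addr_ge0 ?sqr_ge0.
  move: h1 h2; clear; lra.
have t5 : 2 * K * eps * q1 * q * (w1 * p2 - w2 * p1) <= K * (1 + B * M) * (v + z).
  have hs : (w1 * p2 - w2 * p1) ^+ 2 <= M * W by have := cross (- w2) w1; rewrite /W; clear; lra.
  have := young_weighted q eps q1B hs; rewrite ler_norml => /andP[_ h].
  have h' : 0 <= K * (2^-1 * (q1 * q ^+ 2 + B * eps ^+ 2 * (M * W)) - q1 * q * (w1 * p2 - w2 * p1) * eps).
    by rewrite mulr_ge0 ?subr_ge0// ltW.
  have := mulr_ge0 (ltW K0) z0; have := mulr_ge0 (mulr_ge0 (ltW K0) (mulr_ge0 B0 M0)) v0.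
  move: h'; rewrite /v /z; clear; lra.
(* The squares are completed so that the source keeps coefficient exactly 1; this leaves K^2/4 of
   [z], bounded here by K^2 [z]. *)
have t6 : K * eps * (w1 * F2 - w2 * F1) <= F1 ^+ 2 + F2 ^+ 2 + K ^+ 2 * z.
  have := sqr_ge0 (F2 - K / 2 * eps * w1); have := sqr_ge0 (F1 + K / 2 * eps * w2).
  have := mulr_ge0 (sqr_ge0 K) z0; rewrite /z /W; clear; lra.
have sW : (`|w1| + `|w2|) ^+ 2 <= 2 * W.
  have := sqr_ge0 (`|w1| - `|w2|); rewrite /W -[w1 ^+ 2]real_normK ?num_real//.
  rewrite -[w2 ^+ 2]real_normK ?num_real//; clear; lra.
have := young_weighted `|q| eps q1B sW; rewrite ger0_norm; last first.
  by rewrite !mulr_ge0// ?addr_ge0// ltW.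
rewrite real_normK ?num_real// => yW.
(* Young's inequality divided by [eps]: the origin of the factor 1/eps in front of R_a. *)
have yW' : q1 * `|q| * (`|w1| + `|w2|) <= eps^-1 * (2^-1 * (1 + 2 * B) * (v + z)).
  rewrite -ler_pdivrMl ?invr_gt0// invrK mulrC; apply: (le_trans yW).
  have := mulr_ge0 B0 v0; have := mulr_ge0 B0 z0; have := z0; have := v0; rewrite /v /z; clear; lra.
(* One factor (w,a) is bounded by |a| |w|, so that f'' occurs as |a|^2 |f''|, which is at most C f'.
   A single power of (w,a) remains, as in [yW']. *)
have t7 : 4 * q2 * (p1 * A1 + p2 * A2) * q ^+ 2 <= ra / eps * (4 * C * (1 + 2 * B) * (v + z)).
  apply: (le_trans (ler_norm _)).
  have hq : `|q| <= (`|p1| + `|p2|) * (`|w1| + `|w2|).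
    apply: (le_trans (ler_normD _ _)); rewrite !normrM.
    have := mulr_ge0 (normr_ge0 w1) (normr_ge0 p2); have := mulr_ge0 (normr_ge0 w2) (normr_ge0 p1).
    clear; lra.
  have hA : `|p1 * A1 + p2 * A2| <= ra * (`|p1| + `|p2|).
    apply: (le_trans (ler_normD _ _)); rewrite !normrM mulrDr.
    by apply: lerD; rewrite mulrC ler_wpM2r.
  have sp : (`|p1| + `|p2|) ^+ 2 <= 2 * (p1 ^+ 2 + p2 ^+ 2).
    have := sqr_ge0 (`|p1| - `|p2|); rewrite -[p1 ^+ 2]real_normK ?num_real//.
    rewrite -[p2 ^+ 2]real_normK ?num_real//; clear; lra.
  rewrite !normrM ger0_norm//.
  apply: (@le_trans _ _ (4 * `|q2| * (ra * (`|p1| + `|p2|)) * ((`|p1| + `|p2|) * (`|w1| + `|w2|) * `|q|))).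
    apply: ler_pM; rewrite ?mulr_ge0//; first by rewrite ler_wpM2l// mulr_ge0.
    by rewrite ler_wpM2r.
  rewrite (_ : 4 * `|q2| * _ * _ = 4 * ra * (`|w1| + `|w2|) * `|q| * (`|q2| * (`|p1| + `|p2|) ^+ 2)); last by ring.
  apply: (@le_trans _ _ (4 * ra * (`|w1| + `|w2|) * `|q| * (2 * (C * q1)))).
    rewrite ler_wpM2l ?mulr_ge0 ?addr_ge0//.
    apply: (@le_trans _ _ (`|q2| * (2 * (p1 ^+ 2 + p2 ^+ 2)))); first by rewrite ler_wpM2l.
    by rewrite mulrCA ler_wpM2l// mulrC.
  rewrite (_ : 4 * ra * _ * _ * _ = 8 * C * ra * (q1 * `|q| * (`|w1| + `|w2|))); last by ring.
  rewrite (_ : ra / eps * _ = 8 * C * ra * (eps^-1 * (2^-1 * (1 + 2 * B) * (v + z)))); last by field.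
  by rewrite ler_wpM2l// !mulr_ge0.
have t9 : 4 * q1 * q * (w1 * A1 + w2 * A2) <= ra / eps * (2 * (1 + 2 * B) * (v + z)).
  apply: (le_trans (ler_norm _)).
  have hA : `|w1 * A1 + w2 * A2| <= ra * (`|w1| + `|w2|).
    apply: (le_trans (ler_normD _ _)); rewrite !normrM mulrDr.
    by apply: lerD; rewrite mulrC ler_wpM2r.
  rewrite !normrM !(ger0_norm q10) ger0_norm//.
  apply: (@le_trans _ _ (4 * q1 * `|q| * (ra * (`|w1| + `|w2|)))).
    by rewrite ler_wpM2l// !mulr_ge0.
  rewrite (_ : 4 * q1 * _ * _ = 4 * ra * (q1 * `|q| * (`|w1| + `|w2|))); last by ring.
  rewrite (_ : ra / eps * _ = 4 * ra * (eps^-1 * (2^-1 * (1 + 2 * B) * (v + z)))); last by field.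
  by rewrite ler_wpM2l// !mulr_ge0.
have t8 : - (2 * q2 * (p1 ^+ 2 + p2 ^+ 2) * dv * q ^+ 2) <= 2 * d%:R * M * C * v.
  apply: (le_trans (ler_norm _)); rewrite normrN !normrM ger0_norm//.
  rewrite [`|p1 ^+ 2 + _|]ger0_norm ?addr_ge0 ?sqr_ge0//.
  rewrite (_ : `|q| * `|q| = q ^+ 2); last by rewrite -expr2 real_normK ?num_real.
  rewrite (_ : 2 * d%:R * M * C * v = 2 * (C * q1) * (d%:R * M) * q ^+ 2); last by rewrite /v; ring.
  rewrite ler_wpM2r ?sqr_ge0//; apply: ler_pM => //.
    by rewrite mulr_ge0 ?addr_ge0 ?sqr_ge0// mulr_ge0.
  by rewrite -mulrA ler_wpM2l// mulrC.
have t10 : - (2 * q1 * q ^+ 2 * dv) <= 2 * d%:R * M * v.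
  have : - dv <= d%:R * M by move: dvM; rewrite ler_norml => /andP[]; clear; lra.
  by move/(ler_wpM2l v0); rewrite /v; clear; lra.
(* The equation already supplies one factor 1/eps; Young's inequality supplies the second. *)
have t11 : 4 / eps * q1 * q * rp * (p1 * w2 - p2 * w1) <= r0 / eps ^+ 2 * (cr0 * (v + z)).
  have hs : (p1 * w2 - p2 * w1) ^+ 2 <= M * W by have := cross w2 (- w1); rewrite /W; clear; lra.
  have := young_weighted q eps q1B hs; set s := p1 * w2 - p2 * w1 => y.
  apply: (le_trans (ler_norm _)).
  rewrite (_ : 4 / eps * q1 * q * rp * s = rp * (4 / eps ^+ 2) * (q1 * q * s * eps)); last by field.
  rewrite normrM normrM [`|4 / _|]ger0_norm ?divr_ge0 ?sqr_ge0//.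
  rewrite (_ : r0 / eps ^+ 2 * _ = r0 * (4 / eps ^+ 2) * (4^-1 * cr0 * (v + z))); last by field.
  apply: ler_pM => //; first by rewrite mulr_ge0// divr_ge0 ?sqr_ge0.
    by rewrite ler_wpM2r// divr_ge0 ?sqr_ge0.
  apply: (le_trans y); rewrite /cr0.
  have := mulr_ge0 (mulr_ge0 B0 M0) v0; have := z0; have := v0; rewrite /v /z; clear; lra.
pose P := u + v + z.
have P0 : 0 <= P by rewrite !addr_ge0.
pose e := 2^-1 * (eps ^+ 2 * G + 4 * q1 * q ^+ 2 + K * eps ^+ 2 * (w1 ^+ 2 + w2 ^+ 2)).
(* Since e = u/2 + 2 v + K z/2, it is the mass term with K > 0 that controls [z]; 3 + 2/K is a
   common factor for the three parts. *)
have Pe : P <= (3 + 2 / K) * e.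
  have ze : z <= 2 / K * (2^-1 * (K * z)) by rewrite (_ : 2 / K * _ = z)//; field; rewrite gt_eqF.
  have K0' : 0 <= 2 / K by rewrite divr_ge0// ltW.
  have := mulr_ge0 K0' u0; have := mulr_ge0 K0' v0; have := mulr_ge0 (ltW K0) z0.
  have -> : e = 2^-1 * u + 2 * v + 2^-1 * (K * z) by rewrite /e -/W /u /v /z; field.
  move: ze u0 v0 z0; rewrite /P; generalize (2 / K), u, v, z; clear; move=> k u v z; lra.
have ra' : 0 <= ra / eps by rewrite divr_ge0// ltW.
have r1' : 0 <= r1 / eps by rewrite divr_ge0// ltW.
have r0' : 0 <= r0 / eps ^+ 2 by rewrite divr_ge0// sqr_ge0.
have cr10 : 0 <= cr1 by rewrite addr_ge0.
have B2 : 0 <= 1 + 2 * B by rewrite addr_ge0// mulr_ge0.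
have C2 : 0 <= 4 * C + 2 by rewrite addr_ge0// mulr_ge0.
have BM : 0 <= 1 + B * M by rewrite addr_ge0// mulr_ge0.
have ca0 : 0 <= ca := mulr_ge0 C2 B2.
have cr00 : 0 <= cr0 by rewrite mulr_ge0.
have KBM : 0 <= K * (1 + B * M) := mulr_ge0 (ltW K0) BM.
have dMC : 0 <= 2 * d%:R * M * (C + 1).
  by rewrite -[2 * _ * _]mulrA mulr_ge0 ?(mulr_ge0 _ dM0)// addr_ge0.
have Md : 0 <= M * (1 + d%:R) := mulr_ge0 M0 (addr_ge0 ler01 d0).
have c10 : 0 <= c1.
  by move: (addr_ge0 (addr_ge0 (addr_ge0 (addr_ge0 dM0 Md) KBM) (sqr_ge0 K)) dMC).
have S1 : - eps ^+ 2 * E - eps ^+ 2 / 2 * H + 2 * K * eps * q1 * q * (w1 * p2 - w2 * p1)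
   + K * eps * (w1 * F2 - w2 * F1) - 2 * q2 * (p1 ^+ 2 + p2 ^+ 2) * dv * q ^+ 2 - 2 * q1 * q ^+ 2 * dv
   <= c1 * P + (F1 ^+ 2 + F2 ^+ 2).
  have := mulr_ge0 dM0 (addr_ge0 v0 z0); have := mulr_ge0 Md v0; have := mulr_ge0 KBM u0.
  have := mulr_ge0 (sqr_ge0 K) (addr_ge0 u0 v0); have := mulr_ge0 dMC (addr_ge0 u0 z0).
  move: t1 t2 t5 t6 t8 t10; rewrite /c1 /P mulNr.
  set X1 := eps ^+ 2 * E; set X2 := eps ^+ 2 / 2 * H; set X3 := 2 * K * eps * q1 * q * _.
  set X4 := K * eps * _; set X5 := 2 * q2 * _ * _ * _; set X6 := 2 * q1 * _ * _.
  generalize X1, X2, X3, X4, X5, X6, (F1 ^+ 2 + F2 ^+ 2), u, v, z; clear; move=>  X1 X2 X3 X4 X5 X6 X7 u v z.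
  lra.
have Sa : 4 * q2 * (p1 * A1 + p2 * A2) * q ^+ 2 + 4 * q1 * q * (w1 * A1 + w2 * A2) <= ra / eps * (ca * P).
  apply: (le_trans (lerD t7 t9)); rewrite -mulrDr; apply: ler_wpM2l => //.
  have := mulr_ge0 ca0 u0; rewrite /ca /P; generalize u, v, z; clear; move=> u v z; lra.
have Sr1 : eps * J <= r1 / eps * (cr1 * P).
  apply: (le_trans t3); apply: ler_wpM2l => //; apply: ler_wpM2l => //.
  by move: u0 v0 z0; rewrite /P; generalize u, v, z; clear; move=> u v z; lra.
have Sr0 : 4 / eps * q1 * q * rp * (p1 * w2 - p2 * w1) <= r0 / eps ^+ 2 * (cr0 * P).
  apply: (le_trans t11); apply: ler_wpM2l => //; apply: ler_wpM2l => //.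
  by move: u0 v0 z0; rewrite /P; generalize u, v, z; clear; move=> u v z; lra.
pose xa := ra / eps; pose x1 := r1 / eps; pose x0 := r0 / eps ^+ 2.
have fin := assemble_bound c10 ca0 cr10 cr00 ra' r1' r0' P0 Pe.
rewrite -/e; move: (lerD S1 (lerD Sa (lerD Sr1 Sr0))) fin.
move: (c1 * P) (ra / eps * (ca * P)) (r1 / eps * (cr1 * P)) (r0 / eps ^+ 2 * (cr0 * P)).
move: (_ * _ * e) => b; clear => y1 y2 y3 y4; lra.
Qed.

End pointwise_bound.

(** * Residuals and the equation *)

Section L2norm.
Context (R : realType) (d : nat).
Local Notation X := 'rV[R]_d.
Local Notation dx := (leb R d).
Implicit Types (z : X -> R[i]).

Lemma poweR_L2norm z : ((L2norm z) `^ 2 = \int[dx]_x (csqr (z x))%:E)%E.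
Proof.
rewrite /L2norm poweR_Lnorm//; apply: eq_integral => x _.
have -> : (`|(EFin \o cabs z) x| = (cabs z x)%:E)%E by rewrite /= ger0_norm// sqrtr_ge0.
by rewrite poweR_EFin powR_mulrn ?sqrtr_ge0// sqr_sqrtr// csqr_ge0.
Qed.

Lemma L2norm_fin z (r : R) : both (measurable_fun setT) z -> (L2norm z <= r%:E)%E ->
  [/\ L2 dx (fun x => complex.Re (z x)), L2 dx (fun x => complex.Im (z x)),
   nrm dx (fun x => complex.Re (z x)) <= r, nrm dx (fun x => complex.Im (z x)) <= r &
   (L2norm z ^+ 2)%E = (\int[dx]_x (complex.Re (z x) ^+ 2 + complex.Im (z x) ^+ 2))%:E].
Proof.
move=> [m1 m2] zr; pose z1 x := complex.Re (z x); pose z2 x := complex.Im (z x).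
have L0 : (0 <= L2norm z)%E by exact: Lnorm_ge0.
have Lfin : L2norm z \is a fin_num by rewrite ge0_fin_numE// (le_lt_trans zr)// ltry.
pose l := fine (L2norm z); have lE : L2norm z = l%:E by rewrite fineK.
have l0 : 0 <= l by rewrite fine_ge0.
have lr : l <= r by move: zr; rewrite lE lee_fin.
have csE x : csqr (z x) = z1 x ^+ 2 + z2 x ^+ 2 by rewrite csqrE.
have I2 : (\int[dx]_x (z1 x ^+ 2 + z2 x ^+ 2)%:E = (l ^+ 2)%:E)%E.
  under eq_integral do rewrite -csE.
  by rewrite -poweR_L2norm lE poweR_EFin powR_mulrn.
have ms : measurable_fun setT (fun x => z1 x ^+ 2 + z2 x ^+ 2).
  by apply: measurable_funD; apply: measurable_funX.
have Is : L1 dx (fun x => z1 x ^+ 2 + z2 x ^+ 2).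
  apply/integrableP; split; first exact/measurable_EFinP.
  rewrite (eq_integral (fun x => (z1 x ^+ 2 + z2 x ^+ 2)%:E)) ?I2 ?ltry// => x _ /=.
  by rewrite ger0_norm// addr_ge0 ?sqr_ge0.
have R2 : \int[dx]_x (z1 x ^+ 2 + z2 x ^+ 2) = l ^+ 2 by rewrite /Rintegral I2.
have L1z : L2 dx z1.
  split => //; apply: L1_dom Is => [|x]; first exact: measurable_funX.
  by rewrite !ger0_norm ?addr_ge0 ?sqr_ge0// lerDl sqr_ge0.
have L2z : L2 dx z2.
  split => //; apply: L1_dom Is => [|x]; first exact: measurable_funX.
  by rewrite !ger0_norm ?addr_ge0 ?sqr_ge0// lerDr sqr_ge0.
have [_ J1] := L1z; have [_ J2] := L2z.
have := R2; rewrite RintD// -!nrm_sqr => E.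
have r0 := le_trans l0 lr.
split => //.
- apply: (le_trans _ lr); rewrite -(ler_pXn2r (_ : 0 < 2)%N) ?nnegrE ?nrm_ge0//.
  by rewrite -E lerDl sqr_ge0.
- apply: (le_trans _ lr); rewrite -(ler_pXn2r (_ : 0 < 2)%N) ?nnegrE ?nrm_ge0//.
  by rewrite -E lerDr sqr_ge0.
- by rewrite lE -EFin_expe; rewrite -E.
Qed.

End L2norm.

Section residuals.
Context (R : realType) (d : nat) (f : R -> R) (T M : R).
Local Notation X := 'rV[R]_d.
Local Notation dx := (leb R d).
Local Notation e_ i := (delta_mx ord0 i : X).
Implicit Types (i k : 'I_d).
Variables (phi : R -> X -> R) (a : R -> X -> R[i]).
Hypotheses (d0 : (0 < d)%N) (T0 : 0 < T) (Af : assumptionA f)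
  (sphi : smooth_slab T phi) (sa : csmooth_slab T a) (flowM : flow_bound T phi a = M%:E).
Local Notation vel := (vel phi).
Local Notation divv := (divv phi).
Local Notation a1 := (re_part a).
Local Notation a2 := (im_part a).
Local Notation f1 := (f_prime f a).
Local Notation mder := (mder T phi).
Local Notation Rphi := (Rphi f T phi a).

Lemma slab_field_Rphi : slab_field T Rphi.
Proof.
have [M0 _ _ rM] := flow_bounds d0 T0 sphi sa flowM.
have [B [C [B0 C0 BC]]] := nonlinearity_bounds Af M.
rewrite (_ : Rphi = fun s x => dt T phi s x + 2^-1 * (\sum_i vel i s x * vel i s x) + f (rho a s x)).
  apply: slab_fieldD; last first.
    have [_ f0 _ _] := Af.
    apply: (@slab_field_comp _ _ _ f (deriv0y f) _ M (B * M) (deriv0y_sderiv Af)) => //.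
      exact: slab_field_rho sa.
    (* On [0, M] the values of [f] are controlled by f(0) = 0 and f' <= B. *)
    move=> r /andP[r0 rM'].
    have := @sderiv_le R `[(0:R), +oo[%classic f (deriv0y f) B 0 r.
    rewrite f0 !subr0 (ger0_norm r0) => H; apply: (le_trans (H _ _ _)).
    - by move=> y /andP[+ _]; rewrite (min_idPl r0) /= in_itv/= andbT.
    - by move=> y /andP[+ _]; rewrite (min_idPl r0); exact: deriv0y_sderiv.
    - move=> y; rewrite (min_idPl r0) (max_idPr r0) => /andP[y0 yr].
      have [|/andP[h0 h1] _ _] := BC y; first by rewrite y0 (le_trans yr).
      by rewrite ger0_norm.
    - by rewrite ler_wpM2l.
  apply: slab_fieldD; first exact: slab_field_smooth (smooth_slab_dt sphi).
  apply: slab_fieldM; first exact: slab_field_cst.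
  by apply: slab_field_sum => i; apply: slab_fieldM; exact: slab_field_vel.
by apply/funext => s; apply/funext => x.
Qed.

(** An explicit gradient of R_phi in terms of continuous fields, so that its almost everywhere bound
    becomes a pointwise one. *)
Definition dRphi i s x := partial i (dt T phi s) x + \sum_k vel k s x * dvel phi i k s x
  + f1 s x * (2 * (a1 s x * partial i (a1 s) x + a2 s x * partial i (a2 s) x)).

Lemma slab_field_dRphi i : slab_field T (dRphi i).
Proof.
have Fa1 := slab_field_smooth sa.1; have Fa2 := slab_field_smooth sa.2.
have Fp1 := slab_field_smooth (smooth_slab_partial i sa.1).
have Fp2 := slab_field_smooth (smooth_slab_partial i sa.2).
apply: slab_fieldD; first apply: slab_fieldD.
- exact: slab_field_smooth (smooth_slab_partial i (smooth_slab_dt sphi)).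
- by apply: slab_field_sum => k; apply: slab_fieldM; [exact: slab_field_vel | exact: slab_field_dvel].
- apply: slab_fieldM; first exact: slab_field_f1 d0 T0 Af sphi sa flowM.
  apply: slab_fieldM; first exact: slab_field_cst.
  by apply: slab_fieldD; exact: slab_fieldM.
Qed.

Lemma Rphi_space i s : s \in `[0, T] -> diff_along i (Rphi s) (dRphi i s).
Proof.
move=> sT x r; apply: sderivD; first apply: sderivD.
- exact: (@slab_diff_along _ _ T (dt T phi) i s (smooth_slab_dt sphi 1%N) sT x r).
- have H k := @slab_diff_along _ _ T (vel k) i s (smooth_slab_partial k sphi 1%N) sT x r.
  have := sderivZ 2^-1 (@sderiv_sum R setT _ (index_enum _) xpredT _ _ r (fun k _ => sderivM (H k) (H k))).
  have <- : \sum_k vel k s (x + r *: e_ i) * dvel phi i k s (x + r *: e_ i) =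
    2^-1 * \sum_k (partial i (vel k s) (x + r *: e_ i) * vel k s (x + r *: e_ i)
      + vel k s (x + r *: e_ i) * partial i (vel k s) (x + r *: e_ i)).
    rewrite mulr_sumr; apply: eq_bigr => k _; by rewrite -/(dvel phi i k s (x + r *: e_ i)); field.
  by apply: sderiv_ext.
- exact: (@sderiv_comp R _ `[(0:R), +oo[%classic f (fun q => rho a s (x + q *: e_ i)) r _ _
    (fun q _ => rho_half a s (x + q *: e_ i)) (deriv0y_sderiv Af (csqr_ge0 _)) (@rho_space _ _ _ _ sa i s sT x r)).
Qed.

Lemma Rphi_bd s (B : R) : s \in `[0, T] -> (Linfty (Rphi s) <= B%:E)%E -> forall x, `|Rphi s x| <= B.
Proof. by move=> sT; apply: Linfty_le => //; have [] := slab_field_Rphi sT. Qed.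

Let norm_continuous_comp (g : X -> R) : continuous g -> continuous (fun x => `|g x|).
Proof. by move=> cg x; apply: continuous_comp; [exact: cg | exact: norm_continuous]. Qed.

Lemma dRphi_bd s (B : R) : s \in `[0, T] -> (Linfty (grad_norm (Rphi s)) <= B%:E)%E ->
  forall i x, `|dRphi i s x| <= B.
Proof.
move=> sT /(Linfty_ae d0) H i.
apply: (@ae_continuous_le _ _ (fun x => `|dRphi i s x|)).
  by apply: norm_continuous_comp; have [] := slab_field_dRphi i sT.
apply: ae_imp H => x; apply: le_trans; rewrite [leRHS]ger0_norm ?sqrtr_ge0//.
rewrite -(diff_along_partial (@Rphi_space i s sT)).
exact: (@sqrt_ge_term R _ (fun i => partial i (Rphi s) x)).
Qed.

Lemma Ra_bd s (B : R) : s \in `[0, T] -> (Linfty (cabs (Ra T phi a s)) <= B%:E)%E ->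
  forall x, `|complex.Re (Ra T phi a s x)| <= B /\ `|complex.Im (Ra T phi a s x)| <= B.
Proof.
move=> sT /(Linfty_ae d0) H.
have F (b : R -> X -> R) : smooth_slab T b ->
    continuous (fun x => `|mder b s x + 2^-1 * b s x * divv s x|).
  move=> sb; apply: norm_continuous_comp.
  suff /(_ s sT)[] : slab_field T (fun s x => mder b s x + 2^-1 * b s x * divv s x) by [].
  apply: slab_fieldD; first exact: slab_field_mder.
  apply: slab_fieldM; last exact: slab_field_divv.
  by apply: slab_fieldM; [exact: slab_field_cst | exact: slab_field_smooth].
move=> x; split.
  move: x; apply: (@ae_continuous_le _ _ (fun x => `|complex.Re (Ra T phi a s x)|)).
    by under eq_fun do rewrite mder_Re; exact: F sa.1.
  apply: ae_imp H => x; apply: le_trans; rewrite [leRHS]ger0_norm ?sqrtr_ge0//.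
  exact: Re_le_cabs.
move: x; apply: (@ae_continuous_le _ _ (fun x => `|complex.Im (Ra T phi a s x)|)).
  by under eq_fun do rewrite mder_Im; exact: F sa.2.
apply: ae_imp H => x; apply: le_trans; rewrite [leRHS]ger0_norm ?sqrtr_ge0//.
exact: Im_le_cabs.
Qed.

End residuals.

(** * Real and imaginary parts of the solution and of the equation *)

Section components.
Context (R : realType) (d : nat).
Local Notation X := 'rV[R]_d.
Local Notation dx := (leb R d).
Local Notation wp := (@weak_partial R d).
Implicit Types (i : 'I_d) (z : X -> R[i]).

Lemma sobolev_sqnorm_ge0 k (g : X -> R) : (0 <= sobolev_sqnorm k g)%E.
Proof.
elim: k g => [|k IH] g /=; rewrite adde_ge0//.
- by apply: integral_ge0 => x _; rewrite lee_fin sqr_ge0.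
- by apply: integral_ge0 => x _; rewrite lee_fin sqr_ge0.
- by apply: sume_ge0 => i _; exact: IH.
Qed.

Lemma ecvg0_le (G : set_system R) (FG : Filter G) (u v : R -> \bar R) : (forall s, (0 <= u s <= v s)%E) ->
  v @ G --> (0 : \bar R)%E -> u @ G --> (0 : \bar R)%E.
Proof.
move=> uv cv; apply: (@squeeze_cvge _ _ _ _ (fun=> 0%E) u v) => //; last exact: cvg_cst.
by apply: nearW.
Qed.

(** One statement for both parts: the squared Sobolev norm of each is a summand of that of the
    complex function, so the limits descend to it. *)
Lemma C1_H2_components T (w w' : R -> X -> R[i]) : C1_H2 T w w' ->
  forall p : R[i] -> R, (p = @complex.Re R \/ p = @complex.Im R) ->
  let g s x := p (w s x) in let g' s x := p (w' s x) in
  [/\ path_diff T g g',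
     forall i, path_diff T (fun t => wp i (g t)) (fun t => wp i (g' t)),
     forall i j, path_diff T (fun t => wp j (wp i (g t))) (fun t => wp j (wp i (g' t))),
     forall t, t \in `[0, T] -> sobolev 2 (g t) /\ sobolev 2 (g' t) &
     forall t (s : nat -> R), t \in `[0, T] -> (forall n, s n \in `[0, T]) -> s @ \oo --> t ->
       cvL2 dx (fun n => g' (s n)) (g' t)].
Proof.
move=> [H1 H2 H3] p pRI g g'.
have Hg t : t \in `[0, T] -> sobolev 2 (g t) /\ sobolev 2 (g' t).
  by move=> /H1[[h1 h2] [h3 h4]]; rewrite /g /g'; case: pRI => ->.
have pE (c : R) (z1 z2 z3 : R[i]) : p (c%:C%C * (z1 - z2) - z3) = c * (p z1 - p z2) - p z3.
  by case: pRI => ->; case: z1 z2 z3 => [? ?] [? ?] [? ?] /=; ring.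
have pB (z1 z2 : R[i]) : p (z1 - z2) = p z1 - p z2.
  by case: pRI => ->; case: z1 z2 => [? ?] [? ?].
have le z : (0 <= sobolev_sqnorm 2 (fun x => p (z x)) <= H2_sqnorm z)%E.
  rewrite sobolev_sqnorm_ge0/= /H2_sqnorm; case: pRI => ->.
    by rewrite leeDl// sobolev_sqnorm_ge0.
  by rewrite leeDr// sobolev_sqnorm_ge0.
have Hq t : t \in `[0, T] -> sobolev_sqnorm 2 (fun x => (s - t)^-1 * (g s x - g t x) - g' t x)
          @[s --> within `[0, T] t^'] --> (0 : \bar R)%E.
  move=> tT; apply: ecvg0_le (H2 t tT) => s.
  have := le (fun x => ((s - t)^-1)%:C%C * (w s x - w t x) - w' t x).
  rewrite (_ : (fun x => p _) = fun x => (s - t)^-1 * (g s x - g t x) - g' t x)//.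
  by apply/funext => x; rewrite pE.
have Hc t : t \in `[0, T] -> sobolev_sqnorm 2 (fun x => g' s x - g' t x)
          @[s --> within `[0, T] (nbhs t)] --> (0 : \bar R)%E.
  move=> tT; apply: ecvg0_le (H3 t tT) => s.
  have := le (fun x => w' s x - w' t x).
  rewrite (_ : (fun x => p _) = fun x => g' s x - g' t x)//.
  by apply/funext => x; rewrite pB.
have [P1 P2 P3] := C1_H2_path_diff Hg Hq.
split => // t s tT sT cs; exact: (path_cont' Hg Hc tT sT cs).
Qed.

Lemma Re_wlaplacian z x : complex.Re (wlaplacian z x) =
  \sum_i wp i (wp i (fun y => complex.Re (z y))) x.
Proof. by rewrite /wlaplacian Re_sum. Qed.

Lemma Im_wlaplacian z x : complex.Im (wlaplacian z x) =
  \sum_i wp i (wp i (fun y => complex.Im (z y))) x.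
Proof. by rewrite /wlaplacian Im_sum. Qed.

Lemma Lop_algebra (eps lap fp r : R) (Z l v v' g b : R[i]) :
  'i%C * eps%:C%C * v' + ((eps ^+ 2 / 2)%:C%C * l + 'i%C * eps%:C%C * Z
    + 'i%C * (eps / 2)%:C%C * v * lap%:C%C - (2 * fp * cdot v b)%:C%C * b) = r%:C%C * v + g ->
  - (eps * (complex.Im v' + complex.Im Z)) + eps ^+ 2 / 2 * complex.Re l - eps / 2 * complex.Im v * lap
    - 2 * fp * cdot v b * complex.Re b = r * complex.Re v + complex.Re g /\
  eps * (complex.Re v' + complex.Re Z) + eps ^+ 2 / 2 * complex.Im l + eps / 2 * complex.Re v * lap
    - 2 * fp * cdot v b * complex.Im b = r * complex.Im v + complex.Im g.
Proof.
move: (cdot v b) => q.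
case: Z l v v' g b => [Z1 Z2] [l1 l2] [v1 v2] [v1' v2'] [g1 g2] [b1 b2] /=.
move=> /eqP; rewrite eq_complex /= => /andP[/eqP e1 /eqP e2]; split; lra.
Qed.

Lemma Lop_components (f : R -> R) (eps : R) (phi : X -> R) (a w w' F : X -> R[i]) (r : R) x :
  let w1 y := complex.Re (w y) in let w2 y := complex.Im (w y) in
  let q := w1 x * complex.Re (a x) + w2 x * complex.Im (a x) in
  'i%C * eps%:C%C * w' x + Lop f eps phi a w x = r%:C%C * w x + F x ->
  - (eps * (complex.Im (w' x) + \sum_i partial i phi x * wp i w2 x))
    + eps ^+ 2 / 2 * (\sum_i wp i (wp i w1) x) - eps / 2 * w2 x * laplacian phi x
    - 2 * deriv0y f (csqr (a x)) * q * complex.Re (a x) = r * w1 x + complex.Re (F x) /\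
  eps * (complex.Re (w' x) + \sum_i partial i phi x * wp i w1 x)
    + eps ^+ 2 / 2 * (\sum_i wp i (wp i w2) x) + eps / 2 * w1 x * laplacian phi x
    - 2 * deriv0y f (csqr (a x)) * q * complex.Im (a x) = r * w2 x + complex.Im (F x).
Proof.
move=> w1 w2 q /Lop_algebra.
rewrite Re_wlaplacian Im_wlaplacian cdotE Re_sum Im_sum => -[e1 e2]; split.
- rewrite -e1; congr (- (_ * (_ + _)) + _ - _ - _).
  by apply: eq_bigr => i _ /=; rewrite mul0r addr0.
- rewrite -e2; congr (_ * (_ + _) + _ + _ - _).
  by apply: eq_bigr => i _ /=; rewrite mul0r subr0.
Qed.

End components.

Section L2_bounded.
Context d (Y : measurableType d) (R : realType) (mu : {measure set Y -> \bar R}).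
Implicit Types (g h b : Y -> R).

Definition L2le g (C : R) := L2 mu g /\ nrm mu g <= C.

Lemma L2leD g h C D : L2le g C -> L2le h D -> L2le (fun x => g x + h x) (C + D).
Proof.
move=> [Lg gC] [Lh hD]; split; first exact: L2D.
by apply: (le_trans (nrmD Lg Lh)); exact: lerD.
Qed.

Lemma L2le_bM g b (B C : R) : measurable_fun setT b -> (forall x, `|b x| <= B) -> 0 <= B ->
  L2le g C -> L2le (fun x => b x * g x) (B * C).
Proof.
move=> mb bB B0 [Lg gC]; split; first exact: L2_bM bB Lg.
by apply: (le_trans (nrm_bM B0 mb bB Lg)); exact: ler_wpM2l.
Qed.

Lemma L2leZ g k C : L2le g C -> L2le (fun x => k * g x) (`|k| * C).
Proof.
move=> [Lg gC]; split; first exact: L2Z.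
by rewrite nrmZ//; exact: ler_wpM2l.
Qed.

Lemma L2le_ae g h C : measurable_fun setT h -> {ae mu, forall x, g x = h x} ->
  L2le g C -> L2le h C.
Proof.
move=> mh gh [Lg gC]; split; first exact: L2_ae gh Lg.
by rewrite -(nrm_ae (L2_meas Lg) mh gh).
Qed.

End L2_bounded.

(** * Control of the transport term through the equation *)

Section solution.
Context (R : realType) (d : nat) (f : R -> R) (M eps T : R).
Local Notation X := 'rV[R]_d.
Local Notation dx := (leb R d).
Local Notation wp := (@weak_partial R d).
Implicit Types (i k : 'I_d) (s : R).
Variables (phi : R -> X -> R) (a w w' F : R -> X -> R[i]) (t0 : R).
Hypotheses (d0 : (0 < d)%N) (Af : assumptionA f) (eps01 : 0 < eps <= 1) (T0 : 0 < T)
  (sphi : smooth_slab T phi) (sa : csmooth_slab T a) (flowM : flow_bound T phi a = M%:E)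
  (wC : C1_H2 T w w')
  (mF : forall t : R, t \in `[0, T] -> both (measurable_fun setT) (F t))
  (eqn : forall t : R, t \in `[0, T] -> {ae leb R d, forall x,
        'i%C * eps%:C%C * w' t x + Lop f eps (phi t) (a t) (w t) x
        = (Rphi f T phi a t x)%:C%C * w t x + F t x})
  (t0T : t0 \in `[0, T])
  (bRa : bounded_near_time T (fun s => Linfty (cabs (Ra T phi a s))) t0)
  (bRphi : bounded_near_time T (fun s => W1infty (Rphi f T phi a s)) t0)
  (bF : bounded_near_time T (fun s => L2norm (F s)) t0).
Local Notation vel := (vel phi).
Local Notation divv := (divv phi).
Local Notation a1 := (re_part a).
Local Notation a2 := (im_part a).
Local Notation w1 := (re_part w).
Local Notation w2 := (im_part w).
Local Notation w1' := (re_part w').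
Local Notation w2' := (im_part w').
Local Notation F1 := (re_part F).
Local Notation F2 := (im_part F).
Local Notation f1 := (f_prime f a).
Local Notation mder := (mder T phi).
Local Notation Rp := (Rphi f T phi a).
Local Notation grad v := (fun i s => wp i (v s)).
Local Notation lap v := (fun s x => \sum_i wp i (wp i (v s)) x).
Local Notation aadv v := (fun s x => \sum_i vel i s x * wp i (v s) x).

Let e0 : 0 < eps. Proof. by case/andP: eps01. Qed.

Lemma equation_components s : s \in `[0, T] -> {ae dx, forall x,
  let q := w1 s x * a1 s x + w2 s x * a2 s x in
  - (eps * (w2' s x + aadv w2 s x)) + eps ^+ 2 / 2 * lap w1 s x - eps / 2 * w2 s x * divv s x
    - 2 * f1 s x * q * a1 s x = Rp s x * w1 s x + F1 s x /\
  eps * (w1' s x + aadv w1 s x) + eps ^+ 2 / 2 * lap w2 s x + eps / 2 * w1 s x * divv s x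
    - 2 * f1 s x * q * a2 s x = Rp s x * w2 s x + F2 s x}.
Proof. by move=> sT; apply: ae_imp (eqn sT) => x H; exact: (Lop_components H). Qed.

Let C1 := C1_H2_components wC (or_introl erefl).
Let C2 := C1_H2_components wC (or_intror erefl).

Lemma aadv_meas (v : R -> X -> R) s : s \in `[0, T] -> sobolev 2 (v s) -> measurable_fun setT (aadv v s).
Proof.
move=> sT /sobolev2P[_ H]; apply: measurable_sum => i; apply: measurable_funM.
  exact: slab_field_meas (slab_field_vel sphi i) sT.
by have [_ /L2_meas] := H i.
Qed.

(** The shape of the equation divided by [eps] and solved for the transport of [v]: bounded
    coefficients times the two parts of w, plus multiples of the source, of the time derivative and
    of a Laplacian, all in L2. *)
Lemma aadv_L2le (v : R -> X -> R) s (b1 b2 v1 v2 G v' L : X -> R) (B k1 k2 k3 c1 c2 c3 c4 c5 : R) :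
  s \in `[0, T] -> sobolev 2 (v s) -> measurable_fun setT b1 -> measurable_fun setT b2 ->
  (forall x, `|b1 x| <= B) -> (forall x, `|b2 x| <= B) ->
  {ae dx, forall x, b1 x * v1 x + b2 x * v2 x + k1 * G x + k2 * v' x + k3 * L x = aadv v s x} ->
  L2le dx v1 c1 -> L2le dx v2 c2 -> L2le dx G c3 -> L2le dx v' c4 -> L2le dx L c5 ->
  L2le dx (aadv v s) (B * c1 + B * c2 + `|k1| * c3 + `|k2| * c4 + `|k3| * c5).
Proof.
move=> sT sv mb1 mb2 bB1 bB2 E h1 h2 h3 h4 h5.
have B0 : 0 <= B := le_trans (normr_ge0 _) (bB1 0).
apply: (L2le_ae (aadv_meas sT sv) E).
by apply: L2leD (L2leZ k3 h5); apply: L2leD (L2leZ k2 h4); apply: L2leD (L2leZ k1 h3);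
  apply: L2leD; exact: L2le_bM.
Qed.

Lemma path_L2le (v : R -> X -> R) : (forall s, s \in `[0, T] -> L2 dx (v s)) ->
  (forall s : nat -> R, (forall n, s n \in `[0, T]) -> s @ \oo --> t0 -> cvL2 dx (fun n => v (s n)) (v t0)) ->
  exists dl C : R, 0 < dl /\ forall s, near_time T t0 dl s -> L2le dx (v s) C.
Proof.
move=> Lv cv; have [e e_gt0 H] := @path_bounded_near R d T v t0 t0T cv.
by exists e, (nrm dx (v t0) + 1); split => // s [sT st]; split; [exact: Lv | exact: H].
Qed.

Lemma near_timeS (dl dl' : R) : dl <= dl' -> near_time T t0 dl `<=` near_time T t0 dl'.
Proof. by move=> le s [sT st]; split => //; exact: lt_le_trans le. Qed.

(* As [vel] grows linearly, that [vel . grad w] is in L2 can only be read off the equation. *)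
Lemma near_transported : exists dl D B1 B2 : R, [/\ 0 < dl,
  forall s x, near_time T t0 dl s -> `|mder a1 s x| <= D,
  forall s x, near_time T t0 dl s -> `|mder a2 s x| <= D,
  transported T t0 dl vel w1 w1' (grad w1) B1 & transported T t0 dl vel w2 w2' (grad w2) B2].
Proof.
have [M0 _ _ rM] := flow_bounds d0 T0 sphi sa flowM.
have [Bf [Cf [B0 C0 BC]]] := nonlinearity_bounds Af M.
have f1B s x : s \in `[0, T] -> `|f1 s x| <= Bf.
  by move=> sT; have [/andP[h0 h1] _ _] := BC _ (rM s x sT); rewrite ger0_norm.
have a1B := a1_bd d0 T0 sphi sa flowM; have a2B := a2_bd d0 T0 sphi sa flowM.
have dvB := divv_bd d0 T0 sphi sa flowM.
have [P1 Q1 S1 H1 cc1] := C1; have [P2 Q2 S2 H2 cc2] := C2.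
have [da [ra [da0 raN]]] := bounded_near_timeP bRa.
have [dp [rp [dp0 rpN]]] := bounded_near_timeP bRphi.
have [dF [rF [dF0 rFN]]] := bounded_near_timeP bF.
have Lp (v v' : R -> X -> R) s : path_diff T v v' -> s \in `[0, T] -> L2 dx (v s).
  by move=> P /P[].
have Lp' (v v' : R -> X -> R) s : path_diff T v v' -> s \in `[0, T] -> L2 dx (v' s).
  by move=> P /P[].
have pc (v v' : R -> X -> R) : path_diff T v v' -> forall s : nat -> R, (forall n, s n \in `[0, T]) ->
    s @ \oo --> t0 -> cvL2 dx (fun n => v (s n)) (v t0).
  by move=> P s sT cs; exact: (path_diff_cont P t0T sT cs).
have [l1 [c1 [l10 N1]]] := path_L2le (fun s => Lp _ _ s P1) (pc _ _ P1).
have [l2 [c2 [l20 N2]]] := path_L2le (fun s => Lp _ _ s P2) (pc _ _ P2).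
have [l3 [c3 [l30 N3]]] := path_L2le (fun s => Lp' _ _ s P1) (fun s : nat -> R => cc1 t0 s t0T).
have [l4 [c4 [l40 N4]]] := path_L2le (fun s => Lp' _ _ s P2) (fun s : nat -> R => cc2 t0 s t0T).
have [l5 [c5 [l50 N5]]] := @path_L2le (lap w1)
  (fun s sT => L2_sum (index_enum _) (fun i _ => Lp _ _ s (S1 i i) sT))
  (fun (s : nat -> R) sT cs => cvL2_sum (index_enum _) (fun i _ => pc _ _ (S1 i i) s sT cs)).
have [l6 [c6 [l60 N6]]] := @path_L2le (lap w2)
  (fun s sT => L2_sum (index_enum _) (fun i _ => Lp _ _ s (S2 i i) sT))
  (fun (s : nat -> R) sT cs => cvL2_sum (index_enum _) (fun i _ => pc _ _ (S2 i i) s sT cs)).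
pose dl := Num.min (Num.min (Num.min da dp) (Num.min dF l1)) (Num.min (Num.min l2 l3) (Num.min l4 (Num.min l5 l6))).
have dl0 : 0 < dl by rewrite !lt_min da0 dp0 dF0 l10 l20 l30 l40 l50 l60.
have dlP : [/\ dl <= da, dl <= dp, dl <= dF, dl <= l1 & [/\ dl <= l2, dl <= l3, dl <= l4, dl <= l5 & dl <= l6]].
  by rewrite /dl !ge_min !lexx ?orbT.
have [{}/near_timeS raS {}/near_timeS rpS {}/near_timeS rFS {}/near_timeS s1
  [{}/near_timeS s2 {}/near_timeS s3 {}/near_timeS s4 {}/near_timeS s5 {}/near_timeS s6]] := dlP.
have NT s : near_time T t0 dl s -> s \in `[0, T] by case.
(* From D a = R_a - a div u / 2, with parts of a at most M + 1 and |div u| at most d M. *)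
pose D := `|ra| + 2^-1 * (M + 1) * (d%:R * M).
have A0 : 0 <= M + 1 by rewrite addr_ge0.
have D1 s x : near_time T t0 dl s -> `|mder a1 s x| <= D.
  move=> Ns; have sT := NT s Ns.
  have [h _] := Ra_bd d0 sphi sa sT (raN s (raS s Ns)) x.
  rewrite mder_Re in h.
  have -> : mder a1 s x = (mder a1 s x + 2^-1 * a1 s x * divv s x) - 2^-1 * a1 s x * divv s x by ring.
  apply: (le_trans (ler_normB _ _)); apply: lerD; first exact: le_trans (ler_norm _).
  rewrite !normrM ger0_norm// ler_pM ?mulr_ge0//; last exact: dvB.
  by rewrite ler_wpM2l//; exact: a1B.
have D2 s x : near_time T t0 dl s -> `|mder a2 s x| <= D.
  move=> Ns; have sT := NT s Ns.
  have [_ h] := Ra_bd d0 sphi sa sT (raN s (raS s Ns)) x.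
  rewrite mder_Im in h.
  have -> : mder a2 s x = (mder a2 s x + 2^-1 * a2 s x * divv s x) - 2^-1 * a2 s x * divv s x by ring.
  apply: (le_trans (ler_normB _ _)); apply: lerD; first exact: le_trans (ler_norm _).
  rewrite !normrM ger0_norm// ler_pM ?mulr_ge0//; last exact: dvB.
  by rewrite ler_wpM2l//; exact: a2B.
have RpB s x : near_time T t0 dl s -> `|Rp s x| <= rp.
  move=> Ns; apply: (Rphi_bd d0 T0 Af sphi sa flowM (NT s Ns)).
  apply: le_trans (rpN s (rpS s Ns)); rewrite /W1infty leeDl//; exact: Lnorm_ge0.
(* A common bound for the coefficients of both parts of w after division by [eps]. Its dependence on
   [eps] is harmless, as it only serves convergence in time. *)
pose Bb := (2 * Bf * (M + 1) * (M + 1) + rp) / eps + d%:R * M.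
have coef (s x1 x2 x3 : R) x (n : R) : `|n| <= 1 -> near_time T t0 dl s -> `|x1| <= M + 1 -> `|x2| <= M + 1 ->
    `|n * ((2 * f1 s x * x1 * x2 + x3 * Rp s x) / eps)|
      <= (2 * Bf * (M + 1) * (M + 1) + `|x3| * rp) / eps.
  move=> n1_ Ns h1 h2; have sT := NT s Ns; rewrite normrM.
  apply: (le_trans (ler_wpM2r _ n1_)) => //; rewrite mul1r normrM normfV (gtr0_norm e0).
  rewrite ler_pM2r ?invr_gt0//; apply: (le_trans (ler_normD _ _)); apply: lerD.
    rewrite normrM ler_pM// normrM ler_pM// normrM ger0_norm// ler_wpM2l//; exact: f1B.
  by rewrite normrM ler_wpM2l//; exact: RpB.
have rp0 : 0 <= rp by apply: le_trans (RpB t0 0 _) => //; split; rewrite ?subrr ?normr0.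
have cA (s : R) x (n : R) : `|n| <= 1 -> near_time T t0 dl s ->
    `|n * ((2 * f1 s x * a1 s x * a2 s x) / eps) - divv s x / 2| <= Bb.
  move=> hn Ns; have sT := NT s Ns.
  apply: (le_trans (ler_normB _ _)); apply: lerD.
    have := coef s (a1 s x) (a2 s x) 0 x n hn Ns (a1B s x sT) (a2B s x sT).
    rewrite mul0r addr0 normr0 mul0r addr0 => /le_trans; apply.
    by rewrite ler_pM2r ?invr_gt0// lerDl.
  have h := dvB s x sT; rewrite normrM normfV [`|2|]ger0_norm// ler_pdivrMr//.
  by have := mulr_ge0 (ler0n R d) M0; lra.
have cB (s : R) x (n v : R) : `|n| <= 1 -> near_time T t0 dl s -> `|v| <= M + 1 ->
    `|n * ((2 * f1 s x * v * v + Rp s x) / eps)| <= Bb.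
  move=> hn Ns hv; have := coef s v v 1 x n hn Ns hv hv.
  rewrite mul1r normr1 mul1r => /le_trans; apply.
  by rewrite lerDl mulr_ge0.
have m1 s (Ns : near_time T t0 dl s) := slab_field_meas (slab_field_f1 d0 T0 Af sphi sa flowM) (NT s Ns).
have ma1 s (Ns : near_time T t0 dl s) := slab_field_meas (slab_field_smooth sa.1) (NT s Ns).
have ma2 s (Ns : near_time T t0 dl s) := slab_field_meas (slab_field_smooth sa.2) (NT s Ns).
have md s (Ns : near_time T t0 dl s) := slab_field_meas (slab_field_divv sphi) (NT s Ns).
have mR s (Ns : near_time T t0 dl s) := slab_field_meas (slab_field_Rphi d0 T0 Af sphi sa flowM) (NT s Ns).
have mA (n : R) s : near_time T t0 dl s ->
    measurable_fun setT (fun x => n * ((2 * f1 s x * a1 s x * a2 s x) / eps) - divv s x / 2).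
  move=> Ns; apply: measurable_funB; last by apply: measurable_funM => //; exact: md.
  apply: measurable_funM => //; apply: measurable_funM => //.
  by do 2 (apply: measurable_funM; last by [exact: ma1|exact: ma2]); apply: measurable_funM => //; exact: m1.
have mB (n : R) (v : R -> X -> R) s : near_time T t0 dl s -> measurable_fun setT (v s) ->
    measurable_fun setT (fun x => n * ((2 * f1 s x * v s x * v s x + Rp s x) / eps)).
  move=> Ns mv; apply: measurable_funM => //; apply: measurable_funM => //.
  apply: measurable_funD; last exact: mR.
  by do 2 (apply: measurable_funM => //); apply: measurable_funM => //; exact: m1.
have en0 : eps != 0 by rewrite gt_eqF.
have n1_ : `|1 : R| <= 1 by rewrite normr1.
have nN1 : `|-1 : R| <= 1 by rewrite normrN1.
have LF s : near_time T t0 dl s -> L2le dx (F1 s) rF /\ L2le dx (F2 s) rF.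
  by move=> Ns; have [? ? ? ? _] := L2norm_fin (mF (NT s Ns)) (rFN s (rFS s Ns)).
(* The imaginary part of the equation solved for the transport of the real part of w; [adv2] uses
   the real part in the same way. *)
have adv1 s : near_time T t0 dl s -> L2le dx (aadv w1 s)
    (Bb * c1 + Bb * c2 + `|eps^-1| * rF + `|-1| * c3 + `|- eps / 2| * c6).
  move=> Ns; have sT := NT s Ns; have [_ LF2] := LF s Ns.
  apply: (aadv_L2le sT (H1 s sT).1 (mA 1 s Ns) (mB 1 a2 s Ns (ma2 s Ns)) (fun x => cA s x 1 n1_ Ns)
    (fun x => cB s x 1 (a2 s x) n1_ Ns (a2B s x sT)) _ (N1 s (s1 s Ns)) (N2 s (s2 s Ns)) LF2
    (N3 s (s3 s Ns)) (N6 s (s6 s Ns))).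
  apply: ae_imp (equation_components sT) => x [_ E].
  apply: (mulfI en0); apply: (addrI (eps * w1' s x)); rewrite -[RHS]mulrDr.
  have -> : eps * (w1' s x + aadv w1 s x) = Rp s x * w2 s x + F2 s x - (eps ^+ 2 / 2 * lap w2 s x
    + eps / 2 * w1 s x * divv s x - 2 * f1 s x * (w1 s x * a1 s x + w2 s x * a2 s x) * a2 s x) by rewrite -E; ring.
  by field.
have adv2 s : near_time T t0 dl s -> L2le dx (aadv w2 s)
    (Bb * c1 + Bb * c2 + `|- eps^-1| * rF + `|-1| * c4 + `|eps / 2| * c5).
  move=> Ns; have sT := NT s Ns; have [LF1 _] := LF s Ns.
  apply: (aadv_L2le sT (H2 s sT).1 (mB (-1) a1 s Ns (ma1 s Ns)) (mA (-1) s Ns)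
    (fun x => cB s x (-1) (a1 s x) nN1 Ns (a1B s x sT)) (fun x => cA s x (-1) nN1 Ns)
    _ (N1 s (s1 s Ns)) (N2 s (s2 s Ns)) LF1 (N4 s (s4 s Ns)) (N5 s (s5 s Ns))).
  apply: ae_imp (equation_components sT) => x [E _].
  apply: (mulfI en0); apply: (addrI (eps * w2' s x)); rewrite -[RHS]mulrDr.
  have -> : eps * (w2' s x + aadv w2 s x) = - (Rp s x * w1 s x + F1 s x) + (eps ^+ 2 / 2 * lap w1 s x
    - eps / 2 * w2 s x * divv s x - 2 * f1 s x * (w1 s x * a1 s x + w2 s x * a2 s x) * a1 s x) by rewrite -E; ring.
  by field.
have cvN (s : nat -> R) : (forall n, near_time T t0 dl (s n)) -> forall n, s n \in `[0, T].
  by move=> Ns n; exact: NT.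
exists dl, D.
exists (Bb * c1 + Bb * c2 + `|eps^-1| * rF + `|-1| * c3 + `|- eps / 2| * c6).
exists (Bb * c1 + Bb * c2 + `|- eps^-1| * rF + `|-1| * c4 + `|eps / 2| * c5).
split => //.
- split => //.
  + by move=> s Ns; exact: cc1 t0 s t0T (cvN s Ns).
  + by move=> i s /NT/H1[/sobolev2P[_ /(_ i)[]]].
  + by move=> i s Ns; exact: pc _ _ (Q1 i) s (cvN s Ns).
  + by move=> i s /NT/H1[/sobolev2P[_ /(_ i)[]]].
  + by move=> s /adv1[].
  + by move=> s /adv1[].
- split => //.
  + by move=> s Ns; exact: cc2 t0 s t0T (cvN s Ns).
  + by move=> i s /NT/H2[/sobolev2P[_ /(_ i)[]]].
  + by move=> i s Ns; exact: pc _ _ (Q2 i) s (cvN s Ns).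
  + by move=> i s /NT/H2[/sobolev2P[_ /(_ i)[]]].
  + by move=> s /adv2[].
  + by move=> s /adv2[].
Qed.

End solution.

(** * The energy estimate *)

Section energy_derivative.
Context (R : realType) (d : nat) (f : R -> R) (K M eps T : R).
Local Notation X := 'rV[R]_d.
Local Notation dx := (leb R d).
Local Notation wp := (@weak_partial R d).
Implicit Types (i k : 'I_d) (s : R).

Lemma path_sqr_sderiv (v v' : R -> X -> R) t : path_diff T v v' -> t \in `[0, T] ->
  sderiv `[0, T]%classic (fun s => \int[dx]_x (v s x ^+ 2)) t (2 * \int[dx]_x (v t x * v' t x)).
Proof.
move=> P tT s sT st cs.
have [Lv Lv' /(_ s sT st cs) q] := P t tT.
have c1 := cvL2_I q (path_diff_cont P tT sT cs).
have c2 := cvL2_I q (cvL2_cst Lv).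
have := scvgD c1 c2; apply: cvg_eq => [n|]; last first.
  by rewrite mulr_natl mulr2n; congr (_ + _); apply: eq_Rintegral => x _; rewrite mulrC.
have [Ln _ _] := P _ (sT n); have Lq := cvL2_L2 n q.
rewrite -RintD; [|exact: L2M|exact: L2M].
have [_ I1] := Ln; have [_ I2] := Lv.
rewrite -RintB// [RHS]mulrC -RintZ; last exact: L1B.
by apply: eq_Rintegral => x _; field; rewrite subr_eq0.
Qed.

Variables (phi : R -> X -> R) (a w w' : R -> X -> R[i]) (t0 : R).
Hypotheses (d0 : (0 < d)%N) (Af : assumptionA f) (T0 : 0 < T)
  (sphi : smooth_slab T phi) (sa : csmooth_slab T a) (flowM : flow_bound T phi a = M%:E)
  (wC : C1_H2 T w w') (t0T : t0 \in `[0, T]).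
Local Notation a1 := (re_part a).
Local Notation a2 := (im_part a).
Local Notation w1 := (re_part w).
Local Notation w2 := (im_part w).
Local Notation w1' := (re_part w').
Local Notation w2' := (im_part w').
Local Notation f1 := (f_prime f a).
Local Notation mder := (mder T phi).
Local Notation grad v := (fun i s => wp i (v s)).
Local Notation aadv v := (fun s x => \sum_i vel phi i s x * wp i (v s) x).

Let C1 := C1_H2_components wC (or_introl erefl).
Let C2 := C1_H2_components wC (or_intror erefl).

Local Notation form b c g h := (fun s => \int[dx]_x (f1 s x * b s x * c s x * g s x * h s x)).

Lemma energy_integrable s : s \in `[0, T] ->
  [/\ forall i, L1 dx (fun x => wp i (w1 s) x ^+ 2), forall i, L1 dx (fun x => wp i (w2 s) x ^+ 2),
   L1 dx (fun x => w1 s x ^+ 2), L1 dx (fun x => w2 s x ^+ 2) &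
   [/\ L1 dx (fun x => f1 s x * a1 s x * a1 s x * w1 s x * w1 s x),
    L1 dx (fun x => f1 s x * a1 s x * a2 s x * w1 s x * w2 s x) &
    L1 dx (fun x => f1 s x * a2 s x * a2 s x * w2 s x * w2 s x)]].
Proof.
move=> sT; have [_ _ _ /(_ s sT)[/sobolev2P[L1w H1] _] _] := C1.
have [_ _ _ /(_ s sT)[/sobolev2P[L2w H2] _] _] := C2.
have [M0 _ _ rM] := flow_bounds d0 T0 sphi sa flowM.
have [Bf [Cf [B0 C0 BC]]] := nonlinearity_bounds Af M.
have f1B x : `|f1 s x| <= Bf by have [/andP[h0 h1] _ _] := BC _ (rM s x sT); rewrite ger0_norm.
have a1B x := a1_bd d0 T0 sphi sa flowM x sT; have a2B x := a2_bd d0 T0 sphi sa flowM x sT.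
have m1 := slab_field_meas (slab_field_f1 d0 T0 Af sphi sa flowM) sT.
have ma1 := slab_field_meas (slab_field_smooth sa.1) sT.
have ma2 := slab_field_meas (slab_field_smooth sa.2) sT.
have G (b c g h : X -> R) : measurable_fun setT b -> measurable_fun setT c ->
    (forall x, `|b x| <= M + 1) -> (forall x, `|c x| <= M + 1) -> L2 dx g -> L2 dx h ->
    L1 dx (fun x => f1 s x * b x * c x * g x * h x).
  move=> mb mc bB cB; apply: (@L1_bMM _ _ _ _ (Bf * (M + 1) * (M + 1))).
    by apply: measurable_funM => //; exact: measurable_funM.
  by move=> x; rewrite normrM; apply: ler_pM => //; rewrite normrM; exact: ler_pM.
split.
- by move=> i; have [_ []] := H1 i.
- by move=> i; have [_ []] := H2 i.
- by have [] := L1w.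
- by have [] := L2w.
- by split; exact: G.
Qed.

Lemma energy_density s x : eps ^+ 2 * wgrad_sqr (w s) x
    + 4 * deriv0y f (csqr (a s x)) * (cdot (w s x) (a s x)) ^+ 2 + K * eps ^+ 2 * csqr (w s x) =
  eps ^+ 2 * (\sum_i wp i (w1 s) x ^+ 2 + \sum_i wp i (w2 s) x ^+ 2)
    + 4 * f1 s x * (w1 s x * a1 s x + w2 s x * a2 s x) ^+ 2
    + K * eps ^+ 2 * (w1 s x ^+ 2 + w2 s x ^+ 2).
Proof.
rewrite [csqr (w s x)]csqrE cdotE; congr (_ * _ + _ + _).
by rewrite /wgrad_sqr -big_split/=; apply: eq_bigr => i _; rewrite csqrE.
Qed.

(** The square of (w,a) is expanded into products of real and imaginary parts because [form_sderiv]
    treats one product at a time. *)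
Lemma energy_density_form s : (fun x => eps ^+ 2 * wgrad_sqr (w s) x
    + 4 * deriv0y f (csqr (a s x)) * (cdot (w s x) (a s x)) ^+ 2 + K * eps ^+ 2 * csqr (w s x)) =
  fun x => eps ^+ 2 * (\sum_i wp i (w1 s) x ^+ 2 + \sum_i wp i (w2 s) x ^+ 2)
    + 4 * ((f1 s x * a1 s x * a1 s x * w1 s x * w1 s x + 2 * (f1 s x * a1 s x * a2 s x * w1 s x * w2 s x))
      + f1 s x * a2 s x * a2 s x * w2 s x * w2 s x)
    + K * eps ^+ 2 * (w1 s x ^+ 2 + w2 s x ^+ 2).
Proof. by apply/funext => x; rewrite energy_density; congr (_ + _ + _); ring. Qed.

Lemma energy_split s : s \in `[0, T] ->
 L1 dx (fun x => eps ^+ 2 * wgrad_sqr (w s) x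
    + 4 * deriv0y f (csqr (a s x)) * (cdot (w s x) (a s x)) ^+ 2 + K * eps ^+ 2 * csqr (w s x)) /\
 energy f eps K (a s) (w s) =
  2^-1 * (eps ^+ 2 * (\sum_i \int[dx]_x (wp i (w1 s) x ^+ 2) + \sum_i \int[dx]_x (wp i (w2 s) x ^+ 2))
   + 4 * (form a1 a1 w1 w1 s + 2 * form a1 a2 w1 w2 s + form a2 a2 w2 w2 s)
   + K * eps ^+ 2 * (\int[dx]_x (w1 s x ^+ 2) + \int[dx]_x (w2 s x ^+ 2))).
Proof.
move=> /energy_integrable[g1 g2 l1 l2 [h1 h2 h3]]; rewrite /energy energy_density_form.
have s1 : L1 dx (fun x => \sum_i wp i (w1 s) x ^+ 2) by exact: L1_sum.
have s2 : L1 dx (fun x => \sum_i wp i (w2 s) x ^+ 2) by exact: L1_sum.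
have s12 := L1D s1 s2; have l12 := L1D l1 l2.
have h2' := L1Z 2 h2; have h12 := L1D h1 h2'; have h123 := L1D h12 h3.
have LA := L1Z (eps ^+ 2) s12; have LB := L1Z 4 h123; have LC := L1Z (K * eps ^+ 2) l12.
have LAB := L1D LA LB; split; first exact: L1D.
congr (_ * _); rewrite (RintD LAB LC) (RintD LA LB) (RintZ _ s12) (RintZ _ h123) (RintZ _ l12).
by rewrite (RintD s1 s2) (RintD h12 h3) (RintD h1 h2') (RintZ _ h2) (RintD l1 l2) !Rint_sum.
Qed.

End energy_derivative.

(** * Functions of zero integral *)

Section zero_mean.
Context (R : realType) (d : nat).
Local Notation X := 'rV[R]_d.
Local Notation dx := (leb R d).
Implicit Types (g h b : X -> R) (i k : 'I_d).

(** Integrability is included so that the vanishing integral is a genuine one and such functions can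
    be added and scaled. *)
Definition zero_mean g := L1 dx g /\ \int[dx]_x g x = 0.

Lemma zero_meanD g h : zero_mean g -> zero_mean h -> zero_mean (fun x => g x + h x).
Proof. by move=> [Lg g0] [Lh h0]; split; [exact: L1D | rewrite RintD// g0 h0 addr0]. Qed.

Lemma zero_meanZ (c : R) g : zero_mean g -> zero_mean (fun x => c * g x).
Proof. by move=> [Lg g0]; split; [exact: L1Z | rewrite RintZ// g0 mulr0]. Qed.

Lemma zero_mean_sum (g : 'I_d -> X -> R) : (forall i, zero_mean (g i)) ->
  zero_mean (fun x => \sum_i g i x).
Proof.
move=> gP; split; first by apply: L1_sum => i _; have [] := gP i.
rewrite Rint_sum; last by move=> i _; have [] := gP i.
by rewrite big1// => i _; have [] := gP i.
Qed.

Lemma zero_mean_eq g h : (forall x, h x = g x) -> zero_mean g -> zero_mean h.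
Proof. by move=> gh; rewrite (_ : h = g)//; apply/funext. Qed.

Lemma zero_mean_parts i g h dg dh b db (B B' : R) :
  L2 dx g -> L2 dx h -> L2 dx dg -> L2 dx dh ->
  is_weak_partial i g dg -> is_weak_partial i h dh ->
  measurable_fun setT b -> (forall x, `|b x| <= B) ->
  diff_along i b db -> (forall x, `|db x| <= B') ->
  zero_mean (fun x => b x * g x * dh x + b x * dg x * h x + db x * g x * h x).
Proof.
move=> Lg Lh Ldg Ldh gP hP mb bB b_i dB.
have mdb := @diff_along_meas _ _ i b db mb b_i.
have J1 := L1_bMM mb bB Lg Ldh; have J2 := L1_bMM mb bB Ldg Lh; have J3 := L1_bMM mdb dB Lg Lh.
have J12 := L1D J1 J2; split; first exact: L1D.
by rewrite RintD// RintD//; exact: integration_by_parts bB b_i dB.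
Qed.

Lemma zero_mean_parts1 i g h dg dh : L2 dx g -> L2 dx h -> L2 dx dg -> L2 dx dh ->
  is_weak_partial i g dg -> is_weak_partial i h dh ->
  zero_mean (fun x => g x * dh x + dg x * h x).
Proof.
move=> Lg Lh Ldg Ldh gP hP.
have b_i : @diff_along R d i (fun=> 1) (fun=> 0) by move=> x r; exact: sderiv_cst.
have := @zero_mean_parts i g h dg dh (fun=> 1) (fun=> 0) 1 0 Lg Lh Ldg Ldh gP hP
  (measurable_cst _) _ b_i _.
move=> /(_ _ _)/zero_mean_eq; apply => [|x|x]; rewrite ?normr1 ?normr0//.
by move=> x; ring.
Qed.

End zero_mean.

Section energy_identity.
Context (R : realType) (d : nat) (f : R -> R) (K M eps T : R).
Local Notation X := 'rV[R]_d.
Local Notation dx := (leb R d).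
Local Notation wp := (@weak_partial R d).
Implicit Types (i k : 'I_d) (s : R).
Variables (phi : R -> X -> R) (a w w' : R -> X -> R[i]) (t0 : R).
Hypotheses (d0 : (0 < d)%N) (Af : assumptionA f) (T0 : 0 < T)
  (sphi : smooth_slab T phi) (sa : csmooth_slab T a) (flowM : flow_bound T phi a = M%:E)
  (wC : C1_H2 T w w') (t0T : t0 \in `[0, T]).
Local Notation a1 := (re_part a).
Local Notation a2 := (im_part a).
Local Notation w1 := (re_part w).
Local Notation w2 := (im_part w).
Local Notation w1' := (re_part w').
Local Notation w2' := (im_part w').
Local Notation f1 := (f_prime f a).
Local Notation mder := (mder T phi).
Local Notation Rp := (Rphi f T phi a).
Local Notation divv := (divv phi).
Local Notation grad v := (fun i s => wp i (v s)).
Local Notation lap v := (fun s x => \sum_i wp i (wp i (v s)) x).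
Local Notation aadv v := (fun s x => \sum_i vel phi i s x * wp i (v s) x).

Let C1 := C1_H2_components wC (or_introl erefl).
Let C2 := C1_H2_components wC (or_intror erefl).

Definition form_term (b c g g' h h' : R -> X -> R) x :=
  form_rate f T phi a b c t0 x * g t0 x * h t0 x
  + f1 t0 x * b t0 x * c t0 x * (g' t0 x + aadv g t0 x) * h t0 x
  + f1 t0 x * b t0 x * c t0 x * g t0 x * (h' t0 x + aadv h t0 x)
  + divv t0 x * (f1 t0 x * b t0 x * c t0 x) * g t0 x * h t0 x.

(** The raw derivative of the energy, before any spatial integration by parts of the gradient term
    and before the equation is used; it still contains the gradient of w'. *)
Definition energy_rate x :=
  eps ^+ 2 * (\sum_i wp i (w1 t0) x * wp i (w1' t0) x + \sum_i wp i (w2 t0) x * wp i (w2' t0) x)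
  + K * eps ^+ 2 * (w1 t0 x * w1' t0 x + w2 t0 x * w2' t0 x)
  + 2 * (form_term a1 a1 w1 w1' w1 w1' x + 2 * form_term a1 a2 w1 w1' w2 w2' x
         + form_term a2 a2 w2 w2' w2 w2' x).

Variables (dl D B1 B2 : R).
Hypotheses (dl0 : 0 < dl)
  (D1 : forall s x, near_time T t0 dl s -> `|mder a1 s x| <= D)
  (D2 : forall s x, near_time T t0 dl s -> `|mder a2 s x| <= D)
  (tr1 : transported T t0 dl (vel phi) w1 w1' (grad w1) B1)
  (tr2 : transported T t0 dl (vel phi) w2 w2' (grad w2) B2).

Lemma energy_sderiv : L1 dx energy_rate /\
  sderiv `[0, T]%classic (fun s => energy f eps K (a s) (w s)) t0 (\int[dx]_x energy_rate x).
Proof.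
have [P1 Q1 _ _ _] := C1; have [P2 Q2 _ _ _] := C2.
have a1B := a1_bd d0 T0 sphi sa flowM; have a2B := a2_bd d0 T0 sphi sa flowM.
have [I11 E11] := form_sderiv d0 T0 Af sphi sa flowM t0T dl0 D1 D2 tr1 tr1 sa.1 sa.1
  (fun s x sT => a1B s x sT) (fun s x sT => a1B s x sT) D1 D1.
have [I12 E12] := form_sderiv d0 T0 Af sphi sa flowM t0T dl0 D1 D2 tr1 tr2 sa.1 sa.2
  (fun s x sT => a1B s x sT) (fun s x sT => a2B s x sT) D1 D2.
have [I22 E22] := form_sderiv d0 T0 Af sphi sa flowM t0T dl0 D1 D2 tr2 tr2 sa.2 sa.2
  (fun s x sT => a2B s x sT) (fun s x sT => a2B s x sT) D2 D2.
have LM (v v' : R -> X -> R) : path_diff T v v' -> L1 dx (fun x => v t0 x * v' t0 x).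
  by move=> /(_ t0 t0T)[? ? _]; exact: L2M.
have gr (v v' : R -> X -> R) : (forall i, path_diff T (grad v i) (grad v' i)) ->
    sderiv `[0, T]%classic (fun s => \sum_i \int[dx]_x (wp i (v s) x ^+ 2)) t0
      (2 * \int[dx]_x (\sum_i wp i (v t0) x * wp i (v' t0) x)).
  move=> Q; rewrite Rint_sum; last by move=> i _; exact: LM (Q i).
  by rewrite mulr_sumr; apply: sderiv_sum => i _; exact: (path_sqr_sderiv (Q i) t0T).
have G1 i := LM _ _ (Q1 i); have G2 i := LM _ _ (Q2 i).
have SG1 : L1 dx (fun x => \sum_i wp i (w1 t0) x * wp i (w1' t0) x) by exact: L1_sum.
have SG2 : L1 dx (fun x => \sum_i wp i (w2 t0) x * wp i (w2' t0) x) by exact: L1_sum.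
have SG := L1D SG1 SG2; have W := L1D (LM _ _ P1) (LM _ _ P2).
have I12' := L1Z 2 I12; have J1 := L1D I11 I12'; have J := L1D J1 I22.
have LA := L1Z (eps ^+ 2) SG; have LB := L1Z (K * eps ^+ 2) W; have LC := L1Z 2 J.
have LAB := L1D LA LB.
have S1 := sderivD (gr _ _ Q1) (gr _ _ Q2).
have S2 := sderivD (sderivD E11 (sderivZ 2 E12)) E22.
have S3 := sderivD (path_sqr_sderiv P1 t0T) (path_sqr_sderiv P2 t0T).
have S := sderivZ 2^-1 (sderivD (sderivD (sderivZ (eps ^+ 2) S1) (sderivZ 4 S2)) (sderivZ (K * eps ^+ 2) S3)).
split; first exact: (L1D LAB LC).
have -> : \int[dx]_x energy_rate x = 2^-1 * (eps ^+ 2 *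
  (2 * \int[dx]_x (\sum_i wp i (w1 t0) x * wp i (w1' t0) x) +
   2 * \int[dx]_x (\sum_i wp i (w2 t0) x * wp i (w2' t0) x)) +
  4 * (\int[dx]_x form_term a1 a1 w1 w1' w1 w1' x + 2 * \int[dx]_x form_term a1 a2 w1 w1' w2 w2' x
    + \int[dx]_x form_term a2 a2 w2 w2' w2 w2' x) +
  K * eps ^+ 2 * (2 * \int[dx]_x (w1 t0 x * w1' t0 x) + 2 * \int[dx]_x (w2 t0 x * w2' t0 x))).
  rewrite (RintD LAB LC) (RintD LA LB) (RintZ _ SG) (RintZ _ W) (RintZ _ J) (RintD SG1 SG2) (RintD J1 I22) (RintD I11 I12').
  rewrite (RintZ _ I12) (RintD (LM _ _ P1) (LM _ _ P2)).
  have E (e k y1 y2 y3 y4 z1 z2 z3 : R) : e * (y1 + y2) + k * (y3 + y4) + 2 * (z1 + 2 * z2 + z3) =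
    2^-1 * (e * (2 * y1 + 2 * y2) + 4 * (z1 + 2 * z2 + z3) + k * (2 * y3 + 2 * y4)) by field.
  exact: E.
apply: sderiv_ext S => [s sT|]; rewrite (energy_split _ _ d0 Af T0 sphi sa flowM wC _).2//.
Qed.

End energy_identity.

Section energy_estimate.
Context (R : realType) (d : nat) (f : R -> R) (M T : R).
Local Notation X := 'rV[R]_d.
Local Notation dx := (leb R d).
Local Notation wp := (@weak_partial R d).
Implicit Types (i k : 'I_d) (s : R).
Variables (phi : R -> X -> R) (a w w' : R -> X -> R[i]) (t0 : R).
Hypotheses (d0 : (0 < d)%N) (Af : assumptionA f) (T0 : 0 < T)
  (sphi : smooth_slab T phi) (sa : csmooth_slab T a) (flowM : flow_bound T phi a = M%:E)
  (wC : C1_H2 T w w') (t0T : t0 \in `[0, T]).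
Local Notation a1 := (re_part a).
Local Notation a2 := (im_part a).
Local Notation w1 := (re_part w).
Local Notation w2 := (im_part w).
Local Notation w1' := (re_part w').
Local Notation w2' := (im_part w').
Local Notation Rp := (Rphi f T phi a).
Local Notation dRp := (dRphi f T phi a).
Local Notation divv := (divv phi).
Local Notation ddivv := (ddivv phi).
Local Notation dvel := (dvel phi).
Local Notation grad v := (fun i s => wp i (v s)).
Local Notation lap v := (fun s x => \sum_i wp i (wp i (v s)) x).
Local Notation aadv v := (fun s x => \sum_i vel phi i s x * wp i (v s) x).
Local Notation gsq v := (fun x => \sum_i wp i (v t0) x ^+ 2).

Let C1 := C1_H2_components wC (or_introl erefl).
Let C2 := C1_H2_components wC (or_intror erefl).

(** Trades grad w . grad w' for minus the product of the Laplacian with w', into which the equation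
    can be substituted. *)
Lemma zero_mean_time (v v' : R -> X -> R) : sobolev 2 (v t0) -> sobolev 2 (v' t0) ->
  zero_mean (fun x => \sum_i wp i (v t0) x * wp i (v' t0) x + lap v t0 x * v' t0 x).
Proof.
move=> /sobolev2P[Lv Hv] /sobolev2P[Lv' Hv'].
have H i : zero_mean (fun x => wp i (v t0) x * wp i (v' t0) x + wp i (wp i (v t0)) x * v' t0 x).
  have [_ Lg /(_ i)[gP Lgg]] := Hv i; have [hP Lh _] := Hv' i.
  exact: zero_mean_parts1 Lg Lv' Lgg Lh gP hP.
apply: zero_mean_eq (zero_mean_sum H) => x.
by rewrite big_split/= mulr_suml.
Qed.

(** Disposes of the products of div u, w and its Laplacian that come from the term with w div u in
    the equation. *)
Lemma zero_mean_div (v : R -> X -> R) : sobolev 2 (v t0) ->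
  zero_mean (fun x => divv t0 x * gsq v x + divv t0 x * lap v t0 x * v t0 x
    + \sum_i ddivv i t0 x * wp i (v t0) x * v t0 x).
Proof.
move=> /sobolev2P[Lv Hv].
have [M0 _ ddM _] := flow_bounds d0 T0 sphi sa flowM.
have H i := let: And3 gP Lg H := Hv i in
  @zero_mean_parts R d i (wp i (v t0)) (v t0) (wp i (wp i (v t0))) (wp i (v t0))
    (divv t0) (ddivv i t0) (d%:R * M) M Lg Lv (H i).2 Lg (H i).1 gP
    (slab_field_meas (slab_field_divv sphi) t0T) (fun x => divv_bd d0 T0 sphi sa flowM x t0T)
    (@partial_laplacian R d T phi i t0 sphi t0T) (fun x => ddM i t0 x t0T).
apply: zero_mean_eq (zero_mean_sum H) => x.
rewrite !big_split/=; move: (divv t0 x) => c; congr (_ + _ + _).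
  by rewrite mulr_sumr; apply: eq_bigr => i _; ring.
by rewrite mulr_sumr mulr_suml; apply: eq_bigr => i _; ring.
Qed.

(** Disposes of R_phi times products of w with its Laplacian. As R_phi is real, the terms in grad w1
    . grad w2 cancel between the two parts, and only the gradient of R_phi remains. *)
Lemma zero_mean_residual r0 r1 : (forall x, `|Rp t0 x| <= r0) -> (forall i x, `|dRp i t0 x| <= r1) ->
  zero_mean (fun x => Rp t0 x * (lap w1 t0 x * w2 t0 x - lap w2 t0 x * w1 t0 x)
    + (\sum_i dRp i t0 x * wp i (w1 t0) x * w2 t0 x - \sum_i dRp i t0 x * wp i (w2 t0) x * w1 t0 x)).
Proof.
move=> Rr dRr.
have [_ _ _ /(_ t0 t0T)[/sobolev2P[L1w H1] _] _] := C1.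
have [_ _ _ /(_ t0 t0T)[/sobolev2P[L2w H2] _] _] := C2.
have mR := slab_field_meas (slab_field_Rphi d0 T0 Af sphi sa flowM) t0T.
have H i : zero_mean (fun x => Rp t0 x * wp i (wp i (w1 t0)) x * w2 t0 x + dRp i t0 x * wp i (w1 t0) x * w2 t0 x
    + -1 * (Rp t0 x * wp i (wp i (w2 t0)) x * w1 t0 x + dRp i t0 x * wp i (w2 t0) x * w1 t0 x)).
  have [P1 G1 /(_ i)[PP1 GG1]] := H1 i; have [P2 G2 /(_ i)[PP2 GG2]] := H2 i.
  have Rs := @Rphi_space R d f T phi a Af sphi sa i t0 t0T.
  have Z1 := @zero_mean_parts R d i (wp i (w1 t0)) (w2 t0) (wp i (wp i (w1 t0))) (wp i (w2 t0))
    (Rp t0) (dRp i t0) r0 r1 G1 L2w GG1 G2 PP1 P2 mR Rr Rs (dRr i).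
  have Z2 := @zero_mean_parts R d i (wp i (w2 t0)) (w1 t0) (wp i (wp i (w2 t0))) (wp i (w1 t0))
    (Rp t0) (dRp i t0) r0 r1 G2 L1w GG2 G1 PP2 P1 mR Rr Rs (dRr i).
  apply: zero_mean_eq (zero_meanD Z1 (zero_meanZ (-1) Z2)) => x.
  move: (wp i (wp i (w1 t0)) x) (wp i (wp i (w2 t0)) x) (wp i (w1 t0) x) (wp i (w2 t0) x).
  move: (Rp t0 x) (dRp i t0 x) (w1 t0 x) (w2 t0 x) => y1 y2 y3 y4 y5 y6 y7 y8; ring.
apply: zero_mean_eq (zero_mean_sum H) => x.
rewrite big_split/= -mulr_sumr !big_split/=; move: (Rp t0 x) (w1 t0 x) (w2 t0 x) => r v1 v2.
have E (c z : R) (g : 'I_d -> R) : \sum_i c * g i * z = c * ((\sum_i g i) * z).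
  by rewrite mulr_suml mulr_sumr; apply: eq_bigr => i _; rewrite mulrA.
rewrite (E r v2 (fun i => wp i (wp i (w1 t0)) x)) (E r v1 (fun i => wp i (wp i (w2 t0)) x)).
have E2 (l1 l2 s1 s2 : R) : r * (l1 * v2 - l2 * v1) + (s1 - s2) =
  r * (l1 * v2) + s1 + -1 * (r * (l2 * v1) + s2) by ring.
exact: E2.
Qed.

(** Symmetry of the Laplacian. The expression arises, with factor [K * eps ^+ 3 / 2] up to sign,
    when the equation is substituted into the mass term K eps^2 w . w'. *)
Lemma zero_mean_cross : zero_mean (fun x => w1 t0 x * lap w2 t0 x - w2 t0 x * lap w1 t0 x).
Proof.
have [_ _ _ /(_ t0 t0T)[/sobolev2P[L1w H1] _] _] := C1.
have [_ _ _ /(_ t0 t0T)[/sobolev2P[L2w H2] _] _] := C2.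
have H i : zero_mean (fun x => wp i (wp i (w2 t0)) x * w1 t0 x + -1 * (wp i (wp i (w1 t0)) x * w2 t0 x)).
  have [P1 G1 /(_ i)[PP1 GG1]] := H1 i; have [P2 G2 /(_ i)[PP2 GG2]] := H2 i.
  have Z1 := @zero_mean_parts1 R d i (wp i (w1 t0)) (w2 t0) (wp i (wp i (w1 t0))) (wp i (w2 t0)) G1 L2w GG1 G2 PP1 P2.
  have Z2 := @zero_mean_parts1 R d i (wp i (w2 t0)) (w1 t0) (wp i (wp i (w2 t0))) (wp i (w1 t0)) G2 L1w GG2 G1 PP2 P1.
  apply: zero_mean_eq (zero_meanD Z2 (zero_meanZ (-1) Z1)) => x.
  move: (wp i (wp i (w1 t0)) x) (wp i (wp i (w2 t0)) x) (wp i (w1 t0) x) (wp i (w2 t0) x).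
  move: (w1 t0 x) (w2 t0 x) => y3 y4 y5 y6 y7 y8; ring.
apply: zero_mean_eq (zero_mean_sum H) => x.
rewrite big_split/= -mulr_sumr -!mulr_suml.
have E (l1 l2 v1 v2 : R) : v1 * l2 - v2 * l1 = l2 * v1 + -1 * (l1 * v2) by ring.
exact: E.
Qed.

Section advected.
Variable v : R -> X -> R.
Hypotheses (sv : sobolev 2 (v t0)) (La : L2 dx (aadv v t0)).

Let growth : exists Cu, forall k x, `|vel phi k t0 x| <= Cu * (1 + n1 x).
Proof. by have [Cu H] := vel_growth d0 T0 sphi sa flowM; exists Cu => k x; exact: H. Qed.

Let u_meas k : measurable_fun setT (vel phi k t0).
Proof. exact: slab_field_meas (slab_field_vel sphi k) t0T. Qed.

Let u_i i k : diff_along i (vel phi k t0) (dvel i k t0).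
Proof. exact: (@slab_diff_along _ _ T (vel phi k) i t0 (smooth_slab_partial k sphi 1%N) t0T). Qed.

Let du_bd i k x : `|dvel i k t0 x| <= M.
Proof. by have [_ H _ _] := flow_bounds d0 T0 sphi sa flowM; exact: H. Qed.

(** Replaces the transport part of the mass term by a multiple of div u |w|^2. *)
Lemma zero_mean_self : zero_mean (fun x => v t0 x * aadv v t0 x + 2^-1 * divv t0 x * v t0 x ^+ 2).
Proof.
have [Lv Hv] := sobolev2P sv; have [Cu uC] := growth.
have Lg k : L2 dx (wp k (v t0)) by have [] := Hv k.
have gP k : is_weak_partial k (v t0) (wp k (v t0)) by have [] := Hv k.
have := advection_self u_meas uC u_i du_bd Lv Lg gP La.
by apply: zero_mean_eq => x; congr (_ + _); rewrite expr2 mulrA.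
Qed.

(** Removes the product of the Laplacian with u . grad w, leaving div u and grad u against first
    derivatives. *)
Lemma zero_mean_laplacian : zero_mean (fun x => lap v t0 x * aadv v t0 x - 2^-1 * divv t0 x * gsq v x
  + \sum_i \sum_k dvel i k t0 x * wp i (v t0) x * wp k (v t0) x).
Proof.
have [Lv Hv] := sobolev2P sv; have [Cu uC] := growth.
have Lg k : L2 dx (wp k (v t0)) by have [] := Hv k.
have gP k : is_weak_partial k (v t0) (wp k (v t0)) by have [] := Hv k.
have Lgg i k : L2 dx (wp k (wp i (v t0))) by have [_ _ /(_ k)[]] := Hv i.
have ggP i k : is_weak_partial k (wp i (v t0)) (wp k (wp i (v t0))) by have [_ _ /(_ k)[]] := Hv i.
exact: (@advection_laplacian R d _ _ _ _ u_meas uC u_i du_bd (v t0) (fun k => wp k (v t0))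
  (fun i k => wp k (wp i (v t0))) Lv Lg Lgg gP ggP La).
Qed.

End advected.

End energy_estimate.

Section density_estimate.
Context (R : realType).

(* The added combination has zero integral once the variables are fields; it cancels every
   product of a second-order derivative of [w] that does not involve the source. *)
Lemma density_estimate d (K M B C : R) : 0 < K -> 0 <= M -> 0 <= B -> 0 <= C ->
  exists Cst : R, forall (eps ra r0 r1 w1 w2 w1' w2' D1 D2 V1 V2 dv rp F1 F2 p1 p2 A1 A2 m1 m2 q1 q2 S1 S2 : R)
   (g1 g2 ddv dr : 'I_d -> R) (du : 'I_d -> 'I_d -> R), 0 < eps <= 1 ->
  let q := w1 * p1 + w2 * p2 in
  let form b c mb mc g h yg yh :=
    (q2 * (2 * (p1 * m1 + p2 * m2)) * b * c + q1 * mb * c + q1 * b * mc) * g * h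
    + q1 * b * c * yg * h + q1 * b * c * g * yh + dv * (q1 * b * c) * g * h in
  m1 = A1 - 2^-1 * p1 * dv -> m2 = A2 - 2^-1 * p2 * dv ->
  - (eps * (w2' + V2)) + eps ^+ 2 / 2 * D1 - eps / 2 * w2 * dv - 2 * q1 * q * p1 = rp * w1 + F1 ->
  eps * (w1' + V1) + eps ^+ 2 / 2 * D2 + eps / 2 * w1 * dv - 2 * q1 * q * p2 = rp * w2 + F2 ->
  (forall i k, `|du i k| <= M) -> (forall i, `|ddv i| <= M) -> `|dv| <= d%:R * M ->
  p1 ^+ 2 + p2 ^+ 2 <= M -> 0 <= q1 <= B -> `|q2| <= C -> (p1 ^+ 2 + p2 ^+ 2) * `|q2| <= C * q1 ->
  `|A1| <= ra -> `|A2| <= ra -> `|rp| <= r0 -> 0 <= r1 -> (forall i, `|dr i| <= r1) ->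
  eps ^+ 2 * (S1 + S2) + K * eps ^+ 2 * (w1 * w1' + w2 * w2')
   + 2 * (form p1 p1 m1 m1 w1 w1 (w1' + V1) (w1' + V1) + 2 * form p1 p2 m1 m2 w1 w2 (w1' + V1) (w2' + V2)
          + form p2 p2 m2 m2 w2 w2 (w2' + V2) (w2' + V2))
  + (- eps ^+ 2 * ((S1 + D1 * w1') + (S2 + D2 * w2'))
   + - eps ^+ 2 * ((D1 * V1 - 2^-1 * dv * (\sum_i g1 i ^+ 2) + \sum_i \sum_k du i k * g1 i * g1 k)
      + (D2 * V2 - 2^-1 * dv * (\sum_i g2 i ^+ 2) + \sum_i \sum_k du i k * g2 i * g2 k))
   + - (eps ^+ 2 / 2) * ((dv * (\sum_i g1 i ^+ 2) + dv * D1 * w1 + \sum_i ddv i * g1 i * w1)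
      + (dv * (\sum_i g2 i ^+ 2) + dv * D2 * w2 + \sum_i ddv i * g2 i * w2))
   + eps * (rp * (D1 * w2 - D2 * w1) + (\sum_i dr i * g1 i * w2 - \sum_i dr i * g2 i * w1))
   + K * eps ^+ 2 * ((w1 * V1 + 2^-1 * dv * w1 ^+ 2) + (w2 * V2 + 2^-1 * dv * w2 ^+ 2))
   + K * eps ^+ 3 / 2 * (w1 * D2 - w2 * D1))
  <= Cst * (1 + ra / eps + r1 / eps + r0 / eps ^+ 2)
       * (2^-1 * (eps ^+ 2 * (\sum_i g1 i ^+ 2 + \sum_i g2 i ^+ 2) + 4 * q1 * q ^+ 2
          + K * eps ^+ 2 * (w1 ^+ 2 + w2 ^+ 2)))
     + (F1 ^+ 2 + F2 ^+ 2)
     - 4 / eps * q1 * q * (p2 * F1 - p1 * F2) + eps * (D2 * F1 - D1 * F2).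
Proof.
move=> K0 M0 B0 C0; have [Cst H] := @energy_density_bound R d K M B C K0 M0 B0 C0.
exists Cst => eps ra r0 r1 w1 w2 w1' w2' D1 D2 V1 V2 dv rp F1 F2 p1 p2 A1 A2 m1 m2 q1 q2 S1 S2 g1 g2 ddv dr du.
move=> e01 q form E1 E2 eq1 eq2 h1 h2 h3 h4 h5 h6 h7 h8 h9 h10 h11 h12.
have en0 : eps != 0 by case/andP: e01 => e0 _; rewrite gt_eqF.
apply: le_trans (H eps ra r0 r1 w1 w2 D1 D2 dv rp F1 F2 p1 p2 A1 A2 q1 q2 g1 g2 ddv dr du
  e01 h1 h2 h3 h4 h5 h6 h7 h8 h9 h10 h11 h12).
have I := @energy_density_identity R eps K w1 w2 w1' w2' D1 D2 V1 V2 dv rp F1 F2 p1 p2 A1 A2 q1 q2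
  (S1 + S2) (\sum_i g1 i ^+ 2 + \sum_i g2 i ^+ 2)
  (\sum_i \sum_k du i k * g1 i * g1 k + \sum_i \sum_k du i k * g2 i * g2 k)
  (\sum_i ddv i * g1 i * w1 + \sum_i ddv i * g2 i * w2)
  (\sum_i dr i * g1 i * w2 - \sum_i dr i * g2 i * w1) en0 eq1 eq2.
rewrite -{}I -E1 -E2 le_eqVlt; apply/orP; left; apply/eqP.
move: (\sum_i g1 i ^+ 2) (\sum_i g2 i ^+ 2) (\sum_i ddv i * g1 i * w1) (\sum_i ddv i * g2 i * w2)
  (\sum_i dr i * g1 i * w2) (\sum_i dr i * g2 i * w1) (\sum_i \sum_k du i k * g1 i * g1 k)
  (\sum_i \sum_k du i k * g2 i * g2 k) => z1 z2 z3 z4 z5 z6 z7 z8.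
by rewrite /form; ring.
Qed.

End density_estimate.

Lemma cdot_mul_i (R : realType) (z z' : R[i]) :
  cdot z ('i%C * z') = complex.Im z * complex.Re z' - complex.Re z * complex.Im z'.
Proof. by rewrite cdotE; case: z => x y; case: z' => x' y' /=; ring. Qed.

Lemma cdot_scale_mul_i (R : realType) (k : R) (z z' : R[i]) : cdot (k%:C%C * z) ('i%C * z') =
  k * (complex.Im z * complex.Re z' - complex.Re z * complex.Im z').
Proof. by rewrite cdot_mul_i; case: z => x y; case: z' => x' y' /=; ring. Qed.

(** The estimate in real numbers, for arbitrary upper bounds [ra], [r0], [r1] of the residuals. The
    constant comes from the pointwise inequality and is therefore fixed before [eps], [T] and all
    fields. *)
Lemma energy_derivative_le (R : realType) (d : nat) (f : R -> R) (K M : R) :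
  (0 < d)%N -> assumptionA f -> 0 < K ->
  exists C : R,
  forall (eps T : R) (phi : R -> 'rV[R]_d -> R) (a w w' F : R -> 'rV[R]_d -> R[i]),
    0 < eps <= 1 -> 0 < T ->
    smooth_slab T phi -> csmooth_slab T a ->
    flow_bound T phi a = M%:E ->
    C1_H2 T w w' ->
    (forall t : R, t \in `[0, T] -> both (measurable_fun setT) (F t)) ->
    (forall t : R, t \in `[0, T] ->
      {ae leb R d, forall x,
        'i%C * eps%:C%C * w' t x + Lop f eps (phi t) (a t) (w t) x
        = (Rphi f T phi a t x)%:C%C * w t x + F t x}) ->
  forall t : R, t \in `[0, T] ->
    bounded_near_time T (fun s => Linfty (cabs (Ra T phi a s))) t ->
    bounded_near_time T (fun s => W1infty (Rphi f T phi a s)) t ->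
    bounded_near_time T (fun s => L2norm (F s)) t ->
  forall ra r1 r0 : R,
    (Linfty (cabs (Ra T phi a t)) <= ra%:E)%E ->
    (Linfty (grad_norm (Rphi f T phi a t)) <= r1%:E)%E -> 0 <= r1 ->
    (Linfty (Rphi f T phi a t) <= r0%:E)%E ->
  let N := fun s => energy f eps K (a s) (w s) in
  exists2 L, sderiv `[0, T]%classic N t L &
    L <= C * (1 + ra / eps + r1 / eps + r0 / eps ^+ 2) * N t
       + \int[leb R d]_x (complex.Re (F t x) ^+ 2 + complex.Im (F t x) ^+ 2)
       - \int[leb R d]_x (4 / eps * deriv0y f (csqr (a t x))
            * cdot (w t x) (a t x) * cdot (a t x) ('i%C * F t x))
       + \int[leb R d]_x cdot (eps%:C%C * wlaplacian (w t) x) ('i%C * F t x).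
Proof.
(* A negative [M] is not a value of [flow_bound], so in that case any constant will do. *)
move=> d0 Af K0; have [M0|M0] := leP 0 M; last first.
  exists 0 => eps T phi a w w' F _ T0 sphi sa flowM.
  by have [] := flow_bounds d0 T0 sphi sa flowM; rewrite leNgt M0.
have [B [C [B0 C0 BC]]] := nonlinearity_bounds Af M.
have [Cst H] := @density_estimate R d K M B C K0 M0 B0 C0.
exists Cst => eps T phi a w w' F eps01 T0 sphi sa flowM wC mF eqn t tT bRa bRphi bF.
move=> ra r1 r0 raE r1E r10 r0E N.
have [dl [D [B1 [B2 [dl0 D1 D2 tr1 tr2]]]]] :=
  near_transported d0 Af eps01 T0 sphi sa flowM wC mF eqn tT bRa bRphi bF.
have [LP SP] := energy_sderiv K eps d0 Af T0 sphi sa flowM wC tT dl0 D1 D2 tr1 tr2.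
exists (\int[leb R d]_x energy_rate f K eps T phi a w w' t x) => //.
have e0 : 0 < eps by case/andP: eps01.
have Nt : near_time T t dl t by split => //; rewrite subrr normr0.
have [_ _ _ /(_ t tT)[sw1 sw1'] _] := C1_H2_components wC (or_introl erefl).
have [_ _ _ /(_ t tT)[sw2 sw2'] _] := C1_H2_components wC (or_intror erefl).
have La1 := tr_adv_L2 tr1 Nt; have La2 := tr_adv_L2 tr2 Nt.
have RpB := Rphi_bd d0 T0 Af sphi sa flowM tT r0E.
have dRpB := dRphi_bd d0 T0 Af sphi sa flowM tT r1E.
have RaB := Ra_bd d0 sphi sa tT raE.
have [_ dvM ddvM rM] := flow_bounds d0 T0 sphi sa flowM.
have zA := zero_meanD (@zero_mean_time R d t (re_part w) (re_part w') sw1 sw1')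
  (@zero_mean_time R d t (im_part w) (im_part w') sw2 sw2').
have zB := zero_meanD (zero_mean_laplacian d0 T0 sphi sa flowM tT (v := re_part w) sw1 La1)
  (zero_mean_laplacian d0 T0 sphi sa flowM tT (v := im_part w) sw2 La2).
have zC := zero_meanD (zero_mean_div d0 T0 sphi sa flowM tT (v := re_part w) sw1)
  (zero_mean_div d0 T0 sphi sa flowM tT (v := im_part w) sw2).
have zD := zero_mean_residual d0 Af T0 sphi sa flowM wC tT RpB dRpB.
have zE := zero_meanD (zero_mean_self d0 T0 sphi sa flowM tT (v := re_part w) sw1 La1)
  (zero_mean_self d0 T0 sphi sa flowM tT (v := im_part w) sw2 La2).
have zF := zero_mean_cross wC tT.
(* The coefficients are those of the added combination in [density_estimate]. *)
have [Lcorr Icorr] := zero_meanD (zero_meanD (zero_meanD (zero_meanD (zero_meanD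
  (zero_meanZ (- eps ^+ 2) zA) (zero_meanZ (- eps ^+ 2) zB)) (zero_meanZ (- (eps ^+ 2 / 2)) zC))
  (zero_meanZ eps zD)) (zero_meanZ (K * eps ^+ 2) zE)) (zero_meanZ (K * eps ^+ 3 / 2) zF).
set corr := (fun x => _) in Lcorr Icorr.
have Ndens := (energy_split K eps d0 Af T0 sphi sa flowM wC tT).1.
set dens := (fun x => eps ^+ 2 * wgrad_sqr (w t) x + _ + _) in Ndens.
have [L1w _] := sobolev2P sw1; have [L2w _] := sobolev2P sw2.
have [bF0 [rF [bF1 HF]]] := bounded_near_timeP bF.
have Nt' : near_time T t bF0 t by split => //; rewrite subrr normr0.
have [LF1 LF2 _ _ _] := L2norm_fin (mF t tT) (HF t Nt').
have [_ LF1s] := LF1; have [_ LF2s] := LF2; have LFs := L1D LF1s LF2s.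
have L2l (v : R -> 'rV[R]_d -> R) : sobolev 2 (v t) ->
    L2 (leb R d) (fun x => \sum_i weak_partial i (weak_partial i (v t)) x).
  by move=> /sobolev2P[_ Hv]; apply: L2_sum => i _; have [_ _ /(_ i)[]] := Hv i.
have Ll1 := L2l (re_part w) sw1; have Ll2 := L2l (im_part w) sw2.
have a1B x := a1_bd d0 T0 sphi sa flowM x tT; have a2B x := a2_bd d0 T0 sphi sa flowM x tT.
have ma1 := slab_field_meas (slab_field_smooth sa.1) tT.
have ma2 := slab_field_meas (slab_field_smooth sa.2) tT.
have mf1 := slab_field_meas (slab_field_f1 d0 T0 Af sphi sa flowM) tT.
have f1B x : `|f_prime f a t x| <= B by have [/andP[h0 h1] _ _] := BC _ (rM t x tT); rewrite ger0_norm.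
pose J1 x := 4 / eps * deriv0y f (csqr (a t x)) * cdot (w t x) (a t x) * cdot (a t x) ('i%C * F t x).
pose J2 x := cdot (eps%:C%C * wlaplacian (w t) x) ('i%C * F t x).
have J1E x : J1 x = 4 / eps * f_prime f a t x * (re_part w t x * re_part a t x + im_part w t x * im_part a t x)
    * (im_part a t x * re_part F t x - re_part a t x * im_part F t x).
  by rewrite /J1 cdotE cdot_mul_i.
have J2E x : J2 x = eps * ((\sum_i weak_partial i (weak_partial i (im_part w t)) x) * re_part F t x
    - (\sum_i weak_partial i (weak_partial i (re_part w t)) x) * im_part F t x).
  by rewrite /J2 cdot_scale_mul_i Re_wlaplacian Im_wlaplacian.
have LJ1 : L1 (leb R d) J1.
  have Lq := L2D (L2_bM ma1 a1B L1w) (L2_bM ma2 a2B L2w).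
  have Lh := L2B (L2_bM ma2 a2B LF1) (L2_bM ma1 a1B LF2).
  have -> : J1 = fun x => 4 / eps * (f_prime f a t x * (re_part a t x * re_part w t x + im_part a t x * im_part w t x)
    * (im_part a t x * re_part F t x - re_part a t x * im_part F t x)).
    by apply/funext => x; rewrite J1E; ring.
  by apply: L1Z; exact: L1_bMM mf1 f1B Lq Lh.
have LJ2 : L1 (leb R d) J2.
  have -> : J2 = fun x => eps * ((\sum_i weak_partial i (weak_partial i (im_part w t)) x) * re_part F t x
    - (\sum_i weak_partial i (weak_partial i (re_part w t)) x) * im_part F t x).
    by apply/funext => x; rewrite J2E.
  by apply: L1Z; apply: L1B; exact: L2M.
set Lam := 1 + ra / eps + r1 / eps + r0 / eps ^+ 2.
have Ldens := L1Z (Cst * Lam) (L1Z 2^-1 Ndens).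
have Lr1 := L1D Ldens LFs; have Lr2 := L1B Lr1 LJ1; have Lr := L1D Lr2 LJ2.
have -> : N t = 2^-1 * \int[leb R d]_x dens x by [].
rewrite -/J1 -/J2 -(RintZ 2^-1 Ndens) -(RintZ _ (L1Z 2^-1 Ndens)) -(RintD Ldens LFs) -(RintB Lr1 LJ1) -(RintD Lr2 LJ2).
(* The correction enters as an added 0; both sides are now single integrals, and it remains to
   compare integrands almost everywhere. *)
rewrite -[X in X <= _]addr0 -Icorr -(RintD LP Lcorr).
apply: Rint_le_ae => //; first exact: L1D.
apply: ae_imp (equation_components eqn tT) => x [eq1 eq2].
rewrite J1E J2E /dens energy_density.
have [RaR RaI] := RaB x.
have m1E : mder T phi (re_part a) t x = complex.Re (Ra T phi a t x) - 2^-1 * re_part a t x * divv phi t x.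
  by rewrite mder_Re addrK.
have m2E : mder T phi (im_part a) t x = complex.Im (Ra T phi a t x) - 2^-1 * im_part a t x * divv phi t x.
  by rewrite mder_Im addrK.
have [q1B q2C rC] := BC _ (rM t x tT).
have rE : re_part a t x ^+ 2 + im_part a t x ^+ 2 = rho a t x by rewrite /rho csqrE.
have rM' : re_part a t x ^+ 2 + im_part a t x ^+ 2 <= M by rewrite rE; case/andP: (rM t x tT).
have rC' : (re_part a t x ^+ 2 + im_part a t x ^+ 2) * `|f_second f a t x| <= C * f_prime f a t x by rewrite rE.
exact: (H eps ra r0 r1 (re_part w t x) (im_part w t x) (re_part w' t x) (im_part w' t x)
  (\sum_i weak_partial i (weak_partial i (re_part w t)) x) (\sum_i weak_partial i (weak_partial i (im_part w t)) x)
  (\sum_i vel phi i t x * weak_partial i (re_part w t) x) (\sum_i vel phi i t x * weak_partial i (im_part w t) x)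
  (divv phi t x) (Rphi f T phi a t x) (re_part F t x) (im_part F t x) (re_part a t x) (im_part a t x)
  (complex.Re (Ra T phi a t x)) (complex.Im (Ra T phi a t x)) (mder T phi (re_part a) t x) (mder T phi (im_part a) t x)
  (f_prime f a t x) (f_second f a t x)
  (\sum_i weak_partial i (re_part w t) x * weak_partial i (re_part w' t) x)
  (\sum_i weak_partial i (im_part w t) x * weak_partial i (im_part w' t) x)
  (fun i => weak_partial i (re_part w t) x) (fun i => weak_partial i (im_part w t) x)
  (fun i => ddivv phi i t x) (fun i => dRphi f T phi a i t x) (fun i k => dvel phi i k t x)
  eps01 m1E m2E eq1 eq2 (fun i k => dvM i k t x tT) (fun i => ddvM i t x tT)
  (divv_bd d0 T0 sphi sa flowM x tT) rM' q1B q2C rC' RaR RaI (RpB x) r10 (fun i => dRpB i x)).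
Qed.

Local Open Scope complex_scope.

Theorem lemma1 (R : realType) (d : nat) (f : R -> R) (K M : R) :
  (0 < d)%N -> assumptionA f -> 0 < K ->
  exists C : R,
  forall (eps T : R) (phi : R -> 'rV[R]_d -> R) (a w w' F : R -> 'rV[R]_d -> R[i]),
    0 < eps <= 1 -> 0 < T ->
    smooth_slab T phi -> csmooth_slab T a ->
    flow_bound T phi a = M%:E ->
    C1_H2 T w w' ->
    (forall t : R, t \in `[0, T] -> both (measurable_fun setT) (F t)) ->
    (forall t : R, t \in `[0, T] ->
      {ae leb R d, forall x,
        'i%C * eps%:C * w' t x + Lop f eps (phi t) (a t) (w t) x
        = (Rphi f T phi a t x)%:C * w t x + F t x}) ->
  forall t : R, t \in `[0, T] ->
    bounded_near_time T (fun s => Linfty (cabs (Ra T phi a s))) t ->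
    bounded_near_time T (fun s => W1infty (Rphi f T phi a s)) t ->
    bounded_near_time T (fun s => L2norm (F s)) t ->
  let N := fun s => energy f eps K (a s) (w s) in
    derivable_within `[0, T] N t /\
    ((derivative_within `[0, T] N t)%:E <=
       C%:E * (1 + (eps^-1)%:E * Linfty (cabs (Ra T phi a t))
                 + (eps^-1)%:E * W1infty (Rphi f T phi a t)
                 + (eps ^- 2)%:E * Linfty (Rphi f T phi a t)) * (N t)%:E
       + L2norm (F t) ^+ 2
       - (\int[leb R d]_x (4 / eps * deriv0y f (csqr (a t x))
            * cdot (w t x) (a t x) * cdot (a t x) ('i%C * F t x)))%:E
       + (\int[leb R d]_x cdot (eps%:C * wlaplacian (w t) x) ('i%C * F t x))%:E)%E.
Proof.
move=> d0 Af K0; have [C H] := energy_derivative_le M d0 Af K0; exists C.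
move=> eps T phi a w w' F eps01 T0 sphi sa flowM wC mF eqn t tT bRa bRphi bF N.
(* A bound near [t] applies at [t] itself, so the extended-real norms on the right are finite and
   the inequality reduces to one between real numbers. *)
have finite_at (G : R -> \bar R) : (forall s, (0 <= G s)%E) -> bounded_near_time T G t ->
    exists2 r : R, G t = r%:E & 0 <= r.
  move=> G0 /bounded_near_timeP[dl [B [dl0 GB]]].
  have {}GB : (G t <= B%:E)%E by apply: GB; split => //; rewrite subrr normr0.
  have Gt : G t \is a fin_num by rewrite ge0_fin_numE// (le_lt_trans GB)// ltry.
  by exists (fine (G t)); rewrite ?fineK// fine_ge0.
have Linfty_ge0 (g : 'rV[R]_d -> R) : (0 <= Linfty g)%E by exact: Lnorm_ge0.
have [ra raE _] := finite_at _ (fun s => Linfty_ge0 (cabs (Ra T phi a s))) bRa.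
have W1infty_ge0 (g : 'rV[R]_d -> R) : (0 <= W1infty g)%E by exact: adde_ge0.
have [r1 r1E r10] := finite_at _ (fun s => W1infty_ge0 (Rphi f T phi a s)) bRphi.
have r0r1 : (Linfty (Rphi f T phi a t) <= r1%:E)%E by rewrite -r1E /W1infty leeDl.
(* The whole W^(1,oo) norm [r1] serves as the bound for the gradient alone. *)
have gr1 : (Linfty (grad_norm (Rphi f T phi a t)) <= r1%:E)%E by rewrite -r1E /W1infty leeDr.
have r0f : Linfty (Rphi f T phi a t) \is a fin_num.
  by rewrite ge0_fin_numE// (le_lt_trans r0r1)// ltry.
have L2norm_ge0 (z : 'rV[R]_d -> R[i]) : (0 <= L2norm z)%E by exact: Lnorm_ge0.
have [rF rFE _] := finite_at _ (fun s => L2norm_ge0 (F s)) bF.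
have rFle : (L2norm (F t) <= rF%:E)%E by rewrite rFE.
have rale : (Linfty (cabs (Ra T phi a t)) <= ra%:E)%E by rewrite raE.
have r0le : (Linfty (Rphi f T phi a t) <= (fine (Linfty (Rphi f T phi a t)))%:E)%E by rewrite fineK.
have [_ _ _ _ F2E] := L2norm_fin (mF t tT) rFle.
have [L SL HL] := H eps T phi a w w' F eps01 T0 sphi sa flowM wC mF eqn t tT bRa bRphi bF
  ra r1 (fine (Linfty (Rphi f T phi a t))) rale gr1 r10 r0le.
have tT' : 0 <= t <= T by move: tT; rewrite in_itv.
(* As [T] is positive, every point of the time interval is an accumulation point, so the limit [L]
   is the value of [derivative_within]. *)
have [dN ->] := within_sderiv (within_itv_proper T0 tT') SL.
split => //; rewrite raE r1E -(fineK r0f) F2E.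
apply: (@le_trans _ _ (C * (1 + ra / eps + r1 / eps + fine (Linfty (Rphi f T phi a t)) / eps ^+ 2) * N t
       + \int[leb R d]_x (complex.Re (F t x) ^+ 2 + complex.Im (F t x) ^+ 2)
       - \int[leb R d]_x (4 / eps * deriv0y f (csqr (a t x))
            * cdot (w t x) (a t x) * cdot (a t x) ('i%C * F t x))
       + \int[leb R d]_x cdot (eps%:C%C * wlaplacian (w t) x) ('i%C * F t x))%:E).
  by rewrite lee_fin.
rewrite [ra / eps]mulrC [r1 / eps]mulrC [fine _ / _]mulrC.
exact: lexx.
Qed.
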